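(* Fix a closed interval $[\underline b,\overline b]\subset\mathcal I_0$ with $0<\underline b<\overline b$. Then there exist constants $C_0,\tilde s_0>0$ such that the following is true. Consider any Oleinik shock $(u_L,u_R)$ with $u_L,u_R\in[\underline b,\overline b]$ and $|u_L-u_R|=s_0<\tilde s_0$. Then for any $a_1,a_2>0$ satisfying $$1+\frac{C_0}{2}s_0\le\frac{a_1}{a_2}\le1+2C_0s_0,$$ any $u\in\mathcal S_{\text{weak}}$, any $\overline t\in[0,\infty)$ and any $x_0\in\mathbb R$, there exists a Lipschitz shift function $h:[\overline t,\infty)\to\mathbb R$ with $h(\overline t)=x_0$ such that, writing $u_\pm(t)=u(t,h(t)\pm)$, $$a_1\bigl(\dot h(t)\,\eta(u_-(t)|u_L)-q(u_-(t);u_L)\bigr)-a_2\bigl(\dot h(t)\,\eta(u_+(t)|u_R)-q(u_+(t);u_R)\bigr)\le 0$$ for almost every $t\in[\overline t,\infty)$. Moreover, there is a maximal shock speed: a constant $\hat\lambda_2$ such that these shifts satisfy $|\dot h(t)|\le\hat\lambda_2$ for almost every $t\in[\overline t,\infty)$.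
   Context: Setting. Fix $M>0$ and the state space $\mathcal I_0=[-M,M]$. The flux $f:\mathbb R\to\mathbb R$ is of class $C^4$ and concave-convex: $uf''(u)>0$ for $u\ne0$, $f'''(0)\neq0$, and $f'(u)\to+\infty$ as $|u|\to+\infty$. Consider the scalar conservation law $u_t+(f(u))_x=0$, $t>0$, $x\in\mathbb R$, with $u$ valued in $\mathcal I_0$. Fix a strictly convex entropy $\eta\in C^3$ ($\eta''>0$) with entropy flux $q$, $q'=\eta'f'$. For $k\in\mathbb R$ the Kruzkov entropy is $\eta_k(u)=|u-k|$ with flux $q_k(u)=\mathrm{sgn}(u-k)(f(u)-f(k))$. A weak solution $u\in L^\infty(\mathbb R^+\times\mathbb R;\mathcal I_0)$ is $\eta$-entropic (resp. $\eta_k$-entropic) if $(\eta(u))_t+(q(u))_x\le0$ (resp. with $\eta_k,q_k$) in the sense of distributions on $(0,\infty)\times\mathbb R$. The initial value of a weak solution is denoted $u_0=u(0,\cdot)$. Relative quantities: $\eta(a|b)=\eta(a)-\eta(b)-\eta'(b)(a-b)$ and $q(a;b)=q(a)-q(b)-\eta'(b)(f(a)-f(b))$. Strong Trace property: $u\in L^\infty(\mathbb R^+\times\mathbb R)$ has it if for every Lipschitz curve $t\mapsto h(t)$ there are bounded functions $u_-,u_+$ of $t$ such that for every $T>0$, $\lim_{n\to\infty}\int_0^T\sup_{y\in(0,1/n)}|u(t,h(t)+y)-u_+(t)|\,dt=\lim_{n\to\infty}\int_0^T\sup_{y\in(-1/n,0)}|u(t,h(t)+y)-u_-(t)|\,dt=0$.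 One writes $u_\pm(t)=u(t,h(t)\pm)$. An Oleinik shock is a pair $(u_L,u_R)$, $u_L\ne u_R$, with $\frac{f(v)-f(u_L)}{v-u_L}\ge\frac{f(u_R)-f(u_L)}{u_R-u_L}$ for all $v$ strictly between $u_L$ and $u_R$. For $u\neq0$, $\phi^\natural(u)$ is the unique $v\ne u$ with $f'(v)=\frac{f(u)-f(v)}{u-v}$; $\phi^\natural(0)=0$. Class of solutions (depending on $\underline b$): $\mathcal S_{\text{weak}}$ is the set of $u\in L^\infty(\mathbb R^+\times\mathbb R;\mathcal I_0)$ that are weak solutions of $u_t+(f(u))_x=0$, are $\eta$-entropic and $\eta_{\phi^\natural(\underline b)}$-entropic, have the Strong Trace property, and whose initial value satisfies $u_0\ge\phi^\natural(\underline b)$. *)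

(* Defs.v *)
From HB Require Import structures.
From mathcomp Require Import all_boot all_order all_algebra.
From mathcomp Require Import all_classical all_reals all_analysis ess_sup_inf.

Set Implicit Arguments.
Unset Strict Implicit.
Unset Printing Implicit Defensive.

Import Order.TTheory GRing.Theory Num.Theory.
Import numFieldNormedType.Exports.

Local Open Scope classical_set_scope.
Local Open Scope ring_scope.

Section flux_and_entropies.
Context {R : realType}.
Implicit Types (f eta q : R -> R) (u v k a b x : R).

Definition classC (n : nat) f :=
  (forall i, (i < n)%N -> forall x, derivable (derive1n i f) x 1) /\
  continuous (derive1n n f).

Definition concave_convex f :=
  [/\ classC 4 f,
      forall u, u != 0 -> 0 < u * derive1n 2 f u,
      derive1n 3 f 0 != 0,
      derive1 f v @[v --> +oo] --> +oo
    & derive1 f v @[v --> -oo] --> +oo].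

Definition strictly_convex_entropy eta :=
  classC 3 eta /\ forall u, 0 < derive1n 2 eta u.

Definition entropy_flux f eta q :=
  forall u, is_derive u 1 q (derive1 eta u * derive1 f u).

Definition kruzkov_entropy k u := `|u - k|.

Definition kruzkov_flux f k u := Num.sg (u - k) * (f u - f k).

Definition rel_entropy eta a b := eta a - eta b - derive1 eta b * (a - b).

Definition rel_flux f eta q a b := q a - q b - derive1 eta b * (f a - f b).

Definition oleinik_shock f uL uR :=
  uL != uR /\
  forall v, Num.min uL uR < v < Num.max uL uR ->
    (f uR - f uL) / (uR - uL) <= (f v - f uL) / (v - uL).

(* Under [concave_convex f] the set below has exactly one element when
   [u != 0], so the default value of [xget] plays no role. *)
Definition phi_nat f u :=
  if u == 0 then 0
  else xget 0 [set v | v != u /\ derive1 f v = (f u - f v) / (u - v)].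

End flux_and_entropies.

Section weak_solutions.
Context {R : realType}.

Definition leb2 :=
  [the {measure set _ -> \bar R} of (@lebesgue_measure R \x @lebesgue_measure R)%E].

(* Points of the plane are pairs (t, x). *)
Definition half_plane : set (R * R) := [set z | 0 < z.1].

Implicit Types (u phi : R * R -> R) (f eta q E F h w : R -> R).

Definition dt phi : R * R -> R := fun z => 'D_((1, 0) : R * R) phi z.
Definition dx phi : R * R -> R := fun z => 'D_((0, 1) : R * R) phi z.

Definition partials (s : seq bool) phi : R * R -> R :=
  foldr (fun b g => if b then dt g else dx g) phi s.

(* C^oo with compact support: a function is C^oo when all its iterated
   partial derivatives are (Frechet) differentiable everywhere. *)
Definition test_function phi :=
  (forall (s : seq bool) (z : R * R), differentiable (partials s phi) z) /\
  compact (closure [set z | phi z != 0]).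

Definition pairing E F u phi : R :=
  \int[leb2]_(z in half_plane) (E (u z) * dt phi z + F (u z) * dx phi z).

Definition Linfty (M : R) u :=
  measurable_fun half_plane u /\
  {ae leb2, forall z, half_plane z -> - M <= u z <= M}.

Definition weak_solution f u :=
  forall phi, test_function phi ->
    closure [set z | phi z != 0] `<=` half_plane ->
    pairing id f u phi = 0.

Definition entropic eta q u :=
  forall phi, test_function phi -> (forall z, 0 <= phi z) ->
    closure [set z | phi z != 0] `<=` half_plane ->
    0 <= pairing eta q u phi.

(* The value of [u] at time 0 is the function [u0] for which the weak
   formulation holds against test functions that need not vanish at t = 0
   (equivalently, the weak-star limit of u(t, .) as t -> 0+). *)
Definition initial_value f u (u0 : R -> R) :=
  [/\ measurable_fun setT u0,
      exists C : R, {ae lebesgue_measure, forall x, `|u0 x| <= C}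
    & forall phi, test_function phi ->
        pairing id f u phi + \int[lebesgue_measure]_x (u0 x * phi (0, x)) = 0].

Definition lipschitz_from (t0 : R) h := [lipschitz h t | t in `[t0, +oo[].

(* Since [u] stands for a class of functions modulo null sets, the supremum
   over [I n] is the essential one; extending the nonnegative integrand by 0
   outside [I n] does not change it. Only the values of [h] on
   [t0, +oo[ are used. *)
Definition one_sided_trace u h (t0 : R) w (I : nat -> set R) :=
  [/\ measurable_fun `[t0, +oo[ w,
      exists C : R, forall t, t0 <= t -> `|w t| <= C
    & forall T : R, t0 < T ->
        (\int[lebesgue_measure]_(t in `[t0, T])
          ess_sup lebesgue_measure
            ((fun y => `|u (t, h t + y) - w t|%:E) \_ (I n)))%E
        @[n --> \oo] --> 0%E].

Definition traces u h (t0 : R) (um up : R -> R) :=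
  one_sided_trace u h t0 um (fun n => `]- n.+1%:R^-1, 0[%classic) /\
  one_sided_trace u h t0 up (fun n => `]0, n.+1%:R^-1[%classic).

Definition strong_trace u :=
  forall h, lipschitz_from 0 h -> exists um up, traces u h 0 um up.

Definition S_weak (M : R) f eta q (b : R) u :=
  [/\ Linfty M u,
      weak_solution f u,
      entropic eta q u /\
      entropic (kruzkov_entropy (phi_nat f b)) (kruzkov_flux f (phi_nat f b)) u,
      strong_trace u
    & exists2 u0, initial_value f u u0 &
        {ae lebesgue_measure, forall x, phi_nat f b <= u0 x}].

End weak_solutions.

(* Main.v *)
(* Let [k] be the tangent point [phi_nat f bl]. Along a Lipschitz curve [h] the
   left-hand side only involves the traces [u_-], [u_+] and the speed [h']. Where
   the traces differ, the Rankine-Hugoniot relation and the entropy inequality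
   for [eta], obtained by blowing up test functions at the curve, replace one
   trace by the other; where they agree, the sign is decided by the speed.

   The shift is a Filippov solution of [h' = V(u(t, h))], where [V(w)] is the
   characteristic speed (of [max w 0]) for [w <= u_L] and the slope of the chord
   from [u_L] to [w] beyond: it is a cluster point of Euler polygons driven by
   rectangle means of [V(u)], and its speed lies between [V(u_-)] and [V(u_+)] by
   Lebesgue differentiation. The geometry of the flux then gives the dissipation
   inequality for all states above [k], for any weights [a2 <= a1].

   The bound [u >= k] propagates from the initial data with a single Kruzkov
   entropy: let [W] be a potential with [W_x = u - k] and [W_t = f(k) - f(u)].
   The entropy inequality for [|u - k|] is stable under multiplication of test
   functions by increasing functions of [W], which yields a maximum principle
   for [W]; hence [W] remains nondecreasing in [x]. *)

Require Import Defs.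
From HB Require Import structures.
From mathcomp Require Import all_boot all_order all_algebra.
From mathcomp Require Import all_classical all_reals all_analysis.
From mathcomp Require Import ess_sup_inf measurable_realfun ring lra.

Set Implicit Arguments.
Unset Strict Implicit.
Unset Printing Implicit Defensive.

Import Order.TTheory GRing.Theory Num.Theory.
Import numFieldNormedType.Exports.

Local Open Scope classical_set_scope.
Local Open Scope ring_scope.

(** * Dissipation along the shift *)

Section flux_geometry.
Context {R : realType}.
Implicit Types (f df eta deta q : R -> R) (x s a b c u v w : R).

(** The initial value is attained only in the weak sense, and the Kruzkov inequality is known only
    for positive times. The usual estimate, in which the mass of the negative part of [u - k] does
    not grow on a shrinking cone, therefore cannot start: weak convergence as t tends to 0 does not
    make the negative part small. The potential [W] is Lipschitz, so its near monotonicity at small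
    times follows from the weak formulation alone; hence the passage from [u] to [W].

    The threshold k enters the geometry through tangency: the chord from any state at or above k to
    a state above [bl] lies strictly above the graph of [f] between them. An increasing jump ending
    above [uR] would thus produce entropy, and only decreasing jumps remain there.

    At a jump the speed is imposed by Rankine-Hugoniot, and the Filippov property only bounds it by
    the values of [V] at the traces. The dissipation is affine in the speed, its coefficient being a
    difference of weighted relative entropies; beyond [uL] the chord slope in [V] yields both
    inequalities on the speed, whatever the sign of this coefficient. *)

Lemma mvt_lt f df (Hf : forall x, is_derive x 1 f (df x)) (a b : R) : a < b ->
  exists c, [/\ a < c, c < b & f b - f a = df c * (b - a)].
Proof.
move=> ab; have cf : {within `[a, b], continuous f}.
  apply: derivable_within_continuous => x _; exact: (@ex_derive _ _ _ _ _ _ _ (Hf x)).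
have [c + e] := MVT ab (fun x _ => Hf x) cf.
by rewrite in_itv/= => /andP[ac cb]; exists c.
Qed.

Lemma mvt_between f df (Hf : forall x, is_derive x 1 f (df x)) (a b : R) :
  exists c, [/\ Num.min a b <= c, c <= Num.max a b & f b - f a = df c * (b - a)].
Proof.
have [ab|ba|<-] := ltgtP a b.
- by have [c [ac cb e]] := mvt_lt Hf ab; exists c; rewrite !ltW.
- have [c [ac cb e]] := mvt_lt Hf ba; exists c; rewrite !ltW//; split => //; lra.
- by exists a; rewrite lexx; split => //; lra.
Qed.

Section convexity.
Variables (f df ddf : R -> R).
Hypothesis Hf : forall x, is_derive x 1 f (df x).
Hypothesis Hdf : forall x, is_derive x 1 df (ddf x).
Hypothesis Hcc : forall u, u != 0 -> 0 < u * ddf u.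

Lemma df_incr a b : 0 <= a -> a < b -> df a < df b.
Proof.
move=> a0 ab; have [c [ac cb e]] := mvt_lt Hdf ab.
have c0 : 0 < c by lra.
have := Hcc (lt0r_neq0 c0); rewrite pmulr_rgt0// => h.
have : 0 < ddf c * (b - a) by rewrite mulr_gt0 ?subr_gt0.
lra.
Qed.

Lemma df_decr a b : b <= 0 -> a < b -> df b < df a.
Proof.
move=> b0 ab; have [c [ac cb e]] := mvt_lt Hdf ab.
have c0 : c < 0 by lra.
have := Hcc (ltr0_neq0 c0); rewrite nmulr_rgt0// => h.
have : ddf c * (b - a) < 0 by rewrite nmulr_rlt0 ?subr_gt0.
lra.
Qed.

Lemma df_min a : df 0 <= df a.
Proof.
have [a0|a0|->//] := ltgtP a 0.
- by rewrite ltW// df_decr.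
- by rewrite ltW// df_incr.
Qed.

Lemma df_homo_ge0 a b : 0 <= a -> a <= b -> df a <= df b.
Proof. by move=> a0; rewrite le_eqVlt => /predU1P[->//|ab]; rewrite ltW// df_incr. Qed.

Definition below_chord s v u := forall w, v < w -> w < u -> f w < f v + s * (w - v).

(** Strict convexity on the positive half line: the mean slope on ]v,
    w[ is smaller than the one on ]w, u[, and [s] is a weighted mean of the two. *)
Lemma below_chord_ge0 s v u : 0 <= v -> v < u -> f u - f v = s * (u - v) ->
  below_chord s v u.
Proof.
move=> v0 vu e w vw wu.
have [c1 [h1 h2 e1]] := mvt_lt Hf vw; have [c2 [h3 h4 e2]] := mvt_lt Hf wu.
have d : df c1 < df c2 by apply: df_incr; lra.
by have [h|h] := ltP (df c1) s; nra.
Qed.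

(** Here [v] may be negative, where [f] is concave. A point [p] below the chord, between [max v 0]
    and [u], has a slope to [u] larger than [s], and convexity on the positive half line carries
    this slope past [u]. *)
Lemma above_chord_right s v u w : 0 < u -> v < u -> f u - f v = s * (u - v) ->
  below_chord s v u -> u <= w -> f u + s * (w - u) <= f w.
Proof.
move=> u0 vu e bc; rewrite le_eqVlt => /predU1P[<-|uw]; first lra.
pose p := (Num.max v 0 + u) / 2.
have [h1 h2 h3] : [/\ v < p, p < u & 0 < p].
  by rewrite /p; have [|] := leP v 0 => ?; split; lra.
have b := bc _ h1 h2.
have [c1 [h5 h6 e1]] := mvt_lt Hf h2; have [c2 [h7 h8 e2]] := mvt_lt Hf uw.
have d : df c1 < df c2 by apply: df_incr; lra.
have : s < df c1 by nra.
nra.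
Qed.

Lemma above_chord_left s v u w : 0 <= w -> w <= v -> v < u -> f u - f v = s * (u - v) ->
  f u + s * (w - u) <= f w.
Proof.
move=> w0; rewrite le_eqVlt => /predU1P[->|wv] vu e; first nra.
have [c1 [h5 h6 e1]] := mvt_lt Hf wv; have [c2 [h7 h8 e2]] := mvt_lt Hf vu.
have d : df c1 < df c2 by apply: df_incr; lra.
have : df c2 = s by have := subr_gt0 v u; rewrite vu; nra.
nra.
Qed.

Section tangent.
Variables (b k : R).
Hypotheses (b0 : 0 < b) (k0 : k < 0) (Hk : f b - f k = df k * (b - k)).

(** On [k, 0] the slope [f'] decreases, so its mean is below [df k]; the line through the points at
    [k] and [b] having slope [df k], the mean over [0, b] must exceed [df k], and [f'] increases
    from there on. *)
Lemma tangent_slope_lt c : b <= c -> df k < df c.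
Proof.
move: (b0) (k0) (Hk) => b0' k0' Hk' bc.
have [c1 [h1 h2 e1]] := @mvt_lt f df Hf 0 b b0; have [c2 [h3 h4 e2]] := @mvt_lt f df Hf k 0 k0.
have d1 : df c2 < df k by apply: df_decr; lra.
have d2 : df c1 < df c by apply: df_incr; lra.
have p : 0 < (df k - df c2) * (- k) by rewrite mulr_gt0; lra.
have [h|h] := ltP (df k) (df c1); first lra.
have p2 : 0 <= (df k - df c1) * b by rewrite mulr_ge0; lra.
lra.
Qed.

(** For negative [v], the point at [u] lies above the tangent at [k], hence above the tangent at [v]
    by concavity on [k, v]: so [df v < s]. Concavity then keeps the graph under the chord up to 0,
    and from 0 to [u] it stays under the chord issued from 0, which is itself lower. *)
Lemma below_chord_tangent s v u : k <= v -> v < u -> b < u ->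
  f u - f v = s * (u - v) -> below_chord s v u.
Proof.
move: (b0) (k0) (Hk) => b0' k0' Hk' kv vu bu e; have [v0|v0] := leP 0 v; first exact: below_chord_ge0.
have Tk : df k * (u - k) < f u - f k.
  have [c [h1 h2 e1]] := mvt_lt Hf bu.
  have d := tangent_slope_lt (ltW h1).
  have p : 0 < (df c - df k) * (u - b) by rewrite mulr_gt0 ?subr_gt0.
  by lra.
have vs : df v < s.
  suff : df v * (u - v) < f u - f v by rewrite e ltr_pM2r// subr_gt0.
  move: kv; rewrite le_eqVlt => /predU1P[<-//|kv].
  have [c [h1 h2 e1]] := mvt_lt Hf kv.
  have d1 : df c < df k by apply: df_decr; lra.
  have d2 : df v < df k by apply: df_decr; lra.
  have p1 : 0 < (df k - df v) * (u - v) by rewrite mulr_gt0 ?subr_gt0.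
  have p2 : 0 < (df k - df c) * (v - k) by rewrite mulr_gt0 ?subr_gt0.
  by lra.
have neg w : v < w -> w <= 0 -> f w < f v + s * (w - v).
  move=> vw w0; have [c [h1 h2 e1]] := mvt_lt Hf vw.
  have d1 : df c < df v by apply: df_decr; lra.
  have p : 0 < (s - df c) * (w - v) by rewrite mulr_gt0; lra.
  by lra.
move=> w vw wu; have [w0|w0] := leP w 0; first exact: neg.
have f0 := neg 0 v0 (lexx _).
have u0 : 0 < u by lra.
pose s0 := (f u - f 0) / u.
have s0E : f u - f 0 = s0 * (u - 0) by rewrite subr0 mulfVK ?gt_eqF.
have := below_chord_ge0 (lexx 0) u0 s0E w0 wu.
have : s < s0 by nra.
nra.
Qed.

End tangent.

(** [T x] measures how far the tangent at [x] passes above the graph at [b]. It is negative at 0 by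
    convexity and positive far to the left, where [f'] exceeds the mean slope on [0, b]; the tangent
    point is a zero in between. *)
Lemma tangent_point b : 0 < b -> df v @[v --> -oo] --> +oo ->
  exists k, k < 0 /\ f b - f k = df k * (b - k).
Proof.
move=> b0 /cvgryPge Hinf.
have := Hinf ((f b - f 0) / b + 1); move=> [L [_ /(_ (Num.min L 0 - 1))]].
set v := Num.min L 0 - 1 => Hv.
have vL : v < L by rewrite /v; have [|] := leP L 0 => ?; lra.
have v0 : v < 0 by rewrite /v; have [|] := leP L 0 => ?; lra.
have {}Hv := Hv vL.
pose T x := df x * (b - x) - (f b - f x).
have cT : continuous T.
  move=> x; apply: differentiable_continuous; apply/derivable1_diffP.
  have ? := Hf x; have ? := Hdf x; exact: ex_derive.
have T0 : T 0 < 0.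
  have [c [h1 h2 e1]] := @mvt_lt f df Hf 0 b b0.
  by have := df_incr (lexx 0) h1; rewrite /T; nra.
have Tv : 0 < T v.
  have [c [h1 h2 e1]] := @mvt_lt f df Hf v 0 v0.
  have d1 : df c < df v by apply: df_decr; lra.
  have e2 : (f b - f 0) / b * b = f b - f 0 by rewrite mulfVK// gt_eqF.
  by rewrite /T; nra.
have [|x] := @IVT R T v 0 0 (ltW v0) (continuous_subspaceT cT).
  by rewrite ge_min le_max (ltW T0) (ltW Tv) orbT.
rewrite in_itv/= => /andP[vx x0] Tx; exists x; split.
  by rewrite lt_neqAle x0 andbT; apply: contra_eq_neq Tx => ->; rewrite lt_eqF.
by move: Tx; rewrite /T; lra.
Qed.

(** On the positive half line a tangent meets a strictly convex graph only once, so a solution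
    different from [b] must be negative. *)
Lemma tangent_point_neg b k : 0 < b -> k != b -> df k = (f b - f k) / (b - k) ->
  k < 0 /\ f b - f k = df k * (b - k).
Proof.
move=> b0 kb e; have {}e : f b - f k = df k * (b - k).
  by rewrite e mulfVK// subr_eq0 eq_sym.
split => //; rewrite ltNge; apply/negP => k0.
have [kb'|bk|kb'] := ltgtP k b; last by rewrite kb' eqxx in kb.
- have [c [h1 h2 e1]] := mvt_lt Hf kb'; have := df_incr k0 h1; nra.
- have [c [h1 h2 e1]] := mvt_lt Hf bk.
  have : df c < df k by apply: df_incr; lra.
  nra.
Qed.

End convexity.

Section relative_entropy.
Variables (f df eta deta ddeta q : R -> R).
Hypothesis Hf : forall x, is_derive x 1 f (df x).
Hypothesis Heta : forall x, is_derive x 1 eta (deta x).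
Hypothesis Hdeta : forall x, is_derive x 1 deta (ddeta x).
Hypothesis Hq : forall x, is_derive x 1 q (deta x * df x).
Hypothesis eta_cvx : forall x, 0 < ddeta x.

Definition rel_diss s a b :=
  s * (eta a - eta b - deta b * (a - b)) - (q a - q b - deta b * (f a - f b)).

(** As a function of the base state, the dissipation has for derivative [eta''] times the gap
    between [f] and the line of slope [s] through the point at [a]. All later signs thus reduce to
    the position of the graph with respect to a line. *)
Lemma is_derive_rel_diss s a x :
  is_derive x 1 (rel_diss s a) (ddeta x * (f a - f x - s * (a - x))).
Proof.
have h1 := Hf x; have h2 := Heta x; have h3 := Hdeta x; have h4 := Hq x.
by rewrite /rel_diss; apply: is_derive_eq; rewrite /GRing.scale/=; ring.
Qed.

Lemma rel_diss_diff s a b1 b2 : exists c, [/\ Num.min b1 b2 <= c, c <= Num.max b1 b2 &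
  rel_diss s a b2 - rel_diss s a b1 =
    ddeta c * (f a - f c - s * (a - c)) * (b2 - b1)].
Proof.
exact: (mvt_between (is_derive_rel_diss s a)).
Qed.

Lemma rel_diss_same s a : rel_diss s a a = 0.
Proof. by rewrite /rel_diss; ring. Qed.

End relative_entropy.
End flux_geometry.

(** * Dissipation inequality for the traces at a given speed *)

Section shift_inequality.
Context {R : realType}.
Implicit Types (x s a b c u v w : R).
Variables (f df ddf eta deta ddeta q : R -> R).
Hypothesis Hf : forall x, is_derive x 1 f (df x).
Hypothesis Hdf : forall x, is_derive x 1 df (ddf x).
Hypothesis Hcc : forall u, u != 0 -> 0 < u * ddf u.
Hypothesis Heta : forall x, is_derive x 1 eta (deta x).
Hypothesis Hdeta : forall x, is_derive x 1 deta (ddeta x).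
Hypothesis Hq : forall x, is_derive x 1 q (deta x * df x).
Hypothesis eta_cvx : forall x, 0 < ddeta x.

Local Notation rd := (rel_diss f eta deta q).

(* With [c] the left state of the shock, this speed makes the dissipation
   nonpositive when both traces of the solution equal [u]. *)
Definition shift_speed c u :=
  if u <= c then df (Num.max u 0) else (f u - f c) / (u - c).

Lemma rel_diss_jump s um up b :
  f up - f um = s * (up - um) -> q up - q um <= s * (eta up - eta um) ->
  rd s um b <= rd s up b.
Proof.
move=> e h; rewrite /rel_diss.
have : deta b * (f up - f um) = deta b * (s * (up - um)) by rewrite e.
lra.
Qed.

Lemma rel_diss_le s a b1 b2 : b1 <= b2 ->
  (forall c, b1 <= c -> c <= b2 -> f a - f c - s * (a - c) <= 0) ->
  rd s a b2 <= rd s a b1.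
Proof.
move=> b12 h; have [c [h1 h2 e]] := rel_diss_diff Hf Heta Hdeta Hq s a b1 b2.
rewrite min_l// in h1; rewrite max_r// in h2.
rewrite -subr_le0 e mulr_le0_ge0 ?subr_ge0//.
by rewrite mulr_ge0_le0 ?h// ltW.
Qed.

Lemma rel_diss_ge s a b1 b2 : b1 <= b2 ->
  (forall c, b1 <= c -> c <= b2 -> 0 <= f a - f c - s * (a - c)) ->
  rd s a b1 <= rd s a b2.
Proof.
move=> b12 h; have [c [h1 h2 e]] := rel_diss_diff Hf Heta Hdeta Hq s a b1 b2.
rewrite min_l// in h1; rewrite max_r// in h2.
by rewrite -subr_ge0 e mulr_ge0 ?subr_ge0// mulr_ge0 ?h// ltW.
Qed.

Variables (bl k uL uR a1 a2 : R).
Hypotheses (bl0 : 0 < bl) (k0 : k < 0) (Hk : f bl - f k = df k * (bl - k)).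
Hypotheses (blR : bl <= uR) (RL : uR < uL) (a20 : 0 < a2) (a12 : a2 <= a1).

Local Notation V := (shift_speed uL).

Let a10 : 0 < a1. Proof. exact: lt_le_trans a12. Qed.

Let a12_ge0 : 0 <= a1 - a2. Proof. by rewrite subr_ge0. Qed.

(** Beyond [uL], the chord from [uL] to [u] is above the graph between these states and below it on
    [uR, uL]. Up to [uL], the chosen line through the point at [u] stays below the graph at the
    relevant states. Integrating the derivative in the base state turns this into two signs. *)
Lemma shift_speed_cont_state u : a1 * rd (V u) u uL - a2 * rd (V u) u uR <= 0.
Proof.
move: (bl0) (blR) (RL) (a20) (a12) (k0) => bl0' blR' RL' a20' a12' k0'.
(* Write L and R for the two dissipations. If R is negative, a1 L - a2 R = a2 (L - R) + (a1 - a2) L,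
   and both terms are nonpositive. *)
suff [h1 h2] : rd (V u) u uL <= rd (V u) u uR /\ rd (V u) u uL <= 0.
  have [h|h] := leP 0 (rd (V u) u uR).
    have : 0 <= a2 * rd (V u) u uR by rewrite mulr_ge0// ltW.
    have : a1 * rd (V u) u uL <= 0 by rewrite mulr_ge0_le0// ltW.
    lra.
  have : a2 * rd (V u) u uL <= a2 * rd (V u) u uR by rewrite ler_wpM2l// ltW.
  have : (a1 - a2) * rd (V u) u uL <= 0 by rewrite mulr_ge0_le0// ltW.
  lra.
rewrite /shift_speed; case: ifPn => [uuL|]; last first.
  rewrite -ltNge => uLu; set s := _ / _.
  have e : f u - f uL = s * (u - uL) by rewrite mulfVK// subr_eq0 gt_eqF.
  have uL0 : 0 < uL by lra.
  have bc := below_chord_ge0 Hf Hdf Hcc (ltW uL0) uLu e.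
  split; last first.
    rewrite -(rel_diss_same f eta deta q s u); apply: rel_diss_ge; first exact: ltW.
    move=> c; rewrite le_eqVlt => /predU1P[<-|c1]; first lra.
    rewrite le_eqVlt => /predU1P[->|c2]; first lra.
    by have := bc _ c1 c2; lra.
  apply: rel_diss_le; first exact: ltW.
  move=> c c1 c2; have c0 : 0 <= c by lra.
  have := above_chord_left Hf Hdf Hcc c0 c2 uLu e; lra.
(* For u <= 0 the slope [df 0] is the minimum of [f'], and for u > 0 the line is a tangent in the
   convex region: this is the role of [max u 0] in the speed. *)
have key c : uR <= c \/ u <= c -> f u - f c - df (Num.max u 0) * (u - c) <= 0.
  move=> hc; have [u0|u0] := leP u 0.
    have [cu|uc|->] := ltgtP c u; [lra| |lra].
    have [d [h1 h2 e]] := mvt_lt Hf uc.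
    have := df_min Hdf Hcc d => hd.
    have p : 0 <= (df d - df 0) * (c - u) by rewrite mulr_ge0 ?subr_ge0// ltW.
    by lra.
  have [cu|uc|->] := ltgtP c u; last lra.
    have [d [h1 h2 e]] := mvt_lt Hf cu.
    have hd : df d <= df u by apply: (df_homo_ge0 Hdf Hcc); lra.
    have p : 0 <= (df u - df d) * (u - c) by rewrite mulr_ge0 ?subr_ge0// ltW.
    by lra.
  have [d [h1 h2 e]] := mvt_lt Hf uc.
  have hd : df u <= df d by apply: (df_homo_ge0 Hdf Hcc); lra.
  have p : 0 <= (df d - df u) * (c - u) by rewrite mulr_ge0 ?subr_ge0// ltW.
  by lra.
split.
- by apply: rel_diss_le; [exact: ltW|move=> c c1 c2; apply: key; left].
- rewrite -[leRHS](rel_diss_same f eta deta q (df (Num.max u 0)) u); apply: rel_diss_le => //.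
  by move=> c c1 c2; apply: key; right.
Qed.

(** Coefficient of the speed in the dissipation, which is affine in [s]: the sign of [G u] tells on
    which side of [V u] the speed may lie. *)
Let G u := a1 * (eta u - eta uL - deta uL * (u - uL)) -
  a2 * (eta u - eta uR - deta uR * (u - uR)).

Lemma rel_diss_speed s u : (0 <= G u /\ s <= V u) \/ (G u <= 0 /\ V u <= s) ->
  a1 * rd s u uL - a2 * rd s u uR <= 0.
Proof.
move: (bl0) (blR) (RL) (a20) (a12) (k0) => bl0' blR' RL' a20' a12' k0'.
move=> h; have := shift_speed_cont_state u.
have -> : a1 * rd s u uL - a2 * rd s u uR =
  (a1 * rd (V u) u uL - a2 * rd (V u) u uR) - G u * (V u - s).
  by rewrite /G /rel_diss; ring.
suff : 0 <= G u * (V u - s) by lra.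
by case: h => [] [h1 h2]; [rewrite mulr_ge0//|rewrite mulr_le0//]; lra.
Qed.

(** The relative entropy of [u] with respect to [b] increases with [b >= u], so passing from [uR] to
    [uL] increases it, and [a2 <= a1] preserves the order. *)
Lemma relative_entropy_sign u : u <= uR -> 0 <= G u.
Proof.
move: (bl0) (blR) (RL) (a20) (a12) (k0) => bl0' blR' RL' a20' a12' k0'.
move=> uuR; pose P b := eta u - eta b - deta b * (u - b).
have HP x : is_derive x 1 P (ddeta x * (x - u)).
  have h1 := Heta x; have h2 := Hdeta x.
  by rewrite /P; apply: is_derive_eq; rewrite /GRing.scale/=; ring.
have mono b1 b2 : u <= b1 -> b1 <= b2 -> P b1 <= P b2.
  move=> ub1; rewrite le_eqVlt => /predU1P[->//|b12].
  have [c [h1 h2 e]] := mvt_lt HP b12.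
  rewrite -subr_ge0 e mulr_ge0 ?mulr_ge0 ?subr_ge0//; [exact: ltW|lra|exact: ltW].
have P0 : P u = 0 by rewrite /P; ring.
have h1 : 0 <= P uR by rewrite -P0 mono.
have h2 : P uR <= P uL by rewrite mono// ltW.
rewrite /G -/(P uL) -/(P uR).
have : a2 * P uR <= a2 * P uL by rewrite ler_wpM2l// ltW.
have : 0 <= (a1 - a2) * P uL by rewrite mulr_ge0//; exact: le_trans h2.
lra.
Qed.

(** Since a jump can be evaluated at either trace ([Rm] and [Rp]), it suffices that [s] be on the
    favourable side of [V] for one of them. When both traces are at most [uR] the coefficient [G] is
    nonnegative and the bound by the maximum is enough; otherwise the jump decreases and the
    position of [up] with respect to [uL] decides. *)
Lemma shift_speed_jump s um up : k <= um -> k <= up ->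
  f up - f um = s * (up - um) -> q up - q um <= s * (eta up - eta um) ->
  um != up -> s <= Num.max (V um) (V up) ->
  a1 * rd s um uL - a2 * rd s up uR <= 0.
Proof.
move: (bl0) (blR) (RL) (a20) (a12) (k0) => bl0' blR' RL' a20' a12' k0'.
move=> kum kup RH ent ne sV.
have Rm : (0 <= G um /\ s <= V um) \/ (G um <= 0 /\ V um <= s) ->
    a1 * rd s um uL - a2 * rd s up uR <= 0.
  move=> /rel_diss_speed h; have := rel_diss_jump uR RH ent.
  by rewrite -(ler_pM2l a20); lra.
have Rp : (0 <= G up /\ s <= V up) \/ (G up <= 0 /\ V up <= s) ->
    a1 * rd s um uL - a2 * rd s up uR <= 0.
  move=> /rel_diss_speed h; have := rel_diss_jump uL RH ent.
  by rewrite -(ler_pM2l a10); lra.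
have [hmax|hmax] := leP (Num.max um up) uR.
  move: hmax; rewrite ge_max => /andP[h1 h2].
  move: sV; rewrite le_max => /orP[sV|sV]; [apply: Rm|apply: Rp]; left;
    split => //; exact: relative_entropy_sign.
(* an increasing jump would lie below its chord and produce entropy *)
have upm : up < um.
  rewrite ltNge le_eqVlt (negbTE ne)/=; apply/negP => mp.
  have blup : bl < up by rewrite max_r in hmax; [lra|exact: ltW].
  have bc := below_chord_tangent Hf Hdf Hcc bl0 k0 Hk kum mp blup RH.
  have [c [h1 h2 e]] := mvt_lt (is_derive_rel_diss Hf Heta Hdeta Hq s up) mp.
  have := rel_diss_jump um RH ent; rewrite rel_diss_same => h3.
  have h4 : f up - f c - s * (up - c) > 0 by have := bc _ h1 h2; lra.
  have h5 : 0 < ddeta c * (f up - f c - s * (up - c)) * (up - um).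
    by apply: mulr_gt0; [exact: mulr_gt0|rewrite subr_gt0].
  have e0 := rel_diss_same f eta deta q s up.
  by move: e; rewrite e0; lra.
have blum : uR < um by rewrite max_l in hmax => //; exact: ltW.
have um0 : 0 < um by lra.
have RH' : f um - f up = s * (um - up) by lra.
have bc := below_chord_tangent Hf Hdf Hcc bl0 k0 Hk kup upm (le_lt_trans blR blum) RH'.
(* If the jump starts above [uR] and ends at or below [uL], each of the two terms has the right sign
   separately, because the chord of the jump is above the graph inside the jump and below it at the
   other states concerned. *)
have [upL|upL] := leP up uL.
  have bc' w : up <= w -> w <= um -> 0 <= f um - f w - s * (um - w).
    rewrite le_eqVlt => /predU1P[<-|w1]; first lra.
    rewrite le_eqVlt => /predU1P[->|w2]; first lra.
    by have := bc _ w1 w2; lra.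
  have hL : rd s um uL <= 0.
    rewrite -(rel_diss_same f eta deta q s um).
    have [umL|umL] := leP um uL.
      apply: rel_diss_le => // c c1 c2.
      by have := above_chord_right Hf Hdf Hcc um0 upm RH' bc c1; lra.
    by apply: rel_diss_ge; [exact: ltW|move=> c c1 c2; apply: bc'; lra].
  have hR : 0 <= rd s up uR.
    rewrite -(rel_diss_same f eta deta q s up).
    have [upR|upR] := leP up uR.
      apply: rel_diss_ge => // c c1 c2.
      by have h := bc' c c1 (le_trans c2 (ltW blum)); lra.
    apply: rel_diss_le; first exact: ltW.
    move=> c c1 c2; have c0 : 0 <= c by lra.
    by have := above_chord_left Hf Hdf Hcc c0 c2 upm RH'; lra.
  have : a1 * rd s um uL <= 0 by rewrite mulr_ge0_le0// ltW.
  have : 0 <= a2 * rd s up uR by rewrite mulr_ge0// ltW.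
  lra.
have umL : uL < um by lra.
have uL0 : 0 <= uL by lra.
have up0 : 0 <= up by lra.
have eL : (um - uL) * V um = f um - f uL.
  by rewrite /shift_speed leNgt umL/= mulrC mulfVK// subr_eq0 gt_eqF.
have eP : (up - uL) * V up = f up - f uL.
  by rewrite /shift_speed leNgt upL/= mulrC mulfVK// subr_eq0 gt_eqF.
have hs : V um <= s.
  have := above_chord_left Hf Hdf Hcc uL0 (ltW upL) upm RH'.
  have : (um - uL) * V um <= (um - uL) * s -> V um <= s.
    by rewrite ler_pM2l ?subr_gt0.
  by move=> h1 h2; apply: h1; rewrite eL; lra.
have VV : V up <= V um.
  have eL' : f um - f uL = V um * (um - uL) by rewrite -eL mulrC.
  have := below_chord_ge0 Hf Hdf Hcc uL0 umL eL' upL upm.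
  have : (up - uL) * V up <= (up - uL) * V um -> V up <= V um.
    by rewrite ler_pM2l ?subr_gt0.
  by move=> h1 h2; apply: h1; rewrite eP; lra.
(* From [V up <= V um <= s] and [s <= V um], the speed is exactly [V um], and both signs of [G um]
   are harmless. *)
apply: Rm; rewrite max_l// in sV.
by have [h|h] := leP 0 (G um); [left|right; split => //; exact: ltW].
Qed.

Theorem shift_dissipation s um up : k <= um -> k <= up ->
  f up - f um = s * (up - um) -> q up - q um <= s * (eta up - eta um) ->
  Num.min (V um) (V up) <= s -> s <= Num.max (V um) (V up) ->
  a1 * rd s um uL - a2 * rd s up uR <= 0.
Proof.
move=> kum kup RH ent; have [<-|ne] := eqVneq um up; last first.
  by move=> _; exact: shift_speed_jump.
rewrite minxx maxxx => h1 h2; have -> : s = V um by apply/eqP; rewrite eq_le h1 h2.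
exact: shift_speed_cont_state.
Qed.

End shift_inequality.

(** * Test functions on the plane *)

Section partial_derivatives.
Context {R : realType}.
Implicit Types (phi : R * R -> R) (t x : R) (z : R * R).

Lemma mvt_linear (g dg : R -> R) (a h : R) :
  (forall x : R, is_derive x 1 g (dg x)) ->
  exists c, `|c - a| <= `|h| /\ g (a + h) - g a = dg c * h.
Proof.
move=> Hg; have [c [h1 h2 e]] := mvt_between Hg a (a + h).
exists c; rewrite e; split; last by rewrite addrAC subrr add0r.
have [h0|h0] := leP 0 h.
  have ah : a <= a + h by rewrite lerDl.
  move: h1 h2; rewrite (min_l ah) (max_r ah) => h1 h2.
  by rewrite !ger0_norm ?subr_ge0// lerBlDl.
have ah : a + h <= a by rewrite gerDl ltW.
move: h1 h2; rewrite (min_r ah) (max_l ah) => h1 h2.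
by rewrite ler0_norm ?subr_le0// ltr0_norm// opprB lerBlDl -lerBlDr opprK.
Qed.

(** The partial derivatives are given as functions and stated on one-variable sections, so that they
    can be computed with the rules of one-variable calculus. *)
Definition has_partials (phi pt px : R * R -> R) := forall t x : R,
  is_derive t 1 (fun t : R => phi (t, x)) (pt (t, x)) /\
  is_derive x 1 (fun x : R => phi (t, x)) (px (t, x)).

Lemma continuous2P (p : R * R -> R) t x : {for (t, x), continuous p} <->
  forall e : R, 0 < e -> exists2 d : R, 0 < d & forall t' x' : R,
    `|t' - t| < d -> `|x' - x| < d -> `|p (t, x) - p (t', x')| <= e.
Proof.
split=> [/cvgrPdist_le H e e0|H].
  have [[A B] /= [/nbhs_ballP[a /= a0 aA] /nbhs_ballP[b /= b0 bB]] AB] := H _ e0.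
  exists (Num.min a b); first by rewrite lt_min a0 b0.
  move=> t' x'; rewrite !lt_min => /andP[h1 _] /andP[_ h2].
  by apply: AB; split; [apply: aA|apply: bB]; rewrite /ball/= distrC.
apply/cvgrPdist_le => e e0; have [d d0 Hd] := H _ e0.
exists (ball t d, ball x d) => /=; first by split; exact: nbhsx_ballx.
by move=> [t' x'] /= [h1 h2]; apply: Hd; rewrite distrC.
Qed.

(** The increment is split along an L-shaped path, moving first in time and then in space; the mean
    value theorem on each piece and the continuity of the partials at the point bound the
    remainder. *)
Lemma C1_differentiable phi pt px z : has_partials phi pt px ->
  {for z, continuous pt} -> {for z, continuous px} -> differentiable phi z.
Proof.
case: z => t x Hp ct cx.
pose L0 (h : R * R) := pt (t, x) * h.1 + px (t, x) * h.2.
have lin : linear L0.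
  by move=> a [u1 u2] [v1 v2]; rewrite /L0 /= /GRing.scale/=; ring.
pose Lm := GRing.isLinear.Build _ _ _ _ _ lin.
have [L LE] : exists L : {linear _ -> _}, forall h, L h = L0 h.
  by pose L : {linear _ -> _} := HB.pack L0 Lm; exists L.
have cL : continuous L.
  move=> h; rewrite /continuous_at (_ : (L : _ -> _) = L0); last exact/funext.
  apply: cvgD; apply: cvgM; try exact: cvg_cst; [exact: cvg_fst|exact: cvg_snd].
have dE := @diff_unique R _ _ phi L (t, x) cL.
suff E : (phi : (R * R)%type -> R : normedModType R) \o shift (t, x) =
    cst (phi (t, x)) + L +o_ (0 : (R * R)%type : normedModType R) id.
  by apply/diff_locallyP; rewrite dE.
apply/eqaddoP => e e0.
  have e2 : 0 < e / 2 by rewrite divr_gt0.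
  have [d1 d10 H1] := (continuous2P _ _ _).1 ct _ e2.
  have [d2 d20 H2] := (continuous2P _ _ _).1 cx _ e2.
  pose d := Num.min d1 d2.
  have d0 : 0 < d by rewrite /d lt_min d10 d20.
  exists (ball (0:R) d, ball (0:R) d) => /=; first by split; exact: nbhsx_ballx.
  move=> [h1 h2] /= [hd1 hd2]; move: hd1 hd2.
  rewrite -!ball_normE/= !sub0r !normrN => hd1 hd2.
  have [c1 [k1 E1]] := mvt_linear t h1 (fun t => (Hp t (x + h2)).1).
  have [c2 [k2 E2]] := mvt_linear x h2 (fun x => (Hp t x).2).
  have B1 : `|pt (t, x) - pt (c1, x + h2)| <= e / 2.
    apply: H1; first by rewrite (le_lt_trans k1)// (lt_le_trans hd1)// ge_min lexx.
    by rewrite addrAC subrr add0r (lt_le_trans hd2)// ge_min lexx.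
  have B2 : `|px (t, x) - px (t, c2)| <= e / 2.
    apply: H2; first by rewrite subrr normr0.
    by rewrite (le_lt_trans k2)// (lt_le_trans hd2)// ge_min lexx orbT.
  have -> : (phi \o shift (t, x) - (cst (phi (t, x)) + L)) (h1, h2) =
     - (pt (t, x) - pt (c1, x + h2)) * h1 - (px (t, x) - px (t, c2)) * h2.
    rewrite [LHS](_ : _ = phi (h1 + t, h2 + x) - (phi (t, x) + L (h1, h2)))//.
    rewrite LE /L0 (addrC h1) (addrC h2).
    rewrite -[phi (t + h1, _)](subrK (phi (t, x + h2))) E1.
    by rewrite -[phi (t, x + h2)](subrK (phi (t, x))) E2 /=; ring.
  apply: (le_trans (ler_normD _ _)); rewrite normrN normrM normrN normrM.
  have n1 : `|h1| <= `|(h1, h2)| by rewrite prod_normE/= le_max lexx.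
  have n2 : `|h2| <= `|(h1, h2)| by rewrite prod_normE/= le_max lexx orbT.
  have p1 : `|pt (t, x) - pt (c1, x + h2)| * `|h1| <= e / 2 * `|(h1, h2)|.
    by rewrite ler_pM.
  have p2 : `|px (t, x) - px (t, c2)| * `|h2| <= e / 2 * `|(h1, h2)|.
    by rewrite ler_pM.
  apply: (le_trans (lerD p1 p2)).
  by rewrite -mulrDl -splitr.
Qed.

Lemma is_derive_dt phi t x d :
  is_derive t 1 (fun t => phi (t, x)) d -> dt phi (t, x) = d.
Proof.
move=> [h1 <-]; rewrite /dt /derive.
rewrite (_ : (fun h : R => h^-1 *: ((phi \o shift (t, x)) (h *: (1, 0)) - phi (t, x))) =
  fun h : R => h^-1 *: (((fun t => phi (t, x)) \o shift t) (h *: 1) - phi (t, x)))//.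
apply/funext => h /=; congr (_ *: (phi _ - _)).
by transitivity (h * 1 + t, h * 0 + x) => //; rewrite mulr0 add0r.
Qed.

Lemma is_derive_dx phi t x d :
  is_derive x 1 (fun x => phi (t, x)) d -> dx phi (t, x) = d.
Proof.
move=> [h1 <-]; rewrite /dx /derive.
rewrite (_ : (fun h : R => h^-1 *: ((phi \o shift (t, x)) (h *: (0, 1)) - phi (t, x))) =
  fun h : R => h^-1 *: (((fun x => phi (t, x)) \o shift x) (h *: 1) - phi (t, x)))//.
apply/funext => h /=; congr (_ *: (phi _ - _)).
by transitivity (h * 0 + t, h * 1 + x) => //; rewrite mulr0 add0r.
Qed.

Lemma has_partials_dt phi pt px : has_partials phi pt px -> dt phi = pt.
Proof. by move=> H; apply/funext => -[t x]; apply/is_derive_dt/(H t x).1. Qed.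

Lemma has_partials_dx phi pt px : has_partials phi pt px -> dx phi = px.
Proof. by move=> H; apply/funext => -[t x]; apply/is_derive_dx/(H t x).2. Qed.

End partial_derivatives.

(** * Algebras of smooth functions of one variable *)

Section algebra_closure.
Context {T : Type} {R : realType}.

(** Polynomials in the members of [S]. By the Leibniz rule, stability under differentiation has to
    be checked on the generators only. *)
Inductive alg_closure (S : set (T -> R)) : set (T -> R) :=
| AlgIn a : S a -> alg_closure S a
| AlgCst c : alg_closure S (cst c)
| AlgAdd a b : alg_closure S a -> alg_closure S b -> alg_closure S (fun x => a x + b x)
| AlgMul a b : alg_closure S a -> alg_closure S b -> alg_closure S (fun x => a x * b x).

End algebra_closure.

Section smooth1.
Context {R : realType}.
Implicit Types (a b g : R -> R) (x y : R) (S : set (R -> R)).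

Definition smooth_set1 S := forall a, S a -> (exists C : R, forall x : R, `|a x| <= C) /\
  exists2 a', S a' & forall x : R, is_derive x 1 a (a' x).

(* Smooth with all derivatives bounded: the witness [S] contains the function
   together with all its derivatives. *)
Definition smooth1 g := exists2 S, smooth_set1 S & S g.

Lemma smooth1_bounded g : smooth1 g -> exists2 C, 0 < C & forall x, `|g x| <= C.
Proof.
move=> [S /[apply] -[[C HC] _]]; exists (Num.max C 1); first by rewrite lt_max ltr01 orbT.
by move=> x; rewrite le_max HC.
Qed.

Lemma smooth1_derive g : smooth1 g ->
  exists2 g', smooth1 g' & forall x : R, is_derive x 1 g (g' x).
Proof. by move=> [S HS /HS[_ [g' Sg' H]]]; exists g' => //; exists S. Qed.

Lemma smooth1_continuous g : smooth1 g -> continuous g.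
Proof.
move=> /smooth1_derive[g' _ H] x.
by apply: differentiable_continuous; apply/derivable1_diffP; have := H x => ?; exact: ex_derive.
Qed.

Lemma smooth_set1_gen S : (forall a, S a -> (exists C : R, forall x : R, `|a x| <= C) /\
    exists2 a', alg_closure S a' & forall x : R, is_derive x 1 a (a' x)) ->
  smooth_set1 (alg_closure S).
Proof.
move=> HS a; elim=> {a} [a /HS//|c|a b _ [[C HC] [a' Sa' Ha]] _ [[D HD] [b' Sb' Hb]]|
  a b Sa [[C HC] [a' Sa' Ha]] Sb [[D HD] [b' Sb' Hb]]].
- split; first by exists `|c|.
  by exists (cst 0); [exact: AlgCst|move=> x; exact: is_derive_cst].
- split; first by exists (C + D) => x; rewrite (le_trans (ler_normD _ _)) ?lerD.
  by exists (fun x => a' x + b' x); [exact: AlgAdd|move=> x; exact: is_deriveD].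
- split; first by exists (C * D) => x; rewrite normrM ler_pM.
  exists (fun x => a' x * b x + a x * b' x); first by apply: AlgAdd; exact: AlgMul.
  move=> x; have h1 := Ha x; have h2 := Hb x.
  by apply: is_derive_eq; rewrite /GRing.scale/=; ring.
Qed.

Lemma smooth_set1_alg S : smooth_set1 S -> smooth_set1 (alg_closure S).
Proof.
move=> HS; apply: smooth_set1_gen => a /HS[Ca [a' Sa' Ha]]; split => //.
by exists a' => //; exact: AlgIn.
Qed.

Lemma smooth_set1U S S' : smooth_set1 S -> smooth_set1 S' -> smooth_set1 (S `|` S').
Proof.
move=> HS HS' a [/HS|/HS'] [Ca [a' Sa' Ha]]; split => //; exists a' => //; [by left|by right].
Qed.

Lemma smooth1M a b : smooth1 a -> smooth1 b -> smooth1 (fun x => a x * b x).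
Proof.
move=> [S HS Sa] [S' HS' Sb]; exists (alg_closure (S `|` S')).
  exact/smooth_set1_alg/smooth_set1U.
by apply: AlgMul; apply: AlgIn; [left|right].
Qed.

Lemma smooth1D a b : smooth1 a -> smooth1 b -> smooth1 (fun x => a x + b x).
Proof.
move=> [S HS Sa] [S' HS' Sb]; exists (alg_closure (S `|` S')).
  exact/smooth_set1_alg/smooth_set1U.
by apply: AlgAdd; apply: AlgIn; [left|right].
Qed.

Lemma smooth1_cst (c : R) : smooth1 (cst c).
Proof.
exists (alg_closure set0); last exact: AlgCst.
by apply: smooth_set1_alg => a [].
Qed.

Lemma smooth1_affine g (c d : R) : smooth1 g -> smooth1 (fun x => g (c * x + d)).
Proof.
move=> [S HS Sg].
exists [set a | exists k h, S h /\ a = fun x => k * h (c * x + d)]; last first.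
  by exists 1, g; split => //; apply/funext => x; rewrite mul1r.
move=> _ [k [h [Sh ->]]]; have [[C HC] [h' Sh' Hh]] := HS _ Sh; split.
  by exists (`|k| * C) => x; rewrite normrM ler_wpM2l.
exists (fun x => (k * c) * h' (c * x + d)); first by exists (k * c), h'.
move=> x; have h1 := Hh (c * x + d).
have h2 : is_derive x 1 (fun x => c * x + d) c.
  by apply: is_derive_eq; rewrite /GRing.scale/=; ring.
have h3 := @is_derive1_comp R h (fun x => c * x + d) x _ _ h1 h2.
by apply: is_derive_eq; rewrite /GRing.scale/=; ring.
Qed.

Lemma smooth1Z a (c : R) : smooth1 a -> smooth1 (fun x => c * a x).
Proof. by move=> sa; apply: (@smooth1M (cst c)) => //; exact: smooth1_cst. Qed.

(** The inverse is added as one more generator: its derivative, - g' (1/g)^2, is again a polynomial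
    in the generators, and [m] bounds it. *)
Lemma smooth1V g (m : R) : 0 < m -> (forall x, m <= g x) -> smooth1 g ->
  smooth1 (fun x => (g x)^-1).
Proof.
move=> m0 gm [S HS Sg]; pose I := S `|` [set fun x => (g x)^-1].
exists (alg_closure I); last by apply: AlgIn; right.
have gn0 x : g x != 0 by rewrite gt_eqF// (lt_le_trans m0).
have [[C HC] [g' Sg' Hg]] := HS _ Sg.
apply: smooth_set1_gen => a [/HS[Ca [a' Sa' Ha]]|->].
  by split=> //; exists a' => //; apply: AlgIn; left.
split.
  exists m^-1 => x; rewrite normrV ?unitfE// lef_pV2 ?posrE ?normr_gt0//.
  by rewrite ger0_norm// ltW// (lt_le_trans m0).
exists (fun x => cst (-1) x * (g' x * ((g x)^-1 * (g x)^-1))).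
  apply: AlgMul; first exact: AlgCst.
  apply: AlgMul; first by apply: AlgIn; left.
  by apply: AlgMul; apply: AlgIn; right.
move=> x; have h := Hg x; apply: is_derive_eq.
by rewrite /GRing.scale/= expr2 invfM; ring.
Qed.

End smooth1.

(** * The flat exponential, a smooth step and a bump *)

Section flat.
Context {R : realType}.
Implicit Types (x y : R) (p : {poly R}).

Lemma pow_expRN_bounded n : exists C : R, forall y : R, 0 <= y -> y ^+ n * expR (- y) <= C.
Proof.
case: n => [|n].
  by exists 1 => y y0; rewrite expr0 mul1r -expR0 ler_expR oppr_le0.
exists (n.+1`!%:R) => y y0; rewrite expRN ler_pdivrMr ?expR_gt0//.
have f0 : 0 < n.+1`!%:R :> R by rewrite ltr0n fact_gt0.
have h := expR_ge1Dxn n y0.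
rewrite mulrC -ler_pdivrMr//; apply: le_trans h.
by rewrite lerDr.
Qed.

Lemma poly_expRN_bounded p n : exists C : R, forall y : R, 0 <= y ->
  `|y ^+ n * p.[y] * expR (- y)| <= C.
Proof.
elim/poly_ind: p n => [|p c IH] n.
  by exists 0 => y _; rewrite horner0 mulr0 mul0r normr0.
have [C1 H1] := IH n.+1; have [C2 H2] := pow_expRN_bounded n.
exists (C1 + `|c| * C2) => y y0; rewrite hornerMXaddC.
have -> : y ^+ n * (p.[y] * y + c) * expR (- y) =
  y ^+ n.+1 * p.[y] * expR (- y) + c * (y ^+ n * expR (- y)) by rewrite exprS; ring.
apply: (le_trans (ler_normD _ _)); rewrite lerD ?H1// normrM ler_wpM2l//.
by rewrite ger0_norm ?H2// mulr_ge0 ?exprn_ge0 ?expR_ge0.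
Qed.

(** The classical p(1/x) exp(-1/x), extended by 0. The polynomial factor makes the family stable
    under differentiation. *)
Definition flat_poly p x : R := if 0 < x then p.[x^-1] * expR (- x^-1) else 0.

(** Away from 0 this is direct computation. At 0 the difference quotient at h > 0 equals h times y^2
    p(y) exp(-y) with y = 1/h, and the second factor is bounded. *)
Lemma flat_poly_derive p x :
  is_derive x 1 (flat_poly p) (flat_poly ('X^2 * (p - p^`())) x).
Proof.
have [x0|x0|->] := ltgtP x 0.
- apply: (@near_eq_is_derive _ _ _ (cst 0)).
    near=> y; rewrite /flat_poly ltNge ltW//; near: y; exact: lt_nbhsl.
  by rewrite /flat_poly ltNge ltW//=; exact: is_derive_cst.
- apply: (@near_eq_is_derive _ _ _ (fun x => p.[x^-1] * expR (- x^-1))).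
    near=> y; rewrite /flat_poly ifT//; near: y; exact: lt_nbhsr.
  have xn0 : x != 0 by rewrite gt_eqF.
  have h1 : is_derive x 1 (fun x => x^-1) (- x ^- 2).
    by have := @is_deriveV R id x 1 1 xn0 (is_derive_id _ _); rewrite /GRing.scale/= mulr1.
  have h2 : is_derive x 1 (fun x => - x^-1) (x ^- 2) by apply: is_derive_eq; rewrite opprK.
  have h3 := @is_derive1_comp R (horner p) (fun x => x^-1) x _ _ (is_derive_poly _ _) h1.
  have h4 := @is_derive1_comp R expR (fun x => - x^-1) x _ _ (is_derive_expR _) h2.
  have h5 := is_deriveM h3 h4; apply: is_derive_eq.
  rewrite /flat_poly x0 /GRing.scale/= hornerM hornerXn hornerD hornerN exprVn; ring.
- have [C HC] := poly_expRN_bounded p 2.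
  rewrite [flat_poly _ 0]/flat_poly ltxx.
  have cv : h^-1 *: ((flat_poly p \o shift 0) (h *: 1) - flat_poly p 0) @[h --> 0^'] --> (0 : R).
    apply/cvgrPdist_le => e e0.
    have C0 : 0 < `|C| + 1 by rewrite ltr_wpDl.
    exists (e / (`|C| + 1)); first by rewrite /= divr_gt0.
    move=> h /=; rewrite sub0r normrN => he hn0.
    rewrite addr0 [h%:A]mulr1 /flat_poly ltxx subr0 sub0r normrN /GRing.scale/=.
    case: ifPn => [h0|_]; last by rewrite mulr0 normr0 ltW.
    have hV : 0 <= h^-1 by rewrite invr_ge0 ltW.
    have -> : h^-1 * (p.[h^-1] * expR (- h^-1)) =
        h * (h^-1 ^+ 2 * p.[h^-1] * expR (- h^-1)).
      by move: (p.[_]) (expR _) => A B; field.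
    rewrite normrM (@le_trans _ _ (`|h| * (`|C| + 1)))//.
      by rewrite ler_wpM2l// (le_trans (HC _ hV))// (le_trans (ler_norm _))// lerDl.
    by rewrite -ler_pdivlMr// ltW.
  apply: DeriveDef; first by apply/cvg_ex; exists 0.
  exact: cvg_lim cv.
Unshelve. all: by end_near. Qed.

Definition flat : R -> R := flat_poly 1.

Lemma flatE x : flat x = if 0 < x then expR (- x^-1) else 0.
Proof. by rewrite /flat /flat_poly hornerC mul1r. Qed.

Lemma smooth1_flat : smooth1 flat.
Proof.
exists (range flat_poly) => [_ [p _ <-]|]; last by exists 1.
split; last by exists (flat_poly ('X^2 * (p - p^`()))) => [|x]; [exists ('X^2 * (p - p^`()))|exact: flat_poly_derive].
have [C HC] := poly_expRN_bounded p 0; exists `|C| => x; rewrite /flat_poly.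
case: ifPn => x0; last by rewrite normr0.
have xV : 0 <= x^-1 by rewrite invr_ge0 ltW.
by have := HC _ xV; rewrite expr0 mul1r => /le_trans; apply; exact: ler_norm.
Qed.

Lemma flat_gt0 x : 0 < x -> 0 < flat x.
Proof. by move=> x0; rewrite flatE x0 expR_gt0. Qed.

Lemma flat_eq0 x : x <= 0 -> flat x = 0.
Proof. by move=> x0; rewrite flatE ltNge x0. Qed.

Lemma flat_ge0 x : 0 <= flat x.
Proof. by have [/flat_eq0->//|/flat_gt0/ltW] := leP x 0. Qed.

Lemma flat_le1 x : flat x <= 1.
Proof.
rewrite flatE; case: ifPn => // x0.
by rewrite -expR0 ler_expR oppr_le0 invr_ge0 ltW.
Qed.

Lemma flat_homo x y : x <= y -> flat x <= flat y.
Proof.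
have [x0|x0] := leP x 0; first by rewrite flat_eq0// flat_ge0.
move=> xy; have y0 := lt_le_trans x0 xy.
by rewrite !flatE x0 y0 ler_expR lerN2 lef_pV2.
Qed.

Definition dflat : R -> R := flat_poly ('X^2).

Lemma flat_derive x : is_derive x 1 flat (dflat x).
Proof.
have := flat_poly_derive 1 x; rewrite derivC subr0 mulr1; exact.
Qed.

Lemma dflatE x : dflat x = if 0 < x then x^-1 ^+ 2 * expR (- x^-1) else 0.
Proof. by rewrite /dflat /flat_poly hornerXn. Qed.

Lemma dflat_ge0 x : 0 <= dflat x.
Proof. by rewrite dflatE; case: ifP => // x0; rewrite mulr_ge0 ?expR_ge0 ?sqr_ge0. Qed.

Lemma dflat_gt0 x : 0 < x -> 0 < dflat x.
Proof. by move=> x0; rewrite dflatE x0 mulr_gt0 ?expR_gt0// exprn_gt0 ?invr_gt0. Qed.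

Lemma dflat_eq0 x : x <= 0 -> dflat x = 0.
Proof. by move=> x0; rewrite dflatE ltNge x0. Qed.

(** Smooth transition from 0, for x <= -1, to 1, for x >= 1; the denominator is bounded below by
    [flat 1]. *)
Definition step x : R := flat (1 + x) / (flat (1 + x) + flat (1 - x)).

Let den_ge x : flat 1 <= flat (1 + x) + flat (1 - x).
Proof.
have [x0|x0] := leP 0 x.
  by rewrite -[leLHS]addr0 lerD ?flat_ge0// flat_homo// lerDl.
by rewrite -[leLHS]add0r lerD ?flat_ge0// flat_homo// lerDl oppr_ge0 ltW.
Qed.

Let den_gt0 x : 0 < flat (1 + x) + flat (1 - x).
Proof. by rewrite (lt_le_trans _ (den_ge x))// flat_gt0. Qed.

Let smooth1_flat_affine (c d : R) : smooth1 (fun x => flat (d + c * x)).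
Proof.
have := @smooth1_affine R flat c d smooth1_flat.
by under eq_fun do rewrite addrC.
Qed.

Lemma smooth1_step : smooth1 step.
Proof.
have h1 : smooth1 (fun x => flat (1 + x)).
  by have := smooth1_flat_affine 1 1; under eq_fun do rewrite mul1r.
have h2 : smooth1 (fun x => flat (1 - x)).
  by have := smooth1_flat_affine (-1) 1; under eq_fun do rewrite mulN1r.
apply: smooth1M => //; apply: (@smooth1V _ _ (flat 1)) => //; last exact: smooth1D.
exact: flat_gt0.
Qed.

Lemma step_ge1 x : 1 <= x -> step x = 1.
Proof.
move=> x1; have := den_gt0 x; rewrite /step (@flat_eq0 (1 - x)) ?subr_le0// addr0 => h.
by rewrite divff// gt_eqF.
Qed.

Lemma step_leN1 x : x <= -1 -> step x = 0.
Proof. by move=> x1; rewrite /step (@flat_eq0 (1 + x)) ?mul0r// -lerBrDl sub0r. Qed.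

Lemma step_ge0 x : 0 <= step x.
Proof. by rewrite divr_ge0 ?flat_ge0// ltW. Qed.

Lemma step_le1 x : step x <= 1.
Proof. by rewrite ler_pdivrMr// mul1r lerDl flat_ge0. Qed.

(** The derivative of [step], used as bump because its integral, [step 1 - step (-1) = 1], is then
    known without computation. *)
Definition bumpf x : R := (dflat (1 + x) * flat (1 - x) + flat (1 + x) * dflat (1 - x)) /
  (flat (1 + x) + flat (1 - x)) ^+ 2.

Lemma step_derive x : is_derive x 1 step (bumpf x).
Proof.
have h1 : is_derive x 1 (fun x => flat (1 + x)) (dflat (1 + x)).
  have h : is_derive x 1 (fun x => 1 + x) (1:R).
    by have := is_deriveD (is_derive_cst (1:R) x 1) (is_derive_id x (1:R)); rewrite add0r.
  have := @is_derive1_comp R flat (fun x => 1 + x) x _ _ (flat_derive _) h.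
  by rewrite mulr1.
have h2 : is_derive x 1 (fun x => flat (1 - x)) (- dflat (1 - x)).
  have h : is_derive x 1 (fun x => 1 - x) (-1:R).
    by have := is_deriveB (is_derive_cst (1:R) x 1) (is_derive_id x (1:R)); rewrite sub0r.
  have := @is_derive1_comp R flat (fun x => 1 - x) x _ _ (flat_derive _) h.
  by rewrite mulrN1.
have dn0 : flat (1 + x) + flat (1 - x) != 0 by rewrite gt_eqF.
have h3 := is_deriveD h1 h2.
have h4 := @is_deriveV R (fun x => flat (1 + x) + flat (1 - x)) x _ 1 dn0 h3; have h5 := is_deriveM h1 h4.
apply: is_derive_eq; rewrite /bumpf /GRing.scale/=.
by field.
Qed.

Lemma smooth1_bump : smooth1 bumpf.
Proof.
have [g' sg' Hg] := smooth1_derive smooth1_step.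
suff -> : bumpf = g' by [].
by apply/funext => x; have [_ <-] := Hg x; have [_ <-] := step_derive x.
Qed.

Lemma bump_ge0 x : 0 <= bumpf x.
Proof.
by rewrite divr_ge0 ?sqr_ge0// addr_ge0// mulr_ge0 ?flat_ge0 ?dflat_ge0.
Qed.

Lemma bump0_gt0 : 0 < bumpf 0.
Proof.
rewrite /bumpf addr0 subr0 divr_gt0 ?exprn_gt0 ?addr_gt0 ?mulr_gt0//;
  exact: flat_gt0 || exact: dflat_gt0.
Qed.

Lemma bump_eq0 x : 1 <= `|x| -> bumpf x = 0.
Proof.
rewrite ler_normr => /orP[h|h]; rewrite /bumpf.
  by rewrite (@flat_eq0 (1 - x)) ?(@dflat_eq0 (1 - x)) ?subr_le0// !mulr0 addr0 mul0r.
by rewrite (@flat_eq0 (1 + x)) ?(@dflat_eq0 (1 + x)) ?mul0r ?addr0 ?mul0r// -lerBrDl sub0r lerNr.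
Qed.

End flat.

(** * Smooth functions of two variables *)

Section smooth2.
Context {R : realType}.
Implicit Types (phi psi : R * R -> R) (S : set (R * R -> R)).

(** The open set where [phi] exceeds a level is the union of the boxes with rational corners that it
    contains; there are countably many, and each belongs to the product sigma-algebra. *)
Lemma continuous2_measurable phi : continuous phi -> measurable_fun setT phi.
Proof.
move=> cphi; apply: (measurability (@RGenOInfty.G R)); first exact: RGenOInfty.measurableE.
move=> _ [_ [r ->] <-].
rewrite setTI; set O := _ @^-1` _.
pose box (q : rat * rat * rat * rat) : set (R * R) :=
  `](ratr q.1.1.1), (ratr q.1.1.2)[ `*` `](ratr q.1.2), (ratr q.2)[.
have -> : O = \bigcup_q (if `[< box q `<=` O >] then box q else set0).
  apply/seteqP; split => [[t x] /= Orx|z [q _]]; last by case: asboolP => // h /h.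
  have rphi : r < phi (t, x) by move: Orx; rewrite /O /= in_itv/= andbT.
  have e0 : 0 < (phi (t, x) - r) / 2 by rewrite divr_gt0// subr_gt0.
  have [d d0 Hd] := (continuous2P _ _ _).1 (cphi (t, x)) _ e0.
  have [t1l t1r] : t - d < t /\ t < t + d by rewrite ltrBlDr ltrDl.
  have [x1l x1r] : x - d < x /\ x < x + d by rewrite ltrBlDr ltrDl.
  have [q1 q1P] := rat_in_itvoo t1l; have [q2 q2P] := rat_in_itvoo t1r.
  have [q3 q3P] := rat_in_itvoo x1l; have [q4 q4P] := rat_in_itvoo x1r.
  move: q1P q2P q3P q4P; rewrite !in_itv/= => /andP[a1 a2] /andP[b1 b2] /andP[c1 c2] /andP[d1 d2].
  exists (q1, q2, q3, q4) => //; case: asboolP => [_|].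
    by rewrite /box/= !in_itv/= a2 b1 c2 d1.
  case=> -[t' x']; rewrite /box /= !in_itv/= => -[/andP[k1 k2] /andP[k3 k4]].
  rewrite /O /= in_itv/= andbT.
  have : `|phi (t, x) - phi (t', x')| <= (phi (t, x) - r) / 2.
    by apply: Hd => //; rewrite ltr_distlC; apply/andP; split; lra.
  rewrite ler_norml => /andP[_]; lra.
apply: countable_bigcupT_measurable => [|q]; first exact: countableP.
case: asboolP => // _; apply: measurableX; exact: measurable_itv.
Qed.

Definition smooth_set2 S := forall a, S a -> continuous a /\
  exists at_ ax, [/\ S at_, S ax & has_partials a at_ ax].

Definition smooth2 phi := exists2 S, smooth_set2 S & S phi.

Lemma smooth2_continuous phi : smooth2 phi -> continuous phi.
Proof. by move=> [S /[apply] -[]]. Qed.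

Lemma smooth2_measurable phi : smooth2 phi -> measurable_fun setT phi.
Proof. by move=> /smooth2_continuous/continuous2_measurable. Qed.

Lemma smooth2_partials phi : smooth2 phi -> exists pt px,
  [/\ smooth2 pt, smooth2 px & has_partials phi pt px].
Proof.
move=> [S HS /HS[_ [pt [px [h1 h2 h3]]]]].
by exists pt, px; split => //; exists S.
Qed.

Lemma smooth2_differentiable phi z : smooth2 phi -> differentiable phi z.
Proof.
move=> /smooth2_partials[pt [px [h1 h2 h3]]].
by apply: (C1_differentiable h3); exact: smooth2_continuous.
Qed.

Lemma smooth2_iter phi (s : seq bool) : smooth2 phi -> smooth2 (partials s phi).
Proof.
move=> sp; elim: s => //= b s /smooth2_partials[pt [px [h1 h2 h3]]].
by rewrite (has_partials_dt h3) (has_partials_dx h3); case: b.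
Qed.

Lemma smooth2_test phi (B : R) : smooth2 phi ->
  (forall z, phi z != 0 -> `|z.1| <= B /\ `|z.2| <= B) -> test_function phi.
Proof.
move=> sp supp; split=> [s z|]; first exact/smooth2_differentiable/smooth2_iter.
apply: (@subclosed_compact _ _ (`[- B, B]%classic `*` `[- B, B]%classic)).
- exact: closed_closure.
- by apply: compact_setX; exact: segment_compact.
- rewrite closureE => z /(_ (`[- B, B]%classic `*` `[- B, B]%classic)); apply; split.
    apply: compact_closed; first exact: norm_hausdorff.
    by apply: compact_setX; exact: segment_compact.
  by move=> w /= /supp[]; rewrite !ler_norml !in_itv/=.
Qed.

Lemma support_half_plane phi (tau : R) : 0 < tau ->
  (forall z, phi z != 0 -> tau <= z.1) ->
  closure [set z | phi z != 0] `<=` half_plane.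
Proof.
move=> tau0 supp; rewrite closureE => z /(_ [set z | tau <= z.1]) h.
rewrite /half_plane/= (lt_le_trans tau0)//; apply: h; split => //.
apply: (@closed_comp _ _ fst [set t : R | tau <= t]); last exact: closed_ge.
by move=> w _; exact: cvg_fst.
Qed.

Lemma smooth_set2_gen S : (forall a, S a -> continuous a /\
    exists at_ ax, [/\ alg_closure S at_, alg_closure S ax & has_partials a at_ ax]) ->
  smooth_set2 (alg_closure S).
Proof.
move=> HS a; elim=> {a} [a /HS//|c|a b _ [ca [at_ [ax [S1 S2 Ha]]]] _ [cb [bt [bx [S3 S4 Hb]]]]|
  a b Sa [ca [at_ [ax [S1 S2 Ha]]]] Sb [cb [bt [bx [S3 S4 Hb]]]]].
- split; first by move=> z; exact: cvg_cst.
  exists (cst 0), (cst 0); split; [exact: AlgCst|exact: AlgCst|].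
  by move=> t x; split; exact: is_derive_cst.
- split; first by move=> z; apply: cvgD; [exact: ca|exact: cb].
  exists (fun z => at_ z + bt z), (fun z => ax z + bx z).
  split; [exact: AlgAdd|exact: AlgAdd|move=> t x].
  have [h1 h2] := Ha t x; have [h3 h4] := Hb t x; split; exact: is_deriveD.
- split; first by move=> z; apply: cvgM; [exact: ca|exact: cb].
  exists (fun z => at_ z * b z + a z * bt z), (fun z => ax z * b z + a z * bx z).
  split; [by apply: AlgAdd; exact: AlgMul..|move=> t x].
  have [h1 h2] := Ha t x; have [h3 h4] := Hb t x.
  by split; apply: is_derive_eq; rewrite /GRing.scale/=; ring.
Qed.

Lemma smooth_set2U S S' : smooth_set2 S -> smooth_set2 S' -> smooth_set2 (S `|` S').
Proof.
move=> HS HS' a [/HS|/HS'] [Ca [at_ [ax [h1 h2 h3]]]]; split => //;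
  exists at_, ax; split => //; by [left|right].
Qed.

Lemma smooth_set2_alg S : smooth_set2 S -> smooth_set2 (alg_closure S).
Proof.
move=> HS; apply: smooth_set2_gen => a /HS[Ca [at_ [ax [h1 h2 h3]]]]; split => //.
by exists at_, ax; split => //; exact: AlgIn.
Qed.

Lemma smooth2_cst (c : R) : smooth2 (cst c).
Proof.
exists (alg_closure set0); last exact: AlgCst.
by apply: smooth_set2_alg => a [].
Qed.

Lemma smooth2D a b : smooth2 a -> smooth2 b -> smooth2 (fun z => a z + b z).
Proof.
move=> [S HS Sa] [S' HS' Sb]; exists (alg_closure (S `|` S')).
  exact/smooth_set2_alg/smooth_set2U.
by apply: AlgAdd; apply: AlgIn; [left|right].
Qed.

Lemma smooth2M a b : smooth2 a -> smooth2 b -> smooth2 (fun z => a z * b z).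
Proof.
move=> [S HS Sa] [S' HS' Sb]; exists (alg_closure (S `|` S')).
  exact/smooth_set2_alg/smooth_set2U.
by apply: AlgMul; apply: AlgIn; [left|right].
Qed.

Lemma smooth2Z (c : R) a : smooth2 a -> smooth2 (fun z => c * a z).
Proof. by apply: (@smooth2M (cst c)); exact: smooth2_cst. Qed.

Lemma smooth2B a b : smooth2 a -> smooth2 b -> smooth2 (fun z => a z - b z).
Proof.
move=> sa sb; under eq_fun do rewrite -mulN1r.
by apply: smooth2D => //; exact: smooth2Z.
Qed.

Lemma smooth2_fst : smooth2 fst.
Proof.
exists (alg_closure [set fst]); last exact: AlgIn.
apply: smooth_set2_gen => _ ->; split; first by move=> z; exact: cvg_fst.
exists (cst 1), (cst 0); split; [exact: AlgCst..|move=> t x]; split.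
- exact: is_derive_id.
- exact: is_derive_cst.
Qed.

Lemma smooth2_snd : smooth2 snd.
Proof.
exists (alg_closure [set snd]); last exact: AlgIn.
apply: smooth_set2_gen => _ ->; split; first by move=> z; exact: cvg_snd.
exists (cst 0), (cst 1); split; [exact: AlgCst..|move=> t x]; split.
- exact: is_derive_cst.
- exact: is_derive_id.
Qed.

Lemma smooth2_comp (g : R -> R) a : smooth1 g -> smooth2 a -> smooth2 (fun z => g (a z)).
Proof.
move=> [S1 HS1 Sg] [S HS Sa].
exists (alg_closure (S `|` [set b | exists2 h, S1 h & b = h \o a])); last first.
  by apply: AlgIn; right; exists g.
apply: smooth_set2_gen => b [/HS[cb [bt [bx [h1 h2 h3]]]]|[h Sh ->]].
  by split=> //; exists bt, bx; split => //; apply: AlgIn; left.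
have [ca [at_ [ax [h1 h2 h3]]]] := HS _ Sa.
have sh : smooth1 h by exists S1.
split; first by move=> z; apply: continuous_comp; [exact: ca|exact: smooth1_continuous].
have [_ [h' Sh' Hh]] := HS1 _ Sh.
exists (fun z => h' (a z) * at_ z), (fun z => h' (a z) * ax z); split.
- by apply: AlgMul; apply: AlgIn; [right; exists h'|left].
- by apply: AlgMul; apply: AlgIn; [right; exists h'|left].
- move=> t x; have [k1 k2] := h3 t x; have k3 := Hh (a (t, x)); split.
  + exact: (@is_derive1_comp R h (fun t => a (t, x)) t).
  + exact: (@is_derive1_comp R h (fun x => a (t, x)) x).
Qed.

End smooth2.

(** * Integrals of bounded functions with bounded support *)

Section bounded_compact_support.
Context {R : realType}.
Local Notation mu := (@lebesgue_measure R).

(** Bounded, measurable, zero outside a bounded set. This class is stable under sums, products with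
    bounded measurable functions and integration in one variable, so that linearity, Fubini and
    comparison apply without further integrability checks. *)
Definition bcs1 (g : R -> R) := measurable_fun setT g /\ exists C B : R,
  forall x, `|g x| <= C /\ (B < `|x| -> g x = 0).

Definition bcs2 (g : R * R -> R) := measurable_fun setT g /\ exists C B : R,
  forall z, `|g z| <= C /\ (B < `|z.1| \/ B < `|z.2| -> g z = 0).

Lemma bcs1_bound g : bcs1 g -> exists C B : R, [/\ 0 < C, 0 < B &
  forall x, `|g x| <= C /\ (B < `|x| -> g x = 0)].
Proof.
move=> [_ [C [B H]]]; exists (Num.max C 1), (Num.max B 1).
split; [by rewrite lt_max ltr01 orbT..|] => x; have [h1 h2] := H x.
by split; [rewrite le_max h1|rewrite gt_max => /andP[/h2]].
Qed.

Lemma bcs2_bound g : bcs2 g -> exists C B : R, [/\ 0 < C, 0 < B &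
  forall z, `|g z| <= C /\ (B < `|z.1| \/ B < `|z.2| -> g z = 0)].
Proof.
move=> [_ [C [B H]]]; exists (Num.max C 1), (Num.max B 1).
split; [by rewrite lt_max ltr01 orbT..|] => x; have [h1 h2] := H x.
split; first by rewrite le_max h1.
by rewrite !gt_max => -[/andP[hB _]|/andP[hB _]]; apply: h2; [left|right].
Qed.

Lemma segment_measure (a b : R) : a <= b -> mu `[a, b]%classic = (b - a)%:E.
Proof.
rewrite lebesgue_measure_itv/= lte_fin le_eqVlt => /predU1P[->|->]//.
by rewrite ltxx subrr.
Qed.

Lemma segment_measure_lty (a b : R) : (mu `[a, b]%classic < +oo)%E.
Proof. by rewrite lebesgue_measure_itv/=; case: ifP => // _; rewrite -EFinB ltry. Qed.

Lemma bcs1_integrable g : bcs1 g -> mu.-integrable setT (EFin \o g).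
Proof.
move=> bg; have [C [B [C0 B0 H]]] := bcs1_bound bg.
have e : g = g \_ `[- B, B].
  apply/funext => x; rewrite patchE; case: ifPn => // /negP h; apply: (H x).2.
  rewrite ltNge; apply/negP => xB; apply: h; rewrite inE/= in_itv/=.
  by rewrite -ler_norml.
rewrite e -restrict_EFin; apply/integrable_restrict => //=; rewrite setTI.
apply: measurable_bounded_integrable => //.
- exact: segment_measure_lty.
- exact: measurable_funS bg.1.
- by exists C; split; [exact: num_real|move=> x Cx y _; exact: (le_trans (H y).1 (ltW Cx))].
Qed.

Lemma leb2_box (a b c d : R) : a <= b -> c <= d ->
  leb2 (`[a, b] `*` `[c, d]) = ((b - a) * (d - c))%:E.
Proof.
move=> ab cd; rewrite /leb2/= product_measure1E//; [|exact: measurable_itv..].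
rewrite /= !lebesgue_measure_itv/= !lte_fin.
move: ab cd; rewrite !le_eqVlt => /predU1P[->|ab]; first by rewrite ltxx mul0e subrr mul0r.
rewrite ab => /predU1P[->|cd]; first by rewrite ltxx mule0 subrr mulr0.
by rewrite cd -!EFinB -EFinM.
Qed.

Lemma bcs2_integrable (g : R * R -> R) : bcs2 g -> leb2.-integrable setT (EFin \o g).
Proof.
move=> bg; have [C [B [C0 B0 H]]] := bcs2_bound bg.
have mB : measurable (`[- B, B] `*` `[- B, B] : set (R * R)).
  by apply: measurableX; exact: measurable_itv.
have e : g = g \_ (`[- B, B] `*` `[- B, B]).
  apply/funext => z; rewrite patchE; case: ifPn => // /negP h; apply: (H z).2.
  have [h1|h1] := ltP B `|z.1|; first by left.
  have [h2|h2] := ltP B `|z.2|; first by right.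
  by exfalso; apply: h; rewrite inE; split; rewrite /= in_itv/= -ler_norml.
rewrite e -restrict_EFin; apply/integrable_restrict => //=; rewrite setTI.
apply: measurable_bounded_integrable => //.
- by rewrite leb2_box ?ltry//; lra.
- exact: measurable_funS bg.1.
- by exists C; split; [exact: num_real|move=> x Cx y _; exact: (le_trans (H y).1 (ltW Cx))].
Qed.

Lemma bcs1_integral_bound (g : R -> R) (C B : R) : measurable_fun setT g -> 0 <= C -> 0 <= B ->
  (forall x, `|g x| <= C) -> (forall x, B < `|x| -> g x = 0) ->
  `|\int[mu]_x g x| <= C * (2 * B).
Proof.
move=> mg C0 B0 gC gB.
have bg : bcs1 g by split => //; exists C, B => x; split => //; exact: gB.
apply: (le_trans (le_normr_Rintegral _ _)) => //; first exact: bcs1_integrable.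
have e : (fun x => `|g x|) = (fun x => `|g x|) \_ `[- B, B].
  apply/funext => x; rewrite patchE; case: ifPn => // /negP h; rewrite gB ?normr0//.
  by rewrite ltNge; apply/negP => xB; apply: h; rewrite inE/= in_itv/= -ler_norml.
rewrite e -Rintegral_mkcond.
have h : (\int[mu]_(x in `[- B, B]) `|g x| <= \int[mu]_(x in `[- B, B]) C)%R.
  apply: le_Rintegral => //.
  - apply: (@integrableS _ _ _ mu setT) => //.
    by apply/integrable_norm/bcs1_integrable.
  - apply: measurable_bounded_integrable => //.
    + exact: segment_measure_lty.
    + exact: bounded_cst.
have BB : - B <= B by lra.
apply: (le_trans h); have := @Rintegral_cst _ _ _ mu `[- B, B]%classic (measurable_itv _) C.
have F : fine (mu `[- B, B]%classic) <= 2 * B by rewrite (segment_measure BB)/=; lra.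
by move=> ->; exact: ler_wpM2l C0 _ _ F.
Qed.

Lemma bcs2_fst (g : R * R -> R) t : bcs2 g -> bcs1 (fun x => g (t, x)).
Proof.
move=> [mg [C [B H]]]; split; first exact: measurableT_comp mg (measurable_pair1 t).
by exists C, B => x; have [h1 h2] := H (t, x); split => // ?; apply: h2; right.
Qed.

Lemma bcs2_snd (g : R * R -> R) x : bcs2 g -> bcs1 (fun t => g (t, x)).
Proof.
move=> [mg [C [B H]]]; split; first exact: measurableT_comp mg (measurable_pair2 x).
by exists C, B => t; have [h1 h2] := H (t, x); split => // ?; apply: h2; left.
Qed.

Lemma Rintegral_eq0 d (T : measurableType d) (nu : {measure set T -> \bar R}) (D : set T)
  (g : T -> R) : (forall x, D x -> g x = 0) -> \int[nu]_(x in D) g x = 0.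
Proof.
by move=> h; rewrite /Rintegral integral0_eq// => x Dx; rewrite h.
Qed.

Lemma bcs2_inner1 (g : R * R -> R) : bcs2 g -> bcs1 (fun t => \int[mu]_x g (t, x)).
Proof.
move=> bg; have [C [B [C0 B0 H]]] := bcs2_bound bg; split.
  apply: measurableT_comp; first exact: (@fine_measurable R setT).
  exact: measurable_fubini_F (bcs2_integrable bg).
exists (C * (2 * B)), B => t; split.
  apply: bcs1_integral_bound; [exact: (bcs2_fst t bg).1|exact: ltW..| |].
    by move=> x; exact: (H _).1.
  by move=> x xB; apply: (H _).2; right.
move=> tB; apply: Rintegral_eq0 => x _.
by apply: (H _).2; left.
Qed.

Lemma bcs2_inner2 (g : R * R -> R) : bcs2 g -> bcs1 (fun x => \int[mu]_t g (t, x)).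
Proof.
move=> bg; have [C [B [C0 B0 H]]] := bcs2_bound bg; split.
  apply: measurableT_comp; first exact: (@fine_measurable R setT).
  exact: measurable_fubini_G (bcs2_integrable bg).
exists (C * (2 * B)), B => x; split.
  apply: bcs1_integral_bound; [exact: (bcs2_snd x bg).1|exact: ltW..| |].
    by move=> t; exact: (H _).1.
  by move=> t xB; apply: (H _).2; left.
move=> tB; apply: Rintegral_eq0 => t _.
by apply: (H _).2; right.
Qed.

Lemma bcs2_fubini1 (g : R * R -> R) : bcs2 g ->
  \int[leb2]_z g z = \int[mu]_t \int[mu]_x g (t, x).
Proof.
move=> bg; rewrite /Rintegral -(integral12_prod_meas1 (bcs2_integrable bg)).
congr fine; apply: eq_integral => t _; rewrite /fubini_F fineK//.
apply: integrable_fin_num => //; exact: (bcs1_integrable (bcs2_fst t bg)).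
Qed.

Lemma bcs2_fubini2 (g : R * R -> R) : bcs2 g ->
  \int[leb2]_z g z = \int[mu]_x \int[mu]_t g (t, x).
Proof.
move=> bg; rewrite /Rintegral -(integral21_prod_meas1 (bcs2_integrable bg)).
congr fine; apply: eq_integral => x _; rewrite /fubini_G fineK//.
apply: integrable_fin_num => //; exact: (bcs1_integrable (bcs2_snd x bg)).
Qed.

End bounded_compact_support.

(** * Calculus of integrals, dominated convergence and translations *)

Section bcs_calculus.
Context {R : realType}.
Local Notation mu := (@lebesgue_measure R).
Implicit Types (g h : R -> R).

Lemma aeS d (T : measurableType d) (nu : {measure set T -> \bar R}) (P Q : T -> Prop) :
  {ae nu, forall x, P x} -> (forall x, P x -> Q x) -> {ae nu, forall x, Q x}.
Proof. by move=> aeP PQ; exact: filterS aeP. Qed.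

Lemma aeI d (T : measurableType d) (nu : {measure set T -> \bar R}) (P Q : T -> Prop) :
  {ae nu, forall x, P x} -> {ae nu, forall x, Q x} -> {ae nu, forall x, P x /\ Q x}.
Proof. by move=> aeP aeQ; apply: filterS2 aeP aeQ. Qed.

Definition bm1 g := measurable_fun setT g /\ exists C : R, forall x, `|g x| <= C.
Definition bm2 (g : R * R -> R) := measurable_fun setT g /\ exists C : R, forall z, `|g z| <= C.

Lemma bcs1W g : bcs1 g -> bm1 g.
Proof. by move=> [mg [C [B H]]]; split => //; exists C => x; exact: (H x).1. Qed.

Lemma bcs1M g h : bcs1 g -> bm1 h -> bcs1 (fun x => g x * h x).
Proof.
move=> [mg [C [B H]]] [mh [D HD]]; split; first exact: measurable_funM.
exists (C * D), B => x; have [h1 h2] := H x; split.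
  by rewrite normrM ler_pM.
by move=> /h2 ->; rewrite mul0r.
Qed.

Lemma bcs2M (g h : R * R -> R) : bcs2 g -> bm2 h -> bcs2 (fun x => g x * h x).
Proof.
move=> [mg [C [B H]]] [mh [D HD]]; split; first exact: measurable_funM.
exists (C * D), B => x; have [h1 h2] := H x; split.
  by rewrite normrM ler_pM.
by move=> /h2 ->; rewrite mul0r.
Qed.

Lemma bcs1D g h : bcs1 g -> bcs1 h -> bcs1 (fun x => g x + h x).
Proof.
move=> [mg [C [B H]]] [mh [D [B' H']]]; split; first exact: measurable_funD.
exists (C + D), (Num.max B B') => x; have [h1 h2] := H x; have [h3 h4] := H' x; split.
  by rewrite (le_trans (ler_normD _ _))// lerD.
by rewrite gt_max => /andP[/h2 -> /h4 ->]; rewrite addr0.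
Qed.

Lemma bcs2D (g h : R * R -> R) : bcs2 g -> bcs2 h -> bcs2 (fun x => g x + h x).
Proof.
move=> [mg [C [B H]]] [mh [D [B' H']]]; split; first exact: measurable_funD.
exists (C + D), (Num.max B B') => x; have [h1 h2] := H x; have [h3 h4] := H' x; split.
  by rewrite (le_trans (ler_normD _ _))// lerD.
by rewrite !gt_max => -[/andP[k1 k2]|/andP[k1 k2]]; rewrite h2 ?h4 ?addr0//; by [left|right].
Qed.

Lemma bm1_cst (c : R) : bm1 (cst c).
Proof. by split; [exact: measurable_cst|exists `|c|]. Qed.

Lemma bm2_cst (c : R) : bm2 (cst c).
Proof. by split; [exact: measurable_cst|exists `|c|]. Qed.

Lemma bcs1Z (c : R) g : bcs1 g -> bcs1 (fun x => c * g x).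
Proof.
by move=> bg; under eq_fun do rewrite mulrC; apply: (bcs1M bg); exact: bm1_cst.
Qed.

Lemma bcs2Z (c : R) (g : R * R -> R) : bcs2 g -> bcs2 (fun x => c * g x).
Proof.
by move=> bg; under eq_fun do rewrite mulrC; apply: (bcs2M bg); exact: bm2_cst.
Qed.

Lemma bcs1N g : bcs1 g -> bcs1 (fun x => - g x).
Proof. by move=> /(bcs1Z (-1)); under eq_fun do rewrite mulN1r. Qed.

Lemma bcs2N (g : R * R -> R) : bcs2 g -> bcs2 (fun x => - g x).
Proof. by move=> /(bcs2Z (-1)); under eq_fun do rewrite mulN1r. Qed.

Lemma bcs1B g h : bcs1 g -> bcs1 h -> bcs1 (fun x => g x - h x).
Proof. by move=> bg bh; apply: bcs1D => //; exact: bcs1N. Qed.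

Lemma bcs2B (g h : R * R -> R) : bcs2 g -> bcs2 h -> bcs2 (fun x => g x - h x).
Proof. by move=> bg bh; apply: bcs2D => //; exact: bcs2N. Qed.

Lemma bcs1_norm g : bcs1 g -> bcs1 (fun x => `|g x|).
Proof.
move=> [mg [C [B H]]]; split; first exact: measurableT_comp.
by exists C, B => x; have [h1 h2] := H x; rewrite normr_id; split => // /h2->; rewrite normr0.
Qed.

Lemma bcs2_norm (g : R * R -> R) : bcs2 g -> bcs2 (fun x => `|g x|).
Proof.
move=> [mg [C [B H]]]; split; first exact: measurableT_comp.
by exists C, B => x; have [h1 h2] := H x; rewrite normr_id; split => // /h2->; rewrite normr0.
Qed.

Lemma bcs1_integralD g h : bcs1 g -> bcs1 h ->
  \int[mu]_x (g x + h x) = \int[mu]_x g x + \int[mu]_x h x.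
Proof. by move=> bg bh; rewrite RintegralD//; exact: bcs1_integrable. Qed.

Lemma bcs2_integralD (g h : R * R -> R) : bcs2 g -> bcs2 h ->
  \int[leb2]_x (g x + h x) = \int[leb2]_x g x + \int[leb2]_x h x.
Proof. by move=> bg bh; rewrite RintegralD//; exact: bcs2_integrable. Qed.

Lemma bcs1_integralB g h : bcs1 g -> bcs1 h ->
  \int[mu]_x (g x - h x) = \int[mu]_x g x - \int[mu]_x h x.
Proof. by move=> bg bh; rewrite RintegralB//; exact: bcs1_integrable. Qed.

Lemma bcs2_integralB (g h : R * R -> R) : bcs2 g -> bcs2 h ->
  \int[leb2]_x (g x - h x) = \int[leb2]_x g x - \int[leb2]_x h x.
Proof. by move=> bg bh; rewrite RintegralB//; exact: bcs2_integrable. Qed.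

Lemma bcs1_integralZ (c : R) g : bcs1 g -> \int[mu]_x (c * g x) = c * \int[mu]_x g x.
Proof. by move=> bg; rewrite RintegralZl//; exact: bcs1_integrable. Qed.

Lemma bcs2_integralZ (c : R) (g : R * R -> R) : bcs2 g -> \int[leb2]_x (c * g x) = c * \int[leb2]_x g x.
Proof. by move=> bg; rewrite RintegralZl//; exact: bcs2_integrable. Qed.

Lemma bcs1_integral_norm g : bcs1 g -> `|\int[mu]_x g x| <= \int[mu]_x `|g x|.
Proof. by move=> bg; apply: le_normr_Rintegral => //; exact: bcs1_integrable. Qed.

Lemma bcs2_integral_norm (g : R * R -> R) : bcs2 g -> `|\int[leb2]_x g x| <= \int[leb2]_x `|g x|.
Proof. by move=> bg; apply: le_normr_Rintegral => //; exact: bcs2_integrable. Qed.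

Lemma bcs1_integral_le g h : bcs1 g -> bcs1 h -> (forall x, g x <= h x) ->
  \int[mu]_x g x <= \int[mu]_x h x.
Proof. by move=> bg bh gh; apply: le_Rintegral => //; exact: bcs1_integrable. Qed.

Lemma bcs2_integral_le (g h : R * R -> R) : bcs2 g -> bcs2 h -> (forall x, g x <= h x) ->
  \int[leb2]_x g x <= \int[leb2]_x h x.
Proof. by move=> bg bh gh; apply: le_Rintegral => //; exact: bcs2_integrable. Qed.

Lemma ae_eq_Rintegral d (T : measurableType d) (nu : {measure set T -> \bar R}) (D : set T)
  (g h : T -> R) : measurable D -> measurable_fun D g -> measurable_fun D h ->
  {ae nu, forall x, D x -> g x = h x} -> \int[nu]_(x in D) g x = \int[nu]_(x in D) h x.
Proof.
move=> mD mg mh gh; congr fine; apply: ae_eq_integral => //.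
- exact/measurable_EFinP.
- exact/measurable_EFinP.
- by apply: (aeS gh) => x /[apply] ->.
Qed.

(** The minimum of [g] and [h] equals [g] almost everywhere and is below [h] everywhere. *)
Lemma bcs1_integral_ae_le g h : bcs1 g -> bcs1 h -> {ae mu, forall x, g x <= h x} ->
  \int[mu]_x g x <= \int[mu]_x h x.
Proof.
move=> bg bh gh.
have bm : bcs1 (fun x => Num.min (g x) (h x)).
  move: bg bh => [mg [C [B H]]] [mh [D [B' H']]]; split; first exact: measurable_minr.
  exists (C + D), (Num.max B B') => x; have [h1 h2] := H x; have [h3 h4] := H' x; split.
    have C0 : 0 <= C := le_trans (normr_ge0 _) h1.
    have D0 : 0 <= D := le_trans (normr_ge0 _) h3.
    by have [_|_] := leP (g x) (h x); lra.
  by rewrite gt_max => /andP[/h2 -> /h4 ->]; rewrite minxx.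
rewrite (_ : \int[mu]_x g x = \int[mu]_x Num.min (g x) (h x)).
  by apply: bcs1_integral_le => // x; rewrite ge_min lexx orbT.
apply: ae_eq_Rintegral => //; [exact: bg.1|exact: bm.1|].
by apply: (aeS gh) => x ghx _; rewrite min_l.
Qed.

Lemma bcs1_dct (g : nat -> R -> R) h (C B : R) : (forall n, measurable_fun setT (g n)) ->
  (forall n x, `|g n x| <= C) -> (forall n x, B < `|x| -> g n x = 0) ->
  measurable_fun setT h ->
  {ae mu, forall x, g n x @[n --> \oo] --> h x} ->
  \int[mu]_x g n x @[n --> \oo] --> \int[mu]_x h x.
Proof.
move=> mg gC gB mh gh.
have C0 : 0 <= C by exact: le_trans (normr_ge0 _) (gC 0%N 0).
pose D := \1_(`[- B, B]%classic : set R) : R -> R.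
have bG : bcs1 (fun x => C * D x).
  apply: bcs1Z; split; first exact: measurable_indic.
  exists 1, B => x; rewrite /D indicE; split; first by case: (_ \in _); rewrite ?normr1 ?normr0.
  move=> xB; rewrite memNset//= in_itv/= => xI.
  by move: xB; rewrite ltNge ler_norml xI.
have [ | | | | |ih _ H] := @dominated_convergence _ _ _ mu setT measurableT (fun n x => (g n x)%:E)
  (fun x => (h x)%:E) (fun x => (C * D x)%:E).
- by move=> n; apply/measurable_EFinP; exact: mg.
- by apply/measurable_EFinP; exact: mh.
- by apply: (aeS gh) => x ghx _; apply: cvg_EFin => //; exact: nearW.
- exact: bcs1_integrable.
- apply: aeW => x n _; rewrite lee_fin /D indicE.
  case: (boolP (x \in _)) => [_|/negP xB]; first by rewrite mulr1.
  rewrite gB ?normr0 ?mulr0// ltNge; apply/negP => h'; apply: xB.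
  by rewrite inE/= in_itv/= -ler_norml.
- apply: fine_cvg; rewrite fineK//; exact: integrable_fin_num.
Qed.

Section translation.
Variable c : R.
Let T (x : R) : R := x + c.
Let mT : measurable_fun setT T.
Proof. by apply: measurable_funD => //; exact: measurable_cst. Qed.

Let mT' : measurable_fun setT (T : measurableTypeR R -> measurableTypeR R).
Proof. exact: mT. Qed.

(** Lebesgue measure is determined by its values on half-open intervals, and these are invariant. *)
Let mu_translation (A : set R) : measurable A -> pushforward mu T A = mu A.
Proof.
move=> mA; symmetry.
pose nu := measure_function_pushforward__canonical__measure_function_Measure mu mT'.
apply: (@lebesgue_measure_unique R nu _ A mA) => _ [[a b] _ <-].
rewrite /nu/= /pushforward/= (_ : T @^-1` _ = `](a - c), (b - c)]%classic).
  rewrite !lebesgue_measure_itv/= !lte_fin ltrD2r; case: ifP => // _.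
  by rewrite -!EFinB; congr EFin; lra.
by apply/seteqP; split => x /=; rewrite /T !in_itv/= ltrBlDr lerBrDr.
Qed.

Lemma ae_translation (P : R -> Prop) : {ae mu, forall x, P x} -> {ae mu, forall x, P (x + c)}.
Proof.
move=> [N [mN N0 PN]]; exists (T @^-1` N); split.
- by rewrite -[_ @^-1` _]setTI; exact: mT.
- by have := mu_translation mN; rewrite /pushforward N0.
- by move=> x /= h; apply: PN.
Qed.

Lemma bcs1_integral_translation g : bcs1 g -> \int[mu]_x g (x + c) = \int[mu]_x g x.
Proof.
move=> bg; rewrite /Rintegral; congr fine.
have bT : bcs1 (g \o T).
  move: bg => [mg [C [B H]]]; split; first exact: measurableT_comp.
  exists C, (B + `|c|) => x; split; first exact: (H _).1.
  move=> xB; apply: (H _).2; rewrite /T.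
  have := ler_normB (x + c) c; rewrite addrK; lra.
have mg : measurable_fun setT (EFin \o g : measurableTypeR R -> \bar R).
  by apply/measurable_EFinP; exact: bg.1.
have := integral_pushforward mT' (mu := mu) (D := setT) mg.
rewrite preimage_setT => /(_ (bcs1_integrable bT) measurableT) <-.
by apply: eq_measure_integral => A mA _; exact: mu_translation.
Qed.

End translation.

End bcs_calculus.

(** * Lebesgue points and null sets *)

Section lebesgue_points.
Context {R : realType}.
Local Notation mu := (@lebesgue_measure R).
Implicit Types (g : R -> R).

(** Real-valued indicator of [a, b], equal to 0 when b < a. Integrals over segments become integrals
    over the line of compactly supported functions. *)
Definition ind (a b y : R) : R := ((a <= y <= b)%R : nat)%:R.

Lemma indE (a b y : R) : ind a b y = \1_(`[a, b]%classic : set R) y.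
Proof. by rewrite indicE /ind mem_setE in_itv. Qed.

Lemma ind_ge0 (a b y : R) : 0 <= ind a b y. Proof. exact: ler0n. Qed.

Lemma ind_le1 (a b y : R) : ind a b y <= 1. Proof. by rewrite /ind; case: (_ <= _ <= _). Qed.

Lemma ind1 (a b y : R) : a <= y -> y <= b -> ind a b y = 1.
Proof. by rewrite /ind => -> ->. Qed.

Lemma ind0 (a b y : R) : ~~ (a <= y <= b) -> ind a b y = 0.
Proof. by rewrite /ind => /negbTE ->. Qed.

Lemma bcs1_ind (a b : R) : bcs1 (ind a b).
Proof.
split.
  rewrite (_ : ind a b = \1_(`[a, b]%classic : set R)); first exact: measurable_indic.
  by apply/funext => y; exact: indE.
exists 1, (Num.max `|a| `|b|) => x; split.
  by rewrite ger0_norm ?ind_ge0// ind_le1.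
rewrite gt_max => /andP[xa xb]; apply: ind0; apply/negP => /andP[ax xb'].
have h1 := ler_norm b; have h2 := ler_norm (- a); rewrite normrN in h2.
by have [x0|x0] := leP 0 x; [rewrite (ger0_norm x0) in xb|rewrite (ltr0_norm x0) in xa]; lra.
Qed.

Lemma integral_ind (a b : R) g : \int[mu]_(y in `[a, b]) g y = \int[mu]_y (ind a b y * g y).
Proof.
rewrite Rintegral_mkcond; apply: eq_Rintegral => y _.
by rewrite patchE indE indicE; case: (_ \in _); rewrite ?mul1r ?mul0r.
Qed.

Lemma bm1_locally_integrable g : bm1 g -> locally_integrable setT g.
Proof.
move=> [mg [C HC]]; split => // [|K _ cK]; first exact: openT.
apply: (@le_lt_trans _ _ (\int[mu]_(x in K) C%:E)%E).
  apply: ge0_le_integral => //=.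
  - exact: compact_measurable.
  - by apply/measurable_EFinP; apply: measurableT_comp => //; exact: measurable_funS mg.
  - by move=> x _; rewrite lee_fin.
rewrite integral_cst//; last exact: compact_measurable.
by rewrite lte_mul_pinfty// ?lee_fin ?(le_trans _ (HC 0))//; exact: compact_finite_measure.
Qed.

Lemma lebesgue_points g : bm1 g -> {ae mu, forall x : R, forall e : R, 0 < e ->
  exists2 d : R, 0 < d & forall r : R, 0 < r -> r < d ->
    \int[mu]_y (ind (x - r) (x + r) y * `|g y - g x|) <= e * r}.
Proof.
move=> bg; apply: (aeS (lebesgue_differentiation (bm1_locally_integrable bg))) => x Hx e e0.
(* The mean is taken over an interval of length [2 * r], so a mean below [e / 2] gives an integral
   below [e * r]. *)
have e2 : (0 < (e / 2)%:E)%E by rewrite lte_fin divr_gt0.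
have mc : measurable_fun setT (fun y => `|g y - g x|).
  by apply: measurableT_comp => //; apply: measurable_funB; [exact: bg.1|exact: measurable_cst].
have bc r : bcs1 (fun y => ind (x - r) (x + r) y * `|g y - g x|).
  apply: bcs1M; first exact: bcs1_ind.
  split => //; have [_ [C HC]] := bg; exists (C + C) => y.
  by rewrite normr_id (le_trans (ler_normB _ _))// lerD.
move: Hx => /fine_cvgP[_ /cvgrPdist_lt /(_ (e / 2))]; rewrite divr_gt0// => /(_ isT)[d /= d0 Hd].
exists d => // r r0 rd; have := Hd r; rewrite /= sub0r normrN gtr0_norm// => /(_ rd r0).
rewrite sub0r normrN => h; rewrite -integral_ind.
have bE : ball x r = `](x - r), (x + r)[%classic by rewrite ball_itv.
have iE : (\int[mu]_(y in ball x r) `|((center (g x) \o g) y)%:E| =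
    (\int[mu]_(y in `[(x - r)%R, (x + r)%R]) `|g y - g x|)%:E)%E.
  rewrite /Rintegral fineK; last first.
    apply: integrable_fin_num => //.
    apply: measurable_bounded_integrable => //.
    - exact: segment_measure_lty.
    - exact: measurable_funS mc.
    - have [_ [C HC]] := bg; exists (C + C); split; first exact: num_real.
      move=> K CK y _ /=; rewrite normr_id; apply: (le_trans (ler_normB _ _)).
      by apply: ltW; apply: le_lt_trans CK; exact: lerD.
  rewrite bE -(integral_itv_obnd_cbnd (r := x - r)); last first.
    by apply/measurable_EFinP; apply: measurable_funS mc.
  rewrite -integral_itv_bndo_bndc; last by apply/measurable_EFinP; apply: measurable_funS mc.
  by [].
move: h; rewrite /davg /iavg iE (lebesgue_measure_ball _ (ltW r0)).
rewrite inver mulrn_eq0/= gt_eqF//=.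
rewrite ger0_norm; last first.
  apply: mulr_ge0; first by rewrite invr_ge0 mulrn_wge0// ltW.
  by apply: Rintegral_ge0.
rewrite mulrC ltr_pdivrMr ?mulrn_wgt0// => h; apply/ltW; apply: (lt_le_trans h).
by have -> : e / 2 * (r *+ 2) = e * r by field.
Qed.

Lemma ae_slice1 (P : R * R -> Prop) : {ae leb2, forall z, P z} ->
  {ae mu, forall t, {ae mu, forall x, P (t, x)}}.
Proof.
move=> [N [mN N0 PN]].
have m0 : measurable_fun setT (fun t => mu (xsection N t)) by exact: measurable_fun_xsection.
have h : (\int[mu]_t `|mu (xsection N t)| = 0)%E.
  rewrite -[RHS]N0; apply: eq_integral => t _; rewrite gee0_abs//.
have := (ae_eq_integral_abs mu measurableT m0).1 h.
move=> ae0; apply: (aeS ae0) => t /(_ I) tN; exists (xsection N t); split => //.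
- exact: measurable_xsection.
- by move=> x /= nP; rewrite /xsection/= inE; apply: PN.
Qed.

Lemma ftc_segment (F f : R -> R) (a b : R) : a < b -> (forall x : R, is_derive x 1 F (f x)) ->
  continuous f -> \int[mu]_(x in `[a, b]) f x = F b - F a.
Proof.
move=> ab HF cf; have cF : continuous F.
  by move=> x; apply: differentiable_continuous; apply/derivable1_diffP; have := HF x => ?; exact: ex_derive.
rewrite /Rintegral (continuous_FTC2 ab _ _ _ (F := F))//.
- exact: continuous_subspaceT.
- split; [by move=> x _; have := HF x => ?; exact: ex_derive| |].
  + by apply: cvg_at_right_filter; exact: cF.
  + by apply: cvg_at_left_filter; exact: cF.
- by move=> x _; rewrite derive1E; have [_ ->] := HF x.
Qed.

End lebesgue_points.

(** * Smooth test functions supported in a box *)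

Section smooth_tests.
Context {R : realType}.
Local Notation mu := (@lebesgue_measure R).

Lemma continuous2_bounded_box (phi : R * R -> R) (B : R) : continuous phi ->
  exists C : R, forall z, `|z.1| <= B -> `|z.2| <= B -> `|phi z| <= C.
Proof.
move=> cphi.
have cK : compact (`[- B, B]%classic `*` `[- B, B]%classic : set (R * R)).
  by apply: compact_setX; exact: segment_compact.
have := continuous_compact (continuous_subspaceT cphi) cK.
move=> /compact_bounded[C [_ HC]]; exists (C + 1) => z z1 z2.
apply: (HC (C + 1)); first by rewrite ltrDl.
by exists z => //; split; rewrite /= in_itv/= -ler_norml.
Qed.

Lemma bcs2_continuous (phi : R * R -> R) (B : R) : continuous phi ->
  (forall z, phi z != 0 -> `|z.1| <= B /\ `|z.2| <= B) -> bcs2 phi.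
Proof.
move=> cphi supp; split; first exact: continuous2_measurable.
have [C HC] := continuous2_bounded_box B cphi.
exists `|C|, B => z; split.
  have [->|/supp[h1 h2]] := eqVneq (phi z) 0; first by rewrite normr0.
  by rewrite (le_trans (HC _ h1 h2))// ler_norm.
by move=> h; apply/eqP; apply/negPn/negP => /supp[h1 h2]; case: h; rewrite ltNge ?h1 ?h2.
Qed.

Lemma partials_support (phi pt px : R * R -> R) (A : R -> R -> Prop) :
  has_partials phi pt px ->
  (forall t x, ~ A t x -> \forall t' \near t, phi (t', x) = 0) ->
  (forall t x, ~ A t x -> \forall x' \near x, phi (t, x') = 0) ->
  forall t x, ~ A t x -> pt (t, x) = 0 /\ px (t, x) = 0.
Proof.
move=> H H1 H2 t x nA; have [[_ <-] [_ <-]] := H t x; split.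
  have h := H1 _ _ nA.
  have [_ ->//] : is_derive t 1 (fun t : R => phi (t, x)) (0:R).
  by apply: near_eq_is_derive (is_derive_cst (0:R) t 1); apply: filterS h => ? ->.
have h := H2 _ _ nA.
have [_ ->//] : is_derive x 1 (fun x : R => phi (t, x)) (0:R).
by apply: near_eq_is_derive (is_derive_cst (0:R) x 1); apply: filterS h => ? ->.
Qed.

Lemma box_partials (phi pt px : R * R -> R) (tau B : R) : has_partials phi pt px ->
  (forall z, phi z != 0 -> [/\ tau <= z.1, z.1 <= B & `|z.2| <= B]) ->
  forall z, ~ [/\ tau <= z.1, z.1 <= B & `|z.2| <= B] -> pt z = 0 /\ px z = 0.
Proof.
move=> H supp [t x] /= nA.
have z0 t' x' : ~ [/\ tau <= t', t' <= B & `|x'| <= B] -> phi (t', x') = 0.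
  by move=> h; apply/eqP/negPn/negP => /supp.
apply: (partials_support (A := fun t x => [/\ tau <= t, t <= B & `|x| <= B]) H) => //.
- move=> {nA t x} t x nA; have [t1|t1] := ltP t tau.
    near=> t'; apply: z0 => -[]; rewrite leNgt => /negP + _ _; apply.
    by near: t'; exact: lt_nbhsl.
  have [t2|t2] := ltP B t.
    near=> t'; apply: z0 => -[_]; rewrite leNgt => /negP + _; apply.
    by near: t'; exact: lt_nbhsr.
  by near=> t'; apply: z0 => -[_ _ x2]; apply: nA.
- move=> {nA t x} t x nA; have [x1|x1] := ltP B `|x|.
    near=> x'; apply: z0 => -[_ _]; rewrite leNgt => /negP; apply.
    near: x'; have := @norm_continuous R R^o x; rewrite /continuous_at => /(_ [set y | B < y]).
    by apply; exact: lt_nbhsr.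
  by near=> x'; apply: z0 => -[t1 t2 x2]; apply: nA.
Unshelve. all: by end_near. Qed.

(** The partial derivatives vanish before time [tau > 0], so the integral over the half plane is an
    integral over the whole plane. *)
Lemma entropic_smooth (E F : R -> R) (v phi pt px : R * R -> R) (tau B : R) :
  entropic E F v -> smooth2 phi -> (forall z, 0 <= phi z) -> 0 < tau ->
  (forall z, phi z != 0 -> [/\ tau <= z.1, z.1 <= B & `|z.2| <= B]) ->
  has_partials phi pt px ->
  0 <= \int[leb2]_z (E (v z) * pt z + F (v z) * px z).
Proof.
move=> ent sphi phi0 tau0 supp H.
have tphi : test_function phi.
  apply: (smooth2_test (B := B)) => // z /supp[h1 h2 h3]; split => //.
  by rewrite ger0_norm// (le_trans _ h1)// ltW.
have := ent phi tphi phi0 (support_half_plane tau0 _).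
rewrite /pairing (has_partials_dt H) (has_partials_dx H) Rintegral_mkcond.
move=> h; have {}h := h (fun z hz => let: And3 a _ _ := supp z hz in a).
rewrite (_ : \int[leb2]_z _ = \int[leb2]_z ((fun z => E (v z) * pt z + F (v z) * px z) \_ half_plane) z)//.
apply: eq_Rintegral => z _; rewrite patchE; case: ifPn => // /negP zn.
have [|-> ->] := box_partials H supp (z := z); last by rewrite !mulr0 addr0.
by move=> [h1 _ _]; apply: zn; rewrite inE/half_plane/=; exact: lt_le_trans h1.
Qed.

Lemma integral_ind1 (a b : R) : a <= b -> \int[mu]_x ind a b x = b - a.
Proof.
move=> ab; rewrite (_ : \int[mu]_x _ = \int[mu]_x (ind a b x * 1)).
  rewrite -integral_ind Rintegral_cst// mul1r.
  by have := segment_measure ab => /(congr1 fine).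
by apply: eq_Rintegral => x _; rewrite mulr1.
Qed.

Lemma smooth1_dilated (g : R -> R) (a r : R) : smooth1 g -> smooth1 (fun t => g ((t - a) / r)).
Proof.
move=> sg; rewrite (_ : (fun _ => _) = (fun t => g (r^-1 * t + (- a / r)))).
  exact: smooth1_affine.
by apply/funext => t; rewrite mulrBl mulrC mulNr.
Qed.

Lemma integral_dilated_bump (t0 r : R) : 0 < r -> \int[mu]_t bumpf ((t - t0) / r) = r.
Proof.
move=> r0.
have rn0 : r != 0 by rewrite gt_eqF.
rewrite (_ : \int[mu]_t _ = \int[mu]_t (ind (t0 - r) (t0 + r) t * bumpf ((t - t0) / r))); last first.
  apply: eq_Rintegral => t _; rewrite /ind; case: (boolP (t0 - r <= t <= t0 + r)) => [_|h]; first by rewrite mul1r.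
  rewrite mul0r bump_eq0// normrM normfV (gtr0_norm r0) ler_pdivlMr// mul1r.
  by rewrite leNgt; apply/negP; rewrite ltr_distl => /andP[/ltW h1 /ltW h2]; move: h; rewrite h1 h2.
have HF (t : R) : is_derive t 1 (fun t => r * step ((t - t0) / r)) (bumpf ((t - t0) / r)).
  have h1 : is_derive t 1 (fun t => (t - t0) / r) (r^-1).
    have h := is_deriveB (is_derive_id t (1:R)) (is_derive_cst t0 t 1).
    have := is_deriveM h (is_derive_cst (r^-1) t 1).
    by rewrite /GRing.scale/= mulr0 add0r subr0 mulr1.
  have h2 := @is_derive1_comp R step _ t _ _ (step_derive _) h1.
  by have := is_deriveZ r h2; rewrite /GRing.scale/= mulrC mulfVK.
rewrite -integral_ind (ftc_segment _ HF); last 2 first.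
- by lra.
- exact/smooth1_continuous/smooth1_dilated/smooth1_bump.
have -> : (t0 + r - t0) / r = 1 by field.
have -> : (t0 - r - t0) / r = -1 by field.
rewrite step_ge1// step_leN1//.
by rewrite mulr1 mulr0 subr0.
Qed.

End smooth_tests.

(** * Entropy inequalities at the traces *)

Section entropy_at_traces.
Context {R : realType}.
Local Notation mu := (@lebesgue_measure R).

Lemma bcs1_smooth (g : R -> R) (B : R) : smooth1 g -> (forall x, B < `|x| -> g x = 0) -> bcs1 g.
Proof.
move=> sg gB; split.
  by apply: continuous_measurable_fun; exact: smooth1_continuous.
by have [C C0 HC] := smooth1_bounded sg; exists C, B => x; split => //; exact: gB.
Qed.

Lemma bm2_comp (E : R -> R) (v : R * R -> R) (M L : R) : measurable_fun setT E ->
  measurable_fun setT v -> (forall z, `|v z| <= M) ->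
  (forall a b, `|a| <= M -> `|b| <= M -> `|E a - E b| <= L * `|a - b|) -> 0 <= L ->
  bm2 (fun z => E (v z)).
Proof.
move=> mE mv vM EL L0; split; first exact: measurableT_comp.
have M0 : 0 <= M := le_trans (normr_ge0 _) (vM 0).
exists (`|E 0| + L * M) => z; rewrite -[E (v z)](subrK (E 0)) addrC.
apply: (le_trans (ler_normD _ _)); rewrite lerD2l.
apply: (le_trans (EL _ _ (vM z) _)); first by rewrite normr0.
by rewrite subr0 ler_wpM2l.
Qed.

(* The bounds [g n], measurable in time, stand for the essential suprema over
   the strips of width [1 / (n + 1)] in the strong trace property. *)
Definition strip_traces (v : R * R -> R) (h wm wp : R -> R) (g : nat -> R -> R) :=
  [/\ bm1 wm, bm1 wp, forall n, bm1 (g n) /\ forall t, 0 <= g n t,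
    forall T : R, \int[mu]_t (ind 0 T t * g n t) @[n --> \oo] --> (0 : R) &
    {ae mu, forall t, 0 < t -> forall n, {ae mu, forall x, `|x - h t| < n.+1%:R^-1 ->
      (h t < x -> `|v (t, x) - wp t| <= g n t) /\
      (x < h t -> `|v (t, x) - wm t| <= g n t)}}].

Section blow_up.
Variables (r : R) (r0 : 0 < r).

Let db : R -> R := derive1 bumpf.

Let dbP (x : R) : is_derive x 1 bumpf (db x).
Proof.
have [g' _ H] := smooth1_derive (@smooth1_bump R); have := H x => Hx.
by rewrite /db derive1E; apply: DeriveDef => //; exact: ex_derive.
Qed.

Lemma smooth1_dbump : smooth1 (derive1 bumpf : R -> R).
Proof.
have [g' sg' H] := smooth1_derive (@smooth1_bump R).
rewrite -/db (_ : db = g')//; apply/funext => x.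
by have [_ <-] := H x; have [_ <-] := dbP x.
Qed.

Let db_eq0 (x : R) : 1 < `|x| -> db x = 0.
Proof.
move=> x1; suff [_ h1] : is_derive x 1 bumpf (0 : R) by have [_ <-] := dbP x.
apply: near_eq_is_derive (is_derive_cst (0:R) x 1).
near=> y; rewrite bump_eq0//; apply/ltW; near: y.
have := @norm_continuous R R^o x; rewrite /continuous_at => /(_ [set y | 1 < y]).
by apply; exact: lt_nbhsr.
Unshelve. all: by end_near. Qed.

Definition dil (a x : R) : R := bumpf ((x - a) / r).
Definition ddil (a x : R) : R := db ((x - a) / r) / r.

Lemma dil_derive (a x : R) : is_derive x 1 (dil a) (ddil a x).
Proof.
have h1 : is_derive x 1 (fun t => (t - a) / r) (r^-1).
  have h := is_deriveB (is_derive_id x (1:R)) (is_derive_cst a x 1).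
  have := is_deriveM h (is_derive_cst (r^-1) x 1).
  by rewrite /GRing.scale/= mulr0 add0r subr0 mulr1.
exact: (@is_derive1_comp R bumpf _ x _ _ (dbP _) h1).
Qed.

Lemma smooth1_dil (a : R) : smooth1 (dil a).
Proof. exact/smooth1_dilated/smooth1_bump. Qed.

Lemma smooth1_ddil (a : R) : smooth1 (ddil a).
Proof.
rewrite (_ : ddil a = fun x => r^-1 * db ((x - a) / r)).
  by apply: smooth1Z; exact/smooth1_dilated/smooth1_dbump.
by apply/funext => x; rewrite mulrC.
Qed.

Let far (a x : R) : r < `|x - a| -> 1 < `|(x - a) / r|.
Proof. by move=> h; rewrite normrM normfV (gtr0_norm r0) ltr_pdivlMr// mul1r. Qed.

Lemma dil_eq0 (a x : R) : r < `|x - a| -> dil a x = 0.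
Proof. by move=> /far/ltW h; rewrite /dil bump_eq0. Qed.

Lemma ddil_eq0 (a x : R) : r < `|x - a| -> ddil a x = 0.
Proof. by move=> /far h; rewrite /ddil db_eq0// mul0r. Qed.

Let far2 (a x : R) : `|a| + r < `|x| -> r < `|x - a|.
Proof. by have := lerB_dist x a; lra. Qed.

Lemma bcs1_dil (a : R) : bcs1 (dil a).
Proof.
by apply: (bcs1_smooth (B := `|a| + r) (smooth1_dil a)) => x /far2; exact: dil_eq0.
Qed.

Lemma bcs1_ddil (a : R) : bcs1 (ddil a).
Proof.
by apply: (bcs1_smooth (B := `|a| + r) (smooth1_ddil a)) => x /far2; exact: ddil_eq0.
Qed.

Lemma integral_ddil (a : R) : \int[mu]_x ddil a x = 0.
Proof.
rewrite (_ : \int[mu]_x _ = \int[mu]_x (ind (a - 2 * r) (a + 2 * r) x * ddil a x)).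
  rewrite -integral_ind (ftc_segment _ (dil_derive a)); last 2 first.
  - by have := r0; lra.
  - exact/smooth1_continuous/smooth1_ddil.
  have r0' := r0.
  rewrite (@dil_eq0 a (a + 2 * r)); last by rewrite ltr_normr; apply/orP; left; lra.
  rewrite (@dil_eq0 a (a - 2 * r)) ?subrr//.
  by rewrite ltr_normr; apply/orP; right; lra.
apply: eq_Rintegral => x _; rewrite /ind.
case: (boolP (a - 2 * r <= x <= a + 2 * r)) => [_|h]; first by rewrite mul1r.
rewrite mul0r ddil_eq0// ltNge; apply/negP; rewrite ler_distl => /andP[h1 h2].
have r0' := r0.
by move/negP: h; apply; apply/andP; split; lra.
Qed.

Lemma integral_half_ddil : \int[mu]_x (ind 0 r x * ddil 0 x) = - bumpf 0.
Proof.
rewrite -integral_ind (ftc_segment _ (dil_derive 0))//; last first.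
  exact/smooth1_continuous/smooth1_ddil.
rewrite /dil !subr0 mul0r divff ?gt_eqF// bump_eq0 ?sub0r// normr1//.
Qed.

Lemma integral_dil (a : R) : \int[mu]_x dil a x = r.
Proof. exact: integral_dilated_bump. Qed.

(** Space integral, at a fixed time, of a profile with two constant states separated at [l], against
    a dilated bump transported at speed [s]. The full integral of [ddil] vanishes and its integral
    over the right half is - [bumpf 0], which leaves the defect of the jump condition. *)
Lemma integral_two_states (s Em Ep Fm Fp A A' l : R) :
  \int[mu]_x ((if l <= x then Ep else Em) * (A' * dil l x - s * A * ddil l x) +
    (if l <= x then Fp else Fm) * (A * ddil l x)) =
  A' * \int[mu]_x ((if 0 <= x then Ep else Em) * dil 0 x) +
  A * (bumpf 0 * (s * (Ep - Em) - (Fp - Fm))).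
Proof.
have shift_if (a b x : R) : (if l <= x then a else b) = (if 0 <= x + - l then a else b).
  by rewrite subr_ge0.
have bif (a b : R) : bm1 (fun x : R => if 0 <= x then a else b).
  split; last by exists (`|a| + `|b|) => x; case: ifP => _; rewrite ?lerDl ?lerDr.
  apply: measurable_fun_ifT; [|exact: measurable_cst..].
  by apply: measurable_fun_ler; [exact: measurable_cst|exact: measurable_id].
pose H y := A' * ((if 0 <= y then Ep else Em) * dil 0 y) +
  A * ((Fm - s * Em) * ddil 0 y + ((Fp - s * Ep) - (Fm - s * Em)) * (ind 0 r y * ddil 0 y)).
have b1 : bcs1 (fun y => (if 0 <= y then Ep else Em) * dil 0 y).
  by under eq_fun do rewrite mulrC; apply: bcs1M; [exact: bcs1_dil|exact: bif].
have b2 : bcs1 (ddil 0) by exact: bcs1_ddil.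
have b3 : bcs1 (fun y => ind 0 r y * ddil 0 y).
  by apply: bcs1M; [exact: bcs1_ind|exact/bcs1W].
have b4 : bcs1 (fun y => (Fm - s * Em) * ddil 0 y +
    ((Fp - s * Ep) - (Fm - s * Em)) * (ind 0 r y * ddil 0 y)).
  by apply: bcs1D; exact: bcs1Z.
have bH : bcs1 H by apply: bcs1D; exact: bcs1Z.
transitivity (\int[mu]_x H (x + - l)).
  apply: eq_Rintegral => x _; rewrite !shift_if /H /dil /ddil !subr0.
  have [h|h] := leP 0 (x + - l); last by rewrite ind0; [ring|rewrite leNgt h].
  have [h'|h'] := leP (x + - l) r; first by rewrite ind1//; ring.
  have -> : db ((x + - l) / r) = 0.
    by apply: db_eq0; rewrite normrM normfV (gtr0_norm r0) ger0_norm// ltr_pdivlMr// mul1r.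
  by ring.
rewrite bcs1_integral_translation// /H bcs1_integralD; [|exact: bcs1Z..].
rewrite !bcs1_integralZ// bcs1_integralD; [|exact: bcs1Z..].
by rewrite !bcs1_integralZ// integral_ddil integral_half_ddil; ring.
Qed.

End blow_up.

Lemma dil_bound : exists2 C, 0 < C & forall r a x : R, `|dil r a x| <= C.
Proof. by have [C C0 HC] := smooth1_bounded (@smooth1_bump R); exists C => // r a x; exact: HC. Qed.

Lemma ddil_bound : exists2 C, 0 < C & forall r : R, 0 < r -> forall a x, `|ddil r a x| <= C / r.
Proof.
have [C C0 HC] := smooth1_bounded smooth1_dbump; exists C => // r r0 a x.
by rewrite /ddil normrM normfV (gtr0_norm r0) ler_wpM2r// invr_ge0 ltW.
Qed.
Definition lebesgue_at (g : R -> R) (t0 : R) := forall e : R, 0 < e ->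
  exists2 d : R, 0 < d & forall r : R, 0 < r -> r < d ->
    \int[mu]_y (ind (t0 - r) (t0 + r) y * `|g y - g t0|) <= e * r.

Lemma aeN d (T : measurableType d) (nu : {measure set T -> \bar R}) (P : nat -> T -> Prop) :
  (forall n, {ae nu, forall x, P n x}) -> {ae nu, forall x, forall n, P n x}.
Proof.
move=> H; apply: negligibleS (negligible_bigcup H) => x /= nx.
by apply: contrapT => h; apply: nx => n; apply: contrapT => nP; apply: h; exists n.
Qed.

(** * Blow-up at a point of the curve *)

Section jump_condition.
Variables (v : R * R -> R) (M L : R) (E F : R -> R).
Hypotheses (mv : measurable_fun setT v) (vM : forall z, `|v z| <= M).
Hypotheses (mE : measurable_fun setT E) (mF : measurable_fun setT F) (L0 : 0 <= L).
Hypothesis EL : forall a b, `|a| <= M -> `|b| <= M -> `|E a - E b| <= L * `|a - b|.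
Hypothesis FL : forall a b, `|a| <= M -> `|b| <= M -> `|F a - F b| <= L * `|a - b|.
Hypothesis ent : entropic E F v.
Variables (h wm wp : R -> R) (g : nat -> R -> R).
Hypothesis Htr : strip_traces v h wm wp g.
Variables (t0 s : R).
Hypotheses (t00 : 0 < t0) (hs : is_derive t0 1 h s).
Hypotheses (wmM : `|wm t0| <= M) (wpM : `|wp t0| <= M).
Hypotheses (lm : lebesgue_at wm t0) (lp : lebesgue_at wp t0).
Hypothesis lg : forall n, lebesgue_at (g n) t0.
Hypothesis g0 : forall e : R, 0 < e -> exists n, g n t0 < e.

Let M0 : 0 <= M. Proof. exact: le_trans (normr_ge0 _) wmM. Qed.

Let l (t : R) := h t0 + s * (t - t0).

Let tangent (e : R) : 0 < e -> exists2 d : R, 0 < d & forall t, `|t - t0| <= d ->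
  `|h t - l t| <= e * `|t - t0|.
Proof.
move=> e0; have [dh hsE] := hs.
have := derivable_nbhs dh; rewrite /= hsE => /eqaddoP/(_ _ e0)[d /= d0 Hd].
exists (d / 2); first by rewrite divr_gt0.
move=> t td; have := Hd (t - t0); rewrite /= sub0r normrN.
have td' : `|t - t0| < d by rewrite (le_lt_trans td)// ltr_pdivrMr// ltr_pMr// ltr1n.
move=> /(_ td'); rewrite !fctE /= /l.
have -> : (t - t0)%:A + t0 = t by rewrite [_%:A]mulr1 subrK.
move=> H; rewrite (le_trans _ H)//.
by rewrite mulrC /GRing.scale/=.
Qed.

Let gam n t := g n t + `|wp t - wp t0| + `|wm t - wm t0|.

Let mgam n : bm1 (gam n).
Proof.
have [[mm [C1 h1]] [mp [C2 h2]] /(_ n)[[mg [C3 h3]] _] _ _] := Htr.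
split.
  by apply: measurable_funD; [apply: measurable_funD => //|]; apply: measurableT_comp => //;
    apply: measurable_funB => //; exact: measurable_cst.
exists (C3 + (C2 + C2) + (C1 + C1)) => t.
apply: (le_trans (ler_normD _ _)); rewrite normr_id lerD//; last first.
  by apply: (le_trans (ler_normB _ _)); rewrite lerD.
apply: (le_trans (ler_normD _ _)); rewrite normr_id lerD//.
by apply: (le_trans (ler_normB _ _)); rewrite lerD.
Qed.

Section scale.
Variables (r e : R) (n : nat).
Hypotheses (r0 : 0 < r) (e0 : 0 < e) (e1 : e <= 1) (rt0 : r < t0).
Hypothesis hl : forall t, `|t - t0| <= r -> `|h t - l t| <= e * r.
Hypothesis rn : 2 * r < n.+1%:R^-1.

(** The solution frozen at [t0]: the two trace values, separated by the tangent [l] instead of the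
    curve [h]. *)
Let vb z := if l z.1 <= z.2 then wp t0 else wm t0.

Let ml : measurable_fun setT (fun z : R * R => l z.1).
Proof.
apply: measurable_funD; first exact: measurable_cst.
apply: measurable_funM; first exact: measurable_cst.
by apply: measurable_funB; [exact: measurable_fst|exact: measurable_cst].
Qed.

Let mvb : measurable_fun setT vb.
Proof.
apply: measurable_fun_ifT; [|exact: measurable_cst..].
by apply: measurable_fun_ler => //; exact: measurable_snd.
Qed.

Let vbM z : `|vb z| <= M. Proof. by rewrite /vb; case: ifP. Qed.

Let Dd z := ind (t0 - r) (t0 + r) z.1 * (ind (- r) r (z.2 - l z.1) * `|v z - vb z|).

Let box z : ind (t0 - r) (t0 + r) z.1 * ind (- r) r (z.2 - l z.1) != 0 ->
  `|z.1 - t0| <= r /\ `|z.2 - l z.1| <= r.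
Proof.
rewrite mulf_eq0 negb_or /ind => /andP[].
case: (boolP (t0 - r <= z.1 <= t0 + r)) => [h1 _|]; last by rewrite eqxx.
case: (boolP (- r <= z.2 - l z.1 <= r)) => [h2 _|]; last by rewrite eqxx.
by rewrite ler_distl h1 ler_norml h2.
Qed.

Let bDd : bcs2 Dd.
Proof.
split.
  apply: measurable_funM.
    by apply: measurableT_comp; [exact: (bcs1_ind _ _).1|exact: measurable_fst].
  apply: measurable_funM.
    apply: measurableT_comp; first exact: (bcs1_ind _ _).1.
    by apply: measurable_funB => //; exact: measurable_snd.
  by apply: measurableT_comp => //; exact: measurable_funB.
exists (M + M), (`|t0| + r + `|h t0| + `|s| * r + r) => z; split.
  rewrite /Dd !normrM normr_id ger0_norm ?ind_ge0// ger0_norm ?ind_ge0//.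
  have a1 := ind_le1 (t0 - r) (t0 + r) z.1; have a2 := ind_le1 (- r) r (z.2 - l z.1).
  have b1 := ind_ge0 (t0 - r) (t0 + r) z.1; have b2 := ind_ge0 (- r) r (z.2 - l z.1).
  have c : `|v z - vb z| <= M + M by rewrite (le_trans (ler_normB _ _))// lerD.
  rewrite -[leRHS]mul1r ler_pM//; first exact: mulr_ge0.
  by rewrite -[leRHS]mul1r ler_pM.
move=> far; rewrite /Dd mulrA; have [->|/box[b1 b2]] := eqVneq (ind (t0 - r) (t0 + r) z.1 * ind (- r) r (z.2 - l z.1)) 0.
  by rewrite mul0r.
exfalso; have sr : `|s * (z.1 - t0)| <= `|s| * r by rewrite normrM ler_wpM2l.
have p1 : 0 <= `|s| * r := le_trans (normr_ge0 _) sr.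
have q1 : `|z.1| <= `|t0| + r by have := ler_normD (z.1 - t0) t0; rewrite subrK; lra.
have q2 : `|z.2| <= `|h t0| + `|s| * r + r.
  have := ler_normD (z.2 - l z.1) (l z.1); rewrite subrK.
  by have := ler_normD (h t0) (s * (z.1 - t0)); rewrite -/(l _); lra.
have r0' := r0; have := normr_ge0 t0; have := normr_ge0 (h t0).
by case: far; lra.
Qed.

Let bindg (k : R -> R) : bm1 k -> bcs1 (fun t => ind (t0 - r) (t0 + r) t * k t).
Proof. by apply: bcs1M; exact: bcs1_ind. Qed.

(** Where |x - l t| > e r, the point is on the same side of the curve and of its tangent, so the
    distance is at most [gam], on a length [2 * r]. The remaining interval, of length [2 * e * r],
    is paid with the crude bound [2 * M]. *)
Let inner : {ae mu, forall t, \int[mu]_x Dd (t, x) <=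
  ind (t0 - r) (t0 + r) t * (2 * r * gam n t + 4 * M * e * r)}.
Proof.
have [_ _ _ _ ae] := Htr; apply: (aeS ae) => t Ht.
have [it|] := boolP (t0 - r <= t <= t0 + r); last first.
  by move=> nt; rewrite /Dd/= ind0//; under eq_Rintegral do rewrite mul0r; rewrite Rintegral_eq0// mul0r.
have tt0 : `|t - t0| <= r by rewrite ler_distl.
have tp : 0 < t by move: it => /andP[it _]; have := rt0; lra.
have er0 : 0 <= e * r by rewrite mulr_ge0// ltW.
have ler_er : e * r <= r by rewrite ler_piMl// ltW.
have bi (c : R) : bcs1 (fun x => ind (- c) c (x + - l t)).
  split.
    apply: measurableT_comp; first exact: (bcs1_ind _ _).1.
    by apply: measurable_funD => //; exact: measurable_cst.
  exists 1, (`|c| + `|l t|) => x; split; first by rewrite ger0_norm ?ind_ge0// ind_le1.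
  move=> xB; apply: ind0; rewrite -ler_norml -ltNge.
  have := ler_norm c; have := ler_normD (x + - l t) (l t); rewrite subrK; lra.
have ii (c : R) : 0 <= c -> \int[mu]_x ind (- c) c (x + - l t) = 2 * c.
  by move=> c0; rewrite bcs1_integral_translation ?integral_ind1//; [lra|lra|exact: bcs1_ind].
pose k x := gam n t * ind (- r) r (x + - l t) + 2 * M * ind (- (e * r)) (e * r) (x + - l t).
have bk : bcs1 k by apply: bcs1D; apply: bcs1Z.
rewrite (ind1 (a := t0 - r))//; [|by case/andP : it..]; rewrite mul1r.
have -> : 2 * r * gam n t + 4 * M * e * r = \int[mu]_x k x.
  rewrite bcs1_integralD; [|by apply: bcs1Z..].
  by rewrite !bcs1_integralZ// !ii//; [ring|exact: ltW].
apply: bcs1_integral_ae_le => //; first exact: (bcs2_fst t bDd).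
apply: (aeS (Ht tp n)) => x Hx.
rewrite /Dd/= ind1 ?mul1r; [|by case/andP : it..].
have gam0 : 0 <= gam n t.
  have [_ _ /(_ n)[_ /(_ t) gn0] _ _] := Htr.
  by rewrite /gam; do 2 apply: addr_ge0 => //.
rewrite /k; have [xr|xr] := boolP (- r <= x + - l t <= r); last first.
  by rewrite ind0// mul0r mulr0 add0r !mulr_ge0// ind_ge0.
rewrite ind1 ?mul1r ?mulr1; [|by case/andP : xr..].
have [xer|xer] := boolP (- (e * r) <= x + - l t <= e * r).
  rewrite ind1 ?mulr1; [|by case/andP : xer..].
  have : `|v (t, x) - vb (t, x)| <= M + M by rewrite (le_trans (ler_normB _ _))// lerD.
  by have := gam0; lra.
rewrite ind0// mulr0 addr0.
have hlt := hl tt0.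
have xh : `|x - h t| < n.+1%:R^-1.
  move: xr; rewrite -ler_norml => xr; apply: le_lt_trans rn.
  have -> : x - h t = (x + - l t) - (h t - l t) by ring.
  by apply: (le_trans (ler_normB _ _)); have := ler_er; lra.
have [H1 H2] := Hx xh.
rewrite /vb /=; case: ifPn => hx.
  have : h t < x.
    move: xer; rewrite negb_and -!ltNge => /orP[xer|xer]; first by have := er0; lra.
    by move: hlt; rewrite ler_norml => /andP[h1 h2]; lra.
  move=> /H1 vw; rewrite /gam.
  have -> : v (t, x) - wp t0 = (v (t, x) - wp t) + (wp t - wp t0) by ring.
  by apply: (le_trans (ler_normD _ _)); rewrite -[leLHS]addr0 lerD// lerD.
rewrite -ltNge in hx.
have : x < h t.
  move: xer; rewrite negb_and -!ltNge => /orP[xer|xer]; last by have := er0; lra.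
  by move: hlt; rewrite ler_norml => /andP[h1 h2]; lra.
move=> /H2 vw; rewrite /gam addrAC.
have -> : v (t, x) - wm t0 = (v (t, x) - wm t) + (wm t - wm t0) by ring.
by apply: (le_trans (ler_normD _ _)); rewrite -[leLHS]addr0 lerD// lerD.
Qed.

Hypothesis small : \int[mu]_t (ind (t0 - r) (t0 + r) t * gam n t) <= 5 * e * r.

Let DdI : \int[leb2]_z Dd z <= (10 + 8 * M) * e * r ^+ 2.
Proof.
have bb : bcs1 (fun t => ind (t0 - r) (t0 + r) t * (2 * r * gam n t + 4 * M * e * r)).
  apply: bindg; have [mg [C HC]] := mgam n; split.
    by apply: measurable_funD; [apply: measurable_funM => //|]; exact: measurable_cst.
  exists (`|2 * r| * C + `|4 * M * e * r|) => t; rewrite (le_trans (ler_normD _ _))//.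
  by rewrite lerD2r normrM ler_wpM2l.
rewrite bcs2_fubini1//; apply: (le_trans (bcs1_integral_ae_le (bcs2_inner1 bDd) bb inner)).
have bi : bcs1 (ind (t0 - r) (t0 + r)) by exact: bcs1_ind.
have bg : bcs1 (fun t => ind (t0 - r) (t0 + r) t * gam n t) by exact: bindg.
rewrite (_ : \int[mu]_t _ = \int[mu]_t (2 * r * (ind (t0 - r) (t0 + r) t * gam n t) +
    (4 * M * e * r) * ind (t0 - r) (t0 + r) t)); last by apply: eq_Rintegral => t _; ring.
rewrite bcs1_integralD; [|by apply: bcs1Z..].
rewrite !bcs1_integralZ// integral_ind1; last by have := r0; lra.
have : 2 * r * \int[mu]_t (ind (t0 - r) (t0 + r) t * gam n t) <= 2 * r * (5 * e * r).
  by rewrite ler_wpM2l// mulr_ge0// ltW.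
rewrite expr2; lra.
Qed.

(** The bump follows the tangent, so its time derivative contains - [s] times its space derivative:
    this is how the speed enters the jump condition. *)
Let phi z := dil r t0 z.1 * dil r (l z.1) z.2.
Let pt z := ddil r t0 z.1 * dil r (l z.1) z.2 - s * dil r t0 z.1 * ddil r (l z.1) z.2.
Let px z := dil r t0 z.1 * ddil r (l z.1) z.2.

Let phi_partials : has_partials phi pt px.
Proof.
move=> t x; split.
  have h1 := dil_derive r t0 t.
  have hl' : is_derive t 1 (fun t => x - l t) (- s).
    have i1 := is_deriveB (is_derive_id t (1:R)) (is_derive_cst t0 t 1).
    have i2 := is_deriveD (is_derive_cst (h t0) t 1) (is_deriveZ s i1).
    apply: (is_derive_eq (is_deriveB (is_derive_cst x t 1) i2)).
    by rewrite /GRing.scale/=; ring.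
  have h2 := @is_derive1_comp R (dil r 0) (fun t => x - l t) t _ _ (dil_derive r 0 _) hl'.
  have e2 : dil r 0 \o (fun t => x - l t) = fun t => dil r (l t) x.
    by apply/funext => y /=; rewrite /dil subr0.
  rewrite e2 in h2; have h3 := is_deriveM h1 h2; apply: is_derive_eq.
  by rewrite /pt /= /GRing.scale/= /ddil subr0; ring.
have h1 := is_deriveZ (dil r t0 t) (dil_derive r (l t) x).
exact: h1.
Qed.

Let smooth2_phi : smooth2 phi.
Proof.
apply: smooth2M; first by apply: (smooth2_comp (smooth1_dil r t0)); exact: smooth2_fst.
rewrite (_ : (fun _ => _) = fun z => dil r 0 (z.2 - (h t0 + s * (z.1 - t0)))); last first.
  by apply/funext => z; rewrite /dil subr0.
apply: (smooth2_comp (smooth1_dil r 0)); apply: smooth2B; first exact: smooth2_snd.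
apply: smooth2D; first exact: smooth2_cst.
by apply: smooth2Z; apply: smooth2B; [exact: smooth2_fst|exact: smooth2_cst].
Qed.

Let B := `|t0| + r + `|h t0| + `|s| * r + r.

Let outside z : ~ (`|z.1 - t0| <= r /\ `|z.2 - l z.1| <= r) ->
  [/\ phi z = 0, pt z = 0 & px z = 0].
Proof.
rewrite /phi /pt /px; have [h1|h1] := leP `|z.1 - t0| r; last first.
  by rewrite (dil_eq0 r0 h1) (ddil_eq0 r0 h1) mulr0 !mul0r subr0.
have [h2|h2] := leP `|z.2 - l z.1| r; first by case.
by rewrite (dil_eq0 r0 h2) (ddil_eq0 r0 h2) !mulr0 subr0.
Qed.

Let inbox z : `|z.1 - t0| <= r -> `|z.2 - l z.1| <= r ->
  [/\ t0 - r <= z.1, z.1 <= B & `|z.2| <= B].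
Proof.
move=> b1 b2; have sr : `|s * (z.1 - t0)| <= `|s| * r by rewrite normrM ler_wpM2l.
have p1 : 0 <= `|s| * r := le_trans (normr_ge0 _) sr.
have q1 : `|z.1| <= `|t0| + r by have := ler_normD (z.1 - t0) t0; rewrite subrK; lra.
have q2 : `|z.2| <= `|h t0| + `|s| * r + r.
  have := ler_normD (z.2 - l z.1) (l z.1); rewrite subrK.
  by have := ler_normD (h t0) (s * (z.1 - t0)); rewrite -/(l _); lra.
have r0' := r0; have := normr_ge0 t0; have := normr_ge0 (h t0).
move: b1; rewrite ler_distl => /andP[c1 c2]; have := ler_norm z.1; rewrite /B.
by split; lra.
Qed.

Lemma jump_condition_scale (Cb Cd : R) : 0 <= Cb -> 0 <= Cd ->
  (forall a x, `|dil r a x| <= Cb) -> (forall a x, `|ddil r a x| <= Cd / r) ->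
  - (L * Cb * Cd * (2 + `|s|) * (10 + 8 * M) * e) <=
    bumpf 0 * (s * (E (wp t0) - E (wm t0)) - (F (wp t0) - F (wm t0))).
Proof.
move=> Cb0 Cd0 HCb HCd.
have suppP z : (`|z.1 - t0| <= r /\ `|z.2 - l z.1| <= r) \/ [/\ phi z = 0, pt z = 0 & px z = 0].
  have [h1|h1] := leP `|z.1 - t0| r; last first.
    by right; apply: outside => -[]; rewrite leNgt h1.
  have [h2|h2] := leP `|z.2 - l z.1| r; first by left.
  by right; apply: outside => -[_]; rewrite leNgt h2.
have bump_ge (a x : R) : 0 <= dil r a x by exact: bump_ge0.
have I0 : 0 <= \int[leb2]_z (E (v z) * pt z + F (v z) * px z).
  apply: (entropic_smooth (tau := t0 - r) (B := B) ent smooth2_phi) => //.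
  - by move=> z; exact: mulr_ge0.
  - by have := rt0; lra.
  - by move=> z; case: (suppP z) => [[h1 h2] _|[-> _ _]]; [exact: inbox|rewrite eqxx].
have [pt' [px' [spt spx Hp]]] := smooth2_partials smooth2_phi.
have ept : pt = pt'.
  by apply/funext => -[t x]; have [[_ <-] _] := phi_partials t x; have [[_ <-] _] := Hp t x.
have epx : px = px'.
  by apply/funext => -[t x]; have [_ [_ <-]] := phi_partials t x; have [_ [_ <-]] := Hp t x.
have suppB z : (`|z.1 - t0| <= r /\ `|z.2 - l z.1| <= r) -> `|z.1| <= B /\ `|z.2| <= B.
  move=> [h1 h2]; have [i1 i2 i3] := inbox h1 h2; split => //.
  by rewrite ger0_norm//; have := rt0; lra.
have bpt : bcs2 pt.
  rewrite ept; apply: (bcs2_continuous (B := B) (smooth2_continuous spt)) => z; rewrite -ept.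
  by case: (suppP z) => [/suppB//|[_ -> _]]; rewrite eqxx.
have bpx : bcs2 px.
  rewrite epx; apply: (bcs2_continuous (B := B) (smooth2_continuous spx)) => z; rewrite -epx.
  by case: (suppP z) => [/suppB//|[_ _ ->]]; rewrite eqxx.
have bb (w : R * R -> R) : measurable_fun setT w -> (forall z, `|w z| <= M) ->
    bcs2 (fun z => E (w z) * pt z + F (w z) * px z).
  move=> mw wM; apply: bcs2D; under eq_fun do rewrite mulrC; apply: bcs2M => //.
    exact: bm2_comp EL L0.
  exact: bm2_comp FL L0.
have Ibar : \int[leb2]_z (E (vb z) * pt z + F (vb z) * px z) =
    r * (bumpf 0 * (s * (E (wp t0) - E (wm t0)) - (F (wp t0) - F (wm t0)))).
  rewrite bcs2_fubini1; last exact: bb.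
  set c1 := \int[mu]_x ((if 0 <= x then E (wp t0) else E (wm t0)) * dil r 0 x).
  set c2 := bumpf 0 * _.
  transitivity (\int[mu]_t (c1 * ddil r t0 t + c2 * dil r t0 t)).
    apply: eq_Rintegral => t _; rewrite [c1 * _]mulrC [c2 * _]mulrC -(integral_two_states r0 _ _ _ _ _ _ _ (l t)).
    by apply: eq_Rintegral => x _; rewrite /vb /pt /px /= !(fun_if E) !(fun_if F).
  rewrite bcs1_integralD; [|by apply: bcs1Z; exact: bcs1_ddil|by apply: bcs1Z; exact: bcs1_dil].
  rewrite (bcs1_integralZ c1 (bcs1_ddil r0 t0)) (bcs1_integralZ c2 (bcs1_dil r0 t0)).
  by rewrite integral_ddil// integral_dil// mulr0 add0r mulrC.
set K := L * Cb * Cd * (2 + `|s|).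
have pw z : (E (v z) * pt z + F (v z) * px z) - (E (vb z) * pt z + F (vb z) * px z) <=
    K / r * Dd z.
  case: (suppP z) => [[h1 h2]|[_ -> ->]]; last first.
    rewrite !mulr0 addr0 subr0 mulr_ge0//.
      by rewrite divr_ge0 ?mulr_ge0 ?addr_ge0 ?normr_ge0// ltW.
    by rewrite /Dd !mulr_ge0 ?ind_ge0.
  have [i1 i2] : t0 - r <= z.1 /\ z.1 <= t0 + r by move: h1; rewrite ler_distl => /andP.
  have [i3 i4] : - r <= z.2 - l z.1 /\ z.2 - l z.1 <= r by move: h2; rewrite ler_norml => /andP.
  rewrite /Dd ind1// mul1r ind1// mul1r.
  set A := `|v z - vb z|.
  have hE : `|E (v z) - E (vb z)| <= L * A by exact: EL.
  have hF : `|F (v z) - F (vb z)| <= L * A by exact: FL.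
  have hpx : `|px z| <= Cb * (Cd / r) by rewrite /px normrM ler_pM.
  have hpt : `|pt z| <= (1 + `|s|) * (Cb * (Cd / r)).
    rewrite /pt; apply: (le_trans (ler_normB _ _)); rewrite mulrDl mul1r lerD//.
      by rewrite normrM mulrC ler_pM.
    by rewrite -mulrA normrM ler_wpM2l// normrM ler_pM.
  have -> : E (v z) * pt z + F (v z) * px z - (E (vb z) * pt z + F (vb z) * px z) =
    (E (v z) - E (vb z)) * pt z + (F (v z) - F (vb z)) * px z by ring.
  apply: (le_trans (ler_norm _)); apply: (le_trans (ler_normD _ _)).
  rewrite [`|_ * pt z|]normrM [`|_ * px z|]normrM.
  have -> : K / r * A = L * A * ((1 + `|s|) * (Cb * (Cd / r))) + L * A * (Cb * (Cd / r)).
    by rewrite /K; ring.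
  by rewrite lerD// ler_pM.
have : \int[leb2]_z ((E (v z) * pt z + F (v z) * px z) - (E (vb z) * pt z + F (vb z) * px z)) <=
    \int[leb2]_z (K / r * Dd z).
  by apply: bcs2_integral_le => //; [apply: bcs2B; exact: bb|exact: bcs2Z].
rewrite bcs2_integralB; [|exact: bb..]; rewrite Ibar bcs2_integralZ// => H.
have H2 : K / r * \int[leb2]_z Dd z <= K / r * ((10 + 8 * M) * e * r ^+ 2).
  by rewrite ler_wpM2l// divr_ge0 ?mulr_ge0 ?addr_ge0 ?normr_ge0// ltW.
have H3 : K / r * ((10 + 8 * M) * e * r ^+ 2) = r * (K * (10 + 8 * M) * e).
  by field; rewrite gt_eqF.
by rewrite -(ler_pM2l r0); lra.
Qed.

End scale.

Lemma jump_condition : F (wp t0) - F (wm t0) <= s * (E (wp t0) - E (wm t0)).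
Proof.
have [Cb Cb0 HCb] := dil_bound; have [Cd Cd0 HCd] := ddil_bound.
set K := L * Cb * Cd * (2 + `|s|) * (10 + 8 * M).
have K0 : 0 <= K by rewrite /K !mulr_ge0 ?addr_ge0 ?mulr_ge0// ltW.
suff key : forall e : R, 0 < e -> e <= 1 -> - (K * e) <=
    bumpf 0 * (s * (E (wp t0) - E (wm t0)) - (F (wp t0) - F (wm t0))).
  rewrite -subr_ge0 -(pmulr_rge0 _ bump0_gt0) leNgt; apply/negP => neg.
  set Q := bumpf 0 * _ in key neg.
  have K1 : 0 < K + 1 by rewrite ltr_wpDl.
  have KQ : 0 < - Q / (2 * (K + 1)) by rewrite divr_gt0 ?mulr_gt0// oppr_gt0.
  pose e := Num.min 1 (- Q / (2 * (K + 1))).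
  have e0 : 0 < e by rewrite lt_min ltr01 KQ.
  have := key e e0; rewrite ge_min lexx => /(_ isT).
  have : K * e <= (K + 1) * (- Q / (2 * (K + 1))).
    rewrite ler_pM ?(ltW e0)//; first by rewrite lerDl.
    by rewrite ge_min lexx orbT.
  have -> : (K + 1) * (- Q / (2 * (K + 1))) = - Q / 2 by field; rewrite gt_eqF.
  by move: neg; lra.
move=> e e0 e1.
have [n gn] := g0 e0; have [d1 d10 H1] := tangent e0.
have [d2 d20 H2] := lm e0; have [d3 d30 H3] := lp e0; have [d4 d40 H4] := lg n e0.
have n0 : (0 : R) < n.+1%:R^-1 by rewrite invr_gt0.
have [r [[r0 rt rd1 rd2 rd3] [rd4 rn]]] : exists r : R, [/\ 0 < r, r < t0, r < d1, r < d2 & r < d3] /\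
    r < d4 /\ 2 * r < n.+1%:R^-1.
  pose m := Num.min t0 (Num.min d1 (Num.min d2 (Num.min d3 (Num.min d4 n.+1%:R^-1)))).
  have t00' := t00.
  have m0 : 0 < m by rewrite !lt_min t00 d10 d20 d30 d40.
  have : m <= m by []; rewrite {2}/m !le_min => /andP[m1 /andP[m2 /andP[m3 /andP[m4 /andP[m5 m6]]]]].
  clearbody m; move: (n.+1%:R^-1 : R) n0 m6 => N n0 m6.
  by exists (m / 3); split; [split|split]; lra.
(* The 5 collects [e] for the oscillation of [g n], [2 * e] for the value [g n t0 < e] on a length
   [2 * r], and [e] for each trace. *)
have small : \int[mu]_t (ind (t0 - r) (t0 + r) t * gam n t) <= 5 * e * r.
  have b1 (k : R -> R) : bm1 k -> bcs1 (fun t => ind (t0 - r) (t0 + r) t * `|k t - k t0|).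
    move=> [mk [C HC]]; apply: bcs1M; [exact: bcs1_ind|split].
      by apply: measurableT_comp => //; apply: measurable_funB => //; exact: measurable_cst.
    by exists (C + C) => t; rewrite normr_id (le_trans (ler_normB _ _))// lerD.
  have [bm bp /(_ n)[bg gg0] _ _] := Htr.
  pose k t := ind (t0 - r) (t0 + r) t * `|g n t - g n t0| + e * ind (t0 - r) (t0 + r) t.
  pose k2 t := ind (t0 - r) (t0 + r) t * `|wp t - wp t0| +
    ind (t0 - r) (t0 + r) t * `|wm t - wm t0|.
  have bi : bcs1 (fun t => e * ind (t0 - r) (t0 + r) t) by apply: bcs1Z; exact: bcs1_ind.
  have bk : bcs1 k by apply: bcs1D => //; exact: b1.
  have bk2 : bcs1 k2 by apply: bcs1D; exact: b1.
  apply: (@le_trans _ _ (\int[mu]_t (k t + k2 t))).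
    apply: bcs1_integral_le; first exact: (bcs1M (bcs1_ind _ _) (mgam n)).
      exact: bcs1D.
    move=> t; rewrite /k /k2 /gam; have i0 := ind_ge0 (t0 - r) (t0 + r) t.
    have := ler_norm (g n t - g n t0) => h1.
    have h2 : ind (t0 - r) (t0 + r) t * g n t <=
        ind (t0 - r) (t0 + r) t * (`|g n t - g n t0| + e).
      by rewrite ler_wpM2l//; lra.
    by lra.
  rewrite bcs1_integralD// /k /k2 bcs1_integralD; [|exact: b1|exact: bi].
  rewrite bcs1_integralD; [|exact: b1|exact: b1].
  rewrite bcs1_integralZ; last exact: bcs1_ind.
  rewrite integral_ind1; last lra.
  have := H2 r r0 rd2; have := H3 r r0 rd3; have := H4 r r0 rd4; lra.
have hl t : `|t - t0| <= r -> `|h t - l t| <= e * r.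
  move=> tr; apply: (le_trans (H1 t _)); first lra.
  by rewrite ler_wpM2l// ltW.
have := jump_condition_scale r0 e0 e1 rt hl rn small (ltW Cb0) (ltW Cd0) (HCb r) (HCd r r0).
by rewrite /K.
Qed.
End jump_condition.

(** The set of bounded times where all [g n] stay above a fixed positive level is null, since its
    measure times this level is bounded by integrals tending to 0. *)
Lemma strip_traces_vanishing (v : R * R -> R) (h wm wp : R -> R) (g : nat -> R -> R) :
  strip_traces v h wm wp g ->
  {ae mu, forall t, 0 < t -> forall e : R, 0 < e -> exists n, g n t < e}.
Proof.
move=> [_ _ bg g0 _].
have ae1 (j : nat) : {ae mu, forall t, 0 <= t <= j.+1%:R -> exists n, g n t < j.+1%:R^-1}.
  pose A := `[0, j.+1%:R]%classic `&` \bigcap_n [set t | j.+1%:R^-1 <= g n t].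
  have mA : measurable A.
    apply: measurableI => //; apply: bigcap_measurable => // n _.
    rewrite -[X in measurable X]setTI.
    by apply: measurable_fun_le => //; exact: (bg n).1.1.
  have A0 : mu A = 0%E.
    have Afin : (mu A < +oo)%E.
      by apply: le_lt_trans (segment_measure_lty 0 j.+1%:R); apply: le_measure;
        rewrite ?inE// => x [].
    have bA : bcs1 (\1_A : R -> R).
      split; first exact: measurable_indic.
      exists 1, j.+1%:R => x; split; first by rewrite indicE; case: (_ \in _); rewrite ?normr0 ?normr1.
      move=> xj; rewrite indicE memNset// => -[/=]; rewrite in_itv/= => /andP[x0 x1] _.
      by move: xj; rewrite ger0_norm//; lra.
    have E1 : \int[mu]_t \1_A t = fine (mu A).
      by rewrite /Rintegral integral_indic// setIT.
    have le0 : fine (mu A) <= 0.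
      have cv : j.+1%:R * \int[mu]_t (ind 0 j.+1%:R t * g n t) @[n --> \oo] --> j.+1%:R * (0:R).
        by apply: cvgM; [exact: cvg_cst|exact: g0].
      rewrite mulr0 in cv; rewrite -E1; rewrite -(cvg_lim (@Rhausdorff R) cv).
      apply: limr_ge; first exact: cvgP cv.
      apply: nearW => n.
      have bn : bcs1 (fun t => ind 0 j.+1%:R t * g n t) by apply: bcs1M; [exact: bcs1_ind|exact: (bg n).1].
      rewrite -bcs1_integralZ//; apply: bcs1_integral_le => //; first exact: bcs1Z.
      move=> t; rewrite indicE; have [/set_mem[/=]|nA] := boolP (t \in A).
        rewrite in_itv/= => /andP[t1 t2] /(_ n I)/= gt; rewrite ind1// mul1r.
        by rewrite mulrC -ler_pdivrMr// mul1r.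
      by rewrite !mulr_ge0 ?ind_ge0//; exact: (bg n).2.
    have := fine_ge0 (measure_ge0 mu A); rewrite -[LHS]fineK ?ge0_fin_numE//.
    by move=> ge0; congr (_%:E); apply/eqP; rewrite eq_le le0.
  exists A; split => // t /= nt; have tj : 0 <= t <= j.+1%:R.
    by apply: contrapT => ntj; apply: nt => /ntj.
  split; first by rewrite /= in_itv.
  move=> n _ /=; rewrite leNgt; apply/negP => gn; by apply: nt => _; exists n.
apply: (aeS (aeN ae1)) => t Ht t0 e e0.
pose j := Num.truncn (Num.max t e^-1).
have [tj ej] : t < j.+1%:R /\ e^-1 < j.+1%:R.
  have := truncnS_gt (Num.max t e^-1); rewrite gt_max => /andP[]. by [].
have [|n gn] := Ht j; first by rewrite !ltW.
exists n; apply: (lt_trans gn); rewrite -[ltRHS]invrK ltf_pV2 ?posrE ?invr_gt0//.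
Qed.

Lemma ae_jump_condition (v : R * R -> R) (M L : R) (E F : R -> R) (h wm wp : R -> R)
    (g : nat -> R -> R) :
  measurable_fun setT v -> (forall z, `|v z| <= M) ->
  measurable_fun setT E -> measurable_fun setT F -> 0 <= L ->
  (forall a b, `|a| <= M -> `|b| <= M -> `|E a - E b| <= L * `|a - b|) ->
  (forall a b, `|a| <= M -> `|b| <= M -> `|F a - F b| <= L * `|a - b|) ->
  entropic E F v -> strip_traces v h wm wp g ->
  {ae mu, forall t, 0 < t -> `|wm t| <= M -> `|wp t| <= M -> forall s, is_derive t 1 h s ->
    F (wp t) - F (wm t) <= s * (E (wp t) - E (wm t))}.
Proof.
move=> mv vM mE mF L0 EL FL ent Htr; have [bm bp bg _ _] := Htr.
have ag : {ae mu, forall t, forall n, lebesgue_at (g n) t}.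
  by apply: aeN => n; exact: lebesgue_points (bg n).1.
apply: (aeS (aeI (aeI (lebesgue_points bm) (lebesgue_points bp))
  (aeI ag (strip_traces_vanishing Htr)))) => t [[h1 h2] [h3 h4]] t0 wmM wpM s hs.
exact: (jump_condition mv vM mE mF L0 EL FL ent Htr t0 hs wmM wpM h1 h2 h3 (h4 t0)).
Qed.
End entropy_at_traces.

(** * Propagation of a lower bound *)

Section potential_step.
Context {R : realType}.
Local Notation mu := (@lebesgue_measure R).

Lemma dflat_bound : exists2 C : R, 0 < C & forall x, `|dflat x : R| <= C.
Proof.
have [g' sg' H] := smooth1_derive (@smooth1_flat R).
have [C C0 HC] := smooth1_bounded sg'; exists C => // x.
by have [_ E1] := H x; have [_ E2] := @flat_derive R x; rewrite -E2 E1.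
Qed.

Lemma dflat_lower (a b y : R) : 0 < a -> a <= y -> y <= b -> b^-1 ^+ 2 * flat a <= dflat y.
Proof.
move=> a0 ay yb; have y0 : 0 < y := lt_le_trans a0 ay; have b0 : 0 < b := lt_le_trans y0 yb.
rewrite dflatE y0; have -> : expR (- y^-1) = flat y by rewrite flatE y0.
rewrite ler_pM ?flat_ge0 ?exprn_ge0 ?invr_ge0 ?(ltW b0)//; last exact: flat_homo.
by rewrite lerXn2r ?nnegrE ?invr_ge0 ?(ltW b0) ?(ltW y0)// lef_pV2.
Qed.

Lemma continuous_fst_section (p : R * R -> R) (x : R) : continuous p ->
  continuous (fun t : R => p (t, x)).
Proof.
move=> cp t; have /continuous2P c : {for (t, x), continuous p} := cp (t, x).
apply/cvgrPdist_le => e /c[d d0 Hd]; near=> t'; apply: Hd; last by rewrite subrr normr0.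
rewrite distrC; near: t'; exact: cvgr_dist_lt.
Unshelve. all: by end_near. Qed.

(** This allows a positive constant to be added to the entropy [E] in the inequality, which is then
    bounded away from 0. *)
Lemma integral_dt_eq0 (phi pt px : R * R -> R) (tau B : R) : smooth2 phi ->
  has_partials phi pt px -> 0 < tau ->
  (forall z, phi z != 0 -> [/\ tau <= z.1, z.1 <= B & `|z.2| <= B]) ->
  bcs2 pt /\ \int[leb2]_z pt z = 0.
Proof.
move=> sphi H tau0 supp.
have [pt' [px' [spt spx Hp]]] := smooth2_partials sphi.
have ept : pt = pt'.
  by apply/funext => -[t x]; have [[_ <-] _] := H t x; have [[_ <-] _] := Hp t x.
have bpt : bcs2 pt.
  rewrite ept; apply: (bcs2_continuous (B := B) (smooth2_continuous spt)) => z; rewrite -ept => nz.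
  have [h1 h2 h3] : [/\ tau <= z.1, z.1 <= B & `|z.2| <= B].
    by apply: contrapT => /(box_partials H supp)[e _]; rewrite e eqxx in nz.
  by split => //; rewrite ger0_norm// (le_trans _ h1)// ltW.
split => //; rewrite bcs2_fubini2//; apply: Rintegral_eq0 => x _.
have ex t : pt (t, x) = ind 0 (`|B| + 1) t * pt (t, x).
  rewrite /ind; case: (boolP (0 <= t <= `|B| + 1)) => [_|nt]; first by rewrite mul1r.
  have [|-> _] := box_partials H supp (z := (t, x)); last by rewrite mulr0.
  move=> [/= h1 h2 h3]; move/negP: nt; apply; have := ler_norm B.
  by move: tau0 h1 h2; clear; move=> *; apply/andP; split; lra.
under eq_Rintegral do rewrite ex.
have B0 : (0:R) < `|B| + 1 by have := normr_ge0 B; lra.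
rewrite -integral_ind (ftc_segment B0 (fun t => (H t x).1)).
  have z1 : phi (`|B| + 1, x) = 0.
    by apply: contrapT => /eqP/supp[/= _ h _]; have := ler_norm B; lra.
  have z0 : phi (0, x) = 0.
    by apply: contrapT => /eqP/supp[/= h _ _]; lra.
  by rewrite z1 z0 subrr.
by rewrite ept; exact: continuous_fst_section (smooth2_continuous spt).
Qed.

Lemma box_lipschitz (g0 t1 T L : R) (W Wt Wx : R * R -> R) : has_partials W Wt Wx ->
  (forall t x, t1 <= t <= T -> `|x| <= L -> `|Wt (t, x)| <= g0 /\ `|Wx (t, x)| <= g0) ->
  forall t x t' x', t1 <= t <= T -> t1 <= t' <= T -> `|x| <= L -> `|x'| <= L ->
  `|W (t, x) - W (t', x')| <= g0 * (`|t - t'| + `|x - x'|).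
Proof.
move=> HW Wg t x t' x' ht ht' hx hx'; have -> : W (t, x) - W (t', x') =
  (W (t, x) - W (t', x)) + (W (t', x) - W (t', x')) by ring.
apply: (le_trans (ler_normD _ _)); rewrite mulrDr lerD//.
  have [y [h1 h2 ->]] := mvt_between (fun t => (HW t x).1) t' t.
  rewrite normrM ler_wpM2r//; apply: (Wg _ _ _ hx).1.
  move: h1 h2 ht ht'; rewrite ge_min le_max => /orP[]? /orP[]? /andP[? ?] /andP[? ?];
    apply/andP; split; lra.
have [y [h1 h2 ->]] := mvt_between (fun x => (HW t' x).2) x' x.
rewrite normrM ler_wpM2r//; apply: (Wg _ _ ht' _).2.
move: h1 h2 hx hx'; rewrite !ler_norml ge_min le_max => /orP[]? /orP[]? /andP[? ?] /andP[? ?];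
  apply/andP; split; lra.
Qed.

(** * One time step of the maximum principle for the potential *)

Section step.
Variables (a b E F : R * R -> R) (Lam Ca : R).
Hypotheses (Lam0 : 0 < Lam) (ma : measurable_fun setT a) (mb : measurable_fun setT b).
Hypotheses (aC : forall z, `|a z| <= Ca) (bL : forall z, `|b z| <= Lam * `|a z|).
Hypothesis (Ea : forall z, E z = `|a z|).
Hypotheses (Fb : forall z, F z * a z = E z * b z) (mF : measurable_fun setT F).
Hypothesis FL : forall z, `|F z| <= Lam * E z.
Hypothesis ent : forall (phi pt px : R * R -> R) (tau B : R),
  smooth2 phi -> (forall z, 0 <= phi z) -> 0 < tau ->
  (forall z, phi z != 0 -> [/\ tau <= z.1, z.1 <= B & `|z.2| <= B]) ->
  has_partials phi pt px -> 0 <= \int[leb2]_z (E z * pt z + F z * px z).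

(* Distance of the gradient of a potential from [(- b, a)]. *)
Definition potential_error (t1 T L : R) (Wt Wx : R * R -> R) :=
  \int[leb2]_z (ind t1 T z.1 * (ind (- L) L z.2 * (`|Wt z + b z| + `|Wx z - a z|))).

Lemma bcs2_error (g0 t1 T L : R) (W Wt Wx : R * R -> R) : 0 < t1 -> 0 <= g0 -> smooth2 W ->
  has_partials W Wt Wx ->
  (forall t x, t1 <= t <= T -> `|x| <= L -> `|Wt (t, x)| <= g0 /\ `|Wx (t, x)| <= g0) ->
  bcs2 (fun z => ind t1 T z.1 * (ind (- L) L z.2 * (`|Wt z + b z| + `|Wx z - a z|))).
Proof.
move=> t10 g00 sW HW Wg; have L0 := Lam0; have Ca0 : 0 <= Ca := le_trans (normr_ge0 _) (aC 0).
have [wt [wx [swt swx Hw]]] := smooth2_partials sW.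
have ewt : Wt = wt.
  by apply/funext => -[t x]; have [[_ <-] _] := HW t x; have [[_ <-] _] := Hw t x.
have ewx : Wx = wx.
  by apply/funext => -[t x]; have [_ [_ <-]] := HW t x; have [_ [_ <-]] := Hw t x.
have mi (p q : R) : measurable_fun setT (ind p q) by exact: (bcs1_ind _ _).1.
split.
  apply: measurable_funM; first by apply: measurableT_comp => //; exact: measurable_fst.
  apply: measurable_funM; first by apply: measurableT_comp => //; exact: measurable_snd.
  apply: measurable_funD; apply: measurableT_comp => //.
    by apply: measurable_funD => //; rewrite ewt; exact: smooth2_measurable.
  by apply: measurable_funB => //; rewrite ewx; exact: smooth2_measurable.
exists (g0 + Lam * Ca + (g0 + Ca)), (`|T| + `|L|) => z.
have c1 : 0 <= g0 + Lam * Ca + (g0 + Ca).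
  by have := g00; have := mulr_ge0 (ltW L0) Ca0; lra.
rewrite ger0_norm; last by rewrite !mulr_ge0 ?ind_ge0 ?addr_ge0.
rewrite /ind.
case: (boolP (t1 <= z.1 <= T)) => [h1|h1]; last by rewrite mul0r.
case: (boolP (- L <= z.2 <= L)) => [h2|h2]; last by rewrite mul0r mulr0.
split.
  rewrite !mul1r; rewrite -ler_norml in h2.
  have [q1 q2] := Wg _ _ h1 h2; rewrite -surjective_pairing in q1 q2.
  have q3 : `|b z| <= Lam * Ca by rewrite (le_trans (bL z))// ler_wpM2l// ltW.
  rewrite lerD//; first by rewrite (le_trans (ler_normD _ _))// lerD.
  by rewrite (le_trans (ler_normB _ _))// lerD.
move=> far; exfalso; move: h2 far; rewrite -ler_norml => h2.
have := ler_norm T; have := ler_norm L; have := normr_ge0 T; have := normr_ge0 L.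
by move: h1 => /andP[h3 h4]; rewrite (ger0_norm (_ : 0 <= z.1)); [move=> ? ? ? ? []; lra|lra].
Qed.

Section test.
Variables (delta g0 t1 T L eta kap m s r t0 x1 c : R) (W Wt Wx : R * R -> R).
Hypotheses (d0 : 0 < delta) (t10 : 0 < t1) (g00 : 0 <= g0) (m0 : 0 < m) (s0 : 0 < s) (r0 : 0 < r).
Hypotheses (kapE : kap = m * Lam) (st : t1 <= t0 - s) (sd : s <= delta / 2) (rd : r <= delta / 2).
Hypotheses (rL : r <= Lam * delta) (tT : t0 + 2 * delta <= T) (xL : `|x1| + 5 * Lam * delta <= L).
Hypotheses (sW : smooth2 W) (HW : has_partials W Wt Wx).
Hypothesis Wg : forall t x, t1 <= t <= T -> `|x| <= L -> `|Wt (t, x)| <= g0 /\ `|Wx (t, x)| <= g0.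
Hypothesis Wc : forall x, `|x - x1| <= 5 * Lam * delta -> W (t0, x) <= c.
Hypothesis cst_eta : g0 * s + kap * s + kap * (2 * delta) + g0 * (r + r) <= eta / 2.
Hypothesis (Wgt : c + eta < W (t0 + delta, x1)).

Let c' := c + g0 * s + kap * s.
Let kap0 : 0 < kap. Proof. by rewrite kapE mulr_gt0. Qed.

Let lip := box_lipschitz HW Wg.

Let Y z := W z - c' - kap * (z.1 - t0).
Let l1 z := 4 * Lam * delta - (z.2 - x1) - Lam * (z.1 - t0).
Let l2 z := 4 * Lam * delta + (z.2 - x1) - Lam * (z.1 - t0).
Let P z := flat (Y z).
Let X1 z := flat (l1 z).
Let X2 z := flat (l2 z).
Let al t := step ((t - t0) / s).
Let al' t := bumpf ((t - t0) / s) / s.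
Let A t := flat (t0 + 2 * delta - t).
Let A' t := dflat (t0 + 2 * delta - t).

(** Product of an increasing function of the potential, a cutoff to the cone |x - x1| < 4 Lam delta
    - Lam (t - t0), a switch that is on from t0 + s, and a factor decreasing to 0 at t0 + 2 delta.
    The decrease of the last factor yields the strictly negative term on which the contradiction
    rests. *)
Let phi z := P z * (X1 z * X2 z) * (al z.1 * A z.1).
Let pt z := dflat (Y z) * (Wt z - kap) * (X1 z * X2 z) * (al z.1 * A z.1) +
  P z * (- Lam * (dflat (l1 z) * X2 z + X1 z * dflat (l2 z))) * (al z.1 * A z.1) +
  P z * (X1 z * X2 z) * (al' z.1 * A z.1 - al z.1 * A' z.1).
Let px z := dflat (Y z) * Wx z * (X1 z * X2 z) * (al z.1 * A z.1) +
  P z * (- dflat (l1 z) * X2 z + X1 z * dflat (l2 z)) * (al z.1 * A z.1).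

Let smooth2_phi : smooth2 phi.
Proof.
have cst2 k : smooth2 (fun _ : R * R => k) by exact: smooth2_cst.
have st' : smooth2 (fun z : R * R => z.1 - t0) by apply: smooth2B; [exact: smooth2_fst|].
have sx' : smooth2 (fun z : R * R => z.2 - x1) by apply: smooth2B; [exact: smooth2_snd|].
apply: smooth2M.
  apply: smooth2M.
    apply: (smooth2_comp (@smooth1_flat R)); apply: smooth2B; last exact: smooth2Z.
    by apply: smooth2B.
  apply: smooth2M; apply: (smooth2_comp (@smooth1_flat R)); apply: smooth2B; try exact: smooth2Z.
    exact: smooth2B.
  exact: smooth2D.
apply: smooth2M.
  by apply: (smooth2_comp (smooth1_dilated t0 s (@smooth1_step R))); exact: smooth2_fst.
by apply: (smooth2_comp (@smooth1_flat R)); apply: smooth2B => //; exact: smooth2_fst.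
Qed.

Let phi_partials : has_partials phi pt px.
Proof.
move=> t x.
have comp (g dg : R -> R) (k : R -> R) (y k' : R) : (forall y : R, is_derive y 1 g (dg y)) ->
    is_derive y 1 k k' -> is_derive y 1 (fun t => g (k t)) (dg (k y) * k').
  by move=> Hg Hk; exact: (@is_derive1_comp R g k y _ _ (Hg _) Hk).
have aff (p q y : R) : is_derive y 1 (fun y => p + q * y) q.
  have h := is_deriveD (is_derive_cst p y 1) (is_deriveZ q (is_derive_id y (1:R))).
  apply: (is_derive_eq h).
  by rewrite /GRing.scale/= add0r mulr1.
have affe (g : R -> R) (p q y : R) : (forall y, g y = p + q * y) -> is_derive y 1 g q.
  by move=> h; rewrite (_ : g = fun y => p + q * y)//; exact/funext.
have H1 (y : R) : is_derive y 1 flat (dflat y) := @flat_derive R y.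
split.
  have dY : is_derive t 1 (fun t => Y (t, x)) (Wt (t, x) - kap).
    have h := is_deriveB (is_deriveB (HW t x).1 (is_derive_cst c' t 1))
      (affe (fun t => kap * (t - t0)) (- kap * t0) kap t _).
    by apply: is_derive_eq; [apply: h => y; ring|rewrite subr0].
  have dl1 : is_derive t 1 (fun t => l1 (t, x)) (- Lam).
    by apply: (affe _ (4 * Lam * delta - (x - x1) + Lam * t0)) => y; rewrite /l1/=; ring.
  have dl2 : is_derive t 1 (fun t => l2 (t, x)) (- Lam).
    by apply: (affe _ (4 * Lam * delta + (x - x1) + Lam * t0)) => y; rewrite /l2/=; ring.
  have dal : is_derive t 1 al (al' t).
    apply: (comp step bumpf (fun t => (t - t0) / s)); first exact: step_derive.
    by apply: (affe _ (- t0 / s)) => y; ring.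
  have dA : is_derive t 1 A (A' t * -1).
    apply: (comp flat dflat (fun t => t0 + 2 * delta - t)) => //.
    by apply: (affe _ (t0 + 2 * delta)) => y; ring.
  have h := is_deriveM (is_deriveM (comp _ _ _ _ _ H1 dY)
    (is_deriveM (comp _ _ _ _ _ H1 dl1) (comp _ _ _ _ _ H1 dl2))) (is_deriveM dal dA).
  apply: (is_derive_eq h).
  by rewrite /pt /P /X1 /X2 !fctE /GRing.scale/=; ring.
have dY : is_derive x 1 (fun x => Y (t, x)) (Wx (t, x)).
  have h := is_deriveB (is_deriveB (HW t x).2 (is_derive_cst c' x 1))
    (is_derive_cst (kap * (t - t0)) x 1).
  by apply: (is_derive_eq h); rewrite !subr0.
have dl1 : is_derive x 1 (fun x => l1 (t, x)) (-1).
  by apply: (affe _ (4 * Lam * delta + x1 - Lam * (t - t0))) => y; rewrite /l1/=; ring.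
have dl2 : is_derive x 1 (fun x => l2 (t, x)) 1.
  by apply: (affe _ (4 * Lam * delta - x1 - Lam * (t - t0))) => y; rewrite /l2/=; ring.
have h := is_deriveM (is_deriveM (comp _ _ _ _ _ H1 dY)
  (is_deriveM (comp _ _ _ _ _ H1 dl1) (comp _ _ _ _ _ H1 dl2))) (is_derive_cst (al t * A t) x 1).
apply: (is_derive_eq h).
by rewrite /px /P /X1 /X2 !fctE /GRing.scale/=; ring.
Qed.

Let prod_ge0 (p x y k l : R) : 0 <= p -> 0 <= x -> 0 <= y -> 0 <= k -> 0 <= l ->
  0 <= p * (x * y) * (k * l).
Proof. by move=> *; rewrite !mulr_ge0. Qed.

Let al_ge0 t : 0 <= al t. Proof. exact: step_ge0. Qed.
Let A_ge0 t : 0 <= A t. Proof. exact: flat_ge0. Qed.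
Let A'_ge0 t : 0 <= A' t. Proof. exact: dflat_ge0. Qed.
Let P_ge0 z : 0 <= P z. Proof. exact: flat_ge0. Qed.
Let X1_ge0 z : 0 <= X1 z. Proof. exact: flat_ge0. Qed.
Let X2_ge0 z : 0 <= X2 z. Proof. exact: flat_ge0. Qed.

Let al_gt0 t : al t != 0 -> t0 - s < t.
Proof.
rewrite ltNge => h; apply/negP => ts; move/eqP: h; apply; rewrite /al step_leN1//.
by rewrite ler_pdivrMr//; move: (s0); lra.
Qed.

Let flat_neq0 (y : R) : flat y != 0 -> 0 < y.
Proof. by rewrite ltNge => h; apply/negP => y0; move/eqP: h; apply; exact: flat_eq0. Qed.

Let cone z : X1 z * X2 z != 0 -> t0 - s <= z.1 ->
  `|z.2 - x1| <= 5 * Lam * delta /\ `|z.2| <= L.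
Proof.
rewrite mulf_eq0 negb_or => /andP[/flat_neq0 h1 /flat_neq0 h2] zt.
have : Lam * (t0 - z.1) <= Lam * (delta / 2) by rewrite ler_wpM2l ?(ltW Lam0)//; move: (sd); lra.
have : 0 < Lam * delta by rewrite mulr_gt0.
rewrite /l1 /l2 in h1 h2 => q1 q2.
have q : `|z.2 - x1| <= 5 * Lam * delta.
  by rewrite ler_norml; apply/andP; split; move: (xL); lra.
split => //; have := ler_normD (z.2 - x1) x1; rewrite subrK; move: (xL); lra.
Qed.

Let box z : (X1 z * X2 z) * (al z.1 * A z.1) != 0 ->
  [/\ t1 <= z.1, z.1 <= T, `|z.2| <= L & t0 - s <= z.1].
Proof.
rewrite mulf_eq0 negb_or => /andP[hX]; rewrite mulf_eq0 negb_or => /andP[/al_gt0 ha /flat_neq0 hA].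
have [_ hL] := cone hX (ltW ha).
by split => //; move: (st) (tT); lra.
Qed.

Let supp z : phi z != 0 -> [/\ t1 <= z.1, z.1 <= `|T| + L & `|z.2| <= `|T| + L].
Proof.
rewrite /phi -mulrA mulf_eq0 negb_or => /andP[_ /box[h1 h2 h3 _]].
have := ler_norm T; have := normr_ge0 T; have := normr_ge0 z.2.
by split => //; lra.
Qed.

(** The derivative of the switch lives in |t - t0| < s, where the bound of [W] at [t0] and its
    Lipschitz constant give [Y <= 0]; this is the origin of [g0 * s] and [kap * s] in [c']. *)
Let cut_eq0 z : P z * (X1 z * X2 z) * al' z.1 = 0.
Proof.
have [->|hX] := eqVneq (X1 z * X2 z) 0; first by rewrite mulr0 mul0r.
have [ts|ts] := leP s `|z.1 - t0|.
  by rewrite /al' bump_eq0 ?mul0r ?mulr0// normrM normfV (gtr0_norm s0) ler_pdivlMr// mul1r.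
rewrite /P flat_eq0 ?mul0r//.
have zt : t0 - s <= z.1 by move: ts; rewrite ltr_distl => /andP[]; lra.
have [hx hL] := cone hX zt.
have d0' := d0; have sd' := sd; have st' := st; have tT' := tT; have s0' := s0.
have xL' : `|x1| <= L by move: (xL); have := mulr_gt0 Lam0 d0; lra.
have h1 : t1 <= z.1 <= T by move: ts; rewrite ltr_distl => /andP[? ?]; apply/andP; split; lra.
have h0 : t1 <= t0 <= T by apply/andP; split; lra.
have := lip h1 h0 hL hL; rewrite subrr normr0 addr0 -surjective_pairing => hl.
have := ler_norm (W z - W (t0, z.2)); have := Wc hx.
have q1 : g0 * `|z.1 - t0| <= g0 * s by rewrite ler_wpM2l// ltW.
have q2 : kap * (t0 - z.1) <= kap * s.
  by rewrite ler_wpM2l ?(ltW kap0)//; move: zt; lra.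
rewrite /Y /c'; lra.
Qed.

Let C1 := sval (cid2 dflat_bound).
Let C10 : 0 < C1. Proof. by rewrite /C1; case: cid2. Qed.
Let HC1 x : `|dflat x| <= C1. Proof. by rewrite /C1; case: cid2. Qed.

Let D z := ind t1 T z.1 * (ind (- L) L z.2 * (`|Wt z + b z| + `|Wx z - a z|)).
Let Q z := ind (t0 + delta - r) (t0 + delta + r) z.1 * ind (x1 - r) (x1 + r) z.2.
Let c0 := m * flat (eta / 2) * (flat (Lam * delta) * flat (Lam * delta)) *
  ((2 * delta)^-1 ^+ 2 * flat (delta / 2)).

(** If [W] exceeds [c + eta] at (t0 + delta, x1), then [Y >= eta / 2] on the whole square of half
    side [r] around this point; [c0] is the product of the lower bounds of the factors there. *)
Let Q_lower z : c0 * Q z <= (E z + m) * (P z * (X1 z * X2 z) * (al z.1 * A' z.1)).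
Proof.
have rhs0 : 0 <= (E z + m) * (P z * (X1 z * X2 z) * (al z.1 * A' z.1)).
  by apply: mulr_ge0; [rewrite Ea addr_ge0// ltW|exact: prod_ge0].
rewrite /Q /ind; case: (boolP (_ <= z.1 <= _)) => [/andP[h1 h2]|_]; last by rewrite mul0r mulr0.
case: (boolP (_ <= z.2 <= _)) => [/andP[h3 h4]|_]; last by rewrite mulr0 mulr0.
rewrite !mulr1.
have d0' := d0; have sd' := sd; have st' := st; have tT' := tT; have s0' := s0; have rd' := rd.
have r0' := r0; have rL' := rL; have Ld : 0 < Lam * delta by rewrite mulr_gt0.
have al1 : al z.1 = 1.
  by rewrite /al step_ge1// ler_pdivlMr// mul1r; lra.
rewrite al1 mul1r.
have LamT : Lam * (z.1 - t0) <= Lam * (3 / 2 * delta) by rewrite ler_wpM2l ?(ltW Lam0)//; lra.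
have hX1 : flat (Lam * delta) <= X1 z by apply: flat_homo; rewrite /l1; lra.
have hX2 : flat (Lam * delta) <= X2 z by apply: flat_homo; rewrite /l2; lra.
have hA : (2 * delta)^-1 ^+ 2 * flat (delta / 2) <= A' z.1.
  by apply: dflat_lower; lra.
have hP : flat (eta / 2) <= P z.
  apply: flat_homo; rewrite /Y /c'.
  have xL1 := xL; have hx1 : `|x1| <= L by have := Ld; lra.
  have hx : `|z.2 - x1| <= r by rewrite ler_distl; apply/andP; split; lra.
  have hz : `|z.2| <= L by have := ler_normD (z.2 - x1) x1; rewrite subrK; lra.
  have ht : `|z.1 - (t0 + delta)| <= r by rewrite ler_distl; apply/andP; split; lra.
  have T1 : t1 <= z.1 <= T by apply/andP; split; lra.
  have T2 : t1 <= t0 + delta <= T by apply/andP; split; lra.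
  have := lip T1 T2 hz hx1; rewrite -surjective_pairing ler_norml => /andP[hl _].
  have q1 : g0 * (`|z.1 - (t0 + delta)| + `|z.2 - x1|) <= g0 * (r + r) by rewrite ler_wpM2l// lerD.
  have q2 : kap * (z.1 - t0) <= kap * (2 * delta).
    by rewrite ler_wpM2l ?(ltW kap0)//; lra.
  have := cst_eta; have := Wgt; lra.
have mE : m <= E z + m by rewrite Ea lerDr.
have f0 := @flat_ge0 R; have k0 : 0 <= (2 * delta)^-1 ^+ 2 * flat (delta / 2).
  by rewrite mulr_ge0// exprn_ge0// invr_ge0; lra.
have m0' := ltW m0.
have -> : (E z + m) * (P z * (X1 z * X2 z) * A' z.1) = (E z + m) * P z * (X1 z * X2 z) * A' z.1 by ring.
by rewrite /c0; do 3![apply: ler_pM => //; rewrite ?mulr_ge0//].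
Qed.

Let K := Ca + m + Lam * Ca.
Let Ca0 : 0 <= Ca. Proof. exact: le_trans (normr_ge0 _) (aC 0). Qed.
Let K0 : 0 <= K. Proof. by rewrite /K addr_ge0 ?mulr_ge0 ?addr_ge0// ltW. Qed.

(* The terms containing [dflat (Y z)] cancel up to the error of [W], because
   [E * b = F * a]; all the others are nonpositive. *)
Let pointwise z : (E z + m) * pt z + F z * px z <= C1 * K * D z - c0 * Q z.
Proof.
set S := (X1 z * X2 z) * (al z.1 * A z.1).
have E0 : 0 <= E z by rewrite Ea.
have hF := FL z; have hb := bL z; rewrite -Ea in hb.
have f0 := @flat_ge0 R; have df0 := @dflat_ge0 R; have f1 := @flat_le1 R.
have m0' := m0; have L0 := Lam0.
have [S0 S1] : 0 <= S /\ S <= 1.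
  have XX : 0 <= X1 z * X2 z by exact: mulr_ge0.
  have AA : 0 <= al z.1 * A z.1 by exact: mulr_ge0.
  split; first exact: mulr_ge0.
  rewrite -[leRHS]mulr1 /S; apply: ler_pM => //.
    by rewrite -[leRHS]mulr1; apply: ler_pM => //; exact: f1.
  by rewrite -[leRHS]mulr1; apply: ler_pM => //; [exact: step_le1|exact: f1].
have T1 : dflat (Y z) * S * ((E z + m) * (Wt z - kap) + F z * Wx z) <= C1 * K * D z.
  have [->|/box[h1 h2 h3 _]] := eqVneq S 0.
    by rewrite mulr0 mul0r !mulr_ge0// ltW.
  have -> : D z = `|Wt z + b z| + `|Wx z - a z|.
    by rewrite /D ind1// mul1r ind1 ?mul1r//; move: h3; rewrite ler_norml => /andP[].
  have EC : E z <= Ca by rewrite Ea.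
  have w1 : (E z + m) * (Wt z + b z) <= K * `|Wt z + b z|.
    apply: (le_trans (ler_norm _)); rewrite normrM ler_wpM2r// ger0_norm; last lra.
    by rewrite /K; have := mulr_ge0 (ltW L0) Ca0; lra.
  have w2 : F z * (Wx z - a z) <= K * `|Wx z - a z|.
    apply: (le_trans (ler_norm _)); rewrite normrM ler_wpM2r// (le_trans hF)//.
    have : Lam * E z <= Lam * Ca by rewrite ler_wpM2l// ltW.
    by rewrite /K; have := Ca0; lra.
  have w3 : - (m * b z) <= m * (Lam * E z).
    by rewrite -mulrN ler_wpM2l ?(ltW m0')//; have := ler_norm (- b z); rewrite normrN; lra.
  (* The choice [kap = m * Lam] absorbs the term - m b, which is at most [m * Lam * E z]; [Fb]
     cancels the products of [E], [F] with [a], [b]. *)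
  have br : (E z + m) * (Wt z - kap) + F z * Wx z <= K * (`|Wt z + b z| + `|Wx z - a z|).
    have -> : (E z + m) * (Wt z - kap) + F z * Wx z = (E z + m) * (Wt z + b z) +
        F z * (Wx z - a z) + - (m * b z) - (E z + m) * kap + (F z * a z - E z * b z) by ring.
    rewrite Fb kapE; have := mulr_ge0 (mulr_ge0 (ltW m0') (ltW m0')) (ltW L0); lra.
  have d1 : 0 <= dflat (Y z) * S by rewrite mulr_ge0.
  apply: (le_trans (ler_wpM2l d1 br)); rewrite -[leRHS]mulrA; apply: ler_wpM2r.
    by apply: mulr_ge0; [exact: K0|exact: addr_ge0].
  rewrite -[leRHS]mulr1; apply: ler_pM => //.
  exact: le_trans (ler_norm _) (HC1 _).
(* Lateral boundary of the cone: it shrinks at speed [Lam] and |F| <= Lam E, so nothing enters. *)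
have T2 : P z * (al z.1 * A z.1) * ((E z + m) * (- Lam * (dflat (l1 z) * X2 z + X1 z * dflat (l2 z))) +
    F z * (- dflat (l1 z) * X2 z + X1 z * dflat (l2 z))) <= 0.
  apply: mulr_ge0_le0; first by apply: mulr_ge0 => //; exact: mulr_ge0.
  set p := dflat (l1 z) * X2 z; set q := X1 z * dflat (l2 z).
  have p0 : 0 <= p by rewrite mulr_ge0.
  have q0 : 0 <= q by rewrite mulr_ge0.
  rewrite !mulNr -/p; have := mulr_ge0 (mulr_ge0 (ltW m0') (ltW L0)) (addr_ge0 p0 q0).
  have : F z * q <= Lam * E z * q by rewrite ler_wpM2r// (le_trans (ler_norm _)).
  have : - F z * p <= Lam * E z * p by rewrite ler_wpM2r// (le_trans (ler_norm _))// normrN.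
  lra.
have -> : (E z + m) * pt z + F z * px z = dflat (Y z) * S * ((E z + m) * (Wt z - kap) + F z * Wx z) +
  P z * (al z.1 * A z.1) * ((E z + m) * (- Lam * (dflat (l1 z) * X2 z + X1 z * dflat (l2 z))) +
    F z * (- dflat (l1 z) * X2 z + X1 z * dflat (l2 z))) +
  (E z + m) * (P z * (X1 z * X2 z) * al' z.1) * A z.1 -
  (E z + m) * (P z * (X1 z * X2 z) * (al z.1 * A' z.1)).
  by rewrite /pt /px /S; ring.
rewrite cut_eq0 mulr0 mul0r; have := Q_lower z; lra.
Qed.

(** Integration of the pointwise bound against the entropy inequality: a rise of [W] above [c + eta]
    forces a definite amount of gradient error. *)
Lemma step_error_lower : c0 * (4 * r ^+ 2) <= C1 * K * potential_error t1 T L Wt Wx.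
Proof.
have m0' := m0; have L0 := Lam0; have t10' := t10; have r0' := r0.
have bE : bm2 (fun z => E z + m).
  split.
    apply: measurable_funD; last exact: measurable_cst.
    by rewrite (_ : E = fun z => `|a z|); [exact: measurableT_comp|exact/funext].
  exists (Ca + m) => z; rewrite Ea (ger0_norm (addr_ge0 (normr_ge0 _) (ltW m0'))).
  by rewrite lerD2r.
have bF : bm2 F.
  split => //; exists (Lam * Ca) => z; apply: (le_trans (FL z)).
  by rewrite Ea ler_wpM2l// ltW.
have phi_ge0 z : 0 <= phi z.
  exact: prod_ge0.
have [bpt I0] := integral_dt_eq0 smooth2_phi phi_partials t10 supp.
have [pt' [px' [spt spx Hp]]] := smooth2_partials smooth2_phi.
have epx : px = px'.
  by apply/funext => -[t x]; have [_ [_ <-]] := phi_partials t x; have [_ [_ <-]] := Hp t x.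
have bpx : bcs2 px.
  rewrite epx; apply: (bcs2_continuous (B := `|T| + L) (smooth2_continuous spx)) => z.
  rewrite -epx => nz.
  have [h1 h2 h3] : [/\ t1 <= z.1, z.1 <= `|T| + L & `|z.2| <= `|T| + L].
    by apply: contrapT => /(box_partials phi_partials supp)[_ e]; rewrite e eqxx in nz.
  by split => //; rewrite ger0_norm// (le_trans _ h1)// ltW.
have ig := ent smooth2_phi phi_ge0 t10 supp phi_partials.
have b1 : bcs2 (fun z => (E z + m) * pt z).
  by under eq_fun do rewrite mulrC; exact: bcs2M.
have b2 : bcs2 (fun z => F z * px z) by under eq_fun do rewrite mulrC; exact: bcs2M.
have b3 : bcs2 (fun z => E z * pt z).
  rewrite (_ : (fun _ => _) = fun z => (E z + m) * pt z - m * pt z); last by apply/funext => z; ring.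
  by apply: bcs2B => //; exact: bcs2Z.
have {}ig : 0 <= \int[leb2]_z ((E z + m) * pt z + F z * px z).
  rewrite (_ : \int[leb2]_z _ = \int[leb2]_z ((E z * pt z + F z * px z) + m * pt z)).
    rewrite bcs2_integralD; [|exact: bcs2D|exact: bcs2Z].
    by rewrite bcs2_integralZ// I0 mulr0 addr0.
  by apply: eq_Rintegral => z _; ring.
have bD : bcs2 D by exact: (bcs2_error t10 g00 sW HW Wg).
have bQ : bcs2 Q.
  have mi (p q : R) : measurable_fun setT (ind p q) by exact: (bcs1_ind _ _).1.
  split.
    apply: measurable_funM; first by apply: measurableT_comp => //; exact: measurable_fst.
    by apply: measurableT_comp => //; exact: measurable_snd.
  exists 1, (`|t0 + delta| + r + `|x1|) => z.
  rewrite ger0_norm ?mulr_ge0 ?ind_ge0//; split.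
    by rewrite -[leRHS]mulr1 ler_pM ?ind_ge0 ?ind_le1.
  rewrite /Q /ind; case: (boolP (_ <= z.1 <= _)) => [h1|h1]; last by rewrite mul0r.
  case: (boolP (_ <= z.2 <= _)) => [h2|h2]; last by rewrite mulr0.
  rewrite -ler_distl in h1; rewrite -ler_distl in h2.
  have := ler_normD (z.1 - (t0 + delta)) (t0 + delta); have := ler_normD (z.2 - x1) x1.
  rewrite !subrK; have := normr_ge0 x1; have := normr_ge0 (t0 + delta).
  by move=> ? ? ? ? []; lra.
have IQ : \int[leb2]_z Q z = 4 * r ^+ 2.
  rewrite bcs2_fubini1//.
  transitivity (\int[mu]_t (2 * r * ind (t0 + delta - r) (t0 + delta + r) t)).
    apply: eq_Rintegral => t _; rewrite /Q/= (bcs1_integralZ _ (bcs1_ind _ _)) integral_ind1.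
      by ring.
    by lra.
  by rewrite (bcs1_integralZ _ (bcs1_ind _ _)) integral_ind1; [ring|lra].
have := bcs2_integral_le (bcs2D b1 b2) (bcs2B (bcs2Z (C1 * K) bD) (bcs2Z c0 bQ)) pointwise.
rewrite bcs2_integralB; [|exact: bcs2Z..]; rewrite !bcs2_integralZ// IQ.
by move: ig; rewrite /potential_error; lra.
Qed.

End test.

(* A maximum principle for the potential: since [E * b = F * a], the entropy
   inequality is preserved, up to the error of the gradient, by multiplying
   the test function by an increasing function of the potential. *)
Lemma potential_step (delta g0 t1 tau T L eta : R) : 0 < delta -> 0 < t1 -> t1 < tau ->
  0 <= g0 -> 0 < eta ->
  exists2 e : R, 0 < e & forall W Wt Wx, smooth2 W -> has_partials W Wt Wx ->
  (forall t x, t1 <= t <= T -> `|x| <= L -> `|Wt (t, x)| <= g0 /\ `|Wx (t, x)| <= g0) ->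
  potential_error t1 T L Wt Wx <= e ->
  forall t0 x1 c, tau <= t0 -> t0 + 2 * delta <= T -> `|x1| + 5 * Lam * delta <= L ->
    (forall x, `|x - x1| <= 5 * Lam * delta -> W (t0, x) <= c) ->
    W (t0 + delta, x1) <= c + eta.
Proof.
move=> d0 t10 tt g00 eta0; have L0 := Lam0.
have Ca0 : 0 <= Ca := le_trans (normr_ge0 _) (aC 0).
have Ld : 0 < Lam * delta by exact: mulr_gt0.
have g1 : 0 < 16 * (g0 + 1) by lra.
have eg : 0 < eta / (16 * (g0 + 1)) by exact: divr_gt0.
(* These sizes make [g0 * s] and [g0 * r] at most [eta / 16]; the other bounds keep the switch after
   [t1] and the square inside the cone. *)
pose s := Num.min (delta / 2) (Num.min (tau - t1) (eta / (16 * (g0 + 1)))).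
pose r := Num.min (delta / 2) (Num.min (Lam * delta) (eta / (16 * (g0 + 1)))).
have s0 : 0 < s by rewrite !lt_min eg andbT; apply/andP; split; lra.
have r0 : 0 < r by rewrite !lt_min eg Ld !andbT; lra.
have [s1 s2 s3] : [/\ s <= delta / 2, s <= tau - t1 & s <= eta / (16 * (g0 + 1))].
  by have : s <= s by []; rewrite {2}/s !le_min => /and3P[].
have [r1 r2 r3] : [/\ r <= delta / 2, r <= Lam * delta & r <= eta / (16 * (g0 + 1))].
  by have : r <= r by []; rewrite {2}/r !le_min => /and3P[].
(* Then [m * Lam * delta = eta / 16], so the drift [kap] costs only a fraction of [eta]. *)
pose m := eta / (16 * (Lam * delta)).
have m0 : 0 < m by rewrite divr_gt0// mulr_gt0.
pose c0 := m * flat (eta / 2) * (flat (Lam * delta) * flat (Lam * delta)) *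
  ((2 * delta)^-1 ^+ 2 * flat (delta / 2)) : R.
have c00 : 0 < c0.
  have d2 : 0 < (2 * delta)^-1 by rewrite invr_gt0; lra.
  rewrite /c0; apply: mulr_gt0; last by apply: mulr_gt0; [exact: exprn_gt0|apply: flat_gt0; lra].
  by do ![apply: mulr_gt0 => //]; apply: flat_gt0 => //; lra.
set C1 := sval (cid2 dflat_bound).
have C10 : 0 < C1 by rewrite /C1; case: cid2.
pose K := Ca + m + Lam * Ca.
have K0 : 0 < K by rewrite /K; have := mulr_ge0 (ltW L0) Ca0; lra.
have CK : 0 < C1 * K by exact: mulr_gt0.
(* A quarter of the error that [step_error_lower] forces, hence a contradiction. *)
exists (c0 * r ^+ 2 / (C1 * K)); first by rewrite divr_gt0// mulr_gt0// exprn_gt0.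
move=> W Wt Wx sW HW Wg err t0 x1 c tt0 t0T x1L Wc.
rewrite leNgt; apply/negP => Wgt.
have := @step_error_lower delta g0 t1 T L eta (m * Lam) m s r t0 x1 c W Wt Wx d0 t10 g00 m0 s0 r0.
move=> /(_ erefl).
have st : t1 <= t0 - s by lra.
move=> /(_ st s1 r1 r2 t0T x1L sW HW Wg Wc).
have gs : g0 * s <= eta / 16.
  have h : (g0 + 1) * s <= (g0 + 1) * (eta / (16 * (g0 + 1))) by rewrite ler_wpM2l//; lra.
  have e1 : (g0 + 1) * (eta / (16 * (g0 + 1))) = eta / 16 by field; rewrite gt_eqF//; lra.
  lra.
have gr : g0 * r <= eta / 16.
  have h : (g0 + 1) * r <= (g0 + 1) * (eta / (16 * (g0 + 1))) by rewrite ler_wpM2l//; lra.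
  have e1 : (g0 + 1) * (eta / (16 * (g0 + 1))) = eta / 16 by field; rewrite gt_eqF//; lra.
  lra.
have kE : m * Lam * delta = eta / 16.
  by rewrite /m; field; rewrite !gt_eqF.
have ks : m * Lam * s <= m * Lam * (delta / 2) by rewrite ler_wpM2l// mulr_ge0 ?ltW.
have ce : g0 * s + m * Lam * s + m * Lam * (2 * delta) + g0 * (r + r) <= eta / 2 by lra.
move=> /(_ ce Wgt) lower.
move: err; rewrite ler_pdivlMr//.
have : 0 < c0 * r ^+ 2 by rewrite mulr_gt0// exprn_gt0.
rewrite mulrC; move: lower; rewrite -/C1 -/K -/c0; lra.
Qed.
End step.
End potential_step.

(** * Almost monotone potentials *)

Section potential_monotone.
Context {R : realType}.
Local Notation mu := (@lebesgue_measure R).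
Variables (a b E F : R * R -> R) (Lam Ca : R).
Hypotheses (Lam0 : 0 < Lam) (ma : measurable_fun setT a) (mb : measurable_fun setT b).
Hypotheses (aC : forall z, `|a z| <= Ca) (bL : forall z, `|b z| <= Lam * `|a z|).
Hypothesis (Ea : forall z, E z = `|a z|).
Hypotheses (Fb : forall z, F z * a z = E z * b z) (mF : measurable_fun setT F).
Hypothesis FL : forall z, `|F z| <= Lam * E z.
Hypothesis ent : forall (phi pt px : R * R -> R) (tau B : R),
  smooth2 phi -> (forall z, 0 <= phi z) -> 0 < tau ->
  (forall z, phi z != 0 -> [/\ tau <= z.1, z.1 <= B & `|z.2| <= B]) ->
  has_partials phi pt px -> 0 <= \int[leb2]_z (E z * pt z + F z * px z).

(** Backward descent. A value [W (t, y1)] is almost attained from below at time t - delta by some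
    [z1] near [y1], and [W (t, y2)] from above by some [z2] near [y2]. Either [z1 < z2] and the
    descent continues, or the points have crossed; they are then within 10 Lam delta of each other,
    and the Lipschitz bound ends the argument. The spatial margin in [L] pays for all the
    displacements. *)
Lemma potential_monotone (X g0 t1 tau T0 Delta : R) : 0 <= X -> 0 < t1 -> t1 < tau -> tau <= T0 ->
  0 <= g0 -> 0 < Delta ->
  let L := X + 5 * Lam * (T0 + 1) in
  exists2 e : R, 0 < e & forall W Wt Wx, smooth2 W -> has_partials W Wt Wx ->
  (forall t x, t1 <= t <= T0 + 1 -> `|x| <= L -> `|Wt (t, x)| <= g0 /\ `|Wx (t, x)| <= g0) ->
  potential_error a b t1 (T0 + 1) L Wt Wx <= e ->
  (forall y1 y2, y1 < y2 -> `|y1| <= L -> `|y2| <= L -> W (tau, y1) - W (tau, y2) <= Delta) ->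
  forall t y1 y2, tau <= t <= T0 -> y1 < y2 -> `|y1| <= X -> `|y2| <= X ->
    W (t, y1) - W (t, y2) <= 3 * Delta.
Proof.
move=> X0 t10 tt tT g00 De0 L; have L0 := Lam0.
(* Small enough for the Lipschitz errors over a time [delta] at two points, and over a distance
   [10 * Lam * delta], to be at most [Delta]. *)
pose delta := Num.min 1 (Num.min (Delta / (2 * (g0 + 1))) (Delta / (10 * Lam * (g0 + 1)))).
have g1 : 0 < g0 + 1 by lra.
have g2 : 0 < 2 * (g0 + 1) by lra.
have g3 : 0 < 10 * Lam * (g0 + 1) by rewrite !mulr_gt0.
have d0 : 0 < delta by rewrite !lt_min ltr01 !divr_gt0.
have [d1 d2 d3] : [/\ delta <= 1, delta <= Delta / (2 * (g0 + 1)) &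
    delta <= Delta / (10 * Lam * (g0 + 1))].
  by have : delta <= delta by []; rewrite {2}/delta !le_min => /and3P[].
have gd : 2 * g0 * delta <= Delta.
  by move: d2; rewrite ler_pdivlMr//; lra.
have Lgd : g0 * (10 * Lam * delta) <= Delta.
  move: d3; rewrite ler_pdivlMr//; have := mulr_gt0 L0 d0; lra.
pose N := Num.truncn ((T0 - tau) / delta).
have N1 : T0 < tau + N.+1%:R * delta.
  by have := truncnS_gt ((T0 - tau) / delta); rewrite ltr_pdivrMr// -/N; lra.
have N2 : N%:R * delta <= T0.
  have : 0 <= (T0 - tau) / delta by rewrite divr_ge0 ?(ltW d0)//; lra.
  by rewrite -truncn_le -/N ler_pdivlMr//; lra.
(* Each step loses [4 * eta] and there are at most [N] of them, so the total loss is at most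
   [Delta]; the base case costs [2 * Delta]. *)
pose eta := Delta / (4 * N.+1%:R).
have eta0 : 0 < eta by rewrite divr_gt0// mulr_gt0.
have aC' z : `|- a z| <= Ca by rewrite normrN.
have bL' z : `|- b z| <= Lam * `|- a z| by rewrite !normrN.
have Ea' z : E z = `|- a z| by rewrite normrN.
have Fb' z : F z * - a z = E z * - b z by rewrite !mulrN Fb.
have ma' : measurable_fun setT (fun z => - a z) by exact: measurableT_comp.
have mb' : measurable_fun setT (fun z => - b z) by exact: measurableT_comp.
have [e1 e10 H1] := potential_step Lam0 ma mb aC bL Ea Fb mF FL ent (T0 + 1) L d0 t10 tt g00 eta0.
(* With [a], [b] negated and [E], [F] unchanged the hypotheses persist: this is the minimum
   principle, applied below to - W. *)
have [e2 e20 H2] := potential_step Lam0 ma' mb' aC' bL' Ea' Fb' mF FL ent (T0 + 1) L d0 t10 tt g00 eta0.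
exists (Num.min e1 e2); first by rewrite lt_min e10 e20.
move=> W Wt Wx sW HW Wg; rewrite le_min => /andP[err1 err2] init.
have lip := box_lipschitz HW Wg.
have {}H1 := H1 W Wt Wx sW HW Wg err1.
have {}H2 : forall t0 x1 c, tau <= t0 -> t0 + 2 * delta <= T0 + 1 ->
    `|x1| + 5 * Lam * delta <= L ->
    (forall x, `|x - x1| <= 5 * Lam * delta -> c <= W (t0, x)) -> c - eta <= W (t0 + delta, x1).
  move=> t0 x1 c h1 h2 h3 h4; suff : - W (t0 + delta, x1) <= - c + eta by lra.
  have sW' : smooth2 (fun z => - W z).
    rewrite (_ : (fun _ => _) = fun z => (-1) * W z); first exact: smooth2Z.
    by apply/funext => z; rewrite mulN1r.
  have HW' : has_partials (fun z => - W z) (fun z => - Wt z) (fun z => - Wx z).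
    by move=> t x; have [q1 q2] := HW t x; split; exact: is_deriveN.
  have Wg' t x : t1 <= t <= T0 + 1 -> `|x| <= L -> `|- Wt (t, x)| <= g0 /\ `|- Wx (t, x)| <= g0.
    by rewrite !normrN; exact: Wg.
  apply: (H2 _ _ _ sW' HW' Wg') => //; last by move=> x /h4; rewrite lerN2.
  apply: le_trans err2; rewrite /potential_error le_eqVlt; apply/orP; left; apply/eqP.
  by apply: eq_Rintegral => z _; rewrite -!opprD !normrN.
have NL (j : nat) : (j <= N)%N -> X + (N - j)%:R * (5 * Lam * delta) + 5 * Lam * delta <= L.
  move=> jN; have : (N - j)%:R * delta <= N%:R * delta :> R.
    by rewrite ler_pM2r// ler_nat leq_subr.
  move=> h; have : 5 * Lam * ((N - j)%:R * delta + delta) <= 5 * Lam * (T0 + 1).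
    by rewrite ler_wpM2l//; lra.
  by rewrite /L; lra.
have etaE : N.+1%:R * (4 * eta) = Delta.
  have : (N.+1%:R : R) != 0 by rewrite pnatr_eq0.
  by rewrite /eta; move: (N.+1%:R : R) => k k0; field.
clear err1 err2 e10 e20 g1 g2 g3 aC' bL' Ea' Fb' ma' mb'.
clearbody L eta; clear d2 d3 N2; clearbody N; clearbody delta.
have base t y1 y2 : tau <= t -> t < tau + delta -> t <= T0 -> y1 < y2 -> `|y1| <= L -> `|y2| <= L ->
    W (t, y1) - W (t, y2) <= 2 * Delta.
  move=> h1 h2 h3 h4 h5 h6.
  have ht : t1 <= t <= T0 + 1 by apply/andP; split; lra.
  have htau : t1 <= tau <= T0 + 1 by apply/andP; split; lra.
  have q1 := lip _ _ _ _ ht htau h5 h5; have q2 := lip _ _ _ _ ht htau h6 h6.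
  rewrite !subrr !normr0 !addr0 in q1 q2.
  have q3 : g0 * `|t - tau| <= g0 * delta by rewrite ler_wpM2l// ger0_norm; lra.
  have := ler_norm (W (t, y1) - W (tau, y1)); have := ler_norm (- (W (t, y2) - W (tau, y2))).
  by rewrite normrN; have := init _ _ h4 h5 h6; lra.
have main (j : nat) : (j <= N)%N -> forall t y1 y2, tau <= t -> t < tau + j.+1%:R * delta -> t <= T0 ->
    y1 < y2 -> `|y1| <= X + (N - j)%:R * (5 * Lam * delta) ->
    `|y2| <= X + (N - j)%:R * (5 * Lam * delta) ->
    W (t, y1) - W (t, y2) <= 2 * Delta + j%:R * (4 * eta).
  have Ld := mulr_gt0 L0 d0.
  elim: j => [|j IH] jN t y1 y2 h1 h2 h3 h4 h5 h6.
    rewrite mul0r addr0; have := NL 0%N jN => q.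
    by apply: base => //; lra.
  have q := NL j.+1 jN.
  have [tlt|tge] := ltP t (tau + delta).
    have := base t y1 y2 h1 tlt h3 h4; have := mulr_ge0 (ler0n R j.+1) (ltW eta0).
    move=> p1 p2; have : W (t, y1) - W (t, y2) <= 2 * Delta by apply: p2; lra.
    by lra.
  have Sj : (N - j)%:R = (N - j.+1)%:R + 1 :> R.
    by rewrite -subnSK// -natr1.
  have t0E : t - delta + delta = t by rewrite subrK.
  have s1 : tau <= t - delta by lra.
  have s2 : t - delta + 2 * delta <= T0 + 1 by lra.
  have [z1 zy1 zW1] : exists2 z1, `|z1 - y1| <= 5 * Lam * delta &
      W (t, y1) - 2 * eta < W (t - delta, z1).
    apply: contrapT => none; have := H1 (t - delta) y1 (W (t, y1) - 2 * eta) s1 s2.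
    rewrite t0E => /(_ _ _)H; have : W (t, y1) <= W (t, y1) - 2 * eta + eta.
      apply: H; first lra.
      by move=> x hx; rewrite leNgt; apply/negP => ?; apply: none; exists x.
    by move: eta0; lra.
  have [z2 zy2 zW2] : exists2 z2, `|z2 - y2| <= 5 * Lam * delta &
      W (t - delta, z2) < W (t, y2) + 2 * eta.
    apply: contrapT => none; have := H2 (t - delta) y2 (W (t, y2) + 2 * eta) s1 s2.
    rewrite t0E => /(_ _ _)H; have : W (t, y2) + 2 * eta - eta <= W (t, y2).
      apply: H; first lra.
      by move=> x hx; rewrite leNgt; apply/negP => ?; apply: none; exists x.
    by move: eta0; lra.
  have n1 := ler_normD (z1 - y1) y1; have n2 := ler_normD (z2 - y2) y2; rewrite !subrK in n1 n2.
  have Nj (i : nat) : i.+1%:R = i%:R + 1 :> R by rewrite natr1.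
  rewrite Nj.
  have [zz|zz] := ltP z1 z2.
    have t2 : t - delta < tau + j.+1%:R * delta by move: h2; rewrite (Nj j.+1); lra.
    have := IH (ltnW jN) (t - delta) z1 z2 s1 t2 _ zz; rewrite Sj.
    move=> H; have : W (t - delta, z1) - W (t - delta, z2) <= 2 * Delta + j%:R * (4 * eta).
      by apply: H; lra.
    by lra.
  have ht : t1 <= t - delta <= T0 + 1 by apply/andP; split; lra.
  have := lip _ z1 _ z2 ht ht; rewrite subrr normr0 add0r => H.
  have {}H : `|W (t - delta, z1) - W (t - delta, z2)| <= g0 * `|z1 - z2| by apply: H; lra.
  have zd : `|z1 - z2| <= 10 * Lam * delta.
    move: zy1 zy2; rewrite !ler_distl => /andP[p1 p2] /andP[p3 p4].
    by clear IH base H1 H2 init; apply/andP; split; lra.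
  have : g0 * `|z1 - z2| <= g0 * (10 * Lam * delta) by rewrite ler_wpM2l.
  have := ler_norm (W (t - delta, z1) - W (t - delta, z2)).
  have := mulr_ge0 (ler0n R j) (ltW eta0); lra.
move=> t y1 y2 /andP[h1 h2] h3 h4 h5.
have := main N (leqnn _) t y1 y2 h1 _ h2 h3; rewrite subnn mul0r addr0 => /(_ _ h4 h5) H.
have {}H : W (t, y1) - W (t, y2) <= 2 * Delta + N%:R * (4 * eta) by apply: H; lra.
have : N%:R * (4 * eta) <= Delta.
  by rewrite -etaE ler_wpM2r// ?ler_nat//; move: eta0; lra.
by lra.
Qed.

End potential_monotone.

(** * Convolution with smooth kernels *)

Section mollification.
Context {R : realType}.
Local Notation mu := (@lebesgue_measure R).

(** The integral is by definition a difference of integrals of positive and negative parts, and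
    Tonelli applies to each. *)
Lemma measurable_parametric d (T : measurableType d) (G : T * R -> R) : measurable_fun setT G ->
  measurable_fun setT (fun z => \int[mu]_w G (z, w)).
Proof.
move=> mG; apply: measurableT_comp; first exact: (@fine_measurable R setT).
have mGE : measurable_fun setT (fun z => (G z)%:E) by exact/measurable_EFinP.
rewrite (_ : (fun z => _) = fun z => ((\int[mu]_w ((fun w => (G (z, w))%:E) ^\+ w)) -
  (\int[mu]_w ((fun w => (G (z, w))%:E) ^\- w)))%E); last by apply/funext => z; rewrite integralE.
apply: emeasurable_funB.
  have := @measurable_fun_fubini_tonelli_F _ _ T _ R mu (((EFin \o G : T * R -> \bar R) ^\+)%E).
  move=> H; rewrite (_ : (fun x => _) = fubini_F mu (EFin \o G : T * R -> \bar R)^\+%E).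
    by apply: H; [exact: measurable_funepos|exact: funepos_ge0].
  by apply/funext => x; apply: eq_integral => w _; rewrite !funeposE.
have := @measurable_fun_fubini_tonelli_F _ _ T _ R mu (((EFin \o G : T * R -> \bar R) ^\-)%E).
move=> H; rewrite (_ : (fun x => _) = fubini_F mu (EFin \o G : T * R -> \bar R)^\-%E).
    by apply: H; [exact: measurable_funeneg|exact: funeneg_ge0].
  by apply/funext => x; apply: eq_integral => w _; rewrite !funenegE.
Qed.

Lemma is_derive_quadratic (F : R -> R) (x d C : R) :
  (forall h, `|F (x + h) - F x - h * d| <= C * h ^+ 2) -> is_derive x 1 F d.
Proof.
move=> H; have C0 : 0 <= C.
  by have := H 1; rewrite expr1n mulr1; apply: le_trans.
have cv : h^-1 *: (F (h *: 1 + x) - F x) @[h --> 0^'] --> d.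
  apply/cvgrPdist_le => e e0; near=> h.
  have hn0 : h != 0 by near: h; exact: nbhs_dnbhs_neq.
  have h' : `|h| < e / (C + 1).
    near: h; apply: dnbhs0_lt; rewrite divr_gt0// ltr_wpDl//.
  have -> : (h%:A : R) + x = x + h by rewrite [h%:A]mulr1 addrC.
  rewrite distrC.
  have -> : h^-1 *: (F (x + h) - F x) - d = h^-1 * (F (x + h) - F x - h * d).
    by rewrite mulrBr mulKf.
  rewrite normrM normfV ler_pdivrMl ?normr_gt0//.
  apply: (le_trans (H h)); rewrite -real_normK ?num_real// expr2 mulrCA ler_wpM2l//.
  move: h'; rewrite ltr_pdivlMr ?ltr_wpDl// => h'.
  apply: le_trans (ltW h'); rewrite mulrC ler_wpM2l// lerDl//.
apply: DeriveDef; first by apply/cvg_ex; exists d.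
exact/cvg_lim.
Unshelve. all: by end_near. Qed.

Lemma smooth1_lipschitz (g : R -> R) : smooth1 g ->
  exists2 C : R, 0 <= C & forall x y, `|g x - g y| <= C * `|x - y|.
Proof.
move=> /smooth1_derive[g' sg' Hg]; have [C C0 HC] := smooth1_bounded sg'.
exists C; first exact: ltW.
move=> x y; have [c [_ e]] := mvt_linear y (x - y) Hg.
have -> : g x = g (y + (x - y)) by rewrite addrC subrK.
by rewrite e normrM ler_wpM2r.
Qed.

Lemma smooth1_taylor (g g' : R -> R) : smooth1 g -> (forall x : R, is_derive x 1 g (g' x)) ->
  exists2 C : R, 0 <= C & forall x h, `|g (x + h) - g x - h * g' x| <= C * h ^+ 2.
Proof.
move=> sg Hg; have [g'' sg' Hg'] := smooth1_derive sg.
have e : g'' = g' by apply/funext => x; have [_ <-] := Hg x; have [_ <-] := Hg' x.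
rewrite {}e {g'' Hg'} in sg'; have [C C0 HC] := smooth1_lipschitz sg'.
exists C => // x h; have [c [hc e]] := mvt_linear x h Hg; rewrite e [h * _]mulrC -mulrBl normrM.
rewrite -(real_normK (num_real h)) expr2 mulrA ler_wpM2r//.
by apply: (le_trans (HC _ _)); rewrite ler_wpM2l.
Qed.

Lemma bcs2_integral_bound (a k : R * R -> R) (C : R) : bcs2 a -> measurable_fun setT k ->
  (forall w, `|k w| <= C) -> `|\int[leb2]_w (a w * k w)| <= C * \int[leb2]_w `|a w|.
Proof.
move=> ba mk kC; have bk : bm2 k by split => //; exists C.
have b1 := bcs2M ba bk.
apply: (le_trans (bcs2_integral_norm b1)).
rewrite -bcs2_integralZ; last exact: bcs2_norm.
apply: bcs2_integral_le; [exact: bcs2_norm|apply: bcs2Z; exact: bcs2_norm|].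
by move=> w; rewrite normrM mulrC ler_wpM2r.
Qed.

(** The kernel is a product and may be a step or a constant in either variable, as the potential
    requires; compactness of the support comes from [a]. *)
Definition conv2 (a : R * R -> R) (al be : R -> R) (z : R * R) : R :=
  \int[leb2]_w (a w * (al (z.1 - w.1) * be (z.2 - w.2))).

Section conv_smooth.
Variable a : R * R -> R.
Hypothesis ba : bcs2 a.

Let mfst (al : R -> R) (t : R) : smooth1 al ->
  measurable_fun setT (fun w : R * R => al (t - w.1)).
Proof.
move=> /smooth1_continuous/continuous_measurable_fun mal; apply: measurableT_comp => //.
by apply: measurable_funB; [exact: measurable_cst|exact: measurable_fst].
Qed.

Let msnd (al : R -> R) (t : R) : smooth1 al ->
  measurable_fun setT (fun w : R * R => al (t - w.2)).
Proof.
move=> /smooth1_continuous/continuous_measurable_fun mal; apply: measurableT_comp => //.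
by apply: measurable_funB; [exact: measurable_cst|exact: measurable_snd].
Qed.

Lemma bm2_kernel (al be : R -> R) (z : R * R) : smooth1 al -> smooth1 be ->
  bm2 (fun w => al (z.1 - w.1) * be (z.2 - w.2)).
Proof.
move=> sal sbe; split; first by apply: measurable_funM; [exact: mfst|exact: msnd].
have [C1 C10 H1] := smooth1_bounded sal; have [C2 C20 H2] := smooth1_bounded sbe.
by exists (C1 * C2) => w; rewrite normrM ler_pM.
Qed.

Let convB (al be al1 be1 : R -> R) z z1 : smooth1 al -> smooth1 be -> smooth1 al1 -> smooth1 be1 ->
  conv2 a al be z - conv2 a al1 be1 z1 = \int[leb2]_w (a w *
    (al (z.1 - w.1) * be (z.2 - w.2) - al1 (z1.1 - w.1) * be1 (z1.2 - w.2))).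
Proof.
move=> s1 s2 s3 s4; rewrite /conv2 -bcs2_integralB; [|by apply: bcs2M => //; exact: bm2_kernel..].
by apply: eq_Rintegral => w _; rewrite mulrBr.
Qed.

Let conv_continuous (al be : R -> R) : smooth1 al -> smooth1 be -> continuous (conv2 a al be).
Proof.
move=> sal sbe [t x]; apply/continuous2P => e e0.
have [C1 C10 H1] := smooth1_bounded sal; have [C2 C20 H2] := smooth1_bounded sbe.
have [L1 L10 G1] := smooth1_lipschitz sal; have [L2 L20 G2] := smooth1_lipschitz sbe.
set A := \int[leb2]_w `|a w|.
have A0 : 0 <= A by apply: Rintegral_ge0 => w _; exact: normr_ge0.
set K := (L1 * C2 + C1 * L2) * A + 1.
have K0 : 0 < K by rewrite /K ltr_wpDl// mulr_ge0// addr_ge0 ?mulr_ge0// ltW.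
exists (e / K); first exact: divr_gt0.
move=> t' x' ht hx; rewrite convB//=.
apply: (le_trans (bcs2_integral_bound (C := (L1 * C2 + C1 * L2) * (e / K)) ba _ _)).
- have [m1 _] := bm2_kernel (t, x) sal sbe; have [m2 _] := bm2_kernel (t', x') sal sbe.
  exact: measurable_funB.
- move=> w.
  have -> : al (t - w.1) * be (x - w.2) - al (t' - w.1) * be (x' - w.2) =
    (al (t - w.1) - al (t' - w.1)) * be (x - w.2) + al (t' - w.1) * (be (x - w.2) - be (x' - w.2)).
    by ring.
  apply: (le_trans (ler_normD _ _)); rewrite !normrM mulrDl lerD//.
    rewrite -mulrA [C2 * _]mulrC mulrA ler_pM//.
    apply: (le_trans (G1 _ _)); rewrite ler_wpM2l//.
    have -> : t - w.1 - (t' - w.1) = t - t' by ring.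
    by rewrite distrC ltW.
  rewrite -mulrA ler_pM//; apply: (le_trans (G2 _ _)); rewrite ler_wpM2l//.
  have -> : x - w.2 - (x' - w.2) = x - x' by ring.
  by rewrite distrC ltW.
rewrite -/A; have -> : (L1 * C2 + C1 * L2) * (e / K) * A = e * (((L1 * C2 + C1 * L2) * A) / K).
  by ring.
by rewrite ler_piMr ?(ltW e0)// ler_pdivrMr// mul1r /K lerDl.
Qed.

(** Second-order Taylor bounds for the kernels, uniform in the point, pass through the integral and
    give a remainder quadratic in the increment. *)
Lemma conv_partials (al be al' be' : R -> R) : smooth1 al -> smooth1 be ->
  (forall x : R, is_derive x 1 al (al' x)) -> (forall x : R, is_derive x 1 be (be' x)) ->
  has_partials (conv2 a al be) (conv2 a al' be) (conv2 a al be').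
Proof.
move=> sal sbe Hal Hbe t x.
have sder (g g' : R -> R) : smooth1 g -> (forall x : R, is_derive x 1 g (g' x)) -> smooth1 g'.
  move=> /smooth1_derive[g'' sg H] H'; rewrite (_ : g' = g'')//.
  by apply/funext => y; have [_ <-] := H y; have [_ <-] := H' y.
have sal' := sder _ _ sal Hal; have sbe' := sder _ _ sbe Hbe.
have [C1 C10 H1] := smooth1_bounded sal; have [C2 C20 H2] := smooth1_bounded sbe.
have [K1 K10 T1] := smooth1_taylor sal Hal; have [K2 K20 T2] := smooth1_taylor sbe Hbe.
set A := \int[leb2]_w `|a w|.
split.
  apply: (is_derive_quadratic (C := K1 * C2 * A)) => h; rewrite convB//.
  rewrite /conv2 -bcs2_integralZ; last by apply: bcs2M => //; exact: bm2_kernel.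
  rewrite -bcs2_integralB; last 2 first.
  - apply: bcs2M => //; split; last first.
      exists (C1 * C2 + C1 * C2) => w; apply: (le_trans (ler_normB _ _)).
      by rewrite !normrM lerD// ler_pM.
    by apply: measurable_funB; exact: (bm2_kernel _ sal sbe).1.
  - by apply: bcs2Z; apply: bcs2M => //; exact: bm2_kernel.
  rewrite (_ : \int[leb2]_w _ = \int[leb2]_w (a w * ((al (t + h - w.1) - al (t - w.1) -
      h * al' (t - w.1)) * be (x - w.2)))); last by apply: eq_Rintegral => w _ /=; ring.
  apply: (le_trans (bcs2_integral_bound (C := K1 * C2 * h ^+ 2) ba _ _)); last first.
  - by rewrite -/A mulrAC.
  - move=> w; rewrite normrM mulrAC ler_pM//.
    by have := T1 (t - w.1) h; have -> : t - w.1 + h = t + h - w.1 by ring.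
  apply: measurable_funM; last exact: msnd.
  apply: measurable_funB; first by apply: measurable_funB; exact: mfst.
  by apply: measurable_funM; [exact: measurable_cst|exact: mfst].
apply: (is_derive_quadratic (C := C1 * K2 * A)) => h; rewrite convB//.
rewrite /conv2 -bcs2_integralZ; last by apply: bcs2M => //; exact: bm2_kernel.
rewrite -bcs2_integralB; last 2 first.
- apply: bcs2M => //; split; last first.
    exists (C1 * C2 + C1 * C2) => w; apply: (le_trans (ler_normB _ _)).
    by rewrite !normrM lerD// ler_pM.
  by apply: measurable_funB; exact: (bm2_kernel _ sal sbe).1.
- by apply: bcs2Z; apply: bcs2M => //; exact: bm2_kernel.
rewrite (_ : \int[leb2]_w _ = \int[leb2]_w (a w * (al (t - w.1) * (be (x + h - w.2) - be (x - w.2) -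
    h * be' (x - w.2))))); last by apply: eq_Rintegral => w _ /=; ring.
apply: (le_trans (bcs2_integral_bound (C := C1 * K2 * h ^+ 2) ba _ _)); last first.
- by rewrite -/A mulrAC.
- move=> w; rewrite normrM -mulrA ler_pM//.
  by have := T2 (x - w.2) h; have -> : x - w.2 + h = x + h - w.2 by ring.
apply: measurable_funM; first exact: mfst.
apply: measurable_funB; first by apply: measurable_funB; exact: msnd.
by apply: measurable_funM; [exact: measurable_cst|exact: msnd].
Qed.

Lemma smooth2_conv (al be : R -> R) : smooth1 al -> smooth1 be -> smooth2 (conv2 a al be).
Proof.
move=> sal sbe.
exists [set g | exists al be, [/\ smooth1 al, smooth1 be & g = conv2 a al be]]; last first.
  by exists al, be.
move=> _ [al1 [be1 [s1 s2 ->]]]; split; first exact: conv_continuous.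
have [al' sal' Hal] := smooth1_derive s1; have [be' sbe' Hbe] := smooth1_derive s2.
exists (conv2 a al' be1), (conv2 a al1 be'); split; [by exists al', be1|by exists al1, be'|].
exact: conv_partials.
Qed.

End conv_smooth.
End mollification.

(** * Mollifiers and their convergence *)

Section kernels.
Context {R : realType}.
Local Notation mu := (@lebesgue_measure R).

(** A Heaviside function smoothed at scale [r]; its derivative is the mollifier [kern r]. *)
Definition sstep (r y : R) : R := step (y / r).
Definition kern (r y : R) : R := bumpf (y / r) / r.

Lemma smooth1_sstep (r : R) : smooth1 (sstep r).
Proof.
have := smooth1_dilated 0 r (@smooth1_step R).
by congr smooth1; apply/funext => y; rewrite subr0.
Qed.

Lemma smooth1_kern (r : R) : smooth1 (kern r).
Proof.
rewrite (_ : kern r = fun y => r^-1 * bumpf ((y - 0) / r)).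
  by apply: smooth1Z; exact/smooth1_dilated/smooth1_bump.
by apply/funext => y; rewrite subr0 mulrC.
Qed.

Lemma sstep_derive (r y : R) : is_derive y 1 (sstep r) (kern r y).
Proof.
have h : is_derive y 1 (fun y : R => y / r) (r^-1).
  have := is_deriveM (is_derive_id y (1 : R)) (is_derive_cst r^-1 y 1).
  by rewrite /GRing.scale/= mulr0 add0r mulr1.
exact: (@is_derive1_comp R step _ y _ _ (step_derive _) h).
Qed.

Lemma bumpN (y : R) : bumpf (- y) = bumpf y.
Proof.
rewrite /bumpf opprK; congr (_ / _ ^+ 2); last exact: addrC.
by rewrite addrC [X in X + _]mulrC [X in _ + X]mulrC.
Qed.

Lemma kern_ge0 (r y : R) : 0 < r -> 0 <= kern r y.
Proof. by move=> r0; rewrite divr_ge0 ?bump_ge0// ltW. Qed.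

Lemma kern_eq0 (r y : R) : 0 < r -> r <= `|y| -> kern r y = 0.
Proof.
move=> r0 ry; rewrite /kern bump_eq0 ?mul0r// normrM normfV (gtr0_norm r0).
by rewrite ler_pdivlMr// mul1r.
Qed.

Lemma kernE (r t w : R) : kern r (t - w) = r^-1 * dil r t w.
Proof. by rewrite /kern /dil -opprB mulNr bumpN mulrC. Qed.

Lemma bcs1_kern (r t : R) : 0 < r -> bcs1 (fun w => kern r (t - w)).
Proof.
move=> r0; under eq_fun do rewrite kernE.
exact/bcs1Z/bcs1_dil.
Qed.

Lemma integral_kern (r t : R) : 0 < r -> \int[mu]_w kern r (t - w) = 1.
Proof.
move=> r0; under eq_Rintegral do rewrite kernE.
rewrite bcs1_integralZ; last exact: bcs1_dil.
by rewrite integral_dil// mulVf// gt_eqF.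
Qed.

Lemma kern_bound : exists2 C : R, 0 < C & forall r y : R, 0 < r -> `|kern r y| <= C / r.
Proof.
have [C C0 HC] := smooth1_bounded (@smooth1_bump R); exists C => // r y r0.
by rewrite /kern normrM normfV (gtr0_norm r0) ler_wpM2r// invr_ge0 ltW.
Qed.

Lemma mollify_bound (g : R -> R) (C r t : R) : measurable_fun setT g -> (forall x, `|g x| <= C) ->
  0 < r -> `|\int[mu]_w (g w * kern r (t - w))| <= C.
Proof.
move=> mg gC r0; have bg : bm1 g by split => //; exists C.
have bk := bcs1_kern t r0.
have bgk : bcs1 (fun w => g w * kern r (t - w)).
  by under eq_fun do rewrite mulrC; exact: bcs1M.
apply: (le_trans (bcs1_integral_norm bgk)).
rewrite -[leRHS]mulr1 -(integral_kern t r0) -bcs1_integralZ//.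
apply: bcs1_integral_le; [exact: bcs1_norm|exact: bcs1Z|move=> w].
by rewrite normrM [`|kern _ _|]ger0_norm ?kern_ge0// ler_wpM2r// kern_ge0.
Qed.

Lemma mollify_ae (g : R -> R) : bm1 g ->
  {ae mu, forall t, \int[mu]_w (g w * kern n.+1%:R^-1 (t - w)) @[n --> \oo] --> g t}.
Proof.
move=> bg; have [C C0 HC] := kern_bound.
apply: (aeS (lebesgue_points bg)) => t Ht; apply/cvgrPdist_le => e e0.
have [d d0 Hd] := Ht (e / C) (divr_gt0 e0 C0).
near=> n.
have : n.+1%:R^-1 < d by near: n; exact: near_infty_natSinv_lt (PosNum d0).
set r : R := n.+1%:R^-1 => rd; have r0 : 0 < r by rewrite invr_gt0.
have bk := bcs1_kern t r0; have [mg [Cg HCg]] := bg.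
have bgk : bcs1 (fun w => g w * kern r (t - w)).
  by under eq_fun do rewrite mulrC; exact: bcs1M.
rewrite distrC -[g t]mulr1 -(integral_kern t r0) -bcs1_integralZ// -bcs1_integralB//; last exact: bcs1Z.
have bd : bcs1 (fun w => g w * kern r (t - w) - g t * kern r (t - w)).
  by apply: bcs1B => //; exact: bcs1Z.
apply: (le_trans (bcs1_integral_norm bd)).
have bi : bcs1 (fun w => ind (t - r) (t + r) w * `|g w - g t|).
  apply: bcs1M; [exact: bcs1_ind|split].
    by apply: measurableT_comp => //; apply: measurable_funB => //; exact: measurable_cst.
  by exists (Cg + Cg) => x; rewrite normr_id (le_trans (ler_normB _ _))// lerD.
apply: (@le_trans _ _ (\int[mu]_w (C / r * (ind (t - r) (t + r) w * `|g w - g t|)))).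
  apply: bcs1_integral_le; [exact: bcs1_norm|exact: bcs1Z|move=> w].
  rewrite -mulrBl normrM /ind; case: (boolP (t - r <= w <= t + r)) => [_|nw].
    by rewrite mul1r mulrC ler_wpM2r//; exact: HC.
  rewrite kern_eq0 ?normr0 ?mulr0 ?mul0r ?mulr0//.
  rewrite leNgt; apply/negP; rewrite distrC ltr_distl => /andP[h1 h2].
  by move/negP: nw; apply; rewrite !ltW.
rewrite bcs1_integralZ//.
have := Hd r r0 rd; rewrite -(@ler_pM2l _ (C / r)) ?divr_gt0// => h; apply: (le_trans h).
have -> : C / r * (e / C * r) = e by field; rewrite !gt_eqF.
by [].
Unshelve. all: by end_near. Qed.

(** Mollification in one variable at a time, so that convergence rests on one-dimensional Lebesgue
    points and Fubini. *)
Definition mol1 (a : R * R -> R) (r : R) (z : R * R) : R :=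
  \int[mu]_w (a (w, z.2) * kern r (z.1 - w)).
Definition mol2 (a : R * R -> R) (r : R) (z : R * R) : R :=
  \int[mu]_w (a (z.1, w) * kern r (z.2 - w)).

Section mollify_in_one_variable.
Variables (a : R * R -> R) (C B : R).
Hypotheses (C0 : 0 < C) (B0 : 0 < B) (ma : measurable_fun setT a).
Hypothesis aC : forall z, `|a z| <= C.
Hypothesis aB : forall z, B < `|z.1| \/ B < `|z.2| -> a z = 0.

Let ba : bcs2 a. Proof. by split => //; exists C, B => z; split; [exact: aC|exact: aB]. Qed.

Let mk (r : R) : measurable_fun setT (kern r).
Proof. by apply: continuous_measurable_fun; exact: smooth1_continuous (smooth1_kern r). Qed.

Let mol1_bound (r : R) z : 0 < r -> `|mol1 a r z| <= C.
Proof. by move=> r0; apply: mollify_bound => //; exact: (bcs2_snd _ ba).1. Qed.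

Let mol2_bound (r : R) z : 0 < r -> `|mol2 a r z| <= C.
Proof. by move=> r0; apply: mollify_bound => //; exact: (bcs2_fst _ ba).1. Qed.

Let supp1 (r : R) z : 0 < r -> r <= 1 -> B + 1 < `|z.1| \/ B + 1 < `|z.2| -> mol1 a r z = 0.
Proof.
move=> r0 r1 [] zB; apply: Rintegral_eq0 => w _.
  have [wB|wB] := ltP B `|w|; first by rewrite aB ?mul0r//; left.
  rewrite kern_eq0 ?mulr0//; have := lerB_dist z.1 w; lra.
by rewrite aB ?mul0r//; right => /=; lra.
Qed.

Let supp2 (r : R) z : 0 < r -> r <= 1 -> B + 1 < `|z.1| \/ B + 1 < `|z.2| -> mol2 a r z = 0.
Proof.
move=> r0 r1 [] zB; apply: Rintegral_eq0 => w _.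
  by rewrite aB ?mul0r//; left => /=; lra.
have [wB|wB] := ltP B `|w|; first by rewrite aB ?mul0r//; right.
rewrite kern_eq0 ?mulr0//; have := lerB_dist z.2 w; lra.
Qed.

Lemma bcs2_mol1 (r : R) : 0 < r -> r <= 1 -> [/\ measurable_fun setT (mol1 a r),
  forall z, `|mol1 a r z| <= C & forall z, B + 1 < `|z.1| \/ B + 1 < `|z.2| -> mol1 a r z = 0].
Proof.
move=> r0 r1; split; [|by move=> z; exact: mol1_bound|by move=> z; exact: supp1].
apply: (measurable_parametric (G := fun zw : (R * R) * R =>
  a (zw.2, zw.1.2) * kern r (zw.1.1 - zw.2))).
apply: measurable_funM.
  apply: measurableT_comp => //; apply: measurable_fun_pair => //.
  by apply: measurableT_comp; [exact: measurable_snd|exact: measurable_fst].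
apply: measurableT_comp => //; apply: measurable_funB => //.
by apply: measurableT_comp; [exact: measurable_fst|exact: measurable_fst].
Qed.

Lemma bcs2_mol2 (r : R) : 0 < r -> r <= 1 -> [/\ measurable_fun setT (mol2 a r),
  forall z, `|mol2 a r z| <= C & forall z, B + 1 < `|z.1| \/ B + 1 < `|z.2| -> mol2 a r z = 0].
Proof.
move=> r0 r1; split; [|by move=> z; exact: mol2_bound|by move=> z; exact: supp2].
apply: (measurable_parametric (G := fun zw : (R * R) * R =>
  a (zw.1.1, zw.2) * kern r (zw.1.2 - zw.2))).
apply: measurable_funM.
  apply: measurableT_comp => //; apply: measurable_fun_pair => //.
  by apply: measurableT_comp; [exact: measurable_fst|exact: measurable_fst].
apply: measurableT_comp => //; apply: measurable_funB => //.
by apply: measurableT_comp; [exact: measurable_snd|exact: measurable_fst].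
Qed.

Let r_ (n : nat) : R := n.+1%:R^-1.
Let r_gt0 n : 0 < r_ n. Proof. by rewrite invr_gt0. Qed.
Let r_le1 n : r_ n <= 1. Proof. by rewrite invf_le1// ler1n. Qed.

Let dist_bcs2 (g : R * R -> R) : measurable_fun setT g -> (forall z, `|g z| <= C) ->
  (forall z, B + 1 < `|z.1| \/ B + 1 < `|z.2| -> g z = 0) ->
  [/\ bcs2 (fun z => `|g z - a z|), forall z, `| `|g z - a z| | <= C + C &
    forall z, B + 1 < `|z.1| \/ B + 1 < `|z.2| -> `|g z - a z| = 0].
Proof.
move=> mg gC gB.
have h1 z : `| `|g z - a z| | <= C + C by rewrite normr_id (le_trans (ler_normB _ _))// lerD.
have h2 z : B + 1 < `|z.1| \/ B + 1 < `|z.2| -> `|g z - a z| = 0.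
  move=> h; rewrite gB// aB ?subrr ?normr0//.
  by case: h => h; [left|right]; move: h; lra.
split => //; split; last by exists (C + C), (B + 1) => z; split; [exact: h1|exact: h2].
by apply: measurableT_comp => //; exact: measurable_funB.
Qed.

Lemma mol1_cvg : \int[leb2]_z `|mol1 a (r_ n) z - a z| @[n --> \oo] --> (0 : R).
Proof.
have HD n := let: And3 h1 h2 h3 := bcs2_mol1 (r_gt0 n) (r_le1 n) in dist_bcs2 h1 h2 h3.
have bD n := let: And3 h _ _ := HD n in h.
have -> : (fun n => \int[leb2]_z `|mol1 a (r_ n) z - a z|) =
    (fun n => \int[mu]_x \int[mu]_t `|mol1 a (r_ n) (t, x) - a (t, x)|).
  by apply/funext => n; exact: bcs2_fubini2.
have -> : (0 : R) = \int[mu]_(x in setT) 0 by rewrite Rintegral_eq0.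
apply: (bcs1_dct (C := (C + C) * (2 * (B + 1))) (B := B + 1)).
- by move=> n; exact: (bcs2_inner2 (bD n)).1.
- move=> n x; have [h1 h2 h3] := HD n.
  have := C0; have := B0 => b0 c0; apply: bcs1_integral_bound; [exact: (bcs2_snd x h1).1|lra|lra|by []|].
  by move=> t tB; apply: h3; left.
- move=> n x xB; apply: Rintegral_eq0 => t _; have [_ _ h] := HD n.
  by apply: h; right.
- exact: measurable_cst.
apply: aeW => x.
have -> : (0 : R) = \int[mu]_(x in setT) 0 by rewrite Rintegral_eq0.
apply: (bcs1_dct (C := C + C) (B := B + 1)).
- by move=> n; exact: (bcs2_snd x (bD n)).1.
- by move=> n t; have [_ h _] := HD n; exact: h.
- by move=> n t tB; have [_ _ h] := HD n; apply: h; left.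
- exact: measurable_cst.
apply: (aeS (mollify_ae (bcs1W (bcs2_snd x ba)))) => t ct.
have : mol1 a (r_ n) (t, x) - a (t, x) @[n --> \oo] --> a (t, x) - a (t, x).
  by apply: cvgB => //; exact: cvg_cst.
by move/cvg_norm; rewrite subrr normr0.
Qed.

Lemma mol2_cvg : \int[leb2]_z `|mol2 a (r_ n) z - a z| @[n --> \oo] --> (0 : R).
Proof.
have HD n := let: And3 h1 h2 h3 := bcs2_mol2 (r_gt0 n) (r_le1 n) in dist_bcs2 h1 h2 h3.
have bD n := let: And3 h _ _ := HD n in h.
have -> : (fun n => \int[leb2]_z `|mol2 a (r_ n) z - a z|) =
    (fun n => \int[mu]_t \int[mu]_x `|mol2 a (r_ n) (t, x) - a (t, x)|).
  by apply/funext => n; exact: bcs2_fubini1.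
have -> : (0 : R) = \int[mu]_(x in setT) 0 by rewrite Rintegral_eq0.
apply: (bcs1_dct (C := (C + C) * (2 * (B + 1))) (B := B + 1)).
- by move=> n; exact: (bcs2_inner1 (bD n)).1.
- move=> n t; have [h1 h2 h3] := HD n.
  have := C0; have := B0 => b0 c0; apply: bcs1_integral_bound; [exact: (bcs2_fst t h1).1|lra|lra|by []|].
  by move=> x xB; apply: h3; right.
- move=> n t tB; apply: Rintegral_eq0 => x _; have [_ _ h] := HD n.
  by apply: h; left.
- exact: measurable_cst.
apply: aeW => t.
have -> : (0 : R) = \int[mu]_(x in setT) 0 by rewrite Rintegral_eq0.
apply: (bcs1_dct (C := C + C) (B := B + 1)).
- by move=> n; exact: (bcs2_fst t (bD n)).1.
- by move=> n x; have [_ h _] := HD n; exact: h.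
- by move=> n x xB; have [_ _ h] := HD n; apply: h; right.
- exact: measurable_cst.
apply: (aeS (mollify_ae (bcs1W (bcs2_fst t ba)))) => x cx.
have : mol2 a (r_ n) (t, x) - a (t, x) @[n --> \oo] --> a (t, x) - a (t, x).
  by apply: cvgB => //; exact: cvg_cst.
by move/cvg_norm; rewrite subrr normr0.
Qed.

End mollify_in_one_variable.

Lemma conv_kernE (a : R * R -> R) (r s : R) z : bcs2 a -> 0 < r -> 0 < s ->
  conv2 a (kern r) (kern s) z = mol2 (mol1 a r) s z.
Proof.
move=> ba r0 s0; rewrite /conv2 bcs2_fubini2; last first.
  by apply: bcs2M => //; apply: bm2_kernel; exact: smooth1_kern.
rewrite /mol2 /mol1; apply: eq_Rintegral => x _ /=.
rewrite [RHS]mulrC -bcs1_integralZ.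
  by apply: eq_Rintegral => t _; ring.
under eq_fun do rewrite mulrC.
apply: bcs1M; [exact: bcs1_kern|exact/bcs1W/bcs2_snd].
Qed.

Lemma conv_kern_bound (a : R * R -> R) (C r s : R) z : bcs2 a -> 0 < C ->
  (forall z, `|a z| <= C) -> 0 < r -> r <= 1 -> 0 < s -> `|conv2 a (kern r) (kern s) z| <= C.
Proof.
move=> ba C0 aC r0 r1 s0; rewrite conv_kernE//.
have [C' [B [C'0 B0 H]]] := bcs2_bound ba.
have [m1 b1 _] := bcs2_mol1 ba.1 aC (fun z => (H z).2) r0 r1.
apply: mollify_bound => //.
apply: (measurableT_comp m1); exact: measurable_pair1.
Qed.

(** The time scale is fixed before the space scale: the convolution is the mollification in space of
    the mollification in time, whose own limit is taken first. *)
Lemma conv_kern_cvg (a : R * R -> R) (e : R) : bcs2 a -> 0 < e ->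
  \forall m \near \oo, \forall n \near \oo,
    \int[leb2]_z `|conv2 a (kern m.+1%:R^-1) (kern n.+1%:R^-1) z - a z| <= e.
Proof.
move=> ba e0; have [C [B [C0 B0 H]]] := bcs2_bound ba.
have e2 : 0 < e / 2 by rewrite divr_gt0.
have aC z := (H z).1; have aB z := (H z).2.
have h1 := mol1_cvg C0 B0 ba.1 aC aB.
near=> m.
have r0 : 0 < m.+1%:R^-1 :> R by rewrite invr_gt0.
have r1 : m.+1%:R^-1 <= 1 :> R by rewrite invf_le1// ler1n.
have Hm : \int[leb2]_z `|mol1 a m.+1%:R^-1 z - a z| <= e / 2.
  by near: m; apply: (cvgr_le _ h1).
have [mm bC bB] := bcs2_mol1 ba.1 aC aB r0 r1.
have B1 : 0 < B + 1 by lra.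
have h2 := mol2_cvg C0 B1 mm bC bB.
near=> n.
have s0 : 0 < n.+1%:R^-1 :> R by rewrite invr_gt0.
have s1 : n.+1%:R^-1 <= 1 :> R by rewrite invf_le1// ler1n.
have Hn : \int[leb2]_z `|mol2 (mol1 a m.+1%:R^-1) n.+1%:R^-1 z - mol1 a m.+1%:R^-1 z| <= e / 2.
  by near: n; apply: (cvgr_le _ h2).
have bm : bcs2 (mol1 a m.+1%:R^-1).
  by split => //; exists C, (B + 1) => z; split; [exact: bC|exact: bB].
have [mm2 bC2 bB2] := bcs2_mol2 mm bC bB s0 s1.
have bm2 : bcs2 (mol2 (mol1 a m.+1%:R^-1) n.+1%:R^-1).
  by split => //; exists C, (B + 1 + 1) => z; split; [exact: bC2|exact: bB2].
have b1 : bcs2 (fun z => `|mol2 (mol1 a m.+1%:R^-1) n.+1%:R^-1 z - mol1 a m.+1%:R^-1 z|).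
  exact/bcs2_norm/bcs2B.
have b2 : bcs2 (fun z => `|mol1 a m.+1%:R^-1 z - a z|) by exact/bcs2_norm/bcs2B.
apply: (@le_trans _ _ (\int[leb2]_z (`|mol2 (mol1 a m.+1%:R^-1) n.+1%:R^-1 z -
    mol1 a m.+1%:R^-1 z| + `|mol1 a m.+1%:R^-1 z - a z|))).
  apply: bcs2_integral_le; [|exact: bcs2D|].
    under eq_fun do rewrite conv_kernE//.
    exact/bcs2_norm/bcs2B.
  move=> z; rewrite conv_kernE//; set p := mol2 _ _ z; set q := mol1 _ _ z.
  have -> : p - a z = (p - q) + (q - a z) by ring.
  exact: ler_normD.
rewrite bcs2_integralD//; lra.
Unshelve. all: by end_near. Qed.

End kernels.

(** * Approximate potentials *)

Section potential.
Context {R : realType}.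
Local Notation mu := (@lebesgue_measure R).

Lemma bcs2_conv_kern (a : R * R -> R) (r s : R) : bcs2 a -> 0 < r -> r <= 1 -> 0 < s -> s <= 1 ->
  bcs2 (conv2 a (kern r) (kern s)).
Proof.
move=> ba r0 r1 s0 s1; have [C [B [C0 B0 H]]] := bcs2_bound ba.
have [m1 c1 h1] := bcs2_mol1 ba.1 (fun z => (H z).1) (fun z => (H z).2) r0 r1.
have [m2 c2 h2] := bcs2_mol2 m1 c1 h1 s0 s1.
rewrite (_ : conv2 a _ _ = mol2 (mol1 a r) s); last by apply/funext => z; exact: conv_kernE.
by split; [exact: m2|exists C, (B + 1 + 1) => z; split; [exact: c2|exact: h2]].
Qed.

Variables (a b : R * R -> R) (Lam Ca : R).
Hypotheses (Lam0 : 0 < Lam) (Ca0 : 0 < Ca).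
Hypotheses (ma : measurable_fun setT a) (mb : measurable_fun setT b).
Hypotheses (aC : forall z, `|a z| <= Ca) (bL : forall z, `|b z| <= Lam * `|a z|).
Hypothesis a_past : forall z, z.1 <= 0 -> a z = 0.
Hypothesis cons : forall (phi pt px : R * R -> R) (tau B : R), smooth2 phi -> 0 < tau ->
  (forall z, phi z != 0 -> [/\ tau <= z.1, z.1 <= B & `|z.2| <= B]) ->
  has_partials phi pt px -> \int[leb2]_z (a z * pt z + b z * px z) = 0.
Hypothesis init : forall (phi pt px : R * R -> R) (B : R), smooth2 phi -> (forall z, 0 <= phi z) ->
  (forall z, phi z != 0 -> `|z.1| <= B /\ `|z.2| <= B) ->
  has_partials phi pt px -> \int[leb2]_z (a z * pt z + b z * px z) <= 0.

Let bC z : `|b z| <= Lam * Ca.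
Proof. by rewrite (le_trans (bL z))// ler_wpM2l// ltW. Qed.

Let b_past z : z.1 <= 0 -> b z = 0.
Proof. by move=> /a_past z0; apply/eqP; rewrite -normr_le0 (le_trans (bL z))// z0 normr0 mulr0. Qed.

Section construction.
Variables (t1 tau T L r s : R).
Hypotheses (tt : t1 < tau) (tT : tau <= T) (L0 : 0 <= L).
Hypotheses (r0 : 0 < r) (rt : r < t1) (r1 : r <= 1) (s0 : 0 < s) (s1 : s <= 1).

(** Half size of a box containing the supports of the test functions below; the 3 accounts for a
    cutoff that vanishes only for times below -3. *)
Let K := T + L + 3.
Let bx z := ind 0 K z.1 * ind (- K) K z.2.

Let T0 : 0 < T. Proof. by move: (r0) (rt) (tt) (tT); lra. Qed.
Let aB z := bx z * a z.
Let bB z := bx z * b z.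

Let bcs2_bx : bcs2 bx.
Proof.
have mi (p q : R) : measurable_fun setT (ind p q) by exact: (bcs1_ind _ _).1.
split.
  apply: measurable_funM; first by apply: measurableT_comp => //; exact: measurable_fst.
  by apply: measurableT_comp => //; exact: measurable_snd.
exists 1, K => z.
rewrite ger0_norm ?mulr_ge0 ?ind_ge0//; split.
  by rewrite -[leRHS]mulr1 ler_pM ?ind_ge0 ?ind_le1.
have l0 := L0; rewrite /bx /ind; case: (boolP (_ <= z.1 <= _)) => [/andP[h1 h2]|h1]; last by rewrite mul0r.
case: (boolP (_ <= z.2 <= _)) => [h3|h3]; last by rewrite mulr0.
rewrite -ler_norml in h3.
by rewrite (ger0_norm h1) => -[]; lra.
Qed.

Lemma bcs2_box_a : bcs2 aB. Proof. by apply: bcs2M => //; split => //; exists Ca. Qed.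
Lemma bcs2_box_b : bcs2 bB. Proof. by apply: bcs2M => //; split => //; exists (Lam * Ca). Qed.

Let bx_le1 z : `|bx z| <= 1.
Proof. by rewrite ger0_norm ?mulr_ge0 ?ind_ge0// -[leRHS]mulr1 ler_pM ?ind_ge0 ?ind_le1. Qed.

Let aBC z : `|aB z| <= Ca.
Proof. by rewrite normrM -[leRHS]mul1r ler_pM. Qed.

Let bx1 z : 0 <= z.1 -> z.1 <= K -> `|z.2| <= K -> bx z = 1.
Proof. by move=> h1 h2; rewrite ler_norml => /andP[h3 h4]; rewrite /bx !ind1// mulr1. Qed.

Let one : R -> R := cst 1.
(** The factor [step (- x)] restricts to the left of 0 and [bumpf (- x)] averages near 0, so that
    the potential approximates the integral of a(t, .) over [0, x] minus the integral of [b] at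
    position 0 over times up to [t]. *)
Let G (w : R * R) := aB w * step (- w.2).
Let H (w : R * R) := bB w * bumpf (- w.2).

Let mneg (g : R -> R) : smooth1 g -> bm2 (fun w : R * R => g (- w.2)).
Proof.
move=> sg; have [C C0 HC] := smooth1_bounded sg; split; last by exists C => w; exact: HC.
have mg : measurable_fun setT g by apply: continuous_measurable_fun; exact: smooth1_continuous.
apply: (measurableT_comp mg).
by apply: measurableT_comp => //; exact: measurable_snd.
Qed.

Let bG : bcs2 G. Proof. by apply: bcs2M; [exact: bcs2_box_a|exact/mneg/smooth1_step]. Qed.
Let bH : bcs2 H. Proof. by apply: bcs2M; [exact: bcs2_box_b|exact/mneg/smooth1_bump]. Qed.

Let dk := derive1 (kern r).
Let dkP (x : R) : is_derive x 1 (kern r) (dk x).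
Proof.
have [g' _ Hg] := smooth1_derive (smooth1_kern r); have := Hg x => Hx.
by rewrite /dk derive1E; apply: DeriveDef => //; exact: ex_derive.
Qed.
Let sdk : smooth1 dk.
Proof.
have [g' sg' Hg] := smooth1_derive (smooth1_kern r).
rewrite (_ : dk = g')//; apply/funext => x.
by have [_ <-] := Hg x; have [_ <-] := dkP x.
Qed.
Let sone : smooth1 one. Proof. exact: smooth1_cst. Qed.

(* An approximate potential of the field (a, -b): the first term has the
   mollification of [a] as space derivative, and the other two, which depend on
   time only, correct the time derivative. *)
Definition potential z := conv2 aB (kern r) (sstep s) z - conv2 G (kern r) one z - conv2 H (sstep r) one z.
Definition potential_t z := conv2 aB dk (sstep s) z - conv2 G dk one z - conv2 H (kern r) one z.
Definition potential_x z := conv2 aB (kern r) (kern s) z.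

Lemma smooth2_potential : smooth2 potential.
Proof.
by apply: smooth2B; [apply: smooth2B|]; apply: smooth2_conv => //;
  solve [exact: bcs2_box_a|exact: smooth1_kern|exact: smooth1_sstep].
Qed.

Lemma potential_partials : has_partials potential potential_t potential_x.
Proof.
move=> t x; have done1 (y : R) : is_derive y 1 one (cst 0 y) by exact: is_derive_cst.
have [p1 p2] := conv_partials bcs2_box_a (smooth1_kern r) (smooth1_sstep s) dkP (sstep_derive s) t x.
have [p3 p4] := conv_partials bG (smooth1_kern r) sone dkP done1 t x.
have [p5 p6] := conv_partials bH (smooth1_sstep r) sone (sstep_derive r) done1 t x.
split; first exact: is_deriveB (is_deriveB p1 p3) p5.
have e1 (A : R * R -> R) (k : R -> R) : conv2 A k (cst 0) (t, x) = 0.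
  by apply: Rintegral_eq0 => w _; rewrite mulr0 mulr0.
rewrite e1 in p4; rewrite e1 in p6.
by apply: (is_derive_eq (is_deriveB (is_deriveB p2 p4) p6)); rewrite !subr0.
Qed.

Lemma potential_x_bound z : `|potential_x z| <= Ca.
Proof. exact: (conv_kern_bound z bcs2_box_a). Qed.

Let sstep_eq0 (q y : R) : 0 < q -> y <= - q -> sstep q y = 0.
Proof. by move=> q0 yq; rewrite /sstep step_leN1// ler_pdivrMr// mulN1r. Qed.

Let sstep_eq1 (q y : R) : 0 < q -> q <= y -> sstep q y = 1.
Proof. by move=> q0 yq; rewrite /sstep step_ge1// ler_pdivlMr// mul1r. Qed.

(** The conservation law is tested with the mollifier in time multiplied by the difference of two
    steps in space, centred at [x] and at 0. Both steps are 1 far to the left and 0 far to the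
    right, so their difference has compact support. *)
Lemma potential_tE t x : t1 <= t <= T -> `|x| <= L ->
  potential_t (t, x) = - conv2 bB (kern r) (kern s) (t, x).
Proof.
move=> /andP[ht1 htT] hx.
pose phi (w : R * R) := kern r (t - w.1) * (sstep s (x - w.2) - step (- w.2)).
pose pt (w : R * R) := - dk (t - w.1) * (sstep s (x - w.2) - step (- w.2)).
pose px (w : R * R) := kern r (t - w.1) * (- kern s (x - w.2) + bumpf (- w.2)).
have rev (p y : R) (g dg : R -> R) : (forall y : R, is_derive y 1 g (dg y)) ->
    is_derive y 1 (fun y => g (p - y)) (- dg (p - y)).
  move=> Hg; have h : is_derive y 1 (fun y => p - y) (-1).
    by apply: (is_derive_eq (is_deriveB (is_derive_cst p y 1) (is_derive_id y (1:R)))); rewrite sub0r.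
  by apply: (is_derive_eq (@is_derive1_comp R g (fun y => p - y) y _ _ (Hg _) h)); rewrite mulrN1.
have sphi : smooth2 phi.
  apply: smooth2M.
    by apply: (smooth2_comp (smooth1_kern r)); apply: smooth2B; [exact: smooth2_cst|exact: smooth2_fst].
  apply: smooth2B.
    by apply: (smooth2_comp (smooth1_sstep s)); apply: smooth2B; [exact: smooth2_cst|exact: smooth2_snd].
  apply: (smooth2_comp (@smooth1_step R)).
  rewrite (_ : (fun _ => _) = fun z : R * R => (-1) * z.2); last by apply/funext => z; rewrite mulN1r.
  exact/smooth2Z/smooth2_snd.
have Hphi : has_partials phi pt px.
  move=> t' x'; split.
    have h := is_deriveM (rev t t' _ _ dkP) (is_derive_cst (sstep s (x - x') - step (- x')) t' 1).
    by apply: (is_derive_eq h); rewrite /pt /GRing.scale/=; ring.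
  have h1 := rev x x' _ _ (sstep_derive s).
  have h2 := rev 0 x' _ _ (@step_derive R).
  have h := is_deriveZ (kern r (t - t')) (is_deriveB h1 h2).
  rewrite (_ : (fun x0 => phi (t', x0)) = (kern r (t - t') \*: ((fun y => sstep s (x - y)) -
    (fun y => step (0 - y)))))//; last by apply/funext => y; rewrite /phi !fctE/= sub0r.
  by apply: (is_derive_eq h); rewrite /px /GRing.scale/= opprK sub0r.
have l0 := L0; have rt' := rt; have r1' := r1; have r0' := r0; have s1' := s1; have s0' := s0.
have tr : 0 < t - r by lra.
have t00 := T0.
have supp z : phi z != 0 -> [/\ t - r <= z.1, z.1 <= K & `|z.2| <= K].
  rewrite mulf_eq0 negb_or => /andP[k0 g0].
  have : `|t - z.1| < r by rewrite ltNge; apply/negP => h; rewrite kern_eq0 ?eqxx// in k0.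
  rewrite ltr_distl => /andP[h1 h2]; rewrite ler_norml in hx; move/andP: hx => [hx1 hx2].
  rewrite /K; split; [lra|lra|rewrite leNgt; apply/negP].
  rewrite ltr_normr => /orP[h|h]; move/negP: g0; apply.
    by rewrite sstep_eq0 ?step_leN1 ?subrr//; lra.
  by rewrite sstep_eq1 ?step_ge1 ?subrr//; lra.
have := cons sphi tr supp Hphi.
have eB z : a z * pt z + b z * px z = aB z * pt z + bB z * px z.
  have [[h1 h2 h3]|/(box_partials Hphi supp)[-> ->]] := pselect [/\ t - r <= z.1, z.1 <= K & `|z.2| <= K].
    by rewrite /aB /bB bx1 ?mul1r//; lra.
  by rewrite !mulr0.
under eq_Rintegral do rewrite eB.
pose f1 w := aB w * (dk (t - w.1) * sstep s (x - w.2)).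
pose f2 w := G w * (dk (t - w.1) * one (x - w.2)).
pose f3 w := bB w * (kern r (t - w.1) * kern s (x - w.2)).
pose f4 w := H w * (kern r (t - w.1) * one (x - w.2)).
have b1 : bcs2 f1.
  by apply: bcs2M; [exact: bcs2_box_a|apply: (bm2_kernel (t, x)) => //; exact: smooth1_sstep].
have b2 : bcs2 f2 by apply: bcs2M => //; exact: (bm2_kernel (t, x)).
have b3 : bcs2 f3.
  by apply: bcs2M; [exact: bcs2_box_b|apply: (bm2_kernel (t, x)); exact: smooth1_kern].
have b4 : bcs2 f4 by apply: bcs2M => //; apply: (bm2_kernel (t, x)) => //; exact: smooth1_kern.
rewrite (_ : \int[leb2]_z _ = \int[leb2]_z ((f4 z - f3 z) - (f1 z - f2 z))); last first.
  by apply: eq_Rintegral => z _; rewrite /f1 /f2 /f3 /f4 /pt /px /G /H /one /=; ring.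
rewrite bcs2_integralB; [|exact: bcs2B..]; rewrite !bcs2_integralB//.
by rewrite /potential_t /conv2 /= -/f1; move=> E; apply/eqP; rewrite -subr_eq0; apply/eqP; rewrite -[RHS]oppr0 -[in RHS]E; ring.
Qed.

(** The weak initial inequality, tested with a smoothed indicator of times before [tau] and
    positions in [y1, y2], bounds the mass of [a] at time [tau] from below by the flux through the
    two sides, which is of order [tau]. *)
Lemma potential_initial y1 y2 : y1 < y2 -> `|y1| <= L -> `|y2| <= L ->
  potential (tau, y1) - potential (tau, y2) <= 4 * (Lam * Ca) * tau.
Proof.
move=> yy hy1 hy2.
pose ze (x : R) := sstep s (y2 - x) - sstep s (y1 - x).
(* The factor [step (w.1 + 2)] makes the support compact in the past; it equals 1 at positive times,
   and [a], [b] vanish at the others. *)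
pose phi (w : R * R) := (sstep r (tau - w.1) * step (w.1 + 2)) * ze w.2.
pose pt (w : R * R) := (- kern r (tau - w.1) * step (w.1 + 2) + sstep r (tau - w.1) * bumpf (w.1 + 2)) * ze w.2.
pose px (w : R * R) := (sstep r (tau - w.1) * step (w.1 + 2)) * (kern s (y1 - w.2) - kern s (y2 - w.2)).
have l0 := L0; have rt' := rt; have r1' := r1; have r0' := r0; have s1' := s1; have s0' := s0.
have tt' := tt; have t00 := T0; have tT' := tT.
have rev (p y : R) (g dg : R -> R) : (forall y : R, is_derive y 1 g (dg y)) ->
    is_derive y 1 (fun y => g (p - y)) (- dg (p - y)).
  move=> Hg; have h : is_derive y 1 (fun y => p - y) (-1).
    by apply: (is_derive_eq (is_deriveB (is_derive_cst p y 1) (is_derive_id y (1:R)))); rewrite sub0r.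
  by apply: (is_derive_eq (@is_derive1_comp R g (fun y => p - y) y _ _ (Hg _) h)); rewrite mulrN1.
have sphi : smooth2 phi.
  apply: smooth2M; first apply: smooth2M.
  - by apply: (smooth2_comp (smooth1_sstep r)); apply: smooth2B; [exact: smooth2_cst|exact: smooth2_fst].
  - by apply: (smooth2_comp (@smooth1_step R)); apply: smooth2D; [exact: smooth2_fst|exact: smooth2_cst].
  by apply: smooth2B; apply: (smooth2_comp (smooth1_sstep s)); apply: smooth2B;
    (exact: smooth2_cst || exact: smooth2_snd).
have Hphi : has_partials phi pt px.
  move=> t' x'; split.
    have h1 : is_derive t' 1 (fun y : R => step (y + 2)) (bumpf (t' + 2)).
      have h : is_derive t' 1 (fun y : R => y + 2) (1 : R).
        by apply: (is_derive_eq (is_deriveD (is_derive_id t' (1:R)) (is_derive_cst (2:R) t' 1))); rewrite addr0.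
      by apply: (is_derive_eq (@is_derive1_comp R step _ t' _ _ (@step_derive R _) h)); rewrite mulr1.
    have h := is_deriveM (is_deriveM (rev tau t' _ _ (sstep_derive r)) h1) (is_derive_cst (ze x') t' 1).
    by apply: (is_derive_eq h); rewrite /pt !fctE /GRing.scale/=; ring.
  have h := is_deriveZ (sstep r (tau - t') * step (t' + 2))
    (is_deriveB (rev y2 x' _ _ (sstep_derive s)) (rev y1 x' _ _ (sstep_derive s))).
  by apply: (is_derive_eq h); rewrite /px /GRing.scale/=; ring.
have ze0 x : 0 <= ze x.
  have [c [_ e]] := mvt_linear (y1 - x) (y2 - y1) (sstep_derive s).
  have -> : ze x = kern s c * (y2 - y1) by rewrite -e /ze; congr (sstep s _ - _); ring.
  by rewrite mulr_ge0 ?kern_ge0// subr_ge0 ltW.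
have phi0 z : 0 <= phi z.
  by rewrite /phi; apply: mulr_ge0 => //; apply: mulr_ge0; exact: step_ge0.
move: hy1 hy2; rewrite !ler_norml => /andP[q1 q2] /andP[q3 q4].
have zeK x : ze x != 0 -> `|x| <= K.
  move=> g0; rewrite leNgt; apply/negP; rewrite ltr_normr => /orP[h|h]; move/negP: g0; apply;
    rewrite /K in h.
    by rewrite /ze !sstep_eq0 ?subrr//; lra.
  by rewrite /ze !sstep_eq1 ?subrr//; lra.
have supp z : phi z != 0 -> `|z.1| <= K /\ `|z.2| <= K.
  rewrite mulf_eq0 negb_or => /andP[]; rewrite mulf_eq0 negb_or => /andP[k1 k2 g0].
  split; last exact: zeK.
    rewrite /K ler_norml; apply/andP; split; rewrite leNgt; apply/negP => h.
      by move/negP: k2; apply; rewrite step_leN1//; lra.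
    by move/negP: k1; apply; rewrite sstep_eq0//; lra.
have I0 := init sphi phi0 supp Hphi.
pose k w := kern s (y1 - w) + kern s (y2 - w).
have bk : bcs1 k by apply: bcs1D; exact: bcs1_kern.
pose f1 w := aB w * (kern r (tau - w.1) * sstep s (y1 - w.2)).
pose f2 w := aB w * (kern r (tau - w.1) * sstep s (y2 - w.2)).
(* Since r < tau, the time factor vanishes after [2 * tau]; the two mollifiers in [k] have integral
   2, whence the bound [4 * tau]. *)
pose f3 (w : R * R) := ind 0 (2 * tau) w.1 * k w.2.
pose f4 w := a w * pt w + b w * px w.
have b1 : bcs2 f1.
  by apply: bcs2M; [exact: bcs2_box_a|apply: (bm2_kernel (tau, y1)); [exact: smooth1_kern|exact: smooth1_sstep]].
have b2 : bcs2 f2.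
  by apply: bcs2M; [exact: bcs2_box_a|apply: (bm2_kernel (tau, y2)); [exact: smooth1_kern|exact: smooth1_sstep]].
have b3 : bcs2 f3.
  split.
    apply: measurable_funM; first by apply: measurableT_comp; [exact: (bcs1_ind _ _).1|exact: measurable_fst].
    by apply: measurableT_comp; [exact: bk.1|exact: measurable_snd].
  have [C [B [C0 B0 HC]]] := bcs1_bound bk; exists C, (2 * tau + B) => z; split.
    by rewrite /f3 normrM (ger0_norm (ind_ge0 _ _ _)) -[leRHS]mul1r ler_pM ?ind_ge0 ?ind_le1//; exact: (HC _).1.
  rewrite /f3 /ind; case: (boolP (_ <= z.1 <= _)) => [/andP[h1 h2]|h]; last by rewrite mul0r.
  by rewrite mul1r ger0_norm// => -[] h3; apply: (HC _).2; lra.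
have b4 : bcs2 f4.
  have [pt' [px' [spt spx Hp]]] := smooth2_partials sphi.
  have ept : pt = pt'.
    by apply/funext => -[t x]; have [[_ <-] _] := Hphi t x; have [[_ <-] _] := Hp t x.
  have epx : px = px'.
    by apply/funext => -[t x]; have [_ [_ <-]] := Hphi t x; have [_ [_ <-]] := Hp t x.
  have nz z : ~ (`|z.1| <= K /\ `|z.2| <= K) -> pt z = 0 /\ px z = 0.
    move=> nK; apply: (box_partials (tau := - K) (B := K) Hphi) => [w /supp[]|[h1 h2 h3]].
      by rewrite ler_norml => /andP[].
    by apply: nK; rewrite ler_norml h1 h2.
  have bpt : bcs2 pt.
    rewrite ept; apply: (bcs2_continuous (B := K) (smooth2_continuous spt)) => z; rewrite -ept => nz0.
    by apply: contrapT => /nz[e]; rewrite e eqxx in nz0.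
  have bpx : bcs2 px.
    rewrite epx; apply: (bcs2_continuous (B := K) (smooth2_continuous spx)) => z; rewrite -epx => nz0.
    by apply: contrapT => /nz[_ e]; rewrite e eqxx in nz0.
  rewrite /f4; apply: bcs2D; under eq_fun do rewrite mulrC; apply: bcs2M => //; split => //.
    by exists Ca.
  by exists (Lam * Ca).
have I3 : \int[leb2]_z f3 z = 4 * tau.
  rewrite bcs2_fubini1//; transitivity (\int[mu]_t (2 * ind 0 (2 * tau) t)).
    apply: eq_Rintegral => t _; rewrite /f3/= bcs1_integralZ// /k bcs1_integralD; [|exact: bcs1_kern..].
    by rewrite !integral_kern//; ring.
  rewrite bcs1_integralZ; last exact: bcs1_ind.
  by rewrite integral_ind1; lra.
have E : potential (tau, y1) - potential (tau, y2) = \int[leb2]_z (f1 z - f2 z).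
  rewrite bcs2_integralB// /potential /conv2/=; set x1 := \int[leb2]_w _; set x2 := \int[leb2]_w _.
  by ring.
rewrite E.
have pw z : f1 z - f2 z <= f4 z + Lam * Ca * f3 z.
  clear I3 E b1 b2 b3 b4 bk I0 sphi Hphi supp phi0 rev.
  have k1 := kern_ge0 (y1 - z.2) s0; have k2 := kern_ge0 (y2 - z.2) s0.
  have LC : 0 < Lam * Ca by rewrite mulr_gt0.
  have kk : 0 <= k z.2 by rewrite /k addr_ge0.
  have [z0|z0] := leP z.1 0.
    rewrite /f1 /f2 /f4 /aB a_past// b_past// !mulr0 !mul0r subrr addr0 add0r.
    by apply: mulr_ge0; [exact: ltW|apply: mulr_ge0 => //; exact: ind_ge0].
  have s2 : step (z.1 + 2) = 1 by rewrite step_ge1// ler_wpDl ?(ltW z0)// ler1n.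
  have b2' : bumpf (z.1 + 2) = 0.
    by rewrite bump_eq0// ger0_norm ?ler_wpDl ?addr_ge0 ?(ltW z0)// ler1n.
  have -> : f1 z - f2 z = - (bx z * (a z * (kern r (tau - z.1) * ze z.2))).
    by rewrite /f1 /f2 /aB /ze; ring.
  have -> : bx z * (a z * (kern r (tau - z.1) * ze z.2)) = a z * (kern r (tau - z.1) * ze z.2).
    have [->|nz] := eqVneq (kern r (tau - z.1) * ze z.2) 0; first by rewrite !mulr0.
    have tz : `|tau - z.1| < r.
      rewrite ltNge; apply/negP => h; move: nz.
      by rewrite (kern_eq0 r0 h) mul0r eqxx.
    rewrite ltr_distl in tz; move/andP: tz => [h1 h2].
    have h3 : `|z.2| <= K by move: nz; rewrite mulf_eq0 negb_or => /andP[_ /zeK].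
    by rewrite bx1 ?mul1r// /K; lra.
  rewrite /f4 /pt /px s2 b2' !mulr1 mulr0 addr0 /f3.
  set S := sstep r (tau - z.1).
  have S0 : 0 <= S by exact: step_ge0.
  have Si : S <= ind 0 (2 * tau) z.1.
    rewrite /ind; case: (boolP (0 <= z.1 <= _)) => [_|h]; first exact: step_le1.
    rewrite negb_and -!ltNge in h; case/orP: h => h; first by lra.
    by rewrite /S sstep_eq0//; lra.
  have hb := bC z.
  have : - (b z * (S * (kern s (y1 - z.2) - kern s (y2 - z.2)))) <=
      Lam * Ca * (ind 0 (2 * tau) z.1 * k z.2).
    apply: (le_trans (ler_norm _)); rewrite normrN normrM ler_pM//.
    rewrite normrM (ger0_norm S0) ler_pM// (le_trans (ler_normB _ _))//.
    by rewrite !ger0_norm.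
  lra.
apply: (le_trans (bcs2_integral_le (bcs2B b1 b2) (bcs2D b4 (bcs2Z (Lam * Ca) b3)) pw)).
rewrite bcs2_integralD ?bcs2_integralZ// ?I3; last exact: bcs2Z.
have -> : 4 * (Lam * Ca) * tau = Lam * Ca * (4 * tau) by ring.
by rewrite gerDr.
Qed.

End construction.

Lemma potential_exists (t1 tau T L e : R) : 0 < t1 -> t1 < tau -> tau <= T -> 0 <= L -> 0 < e ->
  exists W Wt Wx, [/\ smooth2 W, has_partials W Wt Wx,
    forall t x, t1 <= t <= T -> `|x| <= L ->
      `|Wt (t, x)| <= (1 + Lam) * Ca /\ `|Wx (t, x)| <= (1 + Lam) * Ca,
    potential_error a b t1 T L Wt Wx <= e &
    forall y1 y2, y1 < y2 -> `|y1| <= L -> `|y2| <= L ->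
      W (tau, y1) - W (tau, y2) <= 4 * (Lam * Ca) * tau].
Proof.
move=> t10 tt tT L0 e0; have e2 : 0 < e / 2 by rewrite divr_gt0.
have T0 : 0 < T by lra.
have [g1 g2] : Ca <= (1 + Lam) * Ca /\ Lam * Ca <= (1 + Lam) * Ca.
  by have := Ca0; have := mulr_gt0 Lam0 Ca0; lra.
pose bx (z : R * R) := ind 0 (T + L + 3) z.1 * ind (- (T + L + 3)) (T + L + 3) z.2.
have bx1 t x : t1 <= t <= T -> - L <= x <= L -> bx (t, x) = 1.
  by move=> /andP[h1 h2] /andP[h3 h4]; rewrite /bx !ind1 ?mulr1//=; lra.
have A0 := conv_kern_cvg (bcs2_box_a T L0) e2.
have B0 := conv_kern_cvg (bcs2_box_b T L0) e2.
(* The time scale is also taken below [t1], so that kernels centred after [t1] remain in positive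
   times. *)
have [m [[Hm1 Hm2] Hm3]] := filter_ex (filterI (filterI A0 B0) (near_infty_natSinv_lt (PosNum t10))).
have [n [Hn1 Hn2]] := filter_ex (filterI Hm1 Hm2).
rewrite /= in Hm3 Hn1 Hn2.
move: Hm3 Hn1 Hn2 (ltr0Sn R m) (ltr0Sn R n).
set r : R := m.+1%:R^-1; set s : R := n.+1%:R^-1 => rt Hn1 Hn2 m0 n0.
have r0 : 0 < r by rewrite invr_gt0.
have s0 : 0 < s by rewrite invr_gt0.
have r1 : r <= 1 by rewrite invf_le1// ler1n.
have s1 : s <= 1 by rewrite invf_le1// ler1n.
have LC : 0 < Lam * Ca by exact: mulr_gt0.
have tE t x := @potential_tE t1 tau T L r s tt tT L0 r0 rt r1 s0 s1 t x.
have bx_le1 z : `|bx z| <= 1.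
  by rewrite ger0_norm ?mulr_ge0 ?ind_ge0// -[leRHS]mulr1 ler_pM ?ind_ge0 ?ind_le1.
have ba := bcs2_box_a T L0; have bb := bcs2_box_b T L0.
exists (potential T L r s), (potential_t T L r s), (potential_x T L r s); split.
- exact: smooth2_potential.
- exact: potential_partials.
- move=> t x ht hx; split; last first.
    by apply: le_trans g1; exact: potential_x_bound.
  rewrite tE// normrN; apply: le_trans g2.
  apply: (conv_kern_bound _ bb) => // z.
  by rewrite normrM -[leRHS]mul1r; apply: ler_pM => //; exact: (bx_le1 z).
- pose f z := `|conv2 (fun z => bx z * b z) (kern r) (kern s) z - bx z * b z| +
    `|conv2 (fun z => bx z * a z) (kern r) (kern s) z - bx z * a z|.
  have b1 : bcs2 (fun z => `|conv2 (fun z => bx z * b z) (kern r) (kern s) z - bx z * b z|).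
    by apply: bcs2_norm; apply: bcs2B => //; exact: bcs2_conv_kern.
  have b2 : bcs2 (fun z => `|conv2 (fun z => bx z * a z) (kern r) (kern s) z - bx z * a z|).
    by apply: bcs2_norm; apply: bcs2B => //; exact: bcs2_conv_kern.
  have bf : bcs2 f by exact: bcs2D.
  have bi : bm2 (fun z : R * R => ind t1 T z.1 * ind (- L) L z.2).
    split.
      apply: measurable_funM.
        by apply: measurableT_comp; [exact: (bcs1_ind _ _).1|exact: measurable_fst].
      by apply: measurableT_comp; [exact: (bcs1_ind _ _).1|exact: measurable_snd].
    exists 1 => z; rewrite ger0_norm ?mulr_ge0 ?ind_ge0//.
    by rewrite -[leRHS]mulr1 ler_pM ?ind_ge0 ?ind_le1.
  have -> : e = e / 2 + e / 2 by field.
  apply: le_trans (lerD Hn2 Hn1); rewrite -bcs2_integralD//.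
  rewrite (_ : potential_error _ _ _ _ _ _ _ = \int[leb2]_z (f z * (ind t1 T z.1 * ind (- L) L z.2))).
    apply: bcs2_integral_le => //; first exact: bcs2M.
    move=> z; rewrite -[leRHS]mulr1 ler_wpM2l ?addr_ge0//.
    by rewrite -[leRHS]mulr1 ler_pM ?ind_ge0 ?ind_le1.
  apply: eq_Rintegral => -[t x] _ /=.
  rewrite [RHS]mulrC -[RHS]mulrA.
  have [it|/ind0->] := boolP (t1 <= t <= T); last by rewrite !mul0r.
  have [ix|/ind0->] := boolP (- L <= x <= L); last by rewrite !mul0r !mulr0.
  have hx : `|x| <= L by rewrite ler_norml.
  rewrite tE// /f bx1// !mul1r; congr (_ * (_ * (_ + _))).
  by rewrite -[LHS]normrN opprD opprK.
- move=> y1 y2 yy h1 h2; exact: (@potential_initial t1).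
Qed.

End potential.

(** * Sign of the solution from the sign of its initial value *)

Section sign_from_initial_data.
Context {R : realType}.
Local Notation mu := (@lebesgue_measure R).

Lemma bcs1_ind_mul (p q : R) (g : R -> R) : bm1 g -> bcs1 (fun x => ind p q x * g x).
Proof. by move=> bg; apply: bcs1M => //; exact: bcs1_ind. Qed.

(** At a Lebesgue point with a negative value, some rational interval has a negative integral.
    Rational end points leave countably many conditions, which can hold simultaneously outside one
    null set. *)
Lemma nonneg_from_rational_intervals (g : R -> R) (c : R) : bm1 g ->
  (forall p q : rat, c < ratr p -> ratr p < ratr q :> R ->
    0 <= \int[mu]_x (ind (ratr p) (ratr q) x * g x)) ->
  {ae mu, forall x, c < x -> 0 <= g x}.
Proof.
move=> bg H; suff main (x : R) : lebesgue_at g x -> c < x -> 0 <= g x.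
  by apply: (aeS (lebesgue_points bg)) => x; exact: main.
move=> Hx cx.
rewrite leNgt; apply/negP => gx.
pose e := - g x / 2; have e0 : 0 < e by rewrite /e divr_gt0// oppr_gt0.
have [d d0 Hd] := Hx e e0.
pose r := Num.min (d / 2) ((x - c) / 2).
have r0 : 0 < r by rewrite lt_min !divr_gt0// subr_gt0.
have [r1 r2] : r <= d / 2 /\ r <= (x - c) / 2.
  by have : r <= r by []; rewrite {2}/r le_min => /andP[].
have rd : r < d by lra.
(* The rational interval covers at least [3 / 2 * r] inside ]x - r, x + r[; with [e = - g x / 2] the
   integral is then at most [g x * r]. *)
have lt1 : x - r < x - 3 / 4 * r by lra.
have lt2 : x + 3 / 4 * r < x + r by lra.
have [p /itvP pP] := rat_in_itvoo lt1.
have [q /itvP qP] := rat_in_itvoo lt2.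
have [p1 p2 q1 q2] : [/\ x - r < ratr p, ratr p < x - 3 / 4 * r, x + 3 / 4 * r < ratr q &
  ratr q < x + r] by rewrite !pP !qP.
have bgx : bm1 (fun y => `|g y - g x|).
  have [mg [C HC]] := bg; split.
    by apply: measurableT_comp => //; apply: measurable_funB => //; exact: measurable_cst.
  by exists (C + C) => y; rewrite normr_id (le_trans (ler_normB _ _))// lerD.
have := H p q; move=> /(_ _ _)H1.
have {H1} : 0 <= \int[mu]_y (ind (ratr p) (ratr q) y * g y) by apply: H1; lra.
have : \int[mu]_y (ind (ratr p) (ratr q) y * g y) <=
    \int[mu]_y (ind (x - r) (x + r) y * `|g y - g x| + g x * ind (ratr p) (ratr q) y).
  apply: bcs1_integral_le; [exact: bcs1_ind_mul|apply: bcs1D; [exact: bcs1_ind_mul|]|].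
    by apply: bcs1Z; exact: bcs1_ind.
  move=> y; have := ler_norm (g y - g x); have := normr_ge0 (g y - g x).
  have := ind_ge0 (x - r) (x + r) y.
  have [/andP[y1 y2]|/ind0->] := boolP (ratr p <= y <= ratr q); last first.
    by rewrite mul0r mulr0 addr0 => *; rewrite mulr_ge0.
  by rewrite !ind1; lra.
rewrite bcs1_integralD; [|exact: bcs1_ind_mul|by apply: bcs1Z; exact: bcs1_ind].
rewrite bcs1_integralZ; last exact: bcs1_ind.
rewrite integral_ind1; last by lra.
have := Hd r r0 rd; rewrite /e => h1 h2 h3.
have : g x * (ratr q - ratr p) <= g x * (3 / 2 * r) by rewrite ler_nM2l//; lra.
have : g x * r < 0 by rewrite nmulr_rlt0.
by lra.
Qed.

Lemma continuous_snd_section (p : R * R -> R) (t : R) : continuous p ->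
  continuous (fun x : R => p (t, x)).
Proof.
move=> cp x; have /continuous2P c : {for (t, x), continuous p} := cp (t, x).
apply/cvgrPdist_le => e /c[d d0 Hd]; near=> x'; apply: Hd; first by rewrite subrr normr0.
rewrite distrC; near: x'; exact: cvgr_dist_lt.
Unshelve. all: by end_near. Qed.

Variables (a b E F : R * R -> R) (Lam Ca : R).
Hypotheses (Lam0 : 0 < Lam) (Ca0 : 0 < Ca).
Hypotheses (ma : measurable_fun setT a) (mb : measurable_fun setT b).
Hypotheses (aC : forall z, `|a z| <= Ca) (bL : forall z, `|b z| <= Lam * `|a z|).
Hypothesis a_past : forall z, z.1 <= 0 -> a z = 0.
Hypothesis cons : forall (phi pt px : R * R -> R) (tau B : R), smooth2 phi -> 0 < tau ->
  (forall z, phi z != 0 -> [/\ tau <= z.1, z.1 <= B & `|z.2| <= B]) ->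
  has_partials phi pt px -> \int[leb2]_z (a z * pt z + b z * px z) = 0.
Hypothesis init : forall (phi pt px : R * R -> R) (B : R), smooth2 phi -> (forall z, 0 <= phi z) ->
  (forall z, phi z != 0 -> `|z.1| <= B /\ `|z.2| <= B) ->
  has_partials phi pt px -> \int[leb2]_z (a z * pt z + b z * px z) <= 0.
Hypothesis (Ea : forall z, E z = `|a z|).
Hypotheses (Fb : forall z, F z * a z = E z * b z) (mF : measurable_fun setT F).
Hypothesis FL : forall z, `|F z| <= Lam * E z.
Hypothesis ent : forall (phi pt px : R * R -> R) (tau B : R),
  smooth2 phi -> (forall z, 0 <= phi z) -> 0 < tau ->
  (forall z, phi z != 0 -> [/\ tau <= z.1, z.1 <= B & `|z.2| <= B]) ->
  has_partials phi pt px -> 0 <= \int[leb2]_z (E z * pt z + F z * px z).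

Lemma bcs2_rectangle (s1 s2 x1 x2 C : R) (g : R * R -> R) : measurable_fun setT g -> 0 <= C ->
  (forall t x, s1 <= t <= s2 -> x1 <= x <= x2 -> `|g (t, x)| <= C) ->
  bcs2 (fun z => ind s1 s2 z.1 * (ind x1 x2 z.2 * g z)).
Proof.
move=> mg C0 gC; split.
  apply: measurable_funM.
    by apply: measurableT_comp; [exact: (bcs1_ind _ _).1|exact: measurable_fst].
  apply: measurable_funM => //.
  by apply: measurableT_comp; [exact: (bcs1_ind _ _).1|exact: measurable_snd].
exists C, (`|s1| + `|s2| + `|x1| + `|x2|) => -[t x] /=.
have [/andP[h1 h2]|/ind0->] := boolP (s1 <= t <= s2); last by rewrite mul0r normr0.
have [/andP[h3 h4]|/ind0->] := boolP (x1 <= x <= x2); last by rewrite mul0r mulr0 normr0.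
rewrite !ind1// !mul1r; split; first by apply: gC; apply/andP.
have := normr_ge0 x1; have := normr_ge0 x2; have := normr_ge0 s1; have := normr_ge0 s2.
have n1 : `|t| <= `|s1| + `|s2|.
  rewrite ler_norml; have := ler_norm s2; have := ler_norm (- s1); rewrite normrN.
  by have := normr_ge0 s1; have := normr_ge0 s2; move=> *; apply/andP; split; lra.
have n2 : `|x| <= `|x1| + `|x2|.
  rewrite ler_norml; have := ler_norm x2; have := ler_norm (- x1); rewrite normrN.
  by have := normr_ge0 x1; have := normr_ge0 x2; move=> *; apply/andP; split; lra.
by move=> ? ? ? ? []; lra.
Qed.

(** The integral of [Wx] over a rectangle is a time integral of increments of an almost
    nondecreasing function, and replacing [Wx] by [a] costs the gradient error. All defects are
    proportional to [De]. *)
Lemma rectangle_nonneg (s1 s2 x1 x2 : R) : 0 < s1 -> s1 < s2 -> x1 < x2 ->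
  0 <= \int[leb2]_z (ind s1 s2 z.1 * (ind x1 x2 z.2 * a z)).
Proof.
move=> s10 s12 x12; have LC : 0 < Lam * Ca by exact: mulr_gt0.
have L0 := Lam0; have C0 := Ca0.
have ba : bm2 a by split => //; exists Ca.
suff key De : 0 < De -> - ((3 * (s2 - s1) + 1) * De) <=
    \int[leb2]_z (ind s1 s2 z.1 * (ind x1 x2 z.2 * a z)).
  set I := \int[leb2]_z _ in key *; rewrite leNgt; apply/negP => I0.
  have k0 : 0 < 3 * (s2 - s1) + 1 by lra.
  have := key (- I / (2 * (3 * (s2 - s1) + 1))) _.
  have -> : - ((3 * (s2 - s1) + 1) * (- I / (2 * (3 * (s2 - s1) + 1)))) = I / 2.
    by field; rewrite gt_eqF.
  move=> h; have : I / 2 <= I by apply: h; rewrite divr_gt0 ?oppr_gt0 ?mulr_gt0.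
  by lra.
move=> De0.
pose X := `|x1| + `|x2|; have X0 : 0 <= X by rewrite addr_ge0.
(* With this choice the initial defect [4 * (Lam * Ca) * tau] is at most [De]. *)
pose tau := Num.min s1 (De / (4 * (Lam * Ca))).
have tau0 : 0 < tau by rewrite lt_min s10 divr_gt0// mulr_gt0.
have [tau1 tau2] : tau <= s1 /\ tau <= De / (4 * (Lam * Ca)).
  by have : tau <= tau by []; rewrite {2}/tau le_min => /andP[].
have t10 : 0 < tau / 2 by rewrite divr_gt0.
have tt : tau / 2 < tau by lra.
have tT : tau <= s2 by lra.
have g0 : 0 <= (1 + Lam) * Ca by rewrite mulr_ge0 ?addr_ge0 ?ltW.
have [e e0 mono] := potential_monotone Lam0 ma mb aC bL Ea Fb mF FL ent X0 t10 tt tT g0 De0.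
set L := X + 5 * Lam * (s2 + 1) in mono.
have L1 : 0 <= L by rewrite addr_ge0// mulr_ge0 ?mulr_ge0 ?ltW//; lra.
have e1 : 0 < Num.min e De by rewrite lt_min e0 De0.
have tT1 : tau <= s2 + 1 by lra.
have [W [Wt [Wx [sW HW Wg err Wi]]]] :=
  potential_exists Lam0 Ca0 ma mb aC bL a_past cons init t10 tt tT1 L1 e1.
move: err; rewrite le_min => /andP[err1 err2].
have {mono} mono : forall t, tau <= t <= s2 -> W (t, x1) - W (t, x2) <= 3 * De.
  move=> t ht; apply: (mono W Wt Wx sW HW Wg err1 _ t x1 x2 ht x12); last 2 first.
  - by rewrite lerDl.
  - by rewrite lerDr.
  move=> y1 y2 yy h1 h2; apply: (le_trans (Wi _ _ yy h1 h2)).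
  by move: tau2; rewrite ler_pdivlMr ?mulr_gt0//; lra.
have [wt [wx [swt swx Hw]]] := smooth2_partials sW.
have ewx : Wx = wx.
  by apply/funext => -[t x]; have [_ [_ <-]] := HW t x; have [_ [_ <-]] := Hw t x.
have cW t : continuous (fun x : R => Wx (t, x)).
  by rewrite ewx; exact: continuous_snd_section (smooth2_continuous swx).
have bD := bcs2_error Lam0 ma mb aC bL t10 g0 sW HW Wg.
set Dd := (fun z => _) in bD.
have bA : bcs2 (fun z => ind s1 s2 z.1 * (ind x1 x2 z.2 * a z)).
  by apply: (bcs2_rectangle (C := Ca)) => //; exact: ltW.
have box t x : s1 <= t <= s2 -> x1 <= x <= x2 -> tau / 2 <= t <= s2 + 1 /\ `|x| <= L.
  move=> /andP[h1 h2] /andP[h3 h4]; split; first by apply/andP; split; lra.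
  have xX : `|x| <= X.
    rewrite /X ler_norml; have := ler_norm x2; have := ler_norm (- x1); rewrite normrN.
    by have := normr_ge0 x1; have := normr_ge0 x2; move=> *; apply/andP; split; lra.
  by apply: (le_trans xX); rewrite lerDl mulr_ge0 ?mulr_ge0 ?ltW//; lra.
have bW : bcs2 (fun z => ind s1 s2 z.1 * (ind x1 x2 z.2 * Wx z)).
  apply: (bcs2_rectangle (C := (1 + Lam) * Ca)) => //.
    by rewrite ewx; exact: smooth2_measurable.
  by move=> t x it ix; have [h1 h2] := box t x it ix; exact: (Wg _ _ h1 h2).2.
have IW : - (3 * De) * (s2 - s1) <= \int[leb2]_z (ind s1 s2 z.1 * (ind x1 x2 z.2 * Wx z)).
  rewrite bcs2_fubini1// -(integral_ind1 (ltW s12)) -bcs1_integralZ; last exact: bcs1_ind.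
  apply: bcs1_integral_le; [apply: bcs1Z; exact: bcs1_ind|exact: bcs2_inner1 bW|move=> t].
  have [it|/ind0 it] := boolP (s1 <= t <= s2); last first.
    by rewrite it mulr0 Rintegral_eq0// => x _; rewrite mul0r.
  have -> : \int[mu]_x (ind s1 s2 (t, x).1 * (ind x1 x2 (t, x).2 * Wx (t, x))) =
      \int[mu]_x (ind x1 x2 x * Wx (t, x)).
    by apply: eq_Rintegral => x _ /=; case/andP : it => h1 h2; rewrite ind1// mul1r.
  rewrite -integral_ind (ftc_segment x12 (fun x => (HW t x).2) (cW t)).
  have -> : ind s1 s2 t = 1 by case/andP : it => h1 h2; rewrite ind1.
  have := mono t; move: it => /andP[h1 h2] h; rewrite mulr1 lerNl opprB.
  by apply: h; apply/andP; split; lra.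
have : \int[leb2]_z (ind s1 s2 z.1 * (ind x1 x2 z.2 * Wx z) - ind s1 s2 z.1 * (ind x1 x2 z.2 * a z)) <=
    \int[leb2]_z Dd z.
  apply: bcs2_integral_le => //; first exact: bcs2B.
  move=> [t x]; rewrite /Dd/=.
  have D0 : 0 <= Dd (t, x) by rewrite /Dd !mulr_ge0 ?ind_ge0 ?addr_ge0.
  have [it|/ind0->] := boolP (s1 <= t <= s2); last by rewrite !mul0r subrr.
  have [ix|/ind0->] := boolP (x1 <= x <= x2); last by rewrite !mul0r !mulr0 subrr.
  have [/andP[b1 b2] b3] := box t x it ix.
  move: it ix => /andP[h1 h2] /andP[h3 h4].
  move: b3; rewrite ler_norml => /andP[b3 b4].
  rewrite !ind1//= !mul1r; have := ler_norm (Wx (t, x) - a (t, x)).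
  by have := normr_ge0 (Wt (t, x) + b (t, x)); lra.
rewrite bcs2_integralB// -/(potential_error a b (tau / 2) (s2 + 1) L Wt Wx).
by move: IW err2; lra.
Qed.

Lemma nonneg_from_initial_data : {ae mu, forall t, 0 < t -> {ae mu, forall x, 0 <= a (t, x)}}.
Proof.
have ba (t : R) : bm1 (fun x => a (t, x)).
  by split; [exact: measurableT_comp ma (measurable_pair1 t)|exists Ca].
have key (p q : rat) : ratr p < ratr q :> R ->
    {ae mu, forall t, 0 < t -> 0 <= \int[mu]_x (ind (ratr p) (ratr q) x * a (t, x))}.
  move=> pq; apply: nonneg_from_rational_intervals.
    split.
      apply: (measurable_parametric (G := fun z => ind (ratr p) (ratr q) z.2 * a (z.1, z.2))).
      apply: measurable_funM.
        by apply: measurableT_comp; [exact: (bcs1_ind _ _).1|exact: measurable_snd].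
      by apply: measurableT_comp => //; exact: measurable_fun_pair.
    exists (Ca * (2 * (`|ratr p| + `|ratr q|))) => t.
    apply: bcs1_integral_bound; [exact: (bcs1_ind_mul _ _ (ba t)).1|exact: ltW|exact: addr_ge0| |].
      by move=> x; rewrite normrM (ger0_norm (ind_ge0 _ _ _)) -[leRHS]mul1r ler_pM ?ind_ge0 ?ind_le1.
    move=> x; rewrite ltNge => /negP h; rewrite ind0 ?mul0r//; apply/negP => /andP[h1 h2]; apply: h.
    rewrite ler_norml; have := ler_norm (ratr q : R); have := ler_norm (- (ratr p : R)); rewrite normrN.
    have := normr_ge0 (ratr p : R); have := normr_ge0 (ratr q : R).
    by move=> *; apply/andP; split; lra.
  move=> s1 s2 s10 s12; have := rectangle_nonneg s10 s12 pq.
  rewrite bcs2_fubini1; last by apply: (bcs2_rectangle (C := Ca)) => //; exact: ltW.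
  congr (_ <= _); apply: eq_Rintegral => t _ /=.
  by rewrite bcs1_integralZ//; exact: bcs1_ind_mul.
(* The pairs of rationals are enumerated by [unpickle], so that one null set of times serves for all
   of them. *)
have key2 : {ae mu, forall t, forall n,
    if (unpickle n : option (rat * rat)) is Some (p, q) then ratr p < ratr q :> R -> 0 < t ->
      0 <= \int[mu]_x (ind (ratr p) (ratr q) x * a (t, x)) else True}.
  apply: aeN => n; case: (unpickle n : option (rat * rat)) => [[p q]|]; last exact: aeW.
  have [pq|pq] := ltP (ratr p : R) (ratr q); last first.
    by apply: aeW => t; rewrite ?ltNge ?pq.
  by apply: (aeS (key p q pq)) => t h _; exact: h.
apply: (aeS key2) => t Ht t0.
have {}Ht (p q : rat) : ratr p < ratr q :> R -> 0 <= \int[mu]_x (ind (ratr p) (ratr q) x * a (t, x)).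
  by have := Ht (pickle (p, q)); rewrite pickleK => h pq; exact: h.
have H (n : nat) : {ae mu, forall x, - n%:R < x -> 0 <= a (t, x)}.
  by apply: nonneg_from_rational_intervals => // p q _; exact: Ht.
apply: (aeS (aeN H)) => x Hx.
apply: (Hx (Num.truncn `|x|).+1).
rewrite ltrNl; apply: le_lt_trans (truncnS_gt _); by rewrite -normrN ler_norm.
Qed.

End sign_from_initial_data.

(** * Lipschitz curves and generalized characteristics *)

Section rademacher.
Context {R : realType}.
Local Notation mu := (@lebesgue_measure R).

(* The Stieltjes measure of [G] is dominated by [C] times the Lebesgue measure,
   the difference being the Stieltjes measure of [C x - G x]; then Radon-Nikodym
   and the Lebesgue differentiation theorem apply. *)
Lemma lipschitz_cumulative_ae_derivable (G : R -> R) (C : R) : 0 < C -> nondecreasing G ->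
  (forall x y, x <= y -> G y - G x <= C * (y - x)) ->
  G @ -oo --> (0 : R) -> G @ +oo --> (1 : R) ->
  {ae mu, forall x, derivable G x 1}.
Proof.
move=> C0 ndG lipG G0 G1.
have cG : continuous G.
  move=> x; apply/cvgrPdist_le => e e0; near=> y.
  have hd : `|x - y| <= e / C by near: y; apply: cvgr_dist_le; rewrite ?divr_gt0.
  have [xy|yx] := leP x y.
    rewrite distrC ger0_norm ?subr_ge0 ?ndG//; apply: (le_trans (lipG _ _ xy)).
    by move: hd; rewrite distrC ger0_norm ?subr_ge0// ler_pdivlMr// mulrC.
  rewrite ger0_norm ?subr_ge0 ?ndG ?(ltW yx)//; apply: (le_trans (lipG _ _ (ltW yx))).
  by move: hd; rewrite ger0_norm ?subr_ge0 ?(ltW yx)// ler_pdivlMr// mulrC.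
pose H x := C * x - G x.
have ndH : nondecreasing H by move=> x y xy; have := lipG _ _ xy; rewrite /H; lra.
have cH : continuous H.
  by move=> x; apply: cvgB => //; [apply: cvgM; [exact: cvg_cst|exact: cvg_id]|exact: cG].
pose Gc : cumulativeBounded (0:R) (1:R) := HB.pack G
  (isCumulative.Build R _ R G ndG (right_continuousW cG)) (isCumulativeBounded.Build R 0 1 G G0 G1).
pose Hc : cumulative R R := HB.pack H (isCumulative.Build R _ R H ndH (right_continuousW cH)).
pose nuG := lebesgue_stieltjes_measure Gc.
pose nuH := lebesgue_stieltjes_measure Hc.
have nuGitv (a b : R) : a <= b -> nuG `]a, b]%classic = (G b - G a)%:E.
  move=> ab; rewrite /nuG /lebesgue_stieltjes_measure/= /measure_extension measurable_mu_extE/=; last exact: is_ocitv.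
  by rewrite wlength_itv_bnd.
have nuHitv (a b : R) : a <= b -> nuH `]a, b]%classic = (H b - H a)%:E.
  move=> ab; rewrite /nuH /lebesgue_stieltjes_measure/= /measure_extension measurable_mu_extE/=; last exact: is_ocitv.
  by rewrite wlength_itv_bnd.
have Ci0 : 0 <= C^-1 by rewrite invr_ge0 ltW.
pose nu := mscale (NngNum Ci0) (measure_add nuG nuH).
have nuE A : nu A = (C^-1%:E * (nuG A + nuH A))%E.
  by rewrite /nu /mscale/=; congr (_ * _)%E; exact: (measure_addE nuG nuH A).
have munu (A : set R) : measurable A -> nu A = mu A.
  move=> mA; apply/esym.
  apply: (@lebesgue_measure_unique R nu _ A mA) => _ [[a b] _ <-]/=.
  have [ab|ba] := leP a b; last by rewrite set_itv_ge ?bnd_simp -?leNgt ?ltW// !measure0.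
  rewrite -/nu nuE nuGitv// nuHitv// -EFinD -EFinM lebesgue_measure_itv/= lte_fin.
  case: ltP => h; congr (_%:E); rewrite /H; first by field; rewrite gt_eqF.
  have -> : a = b by apply/eqP; rewrite eq_le ab h.
  by rewrite !subrr addr0 mulr0.
have fin (A : set R) : measurable A -> nuG A \is a fin_num by move=> mA; exact: fin_num_measure.
have dom : nuG `<< mu.
  move=> A nA B mB BA; have := munu B mB; rewrite nA// => /eqP.
  rewrite nuE mule_eq0 gt_eqF ?lte_fin ?invr_gt0//= padde_eq0//.
  by case/andP => /eqP.
have [f [f0 ffin intf fE]] := @radon_nikodym_sigma_finite _ _ R mu nuG dom.
pose g := fine \o f.
have intg : mu.-integrable setT (EFin \o g).
  by rewrite (_ : EFin \o g = f)//; apply/funext => x /=; rewrite fineK.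
have := @FTC1Ny R g.
move=> /(_ _ _)H1.
pose F (y : R) : R := \int[mu]_(t in `]-oo, y]%classic) g t.
have {}H1 : {ae mu, forall x : R, derivable F x 1}.
  apply: (aeS (H1 _ _)) => [y| |x [] //]; first exact: (integrableS measurableT).
  have -> : g = g \_ setT by apply/funext => y; rewrite patchE in_setT.
  exact: (integrable_locally measurableT intg).
apply: (aeS H1) => x.
have FE y : F y = fine (nuG `]-oo, y]%classic).
  transitivity (fine (\int[mu]_(t in `]-oo, y]%classic) f t)%E).
    by congr fine; apply: eq_integral => z _; rewrite /g/= fineK.
  by congr fine; symmetry; exact: (fE `]-oo, y]%classic (measurable_itv _)).
have mU (A B : set R) : measurable A -> measurable B -> A `&` B = set0 ->
    nuG (A `|` B) = (nuG A + nuG B)%E by move=> *; exact: measureU.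
have inc (y z : R) : y <= z -> F z = F y + (G z - G y).
  move=> yz; rewrite !FE (_ : `]-oo, z]%classic = `]-oo, y] `|` `]y, z]).
    rewrite mU//; last first.
      apply/seteqP; split => // w /= []; rewrite !in_itv/= => wy /andP[yw _].
      by move: yw; rewrite ltNge wy.
    rewrite fineD ?fin//; congr (_ + _); exact: (congr1 fine (nuGitv y z yz)).
  by rewrite (@itv_bndbnd_setU _ _ -oo%O (BRight y) (BRight z)).
have GF y : G y = F y + (G 0 - F 0).
  by have [y0|y0] := leP y 0; [have := inc _ _ y0|have := inc _ _ (ltW y0)]; lra.
move=> dF.
rewrite (_ : G = F + cst (G 0 - F 0)); last by apply/funext => y; rewrite GF.
by apply: derivableD => //; exact: derivable_cst.
Unshelve. all: by end_near. Qed.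

(** On ]-N, N[, a linear term makes [h] nondecreasing; freezing it outside and normalising gives a
    cumulative function with limits 0 and 1. The derivative of [h] is recovered by undoing the
    affine change. *)
Lemma lipschitz_ae_derivable (h : R -> R) (L : R) :
  (forall x y, `|h x - h y| <= L * `|x - y|) -> {ae mu, forall x, derivable h x 1}.
Proof.
move=> hL; suff H (n : nat) : {ae mu, forall x : R, - n.+1%:R < x < n.+1%:R -> derivable h x 1}.
  apply: (aeS (aeN H)) => x Hx; apply: (Hx (Num.truncn `|x|)).
  by rewrite -ltr_norml truncnS_gt.
have L0 : 0 <= L by have := hL 1 0; rewrite subr0 normr1 mulr1; apply: le_trans.
set N : R := n.+1%:R; have N0 : 0 < N by [].
pose cl (t : R) := Num.max (- N) (Num.min t N).
have clN t : t <= - N -> cl t = - N.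
  by move=> h1; rewrite /cl min_l ?max_l//; lra.
have clP t : N <= t -> cl t = N.
  by move=> h1; rewrite /cl min_r ?max_r//; lra.
have cl1 t : - N <= t -> t <= N -> cl t = t.
  by move=> h1 h2; rewrite /cl min_l ?max_r.
have cl_lip x y : x <= y -> cl x <= cl y /\ cl y - cl x <= y - x.
  move=> xy; have [x1|x1] := leP x (- N).
    rewrite (clN x)//; have [y1|y1] := leP y (- N); first by rewrite (clN y)//; split; lra.
    have [y2|y2] := leP y N; first by rewrite (cl1 y (ltW y1) y2); split; lra.
    by rewrite (clP y (ltW y2)); split; lra.
  have [x2|x2] := leP x N; last first.
    by rewrite (clP x (ltW x2)) (clP y (le_trans (ltW x2) xy)); split; lra.
  rewrite (cl1 x (ltW x1) x2).
  have [y2|y2] := leP y N; first by rewrite (cl1 y (le_trans (ltW x1) xy) y2); split; lra.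
  by rewrite (clP y (ltW y2)); split; lra.
(* Any slope above [L] makes the sum nondecreasing; the surplus ensures [D > 0]. *)
pose K := 2 * (L + 1).
pose D := h N - h (- N) + K * (N + N).
have D0 : 0 < D.
  have := hL N (- N); rewrite opprK (ger0_norm (_ : 0 <= N + N)); last by lra.
  rewrite ler_norml /D /K => /andP[h1 _]; have := mulr_ge0 L0 (ltW N0); lra.
pose G t := (h (cl t) - h (- N) + K * (cl t + N)) / D.
have GE x y : G y - G x = (h (cl y) - h (cl x) + K * (cl y - cl x)) / D.
  by rewrite /G -mulrBl; congr (_ / _); ring.
have hcl x y : x <= y -> `|h (cl y) - h (cl x)| <= L * (cl y - cl x).
  move=> /cl_lip[h1 _]; have := hL (cl y) (cl x).
  by rewrite (ger0_norm (_ : 0 <= cl y - cl x)) ?subr_ge0.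
have ndG : nondecreasing G.
  move=> x y xy; rewrite -subr_ge0 GE divr_ge0 ?(ltW D0)//.
  have := hcl _ _ xy; rewrite ler_norml => /andP[h1 _].
  have [h2 _] := cl_lip _ _ xy; have : 0 <= L * (cl y - cl x) by rewrite mulr_ge0 ?subr_ge0.
  rewrite /K; lra.
have C0 : 0 < (L + K) / D by rewrite divr_gt0// /K; lra.
have lipG x y : x <= y -> G y - G x <= (L + K) / D * (y - x).
  move=> xy; rewrite GE [leRHS]mulrAC; apply: ler_wpM2r; first by rewrite invr_ge0 ltW.
  have := hcl _ _ xy; rewrite ler_norml => /andP[_ h1].
  have [h2 h3] := cl_lip _ _ xy.
  have : (L + K) * (cl y - cl x) <= (L + K) * (y - x) by rewrite ler_wpM2l// /K; lra.
  lra.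
have G0 : G @ -oo --> (0 : R).
  apply/cvgrPdist_le => e e0; near=> t.
  have : t <= - N by near: t; apply: nbhs_ninfty_le; exact: num_real.
  by move=> /clN ec; rewrite /G ec subrr addNr mulr0 addr0 mul0r subrr normr0 ltW.
have G1 : G @ +oo --> (1 : R).
  apply/cvgrPdist_le => e e0; near=> t.
  have : N <= t by near: t; apply: nbhs_pinfty_ge; exact: num_real.
  by move=> /clP ec; rewrite /G ec -/D divff ?gt_eqF// subrr normr0 ltW.
apply: (aeS (lipschitz_cumulative_ae_derivable C0 ndG lipG G0 G1)) => x dG /andP[x1 x2].
have hG : is_derive x 1 G ('D_1 G x) by exact: DeriveDef.
have h1 := is_deriveB (is_deriveZ D hG) (is_deriveZ K (is_derive_id x (1:R))).
have h2 := is_deriveD h1 (is_derive_cst (h (- N) - K * N) x 1).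
apply: (@ex_derive _ _ _ _ _ _ _ (near_eq_is_derive _ h2)); near=> y.
have y1 : - N < y by near: y; exact: lt_nbhsr.
have y2 : y < N by near: y; exact: lt_nbhsl.
change (D * G y - K * y + (h (- N) - K * N) = h y).
by rewrite /G (cl1 y (ltW y1) (ltW y2)); field; rewrite gt_eqF.
Unshelve. all: by end_near. Qed.

End rademacher.

(** * Filippov curves from Euler polygons *)

Section filippov.
Context {R : realType}.
Local Notation mu := (@lebesgue_measure R).

(** Tychonoff's theorem on the product of the segments [- B t, B t]. Instead of a convergent
    subsequence it gives a cluster point, approached infinitely often at any finitely many times. *)
Lemma pointwise_cluster (X : nat -> R -> R) (B : R -> R) : (forall n t, `|X n t| <= B t) ->
  exists h : R -> R, forall (s : seq R) (e : R) (N0 : nat), 0 < e ->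
    exists2 n, (N0 <= n)%N & forall t, t \in s -> `|X n t - h t| <= e.
Proof.
move=> XB.
pose A := [set f : (forall t : R, R) | forall t, `[- B t, B t]%classic (f t)].
have cA : compact (A : set (prod_topology (fun _ : R => R))).
  apply: (@tychonoff R (fun _ => R) (fun t => `[- B t, B t]%classic)) => t.
  exact: segment_compact.
pose F : set_system (prod_topology (fun _ : R => R)) := X @ \oo.
have FA : F A.
  by exists 0%N => // n _ t /=; rewrite in_itv/= -ler_norml.
have PF : ProperFilter F by exact: fmap_proper_filter.
have [h [_ Fh]] := cA F PF FA.
exists h => s e N0 e0.
pose nb : set_system (prod_topology (fun _ : R => R)) := nbhs (h : prod_topology (fun _ : R => R)).
have Fnb : Filter nb by exact: nbhs_filter.
have nQ : nb [set f | forall t, t \in s -> `|f t - h t| <= e].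
  elim: s => [|t s IH].
    by rewrite (_ : [set f | _] = setT); [exact: filterT|apply/seteqP; split].
  have nt : nb [set f | `|f t - h t| <= e].
    have H := @proj_continuous R (fun _ => R) t h.
    apply: (H [set y | `|y - h t| <= e]).
    by apply/nbhs_ballP; exists e => // y yh; change (`|y - h t| <= e); rewrite distrC; exact: ltW yh.
  apply: (filterS _ (filterI nt IH)) => f [/= f1 f2] u; rewrite inE => /orP[/eqP->//|]; exact: f2.
have [] := Fh [set f | exists2 n, (N0 <= n)%N & f = X n] _ _ nQ.
  by exists N0 => // n /= Nn; exists n.
by move=> f [/= [n Nn ->] H]; exists n.
Unshelve. all: by end_near. Qed.

Lemma integral_ind_add (g : R -> R) (a b c : R) : bm1 g -> a <= b -> b <= c ->
  \int[mu]_t (ind a c t * g t) = \int[mu]_t (ind a b t * g t) + \int[mu]_t (ind b c t * g t).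
Proof.
move=> bg ab bc; have bi p q : bcs1 (fun t => ind p q t * g t) by exact: bcs1_ind_mul.
rewrite -bcs1_integralD//; apply: ae_eq_Rintegral => //.
- by have [] := bi a c.
- by have [] := bcs1D (bi a b) (bi b c).
apply: (@negligibleS _ _ _ mu [set b]); last first.
  by exists [set b]; split => //; exact: lebesgue_measure_set1.
move=> t /= nt; apply: contrapT => tb; apply: nt => _.
have {}tb : t != b by apply/eqP.
rewrite /ind; case: (ltgtP t b) tb => // tb _.
  by rewrite (ltW (lt_le_trans tb bc)) andbT /= mul0r addr0.
by rewrite (le_trans ab (ltW tb))/= mul0r add0r.
Qed.

Lemma integral_ind_bound (g : R -> R) (C a b : R) : measurable_fun setT g -> (forall t, `|g t| <= C) ->
  a <= b -> `|\int[mu]_t (ind a b t * g t)| <= C * (b - a).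
Proof.
move=> mg gC ab; have bg : bm1 g by split => //; exists C.
have bi := bcs1_ind_mul a b bg; apply: (le_trans (bcs1_integral_norm bi)).
rewrite -(integral_ind1 ab) -bcs1_integralZ; last exact: bcs1_ind.
apply: bcs1_integral_le; [exact: bcs1_norm|apply: bcs1Z; exact: bcs1_ind|move=> t].
by rewrite normrM (ger0_norm (ind_ge0 _ _ _)) mulrC ler_wpM2r ?ind_ge0.
Qed.

Section euler.
Variables (b : R * R -> R) (Lam tbar x0 : R).
Hypotheses (Lam0 : 0 < Lam) (mb : measurable_fun setT b) (bC : forall z, `|b z| <= Lam).

(** The mean of [b] over a square of side [d], multiplied by [d]: the displacement during one time
    step, insensitive to null sets. *)
Definition rect_mean (b : R * R -> R) (d s c : R) :=
  d^-1 * \int[leb2]_z (ind s (s + d) z.1 * (ind c (c + d) z.2 * b z)).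

Fixpoint euler (d : R) (j : nat) : R :=
  if j is i.+1 then euler d i + rect_mean b d (tbar + i%:R * d) (euler d i) else x0.

Lemma rect_mean_upper (g : R * R -> R) (be : R -> R) (C d s c : R) : measurable_fun setT g ->
  (forall z, `|g z| <= C) -> bm1 be -> 0 < d ->
  {ae mu, forall t, s <= t <= s + d -> {ae mu, forall x, c <= x <= c + d -> g (t, x) <= be t}} ->
  rect_mean g d s c <= \int[mu]_t (ind s (s + d) t * be t).
Proof.
move=> mg gC bbe d0 H; have C0 : 0 <= C := le_trans (normr_ge0 _) (gC 0).
have br : bcs2 (fun z => ind s (s + d) z.1 * (ind c (c + d) z.2 * g z)).
  exact: (bcs2_rectangle (C := C)).
rewrite /rect_mean bcs2_fubini1// ler_pdivrMl// -bcs1_integralZ; last exact: bcs1_ind_mul.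
apply: bcs1_integral_ae_le; [exact: bcs2_inner1 br|by apply: bcs1Z; exact: bcs1_ind_mul|].
apply: (aeS H) => t Ht.
have [it|/ind0 it] := boolP (s <= t <= s + d); last first.
  by rewrite it mul0r mulr0 Rintegral_eq0// => x _; rewrite mul0r.
have i1 : ind s (s + d) t = 1 by case/andP : it => ? ?; rewrite ind1.
rewrite [X in _ <= d * X](_ : _ = be t); last by rewrite i1 mul1r.
have -> : d * be t = \int[mu]_x (be t * ind c (c + d) x).
  rewrite bcs1_integralZ; last exact: bcs1_ind.
  by rewrite integral_ind1; [ring|lra].
apply: bcs1_integral_ae_le; [exact: (bcs2_fst t br)|by apply: bcs1Z; exact: bcs1_ind|].
apply: (aeS (Ht it)) => x Hx /=; rewrite i1 mul1r.
have [ix|/ind0->] := boolP (c <= x <= c + d); last by rewrite mul0r mulr0.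
by rewrite mulrC ler_wpM2r ?ind_ge0// Hx.
Qed.

Lemma rect_meanZ (k d s c : R) : rect_mean (fun z => k * b z) d s c = k * rect_mean b d s c.
Proof.
have br : bcs2 (fun z => ind s (s + d) z.1 * (ind c (c + d) z.2 * b z)).
  by apply: (bcs2_rectangle (C := Lam)) => //; exact: ltW.
rewrite /rect_mean mulrCA -(bcs2_integralZ k br).
by congr (_ * _); apply: eq_Rintegral => z _; ring.
Qed.

Lemma rect_mean_bound (d s c : R) : 0 < d -> `|rect_mean b d s c| <= Lam * d.
Proof.
move=> d0; have L0 := ltW Lam0.
have up (k : R) : `|k| <= 1 -> k * rect_mean b d s c <= Lam * d.
  move=> k1; rewrite -rect_meanZ; apply: (@le_trans _ _ (\int[mu]_t (ind s (s + d) t * (cst Lam) t))).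
    apply: (rect_mean_upper (C := Lam)) => //.
    - by apply: measurable_funM => //; exact: measurable_cst.
    - by move=> z; rewrite normrM -[leRHS]mul1r ler_pM.
    - exact: bm1_cst.
    - apply: aeW => t _; apply: aeW => x _; apply: (le_trans (ler_norm _)).
      by rewrite normrM -[leRHS]mul1r ler_pM.
  under eq_Rintegral do rewrite mulrC.
  rewrite bcs1_integralZ; last exact: bcs1_ind.
  by rewrite integral_ind1; lra.
rewrite ler_norml; apply/andP; split.
  by have := up (-1); rewrite normrN normr1 => /(_ (lexx _)); lra.
by have := up 1; rewrite normr1 => /(_ (lexx _)); lra.
Qed.

Lemma euler_lipschitz (d : R) (i j : nat) : 0 < d -> (i <= j)%N ->
  `|euler d j - euler d i| <= Lam * d * (j%:R - i%:R).
Proof.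
move=> d0; elim: j => [|j IH].
  by rewrite leqn0 => /eqP->; rewrite !subrr normr0 mulr0.
rewrite leq_eqVlt => /orP[/eqP->|]; first by rewrite !subrr normr0 mulr0.
rewrite ltnS => /IH{}IH; rewrite /= addrAC; apply: (le_trans (ler_normD _ _)).
have := rect_mean_bound (tbar + j%:R * d) (euler d j) d0; rewrite -natr1; lra.
Qed.

(** Constant on each time step. As [truncn] is 0 on negative numbers, the path stays at [x0] before
    [tbar]. *)
Definition euler_path (n : nat) (t : R) : R :=
  euler n.+1%:R^-1 (Num.truncn ((t - tbar) / n.+1%:R^-1)).

Lemma truncn_diff (p q : R) : p <= q ->
  (Num.truncn p <= Num.truncn q)%N /\ (Num.truncn q)%:R - (Num.truncn p)%:R <= q - p + 1.
Proof.
move=> pq; split; first exact: le_truncn.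
have := truncnS_gt p; rewrite -natr1 => p1.
have [q0|q0] := leP 0 q.
  have : (Num.truncn q)%:R <= q by rewrite truncn_le.
  lra.
have [-> ->] : Num.truncn p = 0%N /\ Num.truncn q = 0%N.
  by split; apply/eqP; rewrite -leqn0 leqNgt truncn_gt0 -ltNge; lra.
by rewrite subrr; lra.
Qed.

Lemma euler_path_lipschitz (n : nat) (t t' : R) :
  `|euler_path n t - euler_path n t'| <= Lam * (`|t - t'| + n.+1%:R^-1).
Proof.
wlog tt : t t' / t' <= t.
  move=> H; have [h|h] := leP t' t; first exact: H.
  by rewrite distrC [`|t - _|]distrC; apply: H; exact: ltW.
set d : R := n.+1%:R^-1; have d0 : 0 < d by rewrite invr_gt0.
have le_d : (t' - tbar) / d <= (t - tbar) / d by rewrite ler_pM2r ?invr_gt0// lerD2r.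
have [h1 h2] := truncn_diff le_d.
rewrite /euler_path -/d; apply: (le_trans (euler_lipschitz d0 h1)).
rewrite ger0_norm ?subr_ge0// -mulrA ler_pM2l//.
have -> : t - t' + d = d * ((t - tbar) / d - (t' - tbar) / d + 1) by field; rewrite gt_eqF.
exact: ler_wpM2l (ltW d0) _ _ h2.
Qed.

Lemma euler_path_bound (n : nat) (t : R) : `|euler_path n t| <= `|x0| + Lam * (`|t - tbar| + 1).
Proof.
have := euler_path_lipschitz n t tbar.
have -> : euler_path n tbar = x0 by rewrite /euler_path subrr mul0r truncn0.
have : Lam * (`|t - tbar| + n.+1%:R^-1) <= Lam * (`|t - tbar| + 1).
  by rewrite ler_pM2l// lerD2l invf_le1// ler1n.
have := ler_normD (euler_path n t - x0) x0; rewrite subrK.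
by move: (n.+1%:R^-1 : R) => d; lra.
Qed.

Lemma euler_sum_upper (k : R) (be : R -> R) (d : R) (i j : nat) : `|k| <= 1 -> bm1 be -> 0 < d ->
  (i <= j)%N ->
  (forall l, (i <= l < j)%N -> {ae mu, forall t, tbar + l%:R * d <= t <= tbar + l%:R * d + d ->
    {ae mu, forall x, euler d l <= x <= euler d l + d -> k * b (t, x) <= be t}}) ->
  k * (euler d j - euler d i) <= \int[mu]_t (ind (tbar + i%:R * d) (tbar + j%:R * d) t * be t).
Proof.
move=> k1 bbe d0; elim: j => [|j IH].
  rewrite leqn0 => /eqP-> _; have [mbe [C HC]] := bbe.
  have := integral_ind_bound mbe HC (lexx (tbar + 0%:R * d)).
  by rewrite !subrr !mulr0 normr_le0 => /eqP->.
rewrite leq_eqVlt => /orP[/eqP<- _|].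
  have [mbe [C HC]] := bbe.
  have := integral_ind_bound mbe HC (lexx (tbar + i%:R * d)).
  by rewrite !subrr !mulr0 normr_le0 => /eqP->.
rewrite ltnS => ij H; have Sj : j.+1%:R = j%:R + 1 :> R by rewrite natr1.
have t2 : tbar + j.+1%:R * d = tbar + j%:R * d + d by rewrite Sj; ring.
rewrite (integral_ind_add bbe (b := tbar + j%:R * d)); last 2 first.
- by rewrite lerD2l ler_pM2r// ler_nat.
- by rewrite t2 lerDl ltW.
have -> : k * (euler d j.+1 - euler d i) = k * (euler d j - euler d i) +
    k * rect_mean b d (tbar + j%:R * d) (euler d j) by rewrite /=; ring.
rewrite lerD//.
  by apply: IH => // l /andP[l1 l2]; apply: H; rewrite l1 ltnS ltnW.
rewrite t2 -rect_meanZ; apply: (rect_mean_upper (C := Lam)) => //.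
- by apply: measurable_funM => //; exact: measurable_cst.
- by move=> z; rewrite normrM -[leRHS]mul1r ler_pM.
- by apply: H; rewrite ij ltnSn.
Qed.

(** A bound of [k * b] near the limit curve applies to the squares visited by a polygon close to it;
    summing the displacements and letting the approximation improve gives the bound for [h]. The
    cases k = 1 and k = -1 enclose the speed. *)
Lemma euler_limit_upper (h : R -> R) (k : R) (be : R -> R) (s s' rho : R) :
  (forall (l : seq R) (e : R) (N0 : nat), 0 < e ->
    exists2 n, (N0 <= n)%N & forall t, t \in l -> `|euler_path n t - h t| <= e) ->
  (forall x y, `|h x - h y| <= Lam * `|x - y|) ->
  `|k| <= 1 -> bm1 be -> tbar <= s -> s < s' -> 0 < rho ->
  {ae mu, forall t, s <= t <= s' -> {ae mu, forall x, `|x - h t| < rho -> k * b (t, x) <= be t}} ->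
  k * (h s' - h s) <= \int[mu]_t (ind s s' t * be t).
Proof.
move=> cl hL k1 bbe ts ss rho0 H; have [mbe [C HC]] := bbe; have L0 := Lam0.
have C0 : 0 <= C := le_trans (normr_ge0 _) (HC 0).
(* A point of a visited square is within [(4 * Lam + 2) * e] of the curve: [e] for the square,
   [(3 * Lam + 1) * e] between polygon and curve, [Lam * e] for the motion of the curve in one
   step. *)
suff key e : 0 < e -> e <= 1 -> (4 * Lam + 2) * e < rho ->
    k * (h s' - h s) <= \int[mu]_t (ind s s' t * be t) + (Lam + 2 * C + 2) * e.
  set I := \int[mu]_t _ in key *; rewrite leNgt; apply/negP => lt.
  have K0 : 0 < Lam + 2 * C + 2 by lra.
  have K1 : 0 < 4 * Lam + 2 by lra.
  pose e := Num.min 1 (Num.min (rho / (2 * (4 * Lam + 2)))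
    ((k * (h s' - h s) - I) / (2 * (Lam + 2 * C + 2)))).
  have g0 : 0 < (k * (h s' - h s) - I) / (2 * (Lam + 2 * C + 2)).
    by rewrite divr_gt0 ?mulr_gt0// subr_gt0.
  have g1 : 0 < rho / (2 * (4 * Lam + 2)) by rewrite divr_gt0// mulr_gt0.
  have e0 : 0 < e by rewrite !lt_min ltr01 g0 g1.
  have [e1 e2 e3] : [/\ e <= 1, e <= rho / (2 * (4 * Lam + 2)) &
      e <= (k * (h s' - h s) - I) / (2 * (Lam + 2 * C + 2))].
    by have : e <= e by []; rewrite {2}/e !le_min => /and3P[].
  move: e2 e3; rewrite !ler_pdivlMr ?mulr_gt0// => e2 e3.
  have := key e e0 e1; lra.
move=> e0 e1 er.
(* The polygon is close to [h] only at finitely many times; a net of mesh [e] and the Lipschitz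
   bounds extend this to all of [s, s']. *)
pose net := s :: s' :: [seq s + i%:R * e | i <- iota 0 (Num.truncn ((s' - s) / e)).+1].
have [N0 N0e] : exists N0 : nat, forall n, (N0 <= n)%N -> n.+1%:R^-1 <= e.
  have := near_infty_natSinv_lt (PosNum e0) => -[N0 _ HN]; exists N0 => n Nn.
  exact: ltW (HN n Nn).
have [n Nn Hn] := cl net e N0 e0.
have {N0e Nn} := N0e n Nn.
have : 0 < n.+1%:R^-1 :> R by rewrite invr_gt0.
have := euler_path_lipschitz n; rewrite /euler_path; move: Hn; rewrite /euler_path.
set d : R := n.+1%:R^-1 => Hn XL d0 de.
pose J (t : R) := Num.truncn ((t - tbar) / d).
have near_h t : s <= t <= s' -> `|euler d (J t) - h t| <= (3 * Lam + 1) * e.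
  move=> /andP[t1 t2]; pose i := Num.truncn ((t - s) / e).
  have i1 : i%:R * e <= t - s.
    by rewrite -ler_pdivlMr// truncn_le divr_ge0 ?(ltW e0)// subr_ge0.
  have i2 : t - s < i.+1%:R * e by rewrite -ltr_pdivrMr//; exact: truncnS_gt.
  have im : s + i%:R * e \in net.
    rewrite /net 2!in_cons; apply/orP; right; apply/orP; right.
    apply: (map_f (fun i : nat => s + i%:R * e)); rewrite mem_iota add0n /= ltnS; apply: (truncn_diff _).1.
    by rewrite ler_pM2r ?invr_gt0// lerD2r.
  have ti : `|t - (s + i%:R * e)| <= e.
    by rewrite ger0_norm; move: i2; rewrite -natr1; lra.
  have h1 := Hn _ im; have h2 := XL t (s + i%:R * e); have h3 := hL (s + i%:R * e) t.
  have h4 : Lam * (`|t - (s + i%:R * e)| + d) <= Lam * (e + e) by rewrite ler_pM2l// lerD.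
  have h5 : Lam * `|s + i%:R * e - t| <= Lam * e by rewrite ler_pM2l// distrC.
  rewrite -/(J _) -/(J _) in h1 h2.
  have -> : euler d (J t) - h t = (euler d (J t) - euler d (J (s + i%:R * e))) +
    (euler d (J (s + i%:R * e)) - h (s + i%:R * e)) + (h (s + i%:R * e) - h t) by ring.
  apply: (le_trans (ler_normD _ _)).
  have := ler_normD (euler d (J t) - euler d (J (s + i%:R * e)))
    (euler d (J (s + i%:R * e)) - h (s + i%:R * e)).
  lra.
have hs : `|euler d (J s) - h s| <= e by apply: Hn; rewrite mem_head.
have hs' : `|euler d (J s') - h s'| <= e by apply: Hn; rewrite !inE eqxx orbT.
have kle (x c : R) : `|x| <= c -> k * x <= c.
  move=> xc; apply: (le_trans (ler_norm _)); rewrite normrM -[leRHS]mul1r.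
  by rewrite ler_pM.
have JB (t : R) : tbar <= t -> (J t)%:R * d <= t - tbar /\ t - tbar < (J t).+1%:R * d.
  move=> tt; split; last by rewrite -ltr_pdivrMr//; exact: truncnS_gt.
  by rewrite -ler_pdivlMr// truncn_le divr_ge0 ?(ltW d0)// subr_ge0.
have [a1 a2] := JB s ts; have [b1 b2] := JB s' (le_trans ts (ltW ss)).
have IB a c := integral_ind_bound (a := a) (b := c) mbe HC.
(* Complete steps inside [s, s'] are summed. The incomplete first step costs [Lam * d], and the
   parts of the integral left at both ends cost [C * d] each. *)
have main : k * (euler d (J s') - euler d (J s)) <=
    \int[mu]_t (ind s s' t * be t) + Lam * d + 2 * C * d.
  have le_d : (s - tbar) / d <= (s' - tbar) / d by rewrite ler_pM2r ?invr_gt0// lerD2r ltW.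
  have [ij _] := truncn_diff le_d; rewrite -/(J s) -/(J s') in ij.
  move: ij; rewrite leq_eqVlt => /orP[/eqP ij|ij].
    rewrite -ij subrr mulr0; rewrite -ij in b1 b2.
    have := IB s s' (ltW ss); rewrite ler_norml => /andP[h1 _].
    have : C * (s' - s) <= C * d by rewrite ler_wpM2l//; move: b2; rewrite -natr1; lra.
    have : 0 <= Lam * d by rewrite mulr_ge0 ?ltW.
    by have := mulr_ge0 C0 (ltW d0); lra.
  have Sn (i : nat) : i.+1%:R = i%:R + 1 :> R by rewrite natr1.
  rewrite !Sn in a2 b2.
  have pq : tbar + (J s).+1%:R * d <= tbar + (J s')%:R * d by rewrite lerD2l ler_pM2r// ler_nat.
  have sp : s <= tbar + (J s).+1%:R * d by rewrite Sn; lra.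
  have qs : tbar + (J s')%:R * d <= s' by lra.
  have -> : k * (euler d (J s') - euler d (J s)) = k * (euler d (J s') - euler d (J s).+1) +
    k * (euler d (J s).+1 - euler d (J s)) by ring.
  have st1 : k * (euler d (J s).+1 - euler d (J s)) <= Lam * d.
    apply: kle; have := euler_lipschitz d0 (leqnSn (J s)).
    by rewrite Sn (_ : (J s)%:R + 1 - (J s)%:R = 1 :> R) ?mulr1//; ring.
  have st2 : k * (euler d (J s') - euler d (J s).+1) <=
      \int[mu]_t (ind (tbar + (J s).+1%:R * d) (tbar + (J s')%:R * d) t * be t).
    apply: euler_sum_upper => // l /andP[l1 l2].
    have tl1 : s <= tbar + l%:R * d.
      by apply: (le_trans sp); rewrite lerD2l ler_pM2r// ler_nat.
    have tl2 : tbar + l%:R * d + d <= s'.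
      apply: le_trans qs; have -> : tbar + l%:R * d + d = tbar + l.+1%:R * d by rewrite Sn; ring.
      by rewrite lerD2l ler_pM2r// ler_nat.
    apply: (aeS H) => t Ht /andP[t1 t2].
    have it : s <= t <= s' by apply/andP; split; lra.
    apply: (aeS (Ht it)) => x Hx /andP[x1 x2]; apply: Hx.
    have Jl : J (tbar + l%:R * d) = l.
      rewrite /J (_ : (tbar + l%:R * d - tbar) / d = l%:R) ?natrK//.
      by field; rewrite gt_eqF.
    have il : s <= tbar + l%:R * d <= s' by apply/andP; split; lra.
    have := near_h _ il; rewrite Jl => n1.
    have := hL (tbar + l%:R * d) t => n2.
    have n3 : Lam * `|tbar + l%:R * d - t| <= Lam * e.
      by rewrite ler_pM2l// distrC ger0_norm; lra.
    have n4 : `|x - euler d l| <= e by rewrite ger0_norm; lra.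
    apply: le_lt_trans er.
    have -> : x - h t = (x - euler d l) + (euler d l - h (tbar + l%:R * d)) +
      (h (tbar + l%:R * d) - h t) by ring.
    apply: (le_trans (ler_normD _ _)).
    have := ler_normD (x - euler d l) (euler d l - h (tbar + l%:R * d)); lra.
  have ad1 := integral_ind_add bbe sp (le_trans pq qs).
  have ad2 := integral_ind_add bbe pq qs.
  have := IB _ _ sp; have := IB _ _ qs; rewrite !ler_norml => /andP[u1 _] /andP[u2 _].
  have : C * (tbar + (J s).+1%:R * d - s) <= C * d by rewrite ler_wpM2l// Sn; lra.
  have : C * (s' - (tbar + (J s')%:R * d)) <= C * d by rewrite ler_wpM2l//; lra.
  move: u1 u2 ad1 ad2 st1 st2; lra.
have -> : k * (h s' - h s) = k * (euler d (J s') - euler d (J s)) +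
  k * (euler d (J s) - h s) + - (k * (euler d (J s') - h s')) by ring.
have := kle _ _ hs; have := kle (- (euler d (J s') - h s')) e; rewrite normrN mulrN => /(_ hs').
have : Lam * d <= Lam * e by rewrite ler_pM2l.
have : C * d <= C * e by rewrite ler_wpM2l.
by lra.
Qed.

Lemma filippov_curve : exists h : R -> R,
  [/\ forall x y, `|h x - h y| <= Lam * `|x - y|, forall t, t <= tbar -> h t = x0 &
    forall (k : R) (be : R -> R) (s s' rho : R), `|k| <= 1 -> bm1 be -> tbar <= s -> s < s' ->
      0 < rho ->
      {ae mu, forall t, s <= t <= s' -> {ae mu, forall x, `|x - h t| < rho -> k * b (t, x) <= be t}} ->
      k * (h s' - h s) <= \int[mu]_t (ind s s' t * be t)].
Proof.
have [h cl] := pointwise_cluster euler_path_bound; have L0 := Lam0.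
have hL x y : `|h x - h y| <= Lam * `|x - y|.
  rewrite leNgt; apply/negP => lt; pose e := (`|h x - h y| - Lam * `|x - y|) / (Lam + 3).
  have L3 : 0 < Lam + 3 by lra.
  have e0 : 0 < e by rewrite divr_gt0// subr_gt0.
  have [n0 n0e] : exists n0, n0.+1%:R^-1 < e.
    by have [k0 _ Hk] := near_infty_natSinv_lt (PosNum e0); exists k0; apply: Hk => /=.
  have [n nn Hn] := cl [:: x; y] e n0 e0.
  have nx := Hn x (mem_head _ _); have ny : `|euler_path n y - h y| <= e by apply: Hn; rewrite !inE eqxx orbT.
  have nde : n.+1%:R^-1 <= e.
    by apply: ltW (le_lt_trans _ n0e); rewrite lef_pV2 ?posrE// ler_nat ltnS.
  have lip := euler_path_lipschitz n x y.
  have : Lam * (`|x - y| + n.+1%:R^-1) <= Lam * (`|x - y| + e) by rewrite ler_pM2l// lerD2l.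
  have E : `|h x - h y| = Lam * `|x - y| + e * (Lam + 3).
    by rewrite /e divfK ?gt_eqF//; ring.
  have : `|h x - h y| <= `|euler_path n x - euler_path n y| + `|euler_path n x - h x| + `|euler_path n y - h y|.
    have -> : h x - h y = (euler_path n x - euler_path n y) - (euler_path n x - h x) +
      (euler_path n y - h y) by ring.
    by apply: (le_trans (ler_normD _ _)); rewrite lerD2r; exact: ler_normB.
  move: lip nx ny; rewrite E; clear - e0; move: (n.+1%:R^-1 : R) => d; lra.
exists h; split => //; last by move=> k be s s' rho *; exact: (@euler_limit_upper h k be s s' rho).
move=> t tt; apply/eqP; rewrite -subr_eq0 -normr_le0; apply/ler_addgt0Pr => e e0; rewrite add0r.
have [n _ /(_ t (mem_head _ _))] := cl [:: t] e 0%N e0.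
suff -> : euler_path n t = x0 by rewrite distrC.
have le0 : (t - tbar) / n.+1%:R^-1 <= 0 by rewrite pmulr_lle0 ?invr_gt0 ?invr_gt0//; lra.
have t0 : Num.truncn ((t - tbar) / n.+1%:R^-1) = 0%N.
  by apply/eqP; rewrite -leqn0 leqNgt truncn_gt0 -ltNge (le_lt_trans le0).
by rewrite /euler_path t0.
Qed.

End euler.
End filippov.

(** * Traces along a curve *)

Section traces_and_speed.
Context {R : realType}.
Local Notation mu := (@lebesgue_measure R).
Implicit Types (h wm wp be : R -> R).

Lemma lipschitz_measurable (V : R -> R) (L : R) : (forall x y, `|V x - V y| <= L * `|x - y|) ->
  measurable_fun setT V.
Proof.
move=> VL; apply: continuous_measurable_fun => x; apply/cvgrPdist_le => e e0.
have L1 : 0 < `|L| + 1 by rewrite ltr_wpDl.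
near=> y; apply: (le_trans (VL x y)).
have xy : `|x - y| <= e / (`|L| + 1) by near: y; apply: cvgr_dist_le; rewrite ?divr_gt0.
apply: (@le_trans _ _ ((`|L| + 1) * `|x - y|)).
  by rewrite ler_wpM2r// (le_trans (ler_norm _))// lerDl.
by rewrite mulrC -ler_pdivlMr.
Unshelve. all: by end_near. Qed.

Lemma difference_quotient_upper h be (k s t : R) : bm1 be -> lebesgue_at be t ->
  is_derive t 1 h s -> `|k| <= 1 ->
  (forall r, 0 < r -> k * (h (t + r) - h t) <= \int[mu]_x (ind t (t + r) x * be x)) ->
  k * s <= be t.
Proof.
move=> bbe lb hs k1 H; apply/ler_addgt0Pr => e e0.
have e2 : 0 < e / 2 by rewrite divr_gt0.
have [dh hsE] := hs.
have := derivable_nbhs dh; rewrite /= hsE => /eqaddoP/(_ _ e2)[d /= d0 Hd].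
have [d' d'0 Hd'] := lb _ e2.
pose r := Num.min d d' / 2; have m0 : 0 < Num.min d d' by rewrite lt_min d0.
have r0 : 0 < r by rewrite divr_gt0.
have [rd rd'] : r < d /\ r < d'.
  have : Num.min d d' <= d by rewrite ge_min lexx.
  have : Num.min d d' <= d' by rewrite ge_min lexx orbT.
  by rewrite /r; split; lra.
have q1 : `|h (t + r) - h t - r * s| <= e / 2 * r.
  have := Hd r; rewrite /= sub0r normrN (gtr0_norm r0) => /(_ rd); rewrite !fctE /=.
  have -> : r%:A + t = t + r by rewrite [_%:A]mulr1 addrC.
  by rewrite opprD addrA.
have bI p q : bcs1 (fun x => ind p q x * be x) by exact: bcs1_ind_mul.
have bA : bcs1 (fun x => ind (t - r) (t + r) x * `|be x - be t|).
  move: bbe => [mk [C HC]]; apply: bcs1M; [exact: bcs1_ind|split].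
    by apply: measurableT_comp => //; apply: measurable_funB => //; exact: measurable_cst.
  by exists (C + C) => x; rewrite normr_id (le_trans (ler_normB _ _))// lerD.
have q2 : \int[mu]_x (ind t (t + r) x * be x) <= be t * r + e / 2 * r.
  apply: (@le_trans _ _ (\int[mu]_x (be t * ind t (t + r) x + ind (t - r) (t + r) x * `|be x - be t|))).
    apply: bcs1_integral_le => //; first by apply: bcs1D => //; apply: bcs1Z; exact: bcs1_ind.
    move=> x; have := ler_norm (be x - be t); have := normr_ge0 (be x - be t).
    rewrite /ind; case: (boolP (t <= x <= t + r)) => [/andP[x1 x2]|_].
      rewrite (_ : (t - r <= x <= t + r)%R = true) ?mul1r ?mulr1; first lra.
      by apply/andP; split => //; lra.
    by rewrite mul0r mulr0 add0r => *; rewrite mulr_ge0.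
  rewrite bcs1_integralD//; last by apply: bcs1Z; exact: bcs1_ind.
  rewrite bcs1_integralZ; last exact: bcs1_ind.
  rewrite integral_ind1; last lra.
  by have := Hd' r r0 rd'; lra.
have q3 := H r r0.
have q4 : k * (r * s) - k * (h (t + r) - h t) <= e / 2 * r.
  have -> : k * (r * s) - k * (h (t + r) - h t) = - k * (h (t + r) - h t - r * s) by ring.
  apply: (le_trans (ler_norm _)); rewrite normrM normrN -[leRHS]mul1r.
  exact: ler_pM.
rewrite -(ler_pM2l r0); have -> : r * (k * s) = k * (r * s) by ring.
by lra.
Qed.

(** Each one-sided strip has positive width, so it contains positions where [v] is both in [k, M]
    and within [g n t] of the trace. *)
Lemma traces_in_segment (v : R * R -> R) h wm wp (g : nat -> R -> R) (k M : R) :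
  strip_traces v h wm wp g -> {ae mu, forall t, 0 < t -> {ae mu, forall x, k <= v (t, x) <= M}} ->
  {ae mu, forall t, 0 < t -> k <= wm t <= M /\ k <= wp t <= M}.
Proof.
move=> st; have [_ _ _ _ H] := st; move=> vk.
apply: (aeS (aeI (aeI H vk) (strip_traces_vanishing st))) => t [[H1 H2] H3] t0.
have near (w : R) (P : R -> Prop) : (forall n, ~ {ae mu, forall x, ~ (`|x - h t| < n.+1%:R^-1 /\ P x)}) ->
    (forall n, {ae mu, forall x, `|x - h t| < n.+1%:R^-1 -> P x -> `|v (t, x) - w| <= g n t}) ->
    k <= w <= M.
  move=> nP Hw.
  have {}H e : 0 < e -> k <= w + e /\ w <= M + e.
    move=> /(H3 t0)[n gn]; apply: contrapT => bad; apply: (nP n).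
    apply: (aeS (aeI (Hw n) (H2 t0))) => x [h1 h2] [h3 h4]; apply: bad.
    by have := h1 h3 h4; rewrite ler_norml => /andP[]; move: h2 => /andP[]; split; lra.
  by apply/andP; split; apply/ler_addgt0Pr => e /H[].
have pos (a b : R) : a < b -> ~ {ae mu, forall x, ~ (a < x < b)}.
  move=> ab [N [mN N0 sub]]; have : (mu `]a, b[%classic <= mu N)%E.
    apply: le_measure; rewrite ?inE//.
    by move=> x /=; rewrite in_itv/= => xab; apply: sub => /=; apply.
  by rewrite N0 lebesgue_measure_itv/= lte_fin ab -EFinB lee_fin; lra.
split.
- apply: (near (wm t) (fun x => x < h t)) => n.
    apply: contra_not (pos (h t - n.+1%:R^-1) (h t) _); last by rewrite gtrBl invr_gt0.
    move=> nH; apply: (aeS nH) => x nx /andP[x1 x2]; apply: nx.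
    by move: x1; move: (n.+1%:R^-1 : R) => d x1; split => //; rewrite ltr_norml; apply/andP; split; lra.
  by apply: (aeS (H1 t0 n)) => x Hx h1 h2; exact: (Hx h1).2.
- apply: (near (wp t) (fun x => h t < x)) => n.
    apply: contra_not (pos (h t) (h t + n.+1%:R^-1) _); last by rewrite ltrDl invr_gt0.
    move=> nH; apply: (aeS nH) => x nx /andP[x1 x2]; apply: nx.
    by move: x2; move: (n.+1%:R^-1 : R) => d x2; split => //; rewrite ltr_norml; apply/andP; split; lra.
  by apply: (aeS (H1 t0 n)) => x Hx h1 h2; exact: (Hx h1).1.
Qed.

(** Inside a strip, [k * V (v)] is at most the maximum at the traces plus [L * g n]. The Filippov
    inequality with this bound is differentiated at a Lebesgue point, and then [n] is chosen with
    [g n t] small. *)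
Lemma speed_upper (v : R * R -> R) (V : R -> R) h wm wp (g : nat -> R -> R) (k L Lam tbar : R) :
  strip_traces v h wm wp g -> `|k| <= 1 -> 0 <= L -> 0 <= tbar ->
  (forall x y, `|V x - V y| <= L * `|x - y|) -> (forall x, `|V x| <= Lam) ->
  (forall be (s s' rho : R), bm1 be -> tbar <= s -> s < s' -> 0 < rho ->
    {ae mu, forall t, s <= t <= s' -> {ae mu, forall x, `|x - h t| < rho -> k * V (v (t, x)) <= be t}} ->
    k * (h s' - h s) <= \int[mu]_t (ind s s' t * be t)) ->
  {ae mu, forall t, tbar < t -> forall s, is_derive t 1 h s ->
    k * s <= Num.max (k * V (wm t)) (k * V (wp t))}.
Proof.
move=> st k1 L0 tb0 VL VC Hh; have [[mwm _] [mwp _] bg _ H] := st.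
have mV := lipschitz_measurable VL.
pose be n t := Num.max (k * V (wm t)) (k * V (wp t)) + L * g n t.
have kV x : `|k * V x| <= Lam by rewrite normrM -[leRHS]mul1r ler_pM.
have bbe n : bm1 (be n).
  have [[mg [C HC]] _] := bg n; split.
    apply: measurable_funD; last by apply: measurable_funM => //; exact: measurable_cst.
    by apply: measurable_maxr; apply: measurable_funM; do ?exact: measurable_cst; exact: measurableT_comp.
  exists (Lam + L * C) => t; rewrite (le_trans (ler_normD _ _))// lerD//.
    by case: (leP (k * V (wm t)) (k * V (wp t))) => _; exact: kV.
  by rewrite normrM (ger0_norm L0) ler_wpM2l.
have lb : {ae mu, forall t, forall n, lebesgue_at (be n) t}.
  by apply: aeN => n; exact: lebesgue_points (bbe n).
have nh (t : R) : {ae mu, forall x, x != h t}.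
  exists [set h t]; split => //; first exact: lebesgue_measure_set1.
  by move=> x /= /negP; rewrite negbK => /eqP.
have kd x y : k * V x <= k * V y + L * `|x - y|.
  have : k * (V x - V y) <= L * `|x - y|.
    apply: (le_trans (ler_norm _)); rewrite normrM -[leRHS]mul1r.
    exact: ler_pM.
  by rewrite mulrBr; lra.
apply: (aeS (aeI lb (strip_traces_vanishing st))) => t [Ht1 Ht2] tt s hs.
have key n : k * s <= be n t.
  apply: (difference_quotient_upper (bbe n) (Ht1 n) hs k1) => r r0.
  have n0 : (0 : R) < n.+1%:R^-1 by rewrite invr_gt0.
  apply: (Hh _ _ _ n.+1%:R^-1) => //; [exact: ltW|by rewrite ltrDl|].
  apply: (aeS H) => t' Ht' /andP[t1 t2]; have t'0 : 0 < t' by lra.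
  apply: (aeS (aeI (Ht' t'0 n) (nh t'))) => x [Hx nx] xr.
  have [h1 h2] := Hx xr; rewrite /be; move: nx; rewrite neq_lt => /orP[/h2|/h1] d.
    apply: (le_trans (kd _ (wm t'))); apply: lerD; last by rewrite ler_wpM2l.
    by rewrite le_max lexx.
  apply: (le_trans (kd _ (wp t'))); apply: lerD; last by rewrite ler_wpM2l.
  by rewrite le_max lexx orbT.
apply/ler_addgt0Pr => e e0; have L1 : 0 < L + 1 by rewrite ltr_wpDl.
have t0 : 0 < t by lra.
have [n gn] := Ht2 t0 (e / (L + 1)) (divr_gt0 e0 L1).
apply: (le_trans (key n)); rewrite /be lerD2l.
apply: (@le_trans _ _ ((L + 1) * g n t)); first by rewrite ler_wpM2r ?(bg n).2// lerDl.
by rewrite mulrC -ler_pdivlMr// ltW.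
Qed.

Lemma speed_between_traces (v : R * R -> R) (V : R -> R) h wm wp (g : nat -> R -> R) (L Lam tbar : R) :
  strip_traces v h wm wp g -> 0 <= L -> 0 <= tbar ->
  (forall x y, `|V x - V y| <= L * `|x - y|) -> (forall x, `|V x| <= Lam) ->
  (forall (k : R) be (s s' rho : R), `|k| <= 1 -> bm1 be -> tbar <= s -> s < s' -> 0 < rho ->
    {ae mu, forall t, s <= t <= s' -> {ae mu, forall x, `|x - h t| < rho -> k * V (v (t, x)) <= be t}} ->
    k * (h s' - h s) <= \int[mu]_t (ind s s' t * be t)) ->
  {ae mu, forall t, tbar < t -> forall s, is_derive t 1 h s ->
    Num.min (V (wm t)) (V (wp t)) <= s <= Num.max (V (wm t)) (V (wp t))}.
Proof.
move=> st L0 tb0 VL VC Hh.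
have u1 := speed_upper (k := 1) st _ L0 tb0 VL VC (fun be s s' rho => Hh 1 be s s' rho _).
have u2 := speed_upper (k := -1) st _ L0 tb0 VL VC (fun be s s' rho => Hh (-1) be s s' rho _).
rewrite normrN normr1 lexx in u1 u2.
apply: (aeS (aeI (u1 isT isT) (u2 isT isT))) => t [h1 h2] tt s hs.
have := h1 tt s hs; have := h2 tt s hs; rewrite !mul1r !mulN1r => a1 a2.
by rewrite a2 andbT -lerN2 oppr_min.
Qed.

End traces_and_speed.

(** * From the strong trace property to measurable strip bounds *)

Section strip_traces_of_traces.
Context {R : realType}.
Local Notation mu := (@lebesgue_measure R).

(* No measurability is assumed: the integral of a nonnegative function is a
   supremum over the simple functions below it. *)
Lemma ge0_integral_homo (D D' : set R) (f f' : R -> \bar R) :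
  (forall x, 0 <= (f \_ D) x)%E -> (forall x, (f \_ D) x <= (f' \_ D') x)%E ->
  (\int[mu]_(x in D) f x <= \int[mu]_(x in D') f' x)%E.
Proof.
move=> f0 ff; rewrite integral_mkcond [leRHS]integral_mkcond.
rewrite ge0_integralE; last by move=> x _; exact: f0.
rewrite ge0_integralE; last by move=> x _; exact: le_trans (f0 x) (ff x).
rewrite !patch_setT; apply: le_ereal_sup => _ [p pf <-]; exists p => // x.
exact: le_trans (pf x) (ff x).
Qed.

Lemma lebesgue_measure_setT_gt0 : (0 < mu [set: R])%E.
Proof.
apply: (@lt_le_trans _ _ (mu `[0, 1]%classic)).
  by rewrite lebesgue_measure_itv/= lte_fin ltr01 -EFinB subr0 lte_fin ltr01.
by apply: le_measure; rewrite ?inE//; exact: measurable_itv.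
Qed.

(** The essential supremum exceeds a level exactly at the times where the section of the superlevel
    set has positive measure, and the measure of sections is measurable. *)
Lemma ess_sup_sections (k : R * R -> R) (K : R) : measurable_fun setT k ->
  (forall z, 0 <= k z <= K) -> exists s : R -> R,
  [/\ bm1 s, forall t, 0 <= s t & forall t, ess_sup mu (fun y => (k (t, y))%:E) = (s t)%:E].
Proof.
move=> mk kK; pose S t := ess_sup mu (fun y => (k (t, y))%:E).
have S0 t : (0 <= S t)%E.
  apply: ess_sup_gee; first exact: lebesgue_measure_setT_gt0.
  by apply: nearW => y; rewrite lee_fin; case/andP : (kK (t, y)).
have SK t : (S t <= K%:E)%E.
  by apply/ess_supP; apply: nearW => y; rewrite lee_fin; case/andP : (kK (t, y)).
have Sf t : (fine (S t))%:E = S t.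
  by rewrite fineK// ge0_fin_numE// (le_lt_trans (SK t)) ?ltry.
exists (fun t => fine (S t)); split; last first.
- by move=> t; rewrite Sf.
- by move=> t; exact: fine_ge0.
split; last first.
  exists K => t; rewrite ger0_norm; last exact: fine_ge0.
  by rewrite -lee_fin Sf.
apply: (measurability (@RGenOInfty.G R)); first exact: RGenOInfty.measurableE.
move=> _ [_ [r ->] <-]; rewrite setTI.
pose A := k @^-1` `]r, +oo[.
have mA : measurable A by rewrite /A -[_ @^-1` _]setTI; exact: mk.
rewrite (_ : _ @^-1` _ = (fun t => mu (xsection A t)) @^-1` (~` [set 0%E])).
  rewrite -[_ @^-1` _]setTI; apply: measurable_fun_xsection => //.
  exact: measurableC.
have mkt t : measurable_fun setT (fun y => (k (t, y))%:E).
  by apply/measurable_EFinP; exact: measurableT_comp mk (measurable_pair1 t).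
have key t : (fine (S t) <= r) <-> mu (xsection A t) = 0%E.
  have <- : (fun y => (k (t, y))%:E) @^-1` `]r%:E, +oo[ = xsection A t.
    apply/seteqP; split => y /=; rewrite /xsection /A /= !in_itv/= !andbT lte_fin.
      by move=> h; rewrite inE/= in_itv/= h.
    by rewrite inE/= in_itv/= andbT.
  have [h1 h2] := @ae_le_measureP _ _ R mu (fun y => (k (t, y))%:E) r%:E (mkt t).
  by rewrite -lee_fin Sf; split=> [/ess_supP//|/h2 h]; exact/ess_supP.
apply/seteqP; split => t /=; rewrite in_itv/= andbT.
  by move=> h /(key t).2; rewrite leNgt h.
by move=> h; rewrite ltNge; apply/negP => /(key t).1.
Qed.

(** [u] is replaced by its representative [v] and the trace is extended by 0 to negative times. The
    essential suprema become measurable in time, and at almost every positive time they agree with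
    those of the trace property. *)
Lemma one_sided_trace_bound (u v : R * R -> R) (h w : R -> R) (I : nat -> set R) (M : R) :
  measurable_fun setT v -> (forall z, `|v z| <= M) -> measurable_fun setT h ->
  {ae mu, forall t, 0 < t -> {ae mu, forall x, u (t, x) = v (t, x)}} ->
  (forall n, measurable (I n)) -> one_sided_trace u h 0 w I ->
  exists g : nat -> R -> R, [/\ bm1 (w \_ `[0, +oo[%classic),
    forall n, bm1 (g n) /\ forall t, 0 <= g n t,
    forall T : R, \int[mu]_t (ind 0 T t * g n t) @[n --> \oo] --> (0 : R) &
    {ae mu, forall t, 0 < t -> forall n, {ae mu, forall x, I n (x - h t) ->
      `|v (t, x) - w t| <= g n t}}].
Proof.
move=> mv vM mh uv mI [mw [C wC] cv].
set w' := w \_ _; have w'E t : 0 <= t -> w' t = w t.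
  by move=> t0; rewrite /w' patchE ifT// inE/= in_itv/= t0.
have bw : bm1 w'.
  split; first by apply/(measurable_restrictT _ _).1 => //; exact: measurable_itv.
  exists `|C| => t; rewrite /w' patchE; case: ifPn => [|_]; last by rewrite normr0.
  by rewrite inE/= in_itv/= andbT => /wC h1; apply: (le_trans h1); exact: ler_norm.
have [mw' [C' wC']] := bw.
pose k n (z : R * R) := `|v (z.1, h z.1 + z.2) - w' z.1| * \1_(I n) z.2.
have mk n : measurable_fun setT (k n).
  apply: measurable_funM.
    apply: measurableT_comp => //; apply: measurable_funB; last exact: measurableT_comp.
    apply: measurableT_comp => //; apply: measurable_fun_pair => //.
    by apply: measurable_funD => //; exact: measurableT_comp.
  by apply: measurableT_comp => //; exact: measurable_indic.
have kK n z : 0 <= k n z <= M + C'.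
  rewrite /k; have h1 : `|v (z.1, h z.1 + z.2) - w' z.1| <= M + C'.
    by rewrite (le_trans (ler_normB _ _))// lerD.
  have h0 := normr_ge0 (v (z.1, h z.1 + z.2) - w' z.1).
  by rewrite indicE; case: (_ \in _); rewrite ?mulr1 ?mulr0 ?h0 ?h1 ?lexx//= (le_trans h0).
have [g Hg] := choice (fun n => ess_sup_sections (mk n) (kK n)).
have g_le n t : {ae mu, forall y, k n (t, y) <= g n t}.
  have [_ _ /(_ t) e] := Hg n.
  apply: (aeS (ess_sup_ge mu (fun y => (k n (t, y))%:E))) => y.
  by rewrite e lee_fin.
exists g; split => //; first by move=> n; have [] := Hg n.
- move=> T; have [T0|T0] := leP T 0.
    rewrite (_ : (fun n => _) = cst 0); first exact: cvg_cst.
    apply/funext => n; have [[mg [D gD]] g0 _] := Hg n; have [T00|T00] := eqVneq T 0.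
      have := integral_ind_bound mg gD (lexx (0 : R)); rewrite T00 subrr mulr0 normr_le0.
      by move/eqP.
    apply: Rintegral_eq0 => t _; rewrite ind0 ?mul0r//; apply/negP => /andP[t0 tT].
    by have := lt_neqAle T 0; rewrite T00 T0 /=; lra.
  set G := fun n t => ess_sup mu ((fun y => `|u (t, h t + y) - w t|%:E) \_ (I n)) in cv.
  have G0 n t : (0 <= G n t)%E.
    apply: ess_sup_gee; first exact: lebesgue_measure_setT_gt0.
    by apply: nearW => y; rewrite patchE; case: ifP.
  have Gg n : {ae mu, forall t, 0 < t -> G n t = (g n t)%:E}.
    apply: (aeS uv) => t Ht t0; have [_ _ <-] := Hg n; apply: eq_ess_sup.
    apply: (aeS (ae_translation (h t) (Ht t0))) => y e.
    rewrite patchE /k /= indicE w'E ?(ltW t0)// (addrC (h t)) e.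
    by case: (y \in I n); rewrite ?mulr1 ?mulr0.
  have le_n n : (\int[mu]_(t in `[0%R, T]) (g n t)%:E <= \int[mu]_(t in `[0%R, T]) G n t)%E.
    have [[mg _] g0 _] := Hg n; have [N [mN N0 sub]] := Gg n.
    (* The suprema are compared at positive times only, so time 0 joins the exceptional set. *)
    pose N' := N `|` [set 0].
    have mN' : measurable N' by exact: measurableU.
    have N'0 : mu N' = 0%E.
      by apply: null_set_setU => //; exact: lebesgue_measure_set1.
    rewrite (ae_eq_integral (((fun t => (g n t)%:E) \_ (~` N'))))//; first last.
    - exists N'; split => // t /= nt; apply: contrapT => nN; apply: nt => _.
      by rewrite patchE ifT// inE.
    - apply: (measurable_funS measurableT) => //.
      apply/(measurable_restrictT _ _).1; first exact: measurableC.
      by apply: (measurable_funS measurableT) => //; exact/measurable_EFinP.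
    - by apply: (measurable_funS measurableT) => //; exact/measurable_EFinP.
    apply: ge0_integral_homo => t; rewrite !patchE.
      by case: ifP => //; case: ifP => // _ _; rewrite lee_fin.
    case: ifPn => // /set_mem/=; rewrite in_itv/= => /andP[t0 _]; case: ifPn => // /set_mem nN.
    rewrite -(_ : G n t = (g n t)%:E)//; apply: contrapT => ne; apply: (nN); left; apply: sub => /=.
    move=> H; apply: ne; apply: H; rewrite lt_neqAle t0 andbT; apply/negP => /eqP e0.
    by apply: nN; right.
  have cvg0 : (\int[mu]_(t in `[0%R, T]) (g n t)%:E)%E @[n --> \oo] --> 0%E.
    apply: (squeeze_cvge _ (cvg_cst 0%E) (cv T T0)); apply: nearW => n; rewrite le_n andbT.
    by apply: integral_ge0 => t _; rewrite lee_fin; have [_ ->] := Hg n.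
  rewrite (_ : (fun n => _) = fun n => fine (\int[mu]_(t in `[0%R, T]) (g n t)%:E)).
    exact: fine_cvg cvg0.
  by apply/funext => n; rewrite -integral_ind.
- apply: aeW => t t0 n.
  apply: (aeS (ae_translation (- h t) (g_le n t))) => x; rewrite /k/= => Hx xI.
  by move: Hx; rewrite (addrC (h t)) subrK w'E ?(ltW t0)// indicE mem_set// mulr1.
Qed.

Lemma strip_traces_of_traces (u v : R * R -> R) (h um up : R -> R) (M : R) :
  measurable_fun setT v -> (forall z, `|v z| <= M) -> measurable_fun setT h ->
  {ae mu, forall t, 0 < t -> {ae mu, forall x, u (t, x) = v (t, x)}} ->
  traces u h 0 um up ->
  exists g, strip_traces v h (um \_ `[0, +oo[%classic) (up \_ `[0, +oo[%classic) g.
Proof.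
move=> mv vM mh uv [tm tp].
have [gm [bm bgm cm hm]] := one_sided_trace_bound mv vM mh uv (fun n => measurable_itv _) tm.
have [gp [bp bgp cp hp]] := one_sided_trace_bound mv vM mh uv (fun n => measurable_itv _) tp.
exists (fun n t => gm n t + gp n t); split => //.
- move=> n; have [[m1 [C1 H1]] p1] := bgm n; have [[m2 [C2 H2]] p2] := bgp n.
  split; last by move=> t; exact: addr_ge0.
  split; first exact: measurable_funD.
  by exists (C1 + C2) => t; rewrite (le_trans (ler_normD _ _))// lerD.
- move=> T; have := cvgD (cm T) (cp T); rewrite addr0 => cmp.
  rewrite (_ : (fun n => _) = fun n => \int[mu]_t (ind 0 T t * gm n t) + \int[mu]_t (ind 0 T t * gp n t)); first exact: cmp.
  apply/funext => n; rewrite -bcs1_integralD.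
  + by apply: eq_Rintegral => t _; rewrite mulrDr.
  + exact: bcs1_ind_mul (bgm n).1.
  + exact: bcs1_ind_mul (bgp n).1.
apply: (aeS (aeI hm hp)) => t [h1 h2] t0 n.
have wE (w : R -> R) : (w \_ `[0, +oo[%classic) t = w t by rewrite patchE ifT// inE/= in_itv/= ltW.
apply: (aeS (aeI (h1 t0 n) (h2 t0 n))) => x [a1 a2]; rewrite ltr_norml => /andP[x1 x2]; split => hx.
- rewrite wE; apply: (@le_trans _ _ (gp n t)); last by rewrite lerDr; exact: (bgm n).2.
  by apply: a2; rewrite /= in_itv/= subr_gt0 hx.
- rewrite wE; apply: (@le_trans _ _ (gm n t)); last by rewrite lerDl; exact: (bgp n).2.
  by apply: a1; rewrite /= in_itv/= x1 subr_lt0.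
Qed.

Lemma one_sided_trace_restrict (u : R * R -> R) (h w : R -> R) (I : nat -> set R) (tbar : R) :
  0 <= tbar -> one_sided_trace u h 0 w I -> one_sided_trace u h tbar w I.
Proof.
move=> tb0 [mw [C wC] cv]; split.
- by apply: measurable_funS mw => // t /=; rewrite !in_itv/= !andbT; exact: le_trans.
- by exists C => t tt; apply: wC; exact: le_trans tt.
move=> T tT; have T0 : 0 < T by exact: le_lt_trans tT.
pose G n t := ess_sup mu ((fun y => `|u (t, h t + y) - w t|%:E) \_ (I n)).
have G0 n t : (0 <= G n t)%E.
  apply: ess_sup_gee; first exact: lebesgue_measure_setT_gt0.
  by apply: nearW => y; rewrite patchE; case: ifP.
apply: (squeeze_cvge _ (cvg_cst 0%E) (cv T T0)); apply: nearW => n; apply/andP; split.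
  by apply: integral_ge0 => t _; exact: G0.
apply: (@ge0_integral_homo _ _ (G n) (G n)) => t; rewrite !patchE.
  by case: ifP => // _; exact: G0.
case: ifPn => [/set_mem/=|_]; last by case: ifP => // _; exact: G0.
rewrite in_itv/= => /andP[t1 t2]; rewrite ifT// inE/= in_itv/= t2 andbT.
exact: le_trans t1.
Qed.

End strip_traces_of_traces.

(** * Bounded representatives and the initial value *)

Section representatives.
Context {R : realType}.
Local Notation mu := (@lebesgue_measure R).
Local Notation leb2 := (@leb2 R).

Lemma measurable_half_plane : measurable (half_plane : set (R * R)).
Proof.
rewrite /half_plane -[X in measurable X]setTI.
have -> : [set z : R * R | 0 < z.1] = fst @^-1` `]0, +oo[%classic.
  by apply/seteqP; split => z /=; rewrite in_itv/= andbT.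
by apply: measurable_fst => //; exact: measurable_itv.
Qed.

(** Truncation makes the bound valid everywhere, and the value [k] at nonpositive times makes
    [v - k] and [f v - f k] vanish in the past. *)
Definition bounded_rep (M k : R) (u : R * R -> R) (z : R * R) : R :=
  if 0 < z.1 then Num.max (- M) (Num.min M (u z)) else k.

Lemma bounded_rep_measurable (M k : R) (u : R * R -> R) : measurable_fun half_plane u ->
  measurable_fun setT (bounded_rep M k u).
Proof.
move=> mu_; have mh := measurable_half_plane.
pose w := u \_ half_plane.
have mw : measurable_fun setT w by exact/(measurable_restrictT _ _).1.
have -> : bounded_rep M k u =
    fun z => k + \1_half_plane z * (Num.max (- M) (Num.min M (w z)) - k).
  apply/funext => z; rewrite /bounded_rep /w patchE indicE.
  have -> : (z \in half_plane) = (0 < z.1) by apply/idP/idP; rewrite inE.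
  by case: ifP; rewrite ?mul1r ?mul0r ?addr0// addrC subrK.
apply: measurable_funD; first exact: measurable_cst.
apply: measurable_funM; first exact: measurable_indic.
apply: measurable_funB; last exact: measurable_cst.
apply: measurable_maxr; first exact: measurable_cst.
by apply: measurable_minr => //; exact: measurable_cst.
Qed.

Lemma bounded_rep_bound (M k : R) (u : R * R -> R) z : `|k| <= M -> `|bounded_rep M k u z| <= M.
Proof.
move=> kM; have M0 : 0 <= M := le_trans (normr_ge0 _) kM.
rewrite /bounded_rep; case: ifP => // _; rewrite ler_norml le_max lexx/= ge_max ge_min lexx/= andbT.
by lra.
Qed.

Lemma bounded_rep_ae (M M' k : R) (u : R * R -> R) : M <= M' -> Linfty M u ->
  {ae leb2, forall z, half_plane z -> u z = bounded_rep M' k u z}.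
Proof.
move=> MM [_ H]; apply: (aeS H) => z Hz z0; have /andP[h1 h2] := Hz z0.
rewrite /bounded_rep (_ : 0 < z.1)// min_r; last exact: le_trans h2 MM.
by rewrite max_r// (le_trans _ h1)// lerN2.
Qed.

Lemma partials_measurable (s : seq bool) (phi : R * R -> R) : test_function phi ->
  measurable_fun setT (partials s phi).
Proof.
move=> [sm _]; apply: continuous2_measurable => z.
by apply: differentiable_continuous; exact: sm.
Qed.

Lemma pairing_ae (E F : R -> R) (u v phi : R * R -> R) : measurable_fun setT E ->
  measurable_fun setT F -> measurable_fun half_plane u -> measurable_fun setT v ->
  {ae leb2, forall z, half_plane z -> u z = v z} -> test_function phi ->
  pairing E F u phi = pairing E F v phi.
Proof.
move=> mE mF mu_ mv uv tphi; have mh := measurable_half_plane.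
have mt : measurable_fun half_plane (dt phi).
  exact: (measurable_funS measurableT _ (partials_measurable [:: true] tphi)).
have mx : measurable_fun half_plane (dx phi).
  exact: (measurable_funS measurableT _ (partials_measurable [:: false] tphi)).
have m (w : R * R -> R) : measurable_fun half_plane w ->
    measurable_fun half_plane (fun z => E (w z) * dt phi z + F (w z) * dx phi z).
  by move=> mw; apply: measurable_funD; apply: measurable_funM => //; exact: measurableT_comp.
apply: ae_eq_Rintegral => //; first exact: m.
  by apply: m; apply: (measurable_funS measurableT _ mv).
by apply: (aeS uv) => z H z0; rewrite H.
Qed.

Lemma entropic_ae (E F : R -> R) (u v : R * R -> R) : measurable_fun setT E ->
  measurable_fun setT F -> measurable_fun half_plane u -> measurable_fun setT v ->
  {ae leb2, forall z, half_plane z -> u z = v z} -> entropic E F u -> entropic E F v.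
Proof.
by move=> mE mF mu_ mv uv H phi t p s; rewrite -(pairing_ae mE mF mu_ mv uv t); exact: H.
Qed.

(** Valid for every function, as [fine] sends both infinite values to 0. *)
Lemma RintegralN d (T : measurableType d) (nu : {measure set T -> \bar R}) (D : set T) (g : T -> R) :
  \int[nu]_(x in D) (- g x) = - \int[nu]_(x in D) g x.
Proof.
rewrite /Rintegral integralE [in RHS]integralE.
rewrite (_ : (fun x => (- g x)%:E) = \- (EFin \o g))%E; last by apply/funext.
rewrite funeposN funenegN.
by case: integral => [r| |]; case: integral => [s| |] //=; rewrite ?opprB ?oppr0.
Qed.

(** The equation as a pair of entropy inequalities, so that the jump inequality applied to both
    gives the Rankine-Hugoniot equality. *)
Lemma weak_entropic (f : R -> R) (u : R * R -> R) : weak_solution f u ->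
  entropic id f u /\ entropic (fun x => - x) (fun x => - f x) u.
Proof.
move=> H; split => phi t p s; first by rewrite H.
rewrite (_ : pairing _ _ _ _ = \int[leb2]_(z in half_plane) (- (u z * dt phi z + f (u z) * dx phi z))).
  by rewrite RintegralN -/(pairing id f u phi) H ?oppr0.
by apply: eq_Rintegral => z _; ring.
Qed.

Let pos (z : R * R) : R := \1_half_plane z.

Lemma bm2_half_plane : bm2 pos.
Proof.
split; first by apply: measurable_indic; exact: measurable_half_plane.
by exists 1 => z; rewrite /pos indicE; case: (_ \in _); rewrite ?normr1 ?normr0.
Qed.

Lemma posE (t x : R) : pos (t, x) = ((0 < t)%R : nat)%:R.
Proof. by rewrite /pos indicE; congr (nat_of_bool _)%:R; apply/idP/idP; rewrite inE. Qed.

Lemma integral_half_plane (g : R * R -> R) : \int[leb2]_(z in half_plane) g z = \int[leb2]_z (pos z * g z).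
Proof.
rewrite Rintegral_mkcond; apply: eq_Rintegral => z _.
by rewrite patchE /pos indicE; case: ifP; rewrite ?mul1r ?mul0r.
Qed.

Section box_supported.
Variables (phi pt px : R * R -> R) (B : R).
Hypotheses (sp : smooth2 phi) (H : has_partials phi pt px).
Hypothesis supp : forall z, phi z != 0 -> `|z.1| <= B /\ `|z.2| <= B.

Let E : exists pt' px', [/\ smooth2 pt', smooth2 px', pt = pt' & px = px'].
Proof.
have [pt' [px' [spt spx Hp]]] := smooth2_partials sp; exists pt', px'; split => //.
  by apply/funext => -[t y]; have [[_ <-] _] := H t y; have [[_ <-] _] := Hp t y.
by apply/funext => -[t y]; have [_ [_ <-]] := H t y; have [_ [_ <-]] := Hp t y.
Qed.

Let partials0 z : ~ (`|z.1| <= B /\ `|z.2| <= B) -> pt z = 0 /\ px z = 0.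
Proof.
move=> nz; apply: (@box_partials _ phi pt px (- B) B) => //.
  by move=> w /supp[]; rewrite ler_norml => /andP[h1 h2] h3.
by move=> [h1 h2 h3]; apply: nz; split => //; rewrite ler_norml h1.
Qed.

Lemma box_bcs2 : bcs2 pt /\ bcs2 px.
Proof.
have [pt' [px' [s1 s2 e1 e2]]] := E; rewrite e1 e2; split;
  (apply: (bcs2_continuous (B := B)); first exact: smooth2_continuous);
  move=> z; rewrite -?e1 -?e2 => nz; apply: contrapT => /partials0[h1 h2];
  by move: nz; rewrite ?h1 ?h2 eqxx.
Qed.

Let far (t x : R) : B < `|t| \/ B < `|x| -> phi (t, x) = 0.
Proof.
by move=> h; apply/eqP/negPn/negP => /supp[/= h1 h2]; case: h; rewrite ltNge ?h1 ?h2.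
Qed.

Let B1 : 0 < `|B| + 1. Proof. by rewrite ltr_wpDl. Qed.
Let BB : B < `|B| + 1. Proof. by have := ler_norm B; lra. Qed.

Lemma half_plane_integral_dt : \int[leb2]_z (pos z * pt z) = - \int[mu]_x phi (0, x).
Proof.
have [bt _] := box_bcs2; have [pt' [px' [s1 s2 e1 e2]]] := E.
have bp : bcs2 (fun z => pos z * pt z).
  by under eq_fun do rewrite mulrC; apply: bcs2M => //; exact: bm2_half_plane.
rewrite bcs2_fubini2// -RintegralN; apply: eq_Rintegral => x _.
have -> : - phi (0, x) = phi (`|B| + 1, x) - phi (0, x).
  by rewrite [phi (_ + _, x)]far ?sub0r//; left; rewrite gtr0_norm.
have ct : continuous (fun t : R => pt (t, x)).
  by rewrite e1; exact: continuous_fst_section (smooth2_continuous s1).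
rewrite -(ftc_segment B1 (fun t => (H t x).1) ct) integral_ind.
apply: ae_eq_Rintegral => //.
- exact: (bcs2_snd x bp).1.
- by apply: measurable_funM; [exact: (bcs1_ind _ _).1|exact: (bcs2_snd x bt).1].
exists [set 0]; split => //; first exact: lebesgue_measure_set1.
move=> t /= nt; apply: contrapT => t0; apply: nt => _; rewrite posE /ind.
have [tB|tB] := leP t (`|B| + 1); last first.
  have -> : pt (t, x) = 0.
    by apply: (partials0 _).1 => -[/= h _]; move: (lt_trans BB (lt_le_trans tB (ler_norm t))); rewrite ltNge h.
  by rewrite !mulr0.
by rewrite andbT lt_neqAle eq_sym (introF eqP t0).
Qed.

Lemma half_plane_integral_dx : \int[leb2]_z (pos z * px z) = 0.
Proof.
have [_ bx] := box_bcs2; have [pt' [px' [s1 s2 e1 e2]]] := E.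
have bp : bcs2 (fun z => pos z * px z).
  by under eq_fun do rewrite mulrC; apply: bcs2M => //; exact: bm2_half_plane.
rewrite bcs2_fubini1//; apply: Rintegral_eq0 => t _.
under eq_Rintegral do rewrite posE.
rewrite bcs1_integralZ; last exact: bcs2_fst.
have cx : continuous (fun x : R => px (t, x)).
  by rewrite e2; exact: continuous_snd_section (smooth2_continuous s2).
have BN : - (`|B| + 1) < `|B| + 1 by move: B1; lra.
rewrite (_ : \int[mu]_x px (t, x) = \int[mu]_x (ind (- (`|B| + 1)) (`|B| + 1) x * px (t, x))).
  rewrite -integral_ind (ftc_segment BN (fun x => (H t x).2) cx).
  by rewrite !far ?subrr ?mulr0//; right; rewrite ?normrN gtr0_norm.
apply: eq_Rintegral => x _; rewrite /ind -ler_norml.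
case: (leP `|x| (`|B| + 1)) => xB; first by rewrite mul1r.
by rewrite mul0r; apply: (partials0 _).2 => -[/= _ h]; move: (lt_trans BB xB); rewrite ltNge h.
Qed.

(** Subtracting the constant state [k] adds only a boundary term: over the half plane [pt]
    integrates to minus the integral of [phi] at time 0, and [px] to 0. The function [u1] is [u0]
    truncated at its essential bound. *)
Lemma initial_identity (f : R -> R) (v : R * R -> R) (u0 : R -> R) (k : R) : initial_value f v u0 ->
  bm2 v -> bm2 (fun z => f (v z)) -> (forall z, z.1 <= 0 -> v z = k) ->
  exists u1, [/\ bm1 u1, {ae mu, forall x, u0 x = u1 x} &
  \int[leb2]_z ((v z - k) * pt z + (f (v z) - f k) * px z) = - \int[mu]_x ((u1 x - k) * phi (0, x))].
Proof.
move=> [mu0 [C u0C] iv] bv bfv vk; have [bt bx] := box_bcs2.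
pose u1 x := Num.max (- C) (Num.min C (u0 x)).
have mu1 : measurable_fun setT u1.
  apply: measurable_maxr; first exact: measurable_cst.
  by apply: measurable_minr => //; exact: measurable_cst.
have e01 : {ae mu, forall x, u0 x = u1 x}.
  apply: (aeS u0C) => x; rewrite ler_norml => /andP[h1 h2].
  by rewrite /u1 min_r// max_r.
have bu1 : bm1 u1.
  split => //; exists `|C| => x; rewrite /u1 ler_norml le_max ge_max ge_min.
  have := ler_norm C; have := ler_norm (- C); rewrite normrN => h1 h2; rewrite h2 /= andbT.
  by apply/andP; split; [apply/orP; left|]; lra.
exists u1; split => //.
have tphi : test_function phi by exact: (smooth2_test (B := B)).
have bphi : bcs1 (fun x => phi (0, x)).
  by apply: bcs2_fst; exact: (bcs2_continuous (smooth2_continuous sp) supp).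
have := iv phi tphi; rewrite /pairing (has_partials_dt H) (has_partials_dx H) integral_half_plane.
rewrite (_ : \int[mu]_x (u0 x * _) = \int[mu]_x (phi (0, x) * u1 x)); last first.
  apply: ae_eq_Rintegral => //.
  - by apply: measurable_funM => //; exact: bphi.1.
  - by apply: measurable_funM => //; exact: bphi.1.
  by apply: (aeS e01) => x -> _; rewrite mulrC.
have bpt : bcs2 (fun z => pos z * pt z).
  by under eq_fun do rewrite mulrC; apply: bcs2M => //; exact: bm2_half_plane.
have bpx : bcs2 (fun z => pos z * px z).
  by under eq_fun do rewrite mulrC; apply: bcs2M => //; exact: bm2_half_plane.
have b1 := bcs2M bpt bv; have b2 := bcs2M bpx bfv.
rewrite (_ : \int[leb2]_z (pos z * _) =
  \int[leb2]_z (pos z * pt z * v z + pos z * px z * f (v z))); last first.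
  by apply: eq_Rintegral => z _; ring.
have -> : \int[leb2]_z ((v z - k) * pt z + (f (v z) - f k) * px z) =
   \int[leb2]_z ((pos z * pt z * v z + pos z * px z * f (v z)) -
     (k * (pos z * pt z) + f k * (pos z * px z))).
  apply: eq_Rintegral => -[t x] _; rewrite posE; case: (ltP 0 t) => t0 /=; first by ring.
  by rewrite (vk (t, x) t0); ring.
rewrite (bcs2_integralB (bcs2D b1 b2) (bcs2D (bcs2Z k bpt) (bcs2Z (f k) bpx))).
rewrite (bcs2_integralD (bcs2Z k bpt) (bcs2Z (f k) bpx)).
rewrite (bcs2_integralZ k bpt) (bcs2_integralZ (f k) bpx) half_plane_integral_dt half_plane_integral_dx.
have -> : \int[mu]_x ((u1 x - k) * phi (0, x)) = \int[mu]_x (phi (0, x) * u1 x - k * phi (0, x)).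
  by apply: eq_Rintegral => x _; ring.
rewrite (bcs1_integralB (bcs1M bphi bu1) (bcs1Z k bphi)) (bcs1_integralZ k bphi).
by set I := \int[leb2]_z _; lra.
Qed.
End box_supported.

End representatives.

(** * Lower bound for a solution with one Kruzkov entropy *)

Section propagation_of_lower_bound.
Context {R : realType}.
Local Notation mu := (@lebesgue_measure R).

Lemma measurable_sg : measurable_fun setT (Num.sg : R -> R).
Proof.
apply: nondecreasing_measurable => // x y xy.
by case: (sgrP x) => x0; case: (sgrP y) => y0; lra.
Qed.

(** The abstract data are a = v - k, b = f(v) - f(k), E = |a| and F = sgn(a) b; the relation F a = E
    b is then sgn(a) a = |a|. *)
Lemma kruzkov_lower_bound (f : R -> R) (v : R * R -> R) (u0 : R -> R) (k M Lam : R) :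
  measurable_fun setT f -> measurable_fun setT v -> (forall z, `|v z| <= M) -> `|k| <= M ->
  0 < Lam -> (forall a b, `|a| <= M -> `|b| <= M -> `|f a - f b| <= Lam * `|a - b|) ->
  (forall z, z.1 <= 0 -> v z = k) -> initial_value f v u0 ->
  {ae mu, forall x, k <= u0 x} -> entropic (kruzkov_entropy k) (kruzkov_flux f k) v ->
  {ae mu, forall t, 0 < t -> {ae mu, forall x, k <= v (t, x)}}.
Proof.
move=> mf mv vM kM L0 fL vk iv ku0 ent.
have M0 : 0 <= M := le_trans (normr_ge0 _) kM.
have bv : bm2 v by split => //; exists M.
have bfv : bm2 (fun z => f (v z)) := bm2_comp mf mv vM fL (ltW L0).
have ma : measurable_fun setT (fun z => v z - k).
  by apply: measurable_funB => //; exact: measurable_cst.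
have mb : measurable_fun setT (fun z => f (v z) - f k).
  by apply: measurable_funB; [exact: bfv.1|exact: measurable_cst].
have Ca0 : 0 < M + M + 1 by lra.
suff H : {ae mu, forall t, 0 < t -> {ae mu, forall x, 0 <= v (t, x) - k}}.
  apply: (aeS H) => t Ht t0; apply: (aeS (Ht t0)) => x.
  by rewrite subr_ge0.
apply: (@nonneg_from_initial_data R (fun z => v z - k) (fun z => f (v z) - f k)
  (fun z => kruzkov_entropy k (v z)) (fun z => kruzkov_flux f k (v z)) Lam (M + M + 1)) => //.
- move=> z; rewrite (le_trans (ler_normB _ _))//.
  by apply: (le_trans (lerD (vM z) kM)); rewrite lerDl.
- by move=> z; exact: fL.
- by move=> z /vk ->; rewrite subrr.
- move=> phi pt px tau B sp tau0 supp H.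
  have supp' z : phi z != 0 -> `|z.1| <= B /\ `|z.2| <= B.
    by move=> /supp[h1 h2 h3]; split => //; rewrite ger0_norm// (le_trans _ h1)// ltW.
  have [u1 [_ _ ->]] := initial_identity sp H supp' iv bv bfv vk.
  rewrite Rintegral_eq0 ?oppr0// => x _.
  have [->|/supp[/= h _ _]] := eqVneq (phi (0, x)) 0; first by rewrite mulr0.
  by move: (lt_le_trans tau0 h); rewrite ltxx.
- move=> phi pt px B sp phi0 supp H.
  have [u1 [bu1 e01 ->]] := initial_identity sp H supp iv bv bfv vk.
  rewrite oppr_le0; have bphi : bcs1 (fun x => phi (0, x)).
    by apply: bcs2_fst; exact: (bcs2_continuous (smooth2_continuous sp) supp).
  have b0 : bcs1 (cst 0 : R -> R).
    by split; [exact: measurable_cst|exists 0, 0 => x; rewrite normr0].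
  apply: (@le_trans _ _ (\int[mu]_x (cst 0 x : R))); first by rewrite Rintegral_eq0.
  apply: bcs1_integral_ae_le => //.
    under eq_fun do rewrite mulrC; apply: bcs1M => //; move: bu1 => [mu1 [C HC]]; split.
      by apply: measurable_funB => //; exact: measurable_cst.
    by exists (C + `|k|) => x; rewrite (le_trans (ler_normB _ _))// lerD.
  by apply: (aeS (aeI ku0 e01)) => x [h <-]; rewrite mulr_ge0// subr_ge0.
- move=> z; rewrite /kruzkov_flux /kruzkov_entropy [`|v z - k|]normrEsg.
  by ring.
- apply: measurable_funM => //.
  by apply: measurableT_comp => //; exact: measurable_sg.
- move=> z; rewrite /kruzkov_flux /kruzkov_entropy normrM.
  apply: (@le_trans _ _ (1 * `|f (v z) - f k|)); last by rewrite mul1r; exact: fL.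
  by apply: ler_wpM2r => //; rewrite normr_sg; case: (_ != _).
- move=> phi pt px tau B sp phi0 tau0 supp H.
  exact: (entropic_smooth ent sp phi0 tau0 supp H).
Qed.

End propagation_of_lower_bound.

(** * Lipschitz bounds for the flux and for the shift speed *)

Section flux_on_segments.
Context {R : realType}.
Local Notation mu := (@lebesgue_measure R).

Lemma continuous_bounded_segment (g : R -> R) (M : R) : continuous g ->
  exists2 C, 0 < C & forall x, `|x| <= M -> `|g x| <= C.
Proof.
move=> cg; have [M0|M0] := leP 0 M; last first.
  by exists 1 => // x xM; move: (le_lt_trans xM M0); rewrite normr_lt0.
have MM : - M <= M by lra.
have [] := EVT_max (f := fun x => `|g x|) MM.
  by apply: continuous_subspaceT => x; apply: cvg_norm; exact: cg.
move=> c _ Hc; exists (`|g c| + 1); first by rewrite ltr_wpDl.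
move=> x; rewrite ler_norml => xM; apply: (@le_trans _ _ `|g c|); last by rewrite lerDl.
by apply: Hc; rewrite in_itv.
Qed.

Lemma lipschitz_segment (g dg : R -> R) (M L : R) : (forall x : R, is_derive x 1 g (dg x)) ->
  (forall x, `|x| <= M -> `|dg x| <= L) ->
  forall a b, `|a| <= M -> `|b| <= M -> `|g a - g b| <= L * `|a - b|.
Proof.
move=> Hg gL a b; rewrite ler_norml => /andP[a1 a2]; rewrite ler_norml => /andP[b1 b2].
have [c [h1 h2 ->]] := mvt_between Hg b a; rewrite normrM ler_wpM2r//; apply: gL.
rewrite ler_norml (le_trans _ h1) ?le_min ?a1 ?b1//= (le_trans h2)//.
by rewrite ge_max a2 b2.
Qed.

Lemma is_derive_derive1 (g : R -> R) (x : R) : derivable g x 1 -> is_derive x 1 g (derive1 g x).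
Proof. by move=> dg; rewrite derive1E; exact: DeriveDef. Qed.

Section speed.
Variables (f df : R -> R) (c L M : R).
Hypotheses (Hf : forall x : R, is_derive x 1 f (df x)) (c0 : 0 <= c) (cM : c <= M) (L0 : 0 <= L).
Hypothesis dfL : forall a b, `|a| <= M -> `|b| <= M -> `|df a - df b| <= L * `|a - b|.

Local Notation V := (shift_speed f df c).

Let normM x : 0 <= x -> x <= M -> `|x| <= M. Proof. by move=> x0 xM; rewrite ger0_norm. Qed.

Let mM x : x <= c -> `|Num.max x 0| <= M.
Proof.
by move=> xc; apply: normM; rewrite ?le_max ?lexx ?orbT// ge_max (le_trans xc cM)/= (le_trans c0).
Qed.

Let left_lip u w : u <= w -> w <= c -> `|V u - V w| <= L * (w - u).
Proof.
move=> uw wc; rewrite /shift_speed wc (le_trans uw wc).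
apply: (le_trans (dfL (mM (le_trans uw wc)) (mM wc))); rewrite ler_wpM2l//.
have [u0|u0] := leP u 0; have [w0|w0] := leP w 0.
- by rewrite subrr normr0 subr_ge0.
- by rewrite sub0r normrN gtr0_norm//; lra.
- by lra.
- by rewrite distrC ger0_norm ?subr_ge0.
Qed.

Let slope u : c < u -> u <= M -> exists xi, [/\ c < xi, xi < u, `|xi| <= M & V u = df xi].
Proof.
move=> cu uM; have [xi [h1 h2 e]] := mvt_lt Hf cu; exists xi; split => //.
  by apply: normM; [exact: le_trans c0 (ltW h1)|exact: le_trans (ltW h2) uM].
by rewrite /shift_speed leNgt cu /= e mulfK// subr_eq0 gt_eqF.
Qed.

(** Difference of chord slopes from [c]: it equals (f'(xi) - f'(ze)) (w - u) / (w - c) with xi in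
    ]u, w[ and ze in ]c, u[. As |xi - ze| <= w - c, the constant [L] of [f'] is inherited. *)
Let right_lip u w : c <= u -> u <= w -> w <= M -> `|V u - V w| <= L * (w - u).
Proof.
rewrite le_eqVlt => /orP[/eqP<-|cu] uw wM.
  have Vc : V c = df c by rewrite /shift_speed lexx max_l.
  move: uw; rewrite le_eqVlt => /orP[/eqP<-|cw]; first by rewrite !subrr normr0 mulr0.
  have [xi [h1 h2 h3 ->]] := slope cw wM.
  rewrite Vc (le_trans (dfL (normM c0 cM) h3))// ler_wpM2l// distrC ger0_norm ?subr_ge0 ?(ltW h1)//.
  by rewrite lerD2r ltW.
move: uw; rewrite le_eqVlt => /orP[/eqP<-|uw]; first by rewrite !subrr normr0 mulr0.
have [ze [h1 h2 h3 Vu]] := slope cu (le_trans (ltW uw) wM).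
have [xi [h4 h5 e]] := mvt_lt Hf uw.
have xiM : `|xi| <= M.
  by apply: normM; [exact: le_trans c0 (le_trans (ltW cu) (ltW h4))|exact: le_trans (ltW h5) wM].
have wc : 0 < w - c by rewrite subr_gt0 (lt_trans cu).
have uc : u - c != 0 by rewrite subr_eq0 gt_eqF.
have fu : f u - f c = df ze * (u - c).
  by rewrite -Vu /shift_speed leNgt cu /= divfK.
have E : V w - V u = (df xi - df ze) * ((w - u) / (w - c)).
  rewrite Vu {1}/shift_speed leNgt (lt_trans cu uw) /=.
  have -> : f w - f c = df xi * (w - u) + df ze * (u - c) by rewrite -e -fu; ring.
  by field; rewrite gt_eqF.
have zx : ze < xi by exact: lt_trans h2 h4.
have D0 : 0 <= (w - u) / (w - c) by apply: divr_ge0; [rewrite subr_ge0 ltW|exact: ltW].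
rewrite distrC E normrM (ger0_norm D0).
apply: (@le_trans _ _ (L * (w - c) * ((w - u) / (w - c)))).
  rewrite ler_wpM2r//.
  apply: (le_trans (dfL xiM h3)); rewrite ler_wpM2l// ger0_norm ?subr_ge0 ?(ltW zx)//.
  by rewrite lerD ?lerN2 ?(ltW h1) ?(ltW h5).
by rewrite -mulrA (mulrC (w - c)) divfK// gt_eqF.
Qed.

Lemma shift_speed_lipschitz u w : u <= M -> w <= M -> `|V u - V w| <= L * `|u - w|.
Proof.
wlog uw : u w / u <= w => [H|uM wM].
  by have [h|h] := leP u w => *; [exact: H|rewrite distrC [`|u - _|]distrC; apply: H => //; exact: ltW].
rewrite [`|u - w|]distrC [`|w - u|]ger0_norm ?subr_ge0//.
have [wc|cw] := leP w c; first exact: left_lip.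
have [cu|uc] := leP c u; first exact: right_lip.
have -> : V u - V w = (V u - V c) + (V c - V w) by ring.
apply: (le_trans (ler_normD _ _)).
have := left_lip (ltW uc) (lexx c); have := right_lip (lexx c) (ltW cw) wM.
by lra.
Qed.

Lemma shift_speed_bound (Lam u : R) : (forall a, `|a| <= M -> `|df a| <= Lam) -> u <= M -> `|V u| <= Lam.
Proof.
move=> dfb uM; have [uc|cu] := leP u c; first by rewrite /shift_speed uc; exact/dfb/mM.
by have [xi [_ _ h ->]] := slope cu uM; exact: dfb.
Qed.

End speed.

Definition clamp (M x : R) := Num.max (- M) (Num.min M x).

Lemma clamp_le (M x : R) : 0 <= M -> clamp M x <= M.
Proof. by move=> M0; rewrite /clamp ge_max ge_min lexx /= andbT; lra. Qed.

Lemma clamp_id (M x : R) : `|x| <= M -> clamp M x = x.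
Proof. by rewrite ler_norml => /andP[h1 h2]; rewrite /clamp min_r// max_r. Qed.

Lemma clamp_lipschitz (M x y : R) : `|clamp M x - clamp M y| <= `|x - y|.
Proof.
wlog xy : x y / x <= y => [H|].
  by have [h|h] := leP x y; [exact: H|rewrite distrC [`|x - _|]distrC; apply: H; exact: ltW].
rewrite distrC [leRHS]distrC [leRHS]ger0_norm ?subr_ge0// /clamp.
by case: (leP M x) => h1; case: (leP M y) => h2; rewrite ?maxEle; do ?case: (leP (- M) _) => ?;
  rewrite ler_norml; apply/andP; split; lra.
Qed.

End flux_on_segments.

(** * Construction of the shift *)

Section flux_facts.
Context {R : realType}.
Local Notation mu := (@lebesgue_measure R).

Lemma classC_is_derive (n i : nat) (g : R -> R) : classC n g -> (i < n)%N ->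
  forall x : R, is_derive x 1 (derive1n i g) (derive1n i.+1 g x).
Proof. by move=> [H _] ilt x; exact: is_derive_derive1 (H i ilt x). Qed.

Lemma classC_continuous (n i : nat) (g : R -> R) : classC n g -> (i < n)%N -> continuous (derive1n i g).
Proof.
by move=> [H _] ilt x; apply: differentiable_continuous; apply/derivable1_diffP; exact: H.
Qed.

(** In the convex region the chord of an increasing pair lies strictly above the graph, which
    contradicts the Oleinik condition at the midpoint. *)
Lemma oleinik_shock_decreasing (f : R -> R) (uL uR : R) : concave_convex f -> 0 < uL -> 0 < uR ->
  oleinik_shock f uL uR -> uR < uL.
Proof.
move=> [fC fcc _ _ _] L0 R0 [ne H]; rewrite ltNge le_eqVlt (negbTE ne) /=; apply/negP => LR.
have Hf := classC_is_derive (i := 0) fC isT; have Hdf := classC_is_derive (i := 1) fC isT.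
set s := (f uR - f uL) / (uR - uL) in H.
have d0 : 0 < uR - uL by rewrite subr_gt0.
have e : f uR - f uL = s * (uR - uL) by rewrite /s divfK// gt_eqF.
have m1 : uL < (uL + uR) / 2 by lra.
have m2 : (uL + uR) / 2 < uR by lra.
have bc := below_chord_ge0 Hf Hdf fcc (ltW L0) LR e m1 m2.
have := H ((uL + uR) / 2); rewrite min_l ?(ltW LR)// max_r ?(ltW LR)// m1 m2 => /(_ isT).
rewrite ler_pdivlMr ?subr_gt0//; move: bc; rewrite ltNge => /negP bc h; apply: bc.
by rewrite -lerBrDl.
Qed.

(** Existence of a tangent point makes [xget] return a solution, and every solution is negative,
    whichever is returned. *)
Lemma phi_nat_tangent (f : R -> R) (b : R) : concave_convex f -> 0 < b ->
  phi_nat f b < 0 /\ f b - f (phi_nat f b) = derive1 f (phi_nat f b) * (b - phi_nat f b).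
Proof.
move=> [fC fcc _ _ fN] b0.
have Hf := classC_is_derive (i := 0) fC isT; have Hdf := classC_is_derive (i := 1) fC isT.
rewrite /phi_nat gt_eqF//.
set P := [set v | _].
have [|ne e] := @xgetPex _ 0 P; last exact: (tangent_point_neg Hf Hdf fcc b0 ne e).
have [k [k0 e]] := tangent_point Hf Hdf fcc b0 fN; exists k.
have kb : k < b by exact: lt_trans k0 b0.
by split; [rewrite lt_eqF|rewrite e mulfK// subr_eq0 gt_eqF].
Qed.

Lemma lipschitz_from_of_global (h : R -> R) (L t0 : R) :
  (forall x y, `|h x - h y| <= L * `|x - y|) -> lipschitz_from t0 h.
Proof.
move=> hL; rewrite /lipschitz_from /lipschitz_on; near=> K => -[x y] _ /=.
apply: (le_trans (hL x y)); rewrite ler_wpM2r//; near: K; exact: nbhs_pinfty_ge.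
Unshelve. all: by end_near. Qed.

End flux_facts.

(** * The shift and its dissipation *)

Section dissipative_shift.
Context {R : realType}.
Local Notation mu := (@lebesgue_measure R).
Variables (M : R) (f eta q : R -> R) (bl : R).
Hypotheses (fcc : concave_convex f) (etac : strictly_convex_entropy eta).
Hypotheses (qfl : entropy_flux f eta q) (bl0 : 0 < bl).

Local Notation k := (phi_nat f bl).
Local Notation df := (derive1 f).

(** The bounds [Lf], [Ldf], [Le] are fixed before the shock, the solution and the starting point, so
    the bound on the speed is uniform in them. *)
Lemma dissipative_shift (M' Lf Ldf Le uL uR a1 a2 : R) (u : R * R -> R) (tbar x0 : R) :
  M <= M' -> `|k| <= M' -> 0 < Lf -> 0 <= Ldf -> 0 <= Le ->
  (forall x, `|x| <= M' -> `|df x| <= Lf) ->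
  (forall a b, `|a| <= M' -> `|b| <= M' -> `|df a - df b| <= Ldf * `|a - b|) ->
  (forall a b, `|a| <= M' -> `|b| <= M' -> `|eta a - eta b| <= Le * `|a - b|) ->
  (forall a b, `|a| <= M' -> `|b| <= M' -> `|q a - q b| <= Le * `|a - b|) ->
  bl <= uR -> uR < uL -> uL <= M' -> 0 < a2 -> a2 <= a1 ->
  S_weak M f eta q bl u -> 0 <= tbar ->
  exists h : R -> R, [/\ lipschitz_from tbar h, h tbar = x0 & exists um up : R -> R,
    traces u h tbar um up /\ {ae mu, forall t : R, tbar <= t ->
      [/\ derivable h t 1,
        a1 * (derive1 h t * rel_entropy eta (um t) uL - rel_flux f eta q (um t) uL)
        - a2 * (derive1 h t * rel_entropy eta (up t) uR - rel_flux f eta q (up t) uR) <= 0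
      & `|derive1 h t| <= Lf]}].
Proof.
move=> MM kM Lf0 Ld0 Le0 dfb dfL eL qL blR RL LM a20 a12.
move=> [Lu wu [eu ku] tru [u0 iu u0k]] tb0.
have M'0 : 0 <= M' := le_trans (normr_ge0 _) kM.
have [fC fpos _ _ fN] := fcc; have [etaC eta2] := etac.
have Hf := classC_is_derive (i := 0) fC isT; have Hdf := classC_is_derive (i := 1) fC isT.
have He := classC_is_derive (i := 0) etaC isT; have Hde := classC_is_derive (i := 1) etaC isT.
have [k0 Hk] := phi_nat_tangent fcc bl0.
have fL := lipschitz_segment Hf dfb.
have mf : measurable_fun setT f.
  by apply: continuous_measurable_fun; exact: (classC_continuous (i := 0) fC isT).
have me : measurable_fun setT eta.
  by apply: continuous_measurable_fun; exact: (classC_continuous (i := 0) etaC isT).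
have mq : measurable_fun setT q.
  apply: continuous_measurable_fun => x; apply: differentiable_continuous.
  by apply/derivable1_diffP; have := qfl x => ?; exact: ex_derive.
have mid : measurable_fun setT (id : R -> R) by exact: measurable_id.
have mN (g : R -> R) : measurable_fun setT g -> measurable_fun setT (fun x => - g x).
  by move=> mg; exact: measurableT_comp.
have mke : measurable_fun setT (kruzkov_entropy k).
  by apply: measurableT_comp => //; apply: measurable_funB => //; exact: measurable_cst.
have mkf : measurable_fun setT (kruzkov_flux f k).
  apply: measurable_funM; last by apply: measurable_funB => //; exact: measurable_cst.
  apply: measurableT_comp; first exact: measurable_sg.
  by apply: measurable_funB => //; exact: measurable_cst.
set v := bounded_rep M' k u.
have mu_ := Lu.1; have mv : measurable_fun setT v by exact: bounded_rep_measurable.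
have vM z : `|v z| <= M' by exact: bounded_rep_bound.
have uv := bounded_rep_ae k MM Lu.
have vk z : z.1 <= 0 -> v z = k by move=> z0; rewrite /v /bounded_rep ltNge z0.
have [wu1 wu2] := weak_entropic wu.
have ev1 := entropic_ae mid mf mu_ mv uv wu1.
have ev2 := entropic_ae (mN _ mid) (mN _ mf) mu_ mv uv wu2.
have ev3 := entropic_ae me mq mu_ mv uv eu.
have ev4 := entropic_ae mke mkf mu_ mv uv ku.
have iv : initial_value f v u0.
  have [i1 i2 i3] := iu; split => // phi tphi.
  by rewrite -(pairing_ae mid mf mu_ mv uv tphi); exact: i3.
have vlow := kruzkov_lower_bound mf mv vM kM Lf0 fL vk iv u0k ev4.
have uL0 : 0 <= uL by apply: ltW; apply: lt_trans RL; exact: lt_le_trans bl0 blR.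
(* Composition with [clamp] makes the speed bounded and Lipschitz on the whole line; the values at
   the traces are unchanged. *)
pose V x := shift_speed f df uL (clamp M' x).
have VL x y : `|V x - V y| <= Ldf * `|x - y|.
  apply: (le_trans (shift_speed_lipschitz Hf uL0 LM Ld0 dfL (clamp_le _ M'0) (clamp_le _ M'0))).
  by rewrite ler_wpM2l// clamp_lipschitz.
have VC x : `|V x| <= Lf := shift_speed_bound Hf uL0 LM dfb (clamp_le _ M'0).
have mV := lipschitz_measurable VL.
have [h [hL h0 hup]] := filippov_curve tbar x0 Lf0 (measurableT_comp mV mv) (fun z => VC (v z)).
have hlip t0 := lipschitz_from_of_global t0 hL.
(* The strong trace property concerns curves from time 0. The curve is constant before [tbar], hence
   globally Lipschitz, and its traces are restricted afterwards. *)
have [um [up [tm tp]]] := tru h (hlip 0).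
exists h; split; [exact: hlip|exact: h0|exists um, up; split].
  by split; exact: one_sided_trace_restrict.
have uv' : {ae mu, forall t, 0 < t -> {ae mu, forall x, u (t, x) = v (t, x)}}.
  apply: (aeS (ae_slice1 uv)) => t Ht t0; apply: (aeS Ht) => x; exact.
have [g st] := strip_traces_of_traces mv vM (lipschitz_measurable hL) uv' (conj tm tp).
set wm := um \_ _ in st; set wp := up \_ _ in st.
have vseg : {ae mu, forall t, 0 < t -> {ae mu, forall x, k <= v (t, x) <= M'}}.
  apply: (aeS vlow) => t Ht t0; apply: (aeS (Ht t0)) => x kx; rewrite kx /=.
  exact: le_trans (ler_norm _) (vM (t, x)).
have nidL (a b : R) : `|a| <= M' -> `|b| <= M' -> `|(- a) - (- b)| <= (1 + Lf) * `|a - b|.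
  by move=> _ _; rewrite -opprD normrN ler_peMl//; lra.
have idL (a b : R) : `|a| <= M' -> `|b| <= M' -> `|a - b| <= (1 + Lf) * `|a - b|.
  by move=> _ _; rewrite ler_peMl//; lra.
have fL' a b : `|a| <= M' -> `|b| <= M' -> `|f a - f b| <= (1 + Lf) * `|a - b|.
  by move=> aM bM; apply: (le_trans (fL a b aM bM)); rewrite ler_wpM2r//; lra.
have nfL a b : `|a| <= M' -> `|b| <= M' -> `|(- f a) - (- f b)| <= (1 + Lf) * `|a - b|.
  by rewrite -opprD normrN; exact: fL'.
have L1 : 0 <= 1 + Lf by lra.
have j1 := ae_jump_condition mv vM mid mf L1 idL fL' ev1 st.
have j2 := ae_jump_condition mv vM (mN _ mid) (mN _ mf) L1 nidL nfL ev2 st.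
have j3 := ae_jump_condition mv vM me mq Le0 eL qL ev3 st.
have tseg := traces_in_segment st vseg.
have speed := speed_between_traces st Ld0 tb0 VL VC hup.
(* The speed is controlled at times strictly after [tbar], so this instant is discarded. *)
have ne : {ae mu, forall t, t != tbar}.
  exists [set tbar]; split => //; first exact: lebesgue_measure_set1.
  by move=> t /= /negP; rewrite negbK => /eqP.
have main (t : R) : tbar < t -> derivable h t 1 -> k <= um t <= M' -> k <= up t <= M' ->
    (forall s, is_derive t 1 h s -> [/\ f (up t) - f (um t) <= s * (up t - um t),
      - f (up t) - - f (um t) <= s * (- up t - - um t),
      q (up t) - q (um t) <= s * (eta (up t) - eta (um t)) &
      Num.min (V (um t)) (V (up t)) <= s <= Num.max (V (um t)) (V (up t))]) ->
    [/\ derivable h t 1,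
        a1 * (derive1 h t * rel_entropy eta (um t) uL - rel_flux f eta q (um t) uL)
        - a2 * (derive1 h t * rel_entropy eta (up t) uR - rel_flux f eta q (up t) uR) <= 0
      & `|derive1 h t| <= Lf].
  move=> tt dh /andP[m1 m2] /andP[p1 p2] /(_ _ (is_derive_derive1 dh)).
  set s := derive1 h t => -[c1 c2 c3 /andP[c4 c5]].
  have kM' : - M' <= k by move: kM; rewrite ler_norml => /andP[].
  have umM : `|um t| <= M' by rewrite ler_norml m2 (le_trans kM').
  have upM : `|up t| <= M' by rewrite ler_norml p2 (le_trans kM').
  (* The jump inequalities for the identity and its opposite together give equality. *)
  have RH : f (up t) - f (um t) = s * (up t - um t).
    by move: c1 c2; clear; move=> c1 c2; lra.
  rewrite /V (clamp_id umM) (clamp_id upM) in c4 c5.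
  split => //.
    exact: (shift_dissipation Hf Hdf fpos He Hde qfl eta2 bl0 k0 Hk blR RL a20 a12 m1 p1 RH c3 c4 c5).
  have Vm := VC (um t); have Vp := VC (up t).
  rewrite /V (clamp_id umM) in Vm; rewrite /V (clamp_id upM) in Vp.
  move: Vm Vp; rewrite !ler_norml => /andP[v1 v2] /andP[v3 v4].
  by rewrite (le_trans _ c4) ?le_min ?v1 ?v3//= (le_trans c5)// ge_max v2 v4.
apply: (aeS (aeI (aeI (aeI (lipschitz_ae_derivable hL) ne) (aeI speed tseg)) (aeI j1 (aeI j2 j3)))).
move=> t [[[dh nt] [sp ts]] [h1 [h2 h3]]] tt.
have {}tt : tbar < t by rewrite lt_neqAle tt eq_sym nt.
have t0 : 0 < t := le_lt_trans tb0 tt.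
have wmE : wm t = um t by rewrite /wm patchE ifT// inE/= in_itv/= ltW.
have wpE : wp t = up t by rewrite /wp patchE ifT// inE/= in_itv/= ltW.
have kM' : - M' <= k by move: kM; rewrite ler_norml => /andP[].
have [] := ts t0; rewrite wmE wpE => /[dup] sm /andP[m1 m2] /[dup] sp' /andP[p1 p2].
have umM : `|um t| <= M' by rewrite ler_norml m2 (le_trans kM').
have upM : `|up t| <= M' by rewrite ler_norml p2 (le_trans kM').
rewrite wmE wpE in sp h1 h2 h3.
apply: main => // s hs; split.
- exact: h1 t0 umM upM s hs.
- exact: h2 t0 umM upM s hs.
- exact: h3 t0 umM upM s hs.
- exact: sp tt s hs.
Qed.

End dissipative_shift.

Unset Implicit Arguments.

Theorem theorem1p2 (R : realType) (M : R) (f eta q : R -> R) (bl bu : R)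
    (M_gt0 : 0 < M)
    (f_flux : concave_convex f)
    (eta_entropy : strictly_convex_entropy eta)
    (q_flux : entropy_flux f eta q)
    (bl_gt0 : 0 < bl) (bl_lt_bu : bl < bu)
    (b_sub_I0 : `[bl, bu]%classic `<=` `[- M, M]%classic) :
  exists C0 st0 lam2 : R, [/\ 0 < C0, 0 < st0 &
    forall uL uR : R,
      oleinik_shock f uL uR ->
      bl <= uL <= bu -> bl <= uR <= bu ->
      `|uL - uR| < st0 ->
    forall a1 a2 : R, 0 < a1 -> 0 < a2 ->
      1 + C0 / 2 * `|uL - uR| <= a1 / a2 <= 1 + 2 * C0 * `|uL - uR| ->
    forall (u : R * R -> R), S_weak M f eta q bl u ->
    forall (tbar x0 : R), 0 <= tbar ->
    exists h : R -> R,
      [/\ lipschitz_from tbar h,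
          h tbar = x0
        & exists um up : R -> R,
            traces u h tbar um up /\
            {ae lebesgue_measure, forall t : R, tbar <= t ->
              [/\ derivable h t 1,
                  a1 * (derive1 h t * rel_entropy eta (um t) uL
                        - rel_flux f eta q (um t) uL)
                  - a2 * (derive1 h t * rel_entropy eta (up t) uR
                          - rel_flux f eta q (up t) uR) <= 0
                & `|derive1 h t| <= lam2]}]].
Proof.
have [fC _ _ _ _] := f_flux; have [etaC _] := eta_entropy.
(* The representative takes the value [phi_nat f bl] in the past, so the constants are taken on a
   segment containing it. *)
pose M' := Num.max M `|phi_nat f bl|.
have MM : M <= M' by rewrite le_max lexx.
have kM : `|phi_nat f bl| <= M' by rewrite le_max lexx orbT.
have cdf := classC_continuous (i := 1) fC isT; have cde := classC_continuous (i := 1) etaC isT.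
have [Lf Lf0 HLf] := continuous_bounded_segment M' cdf.
have [Ld Ld0 HLd] := continuous_bounded_segment M' (classC_continuous (i := 2) fC isT).
have [Le Le0 HLe] := continuous_bounded_segment M' cde.
have cdq : continuous (fun x => derive1 eta x * derive1 f x).
  by move=> x; apply: cvgM; [exact: cde|exact: cdf].
have [Lq Lq0 HLq] := continuous_bounded_segment M' cdq.
(* The maximal speed [Lf] bounds |f'| on [- M', M']. The lower bound on [a1 / a2], which is at least
   1, provides [a2 <= a1]. *)
exists 1, 1, Lf; split => // uL uR sh /andP[L1 L2] /andP[R1 R2] _ a1 a2 a10 a20 /andP[a12 _] u Su tbar x0 tb0.
have uM : bu <= M.
  by have /= := b_sub_I0 bu; rewrite !in_itv/= (ltW bl_lt_bu) lexx => /(_ isT)/andP[].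
apply: (@dissipative_shift R M f eta q bl f_flux eta_entropy q_flux bl_gt0 M' Lf Ld (Le + Lq)) => //.
- exact: ltW.
- by rewrite addr_ge0 ?ltW.
- exact: lipschitz_segment (classC_is_derive (i := 1) fC isT) HLd.
- move=> a b aM bM; apply: (le_trans (lipschitz_segment (classC_is_derive (i := 0) etaC isT) HLe aM bM)).
  by rewrite ler_wpM2r// lerDl ltW.
- move=> a b aM bM; apply: (le_trans (lipschitz_segment q_flux HLq aM bM)).
  by rewrite ler_wpM2r// lerDr ltW.
- apply: oleinik_shock_decreasing sh => //; exact: lt_le_trans bl_gt0 _.
- exact: le_trans L2 (le_trans uM MM).
- rewrite -(mul1r a2) -ler_pdivlMr//; apply: le_trans a12.
  by rewrite lerDl mulr_ge0// mul1r invr_ge0.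
Qed.
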